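(* Suppose that $M$ is a compact differentiable ${\bf R}^n$-aspherical manifold such that $\dim(Aff(M)_0)=n-1$, and such that $Aff(M)_0$ is commutative and has a compact orbit. Then $M$ is the total space of a fibre bundle over the circle $S^1$ with fibre the torus ${\bf T}^{n-1}$.
   Context: A group $G$ of homeomorphisms of ${\bf R}^n$ acts freely and properly discontinuously if (i) for all $x\in{\bf R}^n$ and $\gamma\in G$, $\gamma(x)=x$ implies $\gamma=Id_{{\bf R}^n}$; and (ii) every $x\in{\bf R}^n$ has an open neighbourhood $U$ such that for $\gamma\in G$, $\gamma(U)\cap U\neq\emptyset$ implies $\gamma=Id_{{\bf R}^n}$. An ${\bf R}^n$-aspherical manifold is a topological manifold $M$ given as the quotient of ${\bf R}^n$ by a group $G$ acting continuously, freely and properly discontinuously on ${\bf R}^n$; $G$ is identified with $\pi_1(M)$, and $p_M:{\bf R}^n\to M$ is the quotient (covering) map. It is a differentiable ${\bf R}^n$-aspherical manifold if $\pi_1(M)$ acts on ${\bf R}^n$ by diffeomorphisms, $M$ being given the quotient differentiable structure. A homeomorphism $\hat f$ of ${\bf R}^n$ is a lift of a homeomorphism $f$ of $M$ if $p_M\circ\hat f=f\circ p_M$. $Aff(M)$ is the group of homeomorphisms of $M$ having at least one lift which is an affine transformation of ${\bf R}^n$; it is endowed with the compact-open topology, and $Aff(M)_0$ is the connected component of the identity of $Aff(M)$. For $M$ compact, $Aff(M)_0$ is a Lie group, and orbits are orbits of its action on $M$. *)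

(* Defs.v *)
From HB Require Import structures.
From mathcomp Require Import all_boot all_order all_algebra.
From mathcomp Require Import all_classical all_reals all_analysis.

Set Implicit Arguments.
Unset Strict Implicit.
Unset Printing Implicit Defensive.

Import Order.TTheory GRing.Theory Num.Theory.
Import numFieldNormedType.Exports.

Local Open Scope classical_set_scope.
Local Open Scope ring_scope.

Definition homeomorphism {X Y : topologicalType} (f : X -> Y) : Prop :=
  continuous f /\ exists g, [/\ continuous g, cancel f g & cancel g f].

(* On an open set of a finite-dimensional space, [f] is C^(k+1) if and only if
   it is differentiable and all its directional derivatives are C^k; openness
   of [U] is part of [smooth_on]. *)
Fixpoint Ck_on {R : realType} {V W : normedModType R} (k : nat) (U : set V)
    (f : V -> W) : Prop :=
  if k is k'.+1 then
    (forall x, U x -> differentiable f x) /\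
    (forall v : V, Ck_on k' U (fun x => 'D_v f x))
  else forall x, U x -> {for x, continuous f}.

Definition smooth_on {R : realType} {V W : normedModType R} (U : set V)
    (f : V -> W) : Prop :=
  open U /\ forall k, Ck_on k U f.

Definition diffeomorphism {R : realType} {V W : normedModType R}
    (f : V -> W) : Prop :=
  smooth_on setT f /\
  exists g, [/\ smooth_on setT g, cancel f g & cancel g f].

(* A chart of the subspace [H] of [T]: a homeomorphism from an open subset
   [chart_dom] of [H] onto an open subset of R^d.  [chart_map] and [chart_inv]
   are total functions; only their values on [chart_dom] and on [chart_img]
   are relevant. *)
Record chart (R : realType) (d : nat) (T : topologicalType) (H : set T) := Chart {
  chart_dom : set T;
  chart_map : T -> 'rV[R]_d;
  chart_inv : 'rV[R]_d -> T;
  chart_img := chart_map @` chart_dom;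
  chart_dom_open : exists2 O : set T, open O & chart_dom = H `&` O;
  chart_img_open : open chart_img;
  chart_map_continuous : {within chart_dom, continuous chart_map};
  chart_inv_continuous : {within chart_img, continuous chart_inv};
  chart_mapK : {in chart_dom, cancel chart_map chart_inv}
}.

Definition topological_manifold (R : realType) (d : nat) (T : topologicalType)
    : Prop :=
  [/\ hausdorff_space T, @second_countable T
    & forall x : T, exists c : chart R d [set: T], chart_dom c x].

Definition is_group {T : Type} (H : set T) (mul : T -> T -> T) (one : T)
    (inv : T -> T) : Prop :=
  [/\ H one,
      forall x y, H x -> H y -> H (mul x y),
      forall x, H x -> H (inv x)
    & forall x y z, H x -> H y -> H z ->
      [/\ mul x (mul y z) = mul (mul x y) z, mul one x = x, mul x one = x,
          mul (inv x) x = one & mul x (inv x) = one]].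

Definition smooth_atlas (R : realType) (d : nat) (T : topologicalType)
    (H : set T) (A : set (chart R d H)) : Prop :=
  (forall x, H x -> exists2 c, A c & chart_dom c x) /\
  (forall c c', A c -> A c' ->
    smooth_on (chart_map c @` (chart_dom c `&` chart_dom c'))
              (chart_map c' \o chart_inv c)).

(* [(x, y) |-> mul x (inv y)], read in the charts of [A], is smooth.  As
   [smooth_on] includes the openness of the domain, this contains the
   continuity of the operation. *)
Definition smooth_group_law (R : realType) (d : nat) (T : topologicalType)
    (H : set T) (mul : T -> T -> T) (inv : T -> T) (A : set (chart R d H))
    : Prop :=
  forall c1 c2 c3, A c1 -> A c2 -> A c3 ->
    let op (st : 'rV[R]_d * 'rV[R]_d) :=
      mul (chart_inv c1 st.1) (inv (chart_inv c2 st.2)) in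
    smooth_on
      [set st | [/\ chart_img c1 st.1, chart_img c2 st.2
                  & chart_dom c3 (op st)]]
      (chart_map c3 \o op).

(* The subspace [H] of [T], with the given operations, is a [d]-dimensional Lie
   group.  It is not required to be Hausdorff and second countable: both are
   automatic for a connected [H] in a Hausdorff space [T]. *)
Definition lie_group_of_dim (R : realType) (d : nat) (T : topologicalType)
    (H : set T) (mul : T -> T -> T) (one : T) (inv : T -> T) : Prop :=
  is_group H mul one inv /\
  exists A : set (chart R d H), smooth_atlas A /\ smooth_group_law mul inv A.

(* Meaningful only for bijective [f]. *)
Definition fun_inv {X : choiceType} (f : X -> X) : X -> X :=
  fun y => xget y [set x | f x = y].

Definition homeomorphism_group {X : topologicalType} (G : set (X -> X)) : Prop :=
  (forall g, G g -> homeomorphism g) /\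
  is_group G (fun f g => f \o g) id fun_inv.

Definition free_properly_discontinuous {X : topologicalType} (G : set (X -> X))
    : Prop :=
  (forall x g, G g -> g x = x -> g = id) /\
  (forall x, exists U : set X, [/\ open U, U x &
    forall g, G g -> g @` U `&` U !=set0 -> g = id]).

Definition orbit_map {X M : topologicalType} (G : set (X -> X)) (p : X -> M)
    : Prop :=
  [/\ forall m, exists x, p x = m,
      forall U : set M, open U <-> open (p @^-1` U)
    & forall x y, p x = p y <-> exists2 g, G g & g x = y].

Definition aspherical_manifold (R : realType) (n : nat)
    (G : set ('rV[R]_n -> 'rV[R]_n)) (M : topologicalType)
    (p : 'rV[R]_n -> M) : Prop :=
  [/\ topological_manifold R n M, homeomorphism_group G,
      free_properly_discontinuous G & orbit_map G p].

Definition differentiable_aspherical_manifold (R : realType) (n : nat)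
    (G : set ('rV[R]_n -> 'rV[R]_n)) (M : topologicalType)
    (p : 'rV[R]_n -> M) : Prop :=
  aspherical_manifold G p /\ forall g, G g -> diffeomorphism g.

Definition affine_transformation (R : realType) (n : nat)
    (f : 'rV[R]_n -> 'rV[R]_n) : Prop :=
  exists (A : 'M[R]_n) (b : 'rV[R]_n), A \in unitmx /\
    forall x, f x = x *m A + b.

Definition is_lift {X M : topologicalType} (p : X -> M) (fh : X -> X)
    (f : M -> M) : Prop :=
  homeomorphism fh /\ p \o fh = f \o p.

(* The type [{compact-open, M -> M}] matters: the topology that the library
   puts on the bare arrow type [M -> M] is that of pointwise convergence. *)
Definition Aff (R : realType) (n : nat) (M : topologicalType)
    (p : 'rV[R]_n -> M) : set {compact-open, M -> M} :=
  [set f : {compact-open, M -> M} | @homeomorphism M M f /\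
    exists fh, affine_transformation fh /\ is_lift p fh f].

Definition Aff0 (R : realType) (n : nat) (M : topologicalType)
    (p : 'rV[R]_n -> M) : set {compact-open, M -> M} :=
  connected_component (Aff p) (@id M : {compact-open, M -> M}).

Definition compose_co {M : topologicalType} (f g : {compact-open, M -> M})
    : {compact-open, M -> M} := fun x => f (g x).

Definition circle (R : realType) : topologicalType :=
  set_type [set z : R * R | z.1 ^+ 2 + z.2 ^+ 2 = 1].

Definition torus (R : realType) (d : nat) : topologicalType :=
  prod_topology (fun _ : 'I_d => circle R).

(* [x |-> (q x, phi x)] is a homeomorphism from [q @^-1` U] onto [U] times [F],
   with inverse [psi]. *)
Definition local_trivialization {E B F : topologicalType} (q : E -> B)
    (U : set B) (phi : E -> F) (psi : B * F -> E) : Prop :=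
  [/\ {within q @^-1` U, continuous phi},
      {within U `*` [set: F], continuous psi},
      forall x, U (q x) -> psi (q x, phi x) = x
    & forall b y, U b -> q (psi (b, y)) = b /\ phi (psi (b, y)) = y].

Definition fibre_bundle {E B : topologicalType} (F : topologicalType)
    (q : E -> B) : Prop :=
  continuous q /\
  forall b, exists U : set B, [/\ open U, U b &
    exists (phi : E -> F) (psi : B * F -> E), local_trivialization q U phi psi].

(* Main.v *)
(** Aff(M)_0 lifts to a flow of commuting affine maps of R^n that commute with
    G. The flow is free: the fixed points of one of its maps form a G-invariant
    affine subspace, and, by a degree argument in the form of the
    Poincaré–Miranda theorem, a nonempty invariant convex set is the whole
    space. A free commuting affine flow of codimension one has a global slice,
    so that R^n = R × R^(n-1) with G acting by (y, v) ↦ (φ_g y, v + τ_g y). The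
    orbit of the height of a compact leaf is discrete, and the stabilizer of
    the leaf acts on it as a lattice. Between two consecutive such leaves,
    averaging the cocycle τ along the lattice makes it almost linear, which
    yields an equivariant chart [0, 1] × R^(n-1). Hence M is [0, 1] × T^(n-1)
    with its two ends either glued to each other, or each folded by a
    translation of half a period. In the folded case the fibration over the
    circle comes from a character of the lattice that is odd on both doubled
    translations. *)
Require Import Defs.
From HB Require Import structures.
From mathcomp Require Import all_boot all_order all_algebra.
From mathcomp Require Import all_classical all_reals all_analysis.
From mathcomp Require Import ring lra zify.
Set Implicit Arguments.
Unset Strict Implicit.
Unset Printing Implicit Defensive.
Import Order.TTheory GRing.Theory Num.Theory.
Import numFieldNormedType.Exports.
Local Open Scope classical_set_scope.
Local Open Scope ring_scope.

(** * A discrete Stokes formula and the Poincaré–Miranda theorem *)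

Section DiscreteStokes.

(** A map in Aff(M)_0 has an affine lift, but the lift that commutes with [G] is a priori only a
    [G]-translate of it, by an element that varies with the map and need not be affine. The Baire
    category theorem makes this element constant on an open set of parameters, and the group law
    carries affineness back to the identity. One-parameter subgroups are limits, along an
    ultrafilter, of powers of small elements. The slice rests on a dichotomy for the commuting
    fields: all nilpotent, with an invariant affine function or one more commuting nilpotent field;
    or not, with an invariant line split off by Fitting's lemma. The main obstacle is that the
    lattice of a compact leaf may move the heights between two leaves, with any closed set of common
    fixed heights. Between neighbouring fixed heights some lattice direction drifts from one end to
    the other, so the averaged cocycle is close to a mixture, of slowly varying weight, of its
    linear values at both ends. A mixture of invertible matrices can be singular; here properness of
    the action along long segments excludes it. *)

Definition upd (x : nat -> nat) (j v : nat) : nat -> nat :=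
  fun i => if i == j then v else x i.

Definition step (j : nat) (x : nat -> nat) : nat -> nat := upd x j (x j).+1.

(* The coboundary, modulo 2, in direction [j]. *)
Definition ddir (j : nat) (a : (nat -> nat) -> 'F_2) : (nat -> nat) -> 'F_2 :=
  fun x => a (step j x) + a x.

(* The cup product of the coboundaries of the functions [a_k], evaluated on the
   cube at [x] with directions [S]. *)
Fixpoint cup (s : seq ((nat -> nat) -> 'F_2)) (S : seq nat) (x : nat -> nat)
    : 'F_2 :=
  if s is a :: s' then
    \sum_(j <- S) ddir j a x * cup s' (rem j S) (step j x)
  else 1.

Lemma addF2 (x : 'F_2) : x + x = 0.
Proof. by apply/eqP; case: x => -[|[|n]] i. Qed.

Lemma step_comm i j x : step i (step j x) = step j (step i x).
Proof.
apply/funext => k; rewrite /step /upd.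
by case: (eqVneq i j) => [->//|ij]; case: (eqVneq k i) => [->|ki];
  case: (eqVneq k j) => [kj|kj] //=; rewrite ?kj ?(negbTE ij) ?(eq_sym j i) ?(negbTE ij) //;
  move: ij; rewrite ?kj ?eqxx.
Qed.

Lemma ddir_comm i j a x : ddir i (ddir j a) x = ddir j (ddir i a) x.
Proof. by rewrite /ddir step_comm; ring. Qed.

Lemma ddir_sum (I : Type) (r : seq I) P (F : I -> (nat -> nat) -> 'F_2) i x :
  ddir i (fun y => \sum_(j <- r | P j) F j y) x = \sum_(j <- r | P j) ddir i (F j) x.
Proof. by rewrite /ddir -big_split. Qed.

Lemma big_rem_neq (S : seq nat) j (F : nat -> 'F_2) : uniq S -> 
  \sum_(i <- rem j S) F i = \sum_(i <- S | i != j) F i.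
Proof. by move=> uS; rewrite rem_filter // big_filter. Qed.

(** The two off-diagonal halves of a symmetric sum are equal and cancel modulo 2. Applied to second
    differences, this is the identity d d = 0. *)
Lemma sum_sym0 (S : seq nat) (F : nat -> nat -> 'F_2) :
  (forall i j, F i j = F j i) ->
  \sum_(j <- S) \sum_(i <- S | i != j) F i j = 0.
Proof.
move=> Fs; rewrite (eq_bigr (fun j => \sum_(i <- S | (i < j)%N) F i j +
  \sum_(i <- S | (j < i)%N) F i j)); last first.
  move=> j _; rewrite (bigID (fun i => (i < j)%N)) /=; congr (_ + _).
    by apply: eq_bigl => i; case: ltngtP.
  by apply: eq_bigl => i; case: ltngtP.
rewrite big_split /= [X in _ + X](exchange_big_dep predT) //=.
rewrite [X in _ + X](_ : _ = \sum_(j <- S) \sum_(i <- S | (i < j)%N) F i j) ?addF2 //.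
by apply: eq_bigr => j _; apply: eq_bigr => i _; rewrite Fs.
Qed.

Lemma rem_comm (S : seq nat) i j : uniq S -> rem i (rem j S) = rem j (rem i S).
Proof.
move=> uS; rewrite !rem_filter ?filter_uniq // -!filter_predI.
by apply: eq_filter => k /=; rewrite andbC.
Qed.

(** The Leibniz rule modulo 2. Closedness of the cup product of [s] kills one of the two terms in
    the coboundary of [a] times it, which gives exactness for [a :: s]; closedness for [a :: s] then
    follows from d d = 0. *)
Lemma cup_closed_exact s :
  (forall S x, uniq S -> \sum_(j <- S) ddir j (cup s (rem j S)) x = 0) /\
  (forall a S x, uniq S -> cup (a :: s) S x =
     \sum_(j <- S) ddir j (fun y => a y * cup s (rem j S) y) x).
Proof.
have ex s' : (forall S x, uniq S -> \sum_(j <- S) ddir j (cup s' (rem j S)) x = 0) ->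
  forall a S x, uniq S -> cup (a :: s') S x =
     \sum_(j <- S) ddir j (fun y => a y * cup s' (rem j S) y) x.
  move=> cl a S x uS; rewrite /=.
  have /(congr1 (fun z => a x * z)) := cl S x uS; rewrite mulr0 mulr_sumr => z0.
  rewrite -[LHS]addr0 -[X in _ + X = _]z0 -big_split /=.
  apply: eq_bigr => j _; rewrite /ddir.
  set u := a _; set v := a x; set w := cup _ _ _; set t := cup _ _ _.
  by rewrite -[RHS]addr0 -[X in _ = _ + X](addF2 (v * w)); ring.
elim: s => [|a s [IHc IHe]].
  have cl : forall S x, uniq S -> \sum_(j <- S) ddir j (cup [::] (rem j S)) x = 0.
    by move=> S x _; rewrite big1 // => j _; rewrite /ddir /= addF2.
  by split => // a S x uS; exact: ex.
have cl : forall S x, uniq S -> \sum_(j <- S) ddir j (cup (a :: s) (rem j S)) x = 0.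
  move=> S x uS.
  pose b i j y := a y * cup s (rem i (rem j S)) y.
  rewrite (eq_bigr (fun j => \sum_(i <- S | i != j) ddir j (ddir i (b i j)) x)).
    apply: sum_sym0 => i j; rewrite ddir_comm; congr (ddir _ (ddir _ _) _).
    by apply/funext => y; rewrite /b rem_comm.
  move=> j _; rewrite -ddir_sum /ddir !IHe ?rem_uniq // !big_rem_neq //.
by split => // a' S x uS; exact: ex.
Qed.

Lemma upd_comm x i j u v : i != j -> upd (upd x i u) j v = upd (upd x j v) i u.
Proof.
move=> ij; apply/funext => k; rewrite /upd.
by case: (eqVneq k j) => // ->; rewrite eq_sym (negbTE ij).
Qed.

Lemma upd_same x i u v : upd (upd x i u) i v = upd x i v.
Proof. by apply/funext => k; rewrite /upd; case: eqP. Qed.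

Lemma step_upd x i j v : i != j -> step i (upd x j v) = upd (step i x) j v.
Proof.
move=> ij; rewrite /step (_ : upd x j v i = x i); last by rewrite /upd /= (negbTE ij).
by apply: upd_comm; rewrite eq_sym.
Qed.

Variable N : nat.

Fixpoint boxsum (js : seq nat) (F : (nat -> nat) -> 'F_2) (x : nat -> nat) : 'F_2 :=
  if js is j :: js' then \sum_(v < N) boxsum js' F (upd x j v) else F x.

Lemma boxsum_sum (I : Type) (r : seq I) js (F : I -> (nat -> nat) -> 'F_2) x :
  boxsum js (fun y => \sum_(i <- r) F i y) x = \sum_(i <- r) boxsum js (F i) x.
Proof.
elim: js x => [//|j js IH] x /=.
by rewrite exchange_big; apply: eq_bigr => v _; rewrite IH.
Qed.

Lemma eq_boxsum js F G x : (forall y, F y = G y) -> boxsum js F x = boxsum js G x.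
Proof. by move=> FG; congr boxsum; apply/funext. Qed.

Lemma boxsum_upd js F x j v : j \notin js ->
  boxsum js F (upd x j v) = boxsum js (fun y => F (upd y j v)) x.
Proof.
elim: js x => [//|i js IH] x /=; rewrite inE negb_or => /andP[ij jjs].
by apply: eq_bigr => u _; rewrite upd_comm // IH.
Qed.

Lemma telescopeF2 (f : nat -> 'F_2) : \sum_(v < N) (f v.+1 + f v) = f N + f 0%N.
Proof.
elim: N => [|n IH]; first by rewrite big_ord0 addF2.
rewrite big_ord_recr /= IH -[RHS]addr0 -[X in _ = _ + X](addF2 (f n)).
by move: (f n) (f 0%N) (f n.+1) => u v w; ring.
Qed.

(** The sum telescopes in direction [j] and leaves the sums over the two opposite faces. *)
Lemma boxsum_ddir js F x j : uniq js -> j \in js ->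
  (forall y, F (upd y j N) = 0) -> (forall y, F (upd y j 0%N) = 0) ->
  boxsum js (ddir j F) x = 0.
Proof.
move=> + + FN F0; elim: js x => [//|i js IH] x /= /andP[ijs ujs].
rewrite inE; case: (eqVneq j i) => [ji _|ji /= jjs]; last first.
  by rewrite big1 // => v _; exact: IH.
rewrite -ji in ijs *.
rewrite (eq_bigr (fun v : 'I_N => boxsum js (fun y => F (upd y j v.+1)) x +
                       boxsum js (fun y => F (upd y j v)) x)).
  rewrite (telescopeF2 (fun v => boxsum js (fun y => F (upd y j v)) x)).
  have z : forall js y, boxsum js (fun=> 0) y = 0.
    by elim=> [//|? ? IH0] ?; rewrite /= big1.
  by rewrite (eq_boxsum _ _ FN) (eq_boxsum _ _ F0) !z addr0.
move=> v _; rewrite boxsum_upd // .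
have add : forall js f g y, boxsum js (fun z => f z + g z) y = boxsum js f y + boxsum js g y.
  by elim=> [//|? ? IH0] f g y /=; rewrite -big_split; apply: eq_bigr => ? _; rewrite IH0.
rewrite -add; apply: eq_boxsum => y.
by rewrite /ddir /step upd_same /upd eqxx.
Qed.

(** Every term of the expansion has a factor that is the coboundary of [a] in a direction other than
    [j], that is, along a face on which [a] is constant. *)
Lemma cup_const0 (s : seq ((nat -> nat) -> 'F_2)) T x j v a : a \in s -> (forall y, a (upd y j v) = a (upd x j v)) ->
  j \notin T -> cup s T (upd x j v) = 0.
Proof.
move=> + ac; elim: s T x ac => [//|b s IH] T x ac; rewrite inE => /orP[/eqP <-|ain] jT /=.
  rewrite big1_seq // => i /andP[_ iT].
  have ij : i != j by apply: contraNneq jT => <-.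
  by rewrite /ddir step_upd // ac addF2 mul0r.
rewrite big1_seq // => i /andP[_ iT].
have ij : i != j by apply: contraNneq jT => <-.
rewrite step_upd // IH ?mulr0 //.
  by move=> y; rewrite ac [RHS]ac.
by apply: contra jT => /mem_rem.
Qed.


(** Stokes: the cup product is the coboundary of [a j] times the product of the others. On the faces
    of a direction [i] other than [j] that product contains the constant [a i] and vanishes. Of the
    two faces of direction [j] only the one with [a j = 1] contributes, and its share is the
    statement in one dimension less. *)
Lemma boxsum_cup (a : nat -> (nat -> nat) -> 'F_2) (js : seq nat) x : uniq js ->
  (forall j y, a j (upd y j 0%N) = 0) -> (forall j y, a j (upd y j N) = 1) ->
  boxsum js (cup (map a js) js) x = 1.
Proof.
move=> + a0 aN; elim: js x => [//|j js IH] x ujs; have := ujs; rewrite [X in X -> _]/= => /andP[jjs ujs'].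
rewrite (@eq_boxsum (j :: js) _ (fun y => \sum_(i <- j :: js)
  ddir i (fun y => a j y * cup (map a js) (rem i (j :: js)) y) y)); last first.
  by move=> y; exact: (cup_closed_exact _).2.
rewrite boxsum_sum big_cons big1_seq ?addr0 => [|i /andP[_ ijs]]; last first.
  apply: boxsum_ddir; rewrite ?inE ?ijs ?orbT //.
    move=> y; rewrite (@cup_const0 _ _ _ _ _ (a i)) ?mulr0 ?map_f //.
      by move=> z; rewrite !aN.
    by rewrite mem_rem_uniq // inE eqxx.
  move=> y; rewrite (@cup_const0 _ _ _ _ _ (a i)) ?mulr0 ?map_f //.
    by move=> z; rewrite !a0.
  by rewrite mem_rem_uniq // inE eqxx.
rewrite /= eqxx; set F := fun y => a j y * _.
rewrite (eq_bigr (fun v : 'I_N => boxsum js (fun y => F (upd y j v.+1)) x +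
                       boxsum js (fun y => F (upd y j v)) x)); last first.
  move=> v _; rewrite boxsum_upd //.
  have add : forall js f g y, boxsum js (fun z => f z + g z) y = boxsum js f y + boxsum js g y.
    by elim=> [//|? ? IH0] f g y /=; rewrite -big_split; apply: eq_bigr => ? _; rewrite IH0.
  by rewrite -add; apply: eq_boxsum => y; rewrite /ddir /step upd_same {2}/upd eqxx.
rewrite (telescopeF2 (fun v => boxsum js (fun y => F (upd y j v)) x)).
have -> : boxsum js (fun y => F (upd y j 0%N)) x = 0.
  have z : forall js y, boxsum js (fun=> 0) y = 0.
    by elim=> [//|? ? IH0] ?; rewrite /= big1.
  by rewrite (@eq_boxsum _ _ (fun=> 0)) // => y; rewrite /F a0 mul0r.
rewrite addr0 -(IH (upd x j N)) // boxsum_upd //.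
by apply: eq_boxsum => y; rewrite /F aN mul1r.
Qed.

(** A nonzero sum has a nonzero term, all of whose factors are nonzero; a nonzero factor for [a j]
    is a change of value along an edge of the cube. *)
Lemma cup_neq0 (a : nat -> (nat -> nat) -> 'F_2) s S x : uniq S ->
  cup (map a s) S x != 0 -> forall j, j \in s -> exists p q,
  [/\ forall i, (x i <= p i <= x i + (i \in S))%N,
      forall i, (x i <= q i <= x i + (i \in S))%N & a j p != a j q].
Proof.
elim: s S x => [//|b s IH] S x uS /=.
move=> nz j; have [i iS] : exists2 i, i \in S &
    ddir i (a b) x * cup (map a s) (rem i S) (step i x) != 0.
  apply: contrapT => H; move/eqP: nz; apply.
  rewrite big1_seq // => i /andP[_ iS]; apply: contrapT => /eqP nz0.
  by apply: H; exists i.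
rewrite mulf_eq0 negb_or => /andP[di ci].
rewrite inE => /orP[/eqP ->|js].
  exists (step i x), x; split.
  - move=> k; rewrite /step /upd; case: (eqVneq k i) => [->|_]; rewrite ?iS; lia.
  - by move=> k; rewrite leqnn leq_addr.
  - by apply: contraNneq di => e; rewrite /ddir e addF2.
have [p [q [Hp Hq pq]]] := IH _ _ (rem_uniq i uS) ci j js.
have aux k : (step i x k + (k \in rem i S) = x k + (k \in S))%N.
  rewrite mem_rem_uniq // inE /step /upd.
  by case: (eqVneq k i) => [->|_] //=; rewrite iS; lia.
have aux2 k : (x k <= step i x k)%N.
  by rewrite /step /upd; case: eqP => [->|] //; lia.
exists p, q; split => // k.
  by have /andP[h1 h2] := Hp k; rewrite (leq_trans (aux2 k) h1) -aux.
by have /andP[h1 h2] := Hq k; rewrite (leq_trans (aux2 k) h1) -aux.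
Qed.

Lemma boxsum_neq0 js F x : uniq js -> boxsum js F x != 0 ->
  exists2 y, F y != 0 & forall i, i \in js -> (y i < N)%N.
Proof.
elim: js F x => [|j js IH] F x /=; first by move=> _ Fx; exists x.
move=> /andP[jjs ujs] nz.
have [v nzv] : exists v : 'I_N, boxsum js F (upd x j v) != 0.
  apply: contrapT => H; move/eqP: nz; apply.
  rewrite big1 // => v _; apply: contrapT => /eqP nz0; by apply: H; exists v.
move: nzv; rewrite boxsum_upd // => /(IH _ _ ujs) [z Fz zN].
exists (upd z j v) => // i; rewrite inE /upd.
by case: eqP => //= _; exact: zN.
Qed.

(** A cubical form of Sperner's lemma: the cup products of the cells of the box sum to 1, so one of
    them is nonzero, and in that cell each labelling takes both values. *)
Lemma mixed_cell (n : nat) (a : nat -> (nat -> nat) -> bool) :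
  (forall j y, y j = 0%N -> a j y = false) ->
  (forall j y, y j = N -> a j y = true) -> (0 < N)%N ->
  exists x, (forall i, (i < n)%N -> (x i < N)%N) /\
  forall j, (j < n)%N -> exists p q, [/\ forall i, (x i <= p i <= (x i).+1)%N,
    forall i, (x i <= q i <= (x i).+1)%N, a j p & ~~ a j q].
Proof.
move=> a0 aN N0; pose b j y : 'F_2 := if a j y then 1 else 0.
have := @boxsum_cup b (iota 0 n) (fun=> 0%N) (iota_uniq _ _) _ _.
have b0 : forall j y, b j (upd y j 0%N) = 0.
  by move=> j y; rewrite /b a0 // /upd eqxx.
have bN : forall j y, b j (upd y j N) = 1.
  by move=> j y; rewrite /b aN // /upd eqxx.
move=> /(_ b0 bN) e; have : boxsum (iota 0 n) (cup (map b (iota 0 n)) (iota 0 n)) (fun=> 0%N) != 0.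
  by rewrite e.
move=> /(boxsum_neq0 (iota_uniq _ _)) [x cx xN]; exists x; split.
  by move=> i ni; apply: xN; rewrite mem_iota.
move=> j jn; have [|p [q [Hp Hq pq]]] := cup_neq0 (iota_uniq 0 n) cx (j := j).
  by rewrite mem_iota.
have le1 k : (x k + (k \in iota 0 n) <= (x k).+1)%N by case: (_ \in _); lia.
have Hp' k : (x k <= p k <= (x k).+1)%N by have := Hp k; have := le1 k; lia.
have Hq' k : (x k <= q k <= (x k).+1)%N by have := Hq k; have := le1 k; lia.
move: pq; rewrite /b; case: ifPn => [ap|ap]; case: ifPn => [aq|aq]; rewrite ?eqxx // => _.
  by exists p, q.
by exists q, p.
Qed.

End DiscreteStokes.

(** * Norm and convergence of matrices, entry by entry *)

Section MatrixNorm.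
Context {R : realType}.

Lemma near_ball_ex {V : normedModType R} (x : V) (P : V -> Prop) :
  (\forall y \near x, P y) -> exists2 e, 0 < e & forall y, `|x - y| < e -> P y.
Proof. by move=> /nbhs_normP[e /= e0 He]; exists e. Qed.

Lemma ball_near {V : normedModType R} (x : V) (P : V -> Prop) e : 0 < e ->
  (forall y, `|x - y| < e -> P y) -> \forall y \near x, P y.
Proof. by move=> e0 He; apply/nbhs_normP; exists e. Qed.

Lemma near_dist_lt {V : normedModType R} (x : V) e : 0 < e ->
  \forall y \near x, `|x - y| < e.
Proof. by move=> e0; exact: ball_near e0 _. Qed.

Lemma near_right_ex (P : R -> Prop) :
  (\forall d \near 0^'+, P d) -> exists2 d, 0 < d & P d.
Proof. by move=> /(filterI (nbhs_right_gt 0)) /filter_ex[d [/= d0 Pd]]; exists d. Qed.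

Lemma mx_entry_le {m n} (A : 'M[R]_(m, n)) i j : `|A i j| <= `|A|.
Proof.
by rewrite [leRHS]/Num.norm /= mx_normrE; apply/bigmax_geP; right => /=; exists (i, j).
Qed.

Lemma mx_norm_le {m n} (A : 'M[R]_(m, n)) r : 0 <= r ->
  (forall i j, `|A i j| <= r) -> `|A| <= r.
Proof.
move=> r0 Ar; rewrite [leLHS]/Num.norm /= mx_normrE.
by apply/bigmax_leP; split => // -[i j] _; exact: Ar.
Qed.

Lemma mx_norm_lt {m n} (A : 'M[R]_(m, n)) r : 0 < r ->
  (forall i j, `|A i j| < r) -> `|A| < r.
Proof.
move=> r0 Ar; rewrite [ltLHS]/Num.norm /= mx_normrE.
by apply/bigmax_ltP; split => // -[i j] _; exact: Ar.
Qed.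

Lemma cvg_mx {T : Type} {F : set_system T} {FF : Filter F} {m n}
    (f : T -> 'M[R]_(m, n)) (A : 'M[R]_(m, n)) :
  (forall i j, (fun t => f t i j) @ F --> A i j) -> f @ F --> A.
Proof.
move=> fA; apply/cvgrPdist_lt => e e0.
have : \forall t \near F, forall ij : 'I_m * 'I_n, `|A ij.1 ij.2 - f t ij.1 ij.2| < e.
  by apply: filter_forall => -[i j]; move/cvgrPdist_lt: (fA i j); exact.
apply: filterS => t H; apply: mx_norm_lt => // i j.
by rewrite !mxE; exact: (H (i, j)).
Qed.

Lemma cvg_entry {T : Type} {F : set_system T} {FF : Filter F} {m n}
    (f : T -> 'M[R]_(m, n)) (A : 'M[R]_(m, n)) i j :
  f @ F --> A -> (fun t => f t i j) @ F --> A i j.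
Proof.
move=> fA; apply: (cvg_comp f (fun B : 'M[R]_(m, n) => B i j) fA).
exact: coord_continuous.
Qed.

Lemma closed_norm_le {V : normedModType R} r : closed [set x : V | `|x| <= r].
Proof.
refine (@preimage_closed V R (fun x : V => `|x|) [set y | y <= r] _ (@closed_le R r)).
by move=> x _; exact: norm_continuous.
Qed.

Lemma compact_norm_le {n} r : compact [set x : 'rV[R]_n | `|x| <= r].
Proof.
apply: bounded_closed_compact; last exact: closed_norm_le.
by exists r; split; [exact: num_real|move=> M rM x /= /le_trans; apply; exact: ltW].
Qed.

Lemma open_norm_lt {V : normedModType R} r : open [set x : V | `|x| < r].
Proof.
have := @open_lt R r; apply: open_comp => x _; exact: norm_continuous.
Qed.

End MatrixNorm.

Section Miranda.
Context {R : realType} {n : nat}.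

(** Without a zero, compactness gives a radius [d] such that around each point of the cube some
    component of [f] keeps a strict sign on the ball of radius [d]. A cell of mesh below [d] in
    which each component takes both signs is then impossible. *)
Lemma poincare_miranda (f : 'rV[R]_n -> 'rV[R]_n) (r : R) : 0 < r -> continuous f ->
  (forall (x : 'rV[R]_n) i, `|x| <= r -> x ord0 i = - r -> f x ord0 i <= 0) ->
  (forall (x : 'rV[R]_n) i, `|x| <= r -> x ord0 i = r -> 0 <= f x ord0 i) ->
  exists2 x, `|x| <= r & f x = 0.
Proof.
move=> r0 fc fle fge; apply: contrapT => H.
have fn0 x : `|x| <= r -> exists i, f x ord0 i != 0.
  move=> xr; apply: contrapT => Hi; apply: H; exists x => //.
  apply/rowP => i; rewrite mxE; apply: contrapT => /eqP fi.
  by apply: Hi; exists i.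
pose P (d : R) (x : 'rV[R]_n) := exists i,
    (forall y, `|x - y| < d -> f y ord0 i > 0) \/
    (forall y, `|x - y| < d -> f y ord0 i < 0).
have : \forall d \near 0^'+, [set x : 'rV[R]_n | `|x| <= r] `<=` P d.
  move/compact_near_coveringP: (@compact_norm_le R n r); apply => x /fn0[i fi].
  have ci : {for x, continuous (fun y => f y ord0 i)}.
    by exact: (@cvg_entry R _ (nbhs x) _ 1 n f (f x) ord0 i (fc x)).
  have [e e0 He] : exists2 e, 0 < e & forall y, `|x - y| < e ->
      f y ord0 i != 0 /\ (0 < f x ord0 i) = (0 < f y ord0 i).
    case: (ltgtP (f x ord0 i) 0) fi => // fi _.
      have /near_ball_ex[e e0 He] : \forall y \near x, f y ord0 i < 0.
        by exact: (cvgr_lt (f x ord0 i) ci).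
      exists e => // y /He fy.
      by rewrite lt_eqF // (lt_gtF fy).
    have /near_ball_ex[e e0 He] : \forall y \near x, 0 < f y ord0 i.
      by exact: (cvgr_gt (f x ord0 i) ci).
    exists e => // y /He fy.
    by rewrite gt_eqF // fy.
  near=> y d; exists i.
  have key z : `|y - z| < d -> `|x - z| < e.
    move=> yz; rewrite -(subrK y x) -addrA; apply: (le_lt_trans (ler_normD _ _)).
    rewrite (splitr e) ltrD //.
      near: y.
      have e2 : 0 < e / 2 by rewrite divr_gt0.
      have K := @near_dist_lt R 'rV[R]_n x (e / 2) e2. exact K.
    apply: (lt_le_trans yz); near: d; apply: nbhs_right_le; by rewrite divr_gt0.
  have [fx|fx] := boolP (0 < f x ord0 i).
    by left => z /key/He[_ <-].
  right => z /key/He[fz]; rewrite (negbTE fx) => /esym/negbT; rewrite -leNgt => fz0.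
  by rewrite lt_neqAle fz fz0.
move=> /near_right_ex[d d0 Pd].
have [N N0 HN] : exists2 N : nat, (0 < N)%N & r * 2 / N%:R < d.
  have [N HN] : exists N : nat, r * 2 / d < N%:R.
    by exists (Num.truncn (r * 2 / d)).+1; exact: truncnS_gt.
  have NR0 : 0 < N%:R :> R by apply: le_lt_trans HN; rewrite divr_ge0 ?mulr_ge0 // ltW.
  exists N; first by rewrite -(ltr0n R).
  by rewrite ltr_pdivrMr // [d * _]mulrC -ltr_pdivrMr.
have N0' : 0 < (N%:R : R) by rewrite ltr0n.
pose pt (x : nat -> nat) : 'rV[R]_n := \row_i (- r + r * 2 / N%:R * (x i)%:R).
(* The labels are the signs of the components, but they are imposed on the faces, where the
   hypotheses on [f] are only weak inequalities. *)
pose a j (y : nat -> nat) : bool := (y j != 0%N) &&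
  ((y j == N) || if insub j is Some i then 0 < f (pt y) ord0 i else false).
have [] := @mixed_cell N n a _ _ N0.
- by move=> j y /eqP yj; rewrite /a yj.
- by move=> j y yj; rewrite /a yj eqxx andbT -lt0n.
move=> x [xN xa].
have cell p : (forall i, (x i <= p i <= (x i).+1)%N) -> `|pt p| <= r /\ `|pt x - pt p| < d.
  move=> xp; split.
    apply: mx_norm_le (ltW r0) _ => i' i; rewrite mxE ler_norml.
    have pN : (p i)%:R <= N%:R :> R.
      by rewrite ler_nat; have := xp i; have := xN _ (ltn_ord i); lia.
    have c0 : 0 <= r * 2 / N%:R * (p i)%:R.
      by rewrite mulr_ge0 // divr_ge0 // ?mulr_ge0 // ltW.
    have c1 : r * 2 / N%:R * (p i)%:R <= r * 2.
      by rewrite mulrAC ler_pdivrMr // ler_pM2l // mulr_gt0.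
    by move: (_ * _ * (p i)%:R) c0 c1 => c c0 c1; lra.
  apply: mx_norm_lt d0 _ => i' i; rewrite !mxE.
  rewrite [X in `|X|](_ : _ = r * 2 / N%:R * ((x i)%:R - (p i)%:R)); last by ring.
  apply: le_lt_trans HN; rewrite normrM ger0_norm; last by rewrite divr_ge0 // ?mulr_ge0 // ltW.
  rewrite ler_piMr //; first by rewrite divr_ge0 // ?mulr_ge0 // ltW.
  have : (p i = x i \/ p i = (x i).+1)%N by have := xp i; lia.
  by case=> ->; rewrite ?subrr ?normr0 // -natr1 opprD addrA subrr sub0r normrN normr1.
have xx i : (x i <= x i <= (x i).+1)%N by lia.
have [xr _] := cell x xx.
have [i Hi] := Pd _ xr.
have [p [q [Hp Hq ap aq]]] := xa i (ltn_ord i).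
have [pr xp] := cell _ Hp; have [qr xq] := cell _ Hq.
have fp : 0 <= f (pt p) ord0 i.
  move: ap; rewrite /a => /andP[_] /orP[/eqP piN|].
    apply: fge => //; rewrite mxE piN divfK ?gt_eqF //; ring.
  by rewrite valK => /ltW.
have fq : f (pt q) ord0 i <= 0.
  move: aq; rewrite /a negb_and negbK => /orP[/eqP qi0|].
    by apply: fle => //; rewrite mxE qi0 mulr0 addr0.
  by rewrite negb_or valK -leNgt => /andP[].
case: Hi => Hi.
  by have := Hi _ xq; rewrite ltNge fq.
by have := Hi _ xp; rewrite ltNge fp.
Unshelve. all: by end_near.
Qed.

End Miranda.

Section CvgKit.
Context {R : realType} {T : Type} {F : set_system T} {FF : Filter F}.

Lemma cvg_app {U V : topologicalType} (f : T -> U) (g : U -> V) (a : U) :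
  {for a, continuous g} -> f @ F --> a -> (fun t => g (f t)) @ F --> g a.
Proof. by move=> gc fa; exact: (cvg_comp f g fa). Qed.

Lemma cvg_maxr (f g : T -> R) (a b : R) : f @ F --> a -> g @ F --> b ->
  (fun t => Num.max (f t) (g t)) @ F --> Num.max a b.
Proof.
move=> fa gb.
apply: (@cvg_app _ _ (fun t => (f t, g t)) (fun z : R * R => Num.max z.1 z.2 : R) (a, b)).
  by apply: (@continuous_max R _ fst snd); [exact: cvg_fst|exact: cvg_snd].
exact: (@cvg_pair T R R F (nbhs a) (nbhs b) FF _ _ f g fa gb).
Qed.

Lemma cvg_minr (f g : T -> R) (a b : R) : f @ F --> a -> g @ F --> b ->
  (fun t => Num.min (f t) (g t)) @ F --> Num.min a b.
Proof.
move=> fa gb.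
apply: (@cvg_app _ _ (fun t => (f t, g t)) (fun z : R * R => Num.min z.1 z.2 : R) (a, b)).
  by apply: (@continuous_min R _ fst snd); [exact: cvg_fst|exact: cvg_snd].
exact: (@cvg_pair T R R F (nbhs a) (nbhs b) FF _ _ f g fa gb).
Qed.

End CvgKit.

(** * Invariant convex sets of cocompact actions *)

Section ConvexInvariant.
Context {R : realType} {n : nat}.
Notation V := 'rV[R]_n.
Variables (G : set (V -> V)) (inv : (V -> V) -> V -> V) (r0 : R).
Hypothesis G_cont : forall g, G g -> continuous g.
Hypothesis G_id : G id.
Hypothesis G_comp : forall g h, G g -> G h -> G (g \o h).
Hypothesis G_inv : forall g, G g -> [/\ G (inv g), cancel g (inv g) & cancel (inv g) g].
Hypothesis G_proper : forall r, finite_set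
  [set g | G g /\ exists x, `|x| <= r /\ `|g x| <= r].
Hypothesis G_cocompact : forall x, exists2 g, G g & `|g x| <= r0.
Variables (C : set V) (v0 : V).
Hypothesis C_convex : forall x y t, C x -> C y -> 0 <= t <= 1 ->
  C ((1 - t) *: x + t *: y).
Hypothesis C_inv : forall g x, G g -> C x -> C (g x).
Hypothesis C_v0 : C v0.

(** A cutoff equal to 1 on the ball of radius [r0] and zero beyond radius [r0 + 1]: for each [x],
    cocompactness provides a [g] with [bump (g x) = 1], and properness leaves finitely many [g] with
    [bump (g x)] nonzero. *)
Let bump (y : V) : R := Num.max 0 (Num.min 1 (r0 + 1 - `|y|)).

Let bump01 y : 0 <= bump y <= 1.
Proof. by rewrite /bump le_max lexx /= ge_max ler01 ge_min lexx. Qed.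

Let bump1 y : `|y| <= r0 -> bump y = 1.
Proof.
move=> yr; rewrite /bump min_l; first by rewrite max_r.
by move: yr; set u := `|y|; lra.
Qed.

Let bump0 y : bump y != 0 -> `|y| <= r0 + 1.
Proof.
apply: contraR; rewrite -ltNge => yr; rewrite /bump max_l // ge_min; apply/orP; right.
by move: yr; set u := `|y|; lra.
Qed.

Let cvg_bump {T : Type} {F : set_system T} {FF : Filter F} (f : T -> V) a :
  f @ F --> a -> (fun t => bump (f t)) @ F --> bump a.
Proof.
move=> fa; apply: cvg_maxr; first exact: cvg_cst.
apply: cvg_minr; first exact: cvg_cst.
by apply: cvgB; [exact: cvg_cst|exact: cvg_norm].
Qed.

(* [push g t x P] moves [P], in the coordinate given by [g], towards [v0] by the
   fraction [t * bump (g x)]. *)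
Let push g (t : R) (x P : V) :=
  inv g ((1 - t * bump (g x)) *: g P + (t * bump (g x)) *: v0).

Let homot (gs : seq (V -> V)) (t : R) (x : V) : V := foldr (fun g => push g t x) x gs.

Let homot_cvg gs {T : Type} {F : set_system T} {FF : Filter F} (t : T -> R) (x : T -> V) t0 x0 :
  (forall g, g \in gs -> G g) -> t @ F --> t0 -> x @ F --> x0 ->
  (fun s => homot gs (t s) (x s)) @ F --> homot gs t0 x0.
Proof.
move=> + tt0 xx0; elim: gs => [//|g gs IH] gsG /=.
have Gg : G g by apply: gsG; rewrite inE eqxx.
have [Gi _ _] := G_inv Gg.
have c1 : (fun s => t s * bump (g (x s))) @ F --> t0 * bump (g x0).
  by apply: cvgM => //; apply: cvg_bump; apply: cvg_app => //; exact: G_cont.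
have c2 : (fun s => g (homot gs (t s) (x s))) @ F --> g (homot gs t0 x0).
  by apply: cvg_app; [exact: G_cont|apply: IH => h hg; apply: gsG; rewrite inE hg orbT].
apply: cvg_app; first exact: G_cont.
by apply: cvgD; apply: cvgZ => //; [apply: cvgB => //; exact: cvg_cst|exact: cvg_cst].
Qed.

Let homot0 gs x : (forall g, g \in gs -> G g) -> homot gs 0 x = x.
Proof.
elim: gs => [//|g gs IH] gsG /=.
rewrite IH => [|h hg]; last by apply: gsG; rewrite inE hg orbT.
have [_ gK _] := G_inv (gsG g (mem_head _ _)).
by rewrite /push mul0r subr0 scale1r scale0r addr0.
Qed.

(** The push by [g] sends every point to [inv g v0], which is in [C]. The pushes applied after it
    move points towards other images of [v0], hence inside the convex set [C]. *)
Let homot1 gs x g : (forall g, g \in gs -> G g) -> g \in gs -> bump (g x) = 1 ->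
  C (homot gs 1 x).
Proof.
move=> + + b1; elim: gs => [//|h gs IH] gsG; rewrite inE.
have Gh : G h by apply: gsG; rewrite mem_head.
have [Gi _ _] := G_inv Gh.
move=> /orP[/eqP gh|ggs] /=.
  by rewrite /push -gh b1 mul1r subrr scale0r add0r scale1r gh; exact: C_inv.
rewrite /push mul1r; apply: C_inv => //; apply: C_convex => //; apply: C_inv => //.
by apply: IH => // k kg; apply: gsG; rewrite inE kg orbT.
Qed.

Lemma continuous_bounded_ball (f : V -> V) r : continuous f ->
  exists r', forall x, `|x| <= r -> `|f x| <= r'.
Proof.
move=> fc; have : compact (f @` [set x | `|x| <= r]).
  apply: continuous_compact; last exact: compact_norm_le.
  by apply: continuous_subspaceT.
move=> /compact_bounded[M [_ HM]]; exists (M + 1) => x xr.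
by apply: (HM (M + 1)); [rewrite ltrDl|exists x].
Qed.

Let seq_bound (T : eqType) (s : seq T) (P : T -> R -> Prop) :
  (forall g r r', r <= r' -> P g r -> P g r') ->
  (forall g, g \in s -> exists r, P g r) -> exists r, forall g, g \in s -> P g r.
Proof.
move=> Pm; elim: s => [|g s IH] H; first by exists 0.
have [r Hr] := H g (mem_head _ _).
have [r' Hr'] := IH (fun h hs => H h (mem_behead (s := g :: s) hs)).
exists (Num.max r r') => h; rewrite inE => /orP[/eqP->|hs].
  by apply: Pm Hr; rewrite le_max lexx.
by apply: Pm (Hr' _ hs); rewrite le_max lexx orbT.
Qed.

Let push_radius (S : seq (V -> V)) r : (forall g, g \in S -> G g) ->
  exists r', r <= r' /\ forall g t y, g \in S -> 0 <= t <= 1 -> `|y| <= r ->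
   `|inv g ((1 - t) *: g y + t *: v0)| <= r'.
Proof.
move=> SG.
have [r' Hr'] : exists r', forall g, g \in S -> forall t y, 0 <= t <= 1 -> `|y| <= r ->
   `|inv g ((1 - t) *: g y + t *: v0)| <= r'.
  apply: seq_bound => [g a b ab H t y t01 yr|g gS].
    exact: le_trans (H t y t01 yr) ab.
  have [Gi _ _] := G_inv (SG g gS).
  have [r1 H1] := continuous_bounded_ball r (G_cont (SG g gS)).
  have [r2 H2] := continuous_bounded_ball (r1 + `|v0|) (G_cont Gi).
  exists r2 => t y /andP[t0 t1] yr; apply: H2; apply: (le_trans (ler_normD _ _)).
  rewrite !normrZ !ger0_norm ?subr_ge0 //.
  have := H1 y yr; have := normr_ge0 v0; have := normr_ge0 (g y).
  by move: (`|v0|) (`|g y|) => a b; nra.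
exists (Num.max r r'); split; first by rewrite le_max lexx.
by move=> g t y gS t01 yr; rewrite le_max Hr' ?orbT.
Qed.

(** The homotopy moves points a bounded amount, uniformly over the group. Seen in the coordinate
    [h], an active push is given by [g \o inv h], which belongs to the finite set [S]; so at most
    [size S] pushes are active, and each enlarges the radius by the fixed function [nxt]. *)
Let homot_bounded : exists B, forall gs t x h, (forall g, g \in gs -> G g) -> uniq gs ->
  0 <= t <= 1 -> G h -> `|h x| <= r0 -> `|h (homot gs t x)| <= B.
Proof.
have /finite_seqP[S HS] := G_proper (r0 + 1).
have SP g : g \in S <-> (G g /\ exists x, `|x| <= r0 + 1 /\ `|g x| <= r0 + 1).
  by have /(congr1 (fun A => A g)) /= := HS => ->.
have SG g : g \in S -> G g by move=> /SP[].
have [nxt Hn] := choice (fun r => push_radius r SG).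
pose rho j := iter j nxt r0.
have rho_mono j k : (j <= k)%N -> rho j <= rho k.
  move=> /subnKC <-; elim: (k - j)%N => [|i IH]; first by rewrite addn0.
  by rewrite addnS (le_trans IH) // /rho iterS; have [] := Hn (iter (j + i) nxt r0).
exists (rho (size S)) => gs t x h gsG ugs t01 Gh hx.
pose act g := bump (g x) != 0.
have [Ghi hK hiK] := G_inv Gh.
have actS g : G g -> act g -> (g \o inv h) \in S.
  move=> Gg /bump0 gx; apply/SP; split; first exact: G_comp.
  exists (h x); split; first by apply: (le_trans hx); rewrite lerDl.
  by rewrite /= hK.
have cnt : (count act gs <= size S)%N.
  rewrite -size_filter -(size_map (fun g => g \o inv h)); apply: uniq_leq_size.
    rewrite map_inj_in_uniq ?filter_uniq // => f g _ _ fg.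
    apply/funext => y; have /(congr1 (fun k => k (h y))) := fg.
    by rewrite /= hK.
  move=> _ /mapP[g + ->]; rewrite mem_filter => /andP[ag ggs].
  by apply: actS => //; exact: gsG.
apply: (le_trans _ (rho_mono _ _ cnt)); move: {ugs cnt} gsG.
elim: gs => [//|g gs IH] gsG.
have Gg : G g by apply: gsG; rewrite mem_head.
have {}IH : `|h (homot gs t x)| <= rho (count act gs).
  by apply: IH => k kg; apply: gsG; rewrite inE kg orbT.
have [Ggi gK giK] := G_inv Gg.
rewrite /= /push -/(act g); have [ag|] := boolP (act g); last first.
  by rewrite negbK => /eqP ->; rewrite mulr0 subr0 scale1r scale0r addr0 gK add0n.
have /(Hn (rho (count act gs))).2 Hb := actS g Gg ag.
set s := t * _; set P := homot gs t x.
have s01 : 0 <= s <= 1.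
  have := bump01 (g x); move: t01; rewrite /s; move: (bump _) => b.
  by move=> /andP[? ?] /andP[? ?]; apply/andP; split; nra.
have := Hb s (h P) s01 IH.
have [Gk kK kiK] := G_inv (G_comp Gg Ghi).
have -> : inv (g \o inv h) ((1 - s) *: (g \o inv h) (h P) + s *: v0) =
    h (inv g ((1 - s) *: g P + s *: v0)).
  rewrite /= hK; set w := _ + _.
  by rewrite -[RHS]kK /= hK giK.
by rewrite add1n.
Qed.

(** If [z] were outside [C], the homotopy from the identity to a map into [C] would miss [z] on a
    large sphere centred at [z], since it moves points boundedly. The degree would be preserved, and
    the final map would take the value [z] after all. *)
Theorem invariant_convex_full z : C z.
Proof.
apply: contrapT => nCz.
have [B HB] := homot_bounded.
have [r' Hr'] : exists r', forall gs t x, (forall g, g \in gs -> G g) -> uniq gs ->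
    0 <= t <= 1 -> homot gs t x = z -> `|x| <= r'.
  have /finite_seqP[S HS] := G_proper (Num.max `|z| B).
  have SP g : g \in S <-> (G g /\ exists x, `|x| <= Num.max `|z| B /\ `|g x| <= Num.max `|z| B).
    by have /(congr1 (fun A => A g)) /= := HS => ->.
  have [r' Hr] : exists r', forall g, g \in S -> forall y, `|y| <= r0 -> `|inv g y| <= r'.
    apply: seq_bound => [g a b ab H y yr|g gS]; first exact: le_trans (H y yr) ab.
    have [Gi _ _] := G_inv ((SP g).1 gS).1.
    exact: continuous_bounded_ball (G_cont Gi).
  exists r' => gs t x gsG ugs t01 hz.
  have [h Gh hx] := G_cocompact x.
  have := HB gs t x h gsG ugs t01 Gh hx; rewrite hz => hzB.
  have [_ hK _] := G_inv Gh.
  rewrite -(hK x); apply: Hr => //; apply/SP; split => //.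
  by exists z; rewrite !le_max lexx hzB orbT.
pose r := `|r'| + `|z| + 1.
have r_gt0 : 0 < r by rewrite /r ltr_wpDl // addr_ge0.
have /finite_seqP[S HS] := G_proper (Num.max (r + `|z|) (r0 + 1)).
have SP g : g \in S <-> (G g /\ exists x, `|x| <= Num.max (r + `|z|) (r0 + 1) /\
    `|g x| <= Num.max (r + `|z|) (r0 + 1)).
  by have /(congr1 (fun A => A g)) /= := HS => ->.
pose gs := undup S.
have gsG g : g \in gs -> G g by rewrite mem_undup => /SP[].
have ugs : uniq gs by exact: undup_uniq.
(* The map [Q] packs the homotopy into one cube of radius [2 * r]. Inside radius [r] the time is 1;
   from [r] to [2 * r] the point stays at distance [r] from [z] while the time falls to 0. On the
   outer boundary [Q w] is [w / 2], whence the sign conditions. *)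
pose tt (w : V) : R := Num.max 0 (Num.min 1 (2 - `|w| / r)).
have tt01 (w : V) : 0 <= tt w <= 1 by rewrite /tt le_max lexx /= ge_max ler01 ge_min lexx.
pose xx (w : V) := z + (r / Num.max r `|w|) *: w.
have mx_gt0 (w : V) : 0 < Num.max r `|w| by rewrite lt_max r_gt0.
pose Q w := homot gs (tt w) (xx w) - z.
have Qc : continuous Q.
  move=> w; have FF := @nbhs_filter V w.
  apply: (@cvgB _ _ _ _ _ (fun u => homot gs (tt u) (xx u)) (fun=> z)); last exact: cvg_cst.
  have cn : (fun u : V => `|u|) @ w --> `|w| by apply: norm_continuous.
  apply: homot_cvg => //.
    apply: cvg_maxr; first exact: cvg_cst.
    apply: cvg_minr; first exact: cvg_cst.
    apply: cvgB; first exact: cvg_cst.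
    by apply: cvgM => //; exact: cvg_cst.
  apply: cvgD; first exact: cvg_cst.
  apply: cvgZ; last exact: cvg_id.
  apply: cvgM; first exact: cvg_cst.
  apply: cvgV; first by rewrite gt_eqF.
  by apply: cvg_maxr => //; exact: cvg_cst.
have Qbd (w : V) i s : `|w| <= 2 * r -> w ord0 i = s -> `|s| = 2 * r -> Q w = 2^-1 *: w.
  move=> wr wi sr.
  have wE : `|w| = 2 * r.
    by apply/eqP; rewrite eq_le wr -sr -wi mx_entry_le.
  have t0 : tt w = 0.
    by rewrite /tt wE mulfK ?gt_eqF // subrr min_r // maxxx.
  rewrite /Q t0 homot0 // /xx wE max_r; last by move: r_gt0; lra.
  by rewrite invfM [r * _]mulrCA mulfV ?gt_eqF // mulr1 addrC addKr.
have [] := @poincare_miranda R n Q (2 * r) _ Qc _ _.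
- by rewrite mulr_gt0.
- move=> w i wr wi; rewrite (Qbd w i _ wr wi) ?normrN ?gtr0_norm ?mulr_gt0 //.
  by rewrite mxE wi; move: r_gt0; lra.
- move=> w i wr wi; rewrite (Qbd w i _ wr wi) ?gtr0_norm ?mulr_gt0 //.
  by rewrite mxE wi; move: r_gt0; lra.
move=> w wr /eqP; rewrite subr_eq0 => /eqP Qz.
(* A zero in the inner part puts [z] in [C]; a zero in the shell comes from a point farther than the
   bound [r'] allows. *)
have [wlt|wge] := ltP `|w| r.
  have tE : tt w = 1.
    rewrite /tt min_l ?max_r // lerBrDr -lerBrDl ler_pdivrMr //.
    by move: wlt; move: (`|w|) => u; lra.
  have xE : xx w = z + w by rewrite /xx max_l ?ltW // divff ?gt_eqF // scale1r.
  apply: nCz; rewrite -Qz tE.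
  have [g Gg gx] := G_cocompact (xx w).
  apply: (@homot1 _ _ g) => //; last exact: bump1.
  rewrite mem_undup; apply/SP; split => //; exists (xx w); split.
    rewrite le_max; apply/orP; left; rewrite xE addrC.
    by apply: (le_trans (ler_normD _ _)); rewrite lerD2r ltW.
  by rewrite le_max; apply/orP; right; apply: (le_trans gx); rewrite lerDl.
have := Hr' gs (tt w) (xx w) gsG ugs (tt01 w) Qz.
apply/negP; rewrite -ltNge.
have : r <= `|xx w - z|.
  have w0 : 0 < `|w| by exact: lt_le_trans wge.
  rewrite /xx addrC addKr normrZ max_r // ger0_norm; last by rewrite divr_ge0 // ltW.
  by rewrite divfK // lt0r_neq0.
move=> /le_trans/(_ (ler_normB _ _)); rewrite /r.
by have := ler_norm r'; move: (`|r'|) (`|z|) (`|xx w|) => a b c; lra.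
Qed.

End ConvexInvariant.

(** * Proper actions and lifts *)

Lemma open_dist_lt {R : realType} {V : normedModType R} (x : V) r :
  open [set y | `|x - y| < r].
Proof.
apply: (@open_comp _ _ (fun y => `|x - y|) [set y : R | y < r]); last exact: open_lt.
by move=> y _; apply: cvg_norm; apply: cvgB; [exact: cvg_cst|exact: cvg_id].
Qed.

Lemma closed_dist_le {R : realType} {V : normedModType R} (x : V) r :
  closed [set y | `|x - y| <= r].
Proof.
refine (@preimage_closed V R (fun y : V => `|x - y|) [set y | y <= r] _ (@closed_le R r)).
by move=> y _; apply: cvg_norm; apply: cvgB; [exact: cvg_cst|exact: cvg_id].
Qed.

Section Actions.
Context {R : realType} {V : normedModType R} {M : topologicalType}.
Variables (G : set (V -> V)) (p : V -> M).
Hypothesis cball : forall r, compact [set x : V | `|x| <= r].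
Hypothesis G_homeo : homeomorphism_group G.
Hypothesis G_fpd : free_properly_discontinuous G.
Hypothesis Gp : orbit_map G p.
Hypothesis M_hausdorff : hausdorff_space M.
Hypothesis M_compact : compact [set: M].

Lemma act_cont g : G g -> continuous g.
Proof. by move=> /G_homeo.1[]. Qed.

Lemma act_id : G id. Proof. by case: G_homeo => _ []. Qed.

Lemma act_comp g h : G g -> G h -> G (g \o h).
Proof. by case: G_homeo => _ [_ H _ _]; exact: H. Qed.

Lemma act_inv g : G g -> [/\ G (fun_inv g), cancel g (fun_inv g) & cancel (fun_inv g) g].
Proof.
move=> Gg; case: G_homeo => _ [_ _ /(_ _ Gg) Gi /(_ _ _ _ Gg Gg Gg)[_ _ _ gK giK]].
split => // x; first by have /(congr1 (fun f => f x)) := gK.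
by have /(congr1 (fun f => f x)) := giK.
Qed.

Lemma act_inj g : G g -> injective g.
Proof. by move=> /act_inv[_ gK _]; exact: can_inj gK. Qed.

Lemma proj_cont : continuous p.
Proof. by apply/continuousP => A; case: Gp => _ H _ /H. Qed.

Lemma proj_eq x y : p x = p y <-> exists2 g, G g & g x = y.
Proof. by case: Gp. Qed.

Lemma proj_act g x : G g -> p (g x) = p x.
Proof. by move=> Gg; apply/esym/proj_eq; exists g. Qed.

Lemma proj_surj m : exists x, p x = m.
Proof. by case: Gp. Qed.

Lemma proj_open U : open U -> open (p @` U).
Proof.
move=> oU; case: Gp => _ /(_ (p @` U)) H _; apply/H.
rewrite (_ : p @^-1` (p @` U) = \bigcup_(g in G) (fun_inv g @^-1` U)).
  apply: bigcup_open => g Gg; apply: open_comp => // x _.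
  by apply: act_cont; have [] := act_inv Gg.
apply/seteqP; split => [x [y Uy /proj_eq[g Gg gy]]|x [g Gg Ux]].
  by exists g => //=; rewrite -gy; have [_ ->] := act_inv Gg.
have [Gi _ giK] := act_inv Gg.
by exists (fun_inv g x) => //; exact: proj_act.
Qed.

(** If [x] and [y] are in one orbit, proper discontinuity at [x] leaves a single element that
    carries points near [x] to points near [y]. If not, their images have disjoint neighbourhoods in
    the Hausdorff space [M], and no element does. *)
Lemma proper_pair x y : exists2 e, 0 < e & forall u u' g g', G g -> G g' ->
  `|x - u| < e -> `|x - u'| < e -> `|y - g u| < e -> `|y - g' u'| < e -> g = g'.
Proof.
have [/proj_eq[g0 Gg0 <-]|pxy] := pselect (p x = p y).
  have [U [oU Ux HU]] := G_fpd.2 x.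
  have [Gi gK giK] := act_inv Gg0.
  have /near_ball_ex[e e0 He] : \forall y \near x, U y by exact: open_nbhs_nbhs.
  have /near_ball_ex[e' e'0 He'] : \forall y \near g0 x, U (fun_inv g0 y).
    by apply: act_cont => //; rewrite gK; exact: open_nbhs_nbhs.
  exists (Num.min e e'); first by rewrite lt_min e0.
  move=> u u' g g' Gg Gg'; rewrite !lt_min => /andP[xu _] /andP[xu' _] /andP[_ yu] /andP[_ yu'].
  suff H k v : G k -> `|x - v| < e -> `|g0 x - k v| < e' -> k = g0.
    by rewrite (H g u) // (H g' u').
  move=> Gk xv yv; have : fun_inv g0 \o k = id.
    by apply: HU; [exact: act_comp|exists (fun_inv g0 (k v)); split; [exists v => //; exact: He|exact: He']].
  by move=> kE; apply/funext => w; have /(congr1 (fun f => g0 (f w))) := kE; rewrite /= giK.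
have := M_hausdorff; rewrite open_hausdorff => /(_ (p x) (p y)).
have pn : p x != p y by apply/eqP.
move=> /(_ pn)[[A B]] /= [/set_mem Ax /set_mem By] [oA oB AB0].
have /near_ball_ex[e e0 He] : \forall u \near x, A (p u).
  by apply: proj_cont; exact: open_nbhs_nbhs.
have /near_ball_ex[e' e'0 He'] : \forall u \near y, B (p u).
  by apply: proj_cont; exact: open_nbhs_nbhs.
exists (Num.min e e'); first by rewrite lt_min e0.
move=> u u' g g' Gg Gg'; rewrite !lt_min => /andP[xu _] _ /andP[_ yu] _; exfalso.
suff : (A `&` B) (p u) by rewrite (eqP AB0).
by split; [exact: He|rewrite -(proj_act u Gg); exact: He'].
Qed.

Lemma act_finite A : compact A -> finite_set [set g | G g /\ exists2 a, A a & A (g a)].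
Proof.
(* The filter of finite lists directed by inclusion: the near-covering form of compactness then
   merges the local lists, of at most one element each, into a single one. *)
move=> cA; pose F : set_system (seq (V -> V)) :=
  filter_from [set: seq (V -> V)] (fun s0 => [set s : seq (V -> V) | {subset s0 <= s}]).
have FF : Filter F.
  apply: filter_from_filter; first by exists [::].
  move=> s t _ _; exists (s ++ t) => // u /= su; split => g gs; apply: su.
    by rewrite mem_cat gs.
  by rewrite mem_cat gs orbT.
have : \forall s \near F, (A `*` A) `<=` (fun xy => forall g, G g -> g xy.1 = xy.2 -> g \in (s : seq (V -> V))).
  move/compact_near_coveringP: (compact_setX cA cA); apply => -[x y] _.
  have [e e0 He] := proper_pair x y.
  have [[g [Gg [u [xu yu]]]]|nog] := pselect (exists g, G g /\ exists u,
      `|x - u| < e /\ `|y - g u| < e).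
    exists ([set z | `|x - z.1| < e /\ `|y - z.2| < e], [set s : seq (V -> V) | {subset [:: g] <= s}]).
      split => /=; last by exists [:: g].
      by apply: filterI; [exact: (cvg_fst (near_dist_lt x e0))|exact: (cvg_snd (near_dist_lt y e0))].
    move=> [[x1 y1] s] /= [[xx1 yy1] gs] h Gh hx; apply: gs; rewrite inE; apply/eqP.
    by apply: (He x1 u h g) => //; rewrite hx.
  exists ([set z | `|x - z.1| < e /\ `|y - z.2| < e], setT).
    split => /=; last by exact: filterT.
    by apply: filterI; [exact: (cvg_fst (near_dist_lt x e0))|exact: (cvg_snd (near_dist_lt y e0))].
  move=> [[x1 y1] s] /= [[xx1 yy1] _] h Gh hx; exfalso; apply: nog.
  by exists h; split => //; exists x1; rewrite hx.
move=> [s _ /(_ s (fun _ h => h)) Hs]; apply: (sub_finite_set (B := [set` s])).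
  by move=> g [Gg [a Aa Aga]]; apply: (Hs (a, g a)).
exact: finite_seq.
Qed.

Lemma act_proper r : finite_set [set g | G g /\ exists x, `|x| <= r /\ `|g x| <= r].
Proof.
apply: sub_finite_set (act_finite (@cball r)) => g [Gg [x [xr gxr]]].
by split => //; exists x.
Qed.

Lemma act_cocompact : exists2 r0, 0 < r0 & forall x, exists2 g, G g & `|g x| < r0.
Proof.
have : \forall r \near +oo, [set: M] `<=` (fun m => exists2 x, p x = m & `|x| < (r : R)).
  move/compact_near_coveringP: M_compact; apply => m _.
  have [x xm] := proj_surj m.
  exists (p @` [set y | `|x - y| < 1], [set r : R | `|x| + 1 < r]).
    split => /=; last by exact: nbhs_pinfty_gt.
    apply: open_nbhs_nbhs; split; last by exists x => //=; rewrite subrr normr0.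
    apply: proj_open; exact: open_dist_lt.
  move=> [_ r] /= [[y xy <-] xr]; exists y => //; apply: le_lt_trans xr.
  rewrite -[X in `|X|](subrK x) addrC (le_trans (ler_normD _ _)) // lerD2l distrC.
  exact: ltW.
move=> /(filterI (nbhs_pinfty_gt (num_real 0))) /filter_ex[r [/= r0 Hr]].
exists r => // x; have [y pyx yr] := Hr (p x) I.
by have /proj_eq[g Gg gy] := esym pyx; exists g => //; rewrite gy.
Qed.

Section Tube.
Variable r0 : R.
Hypothesis cocomp : forall x, exists2 g, G g & `|g x| < r0.

(* The [G]-invariant neighbourhood of the diagonal. *)
Definition tube (d : R) (x x' : V) := exists g, [/\ G g, `|g x| < r0 & `|g x - g x'| < d].

(** By compactness [proper_pair] has a uniform radius for pairs in the ball of radius [r0]. If [g0]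
    and [g1] witness the two tube conditions, then [g1] and [g1 \o h], both preceded by the inverse
    of [g0], carry points near [g0 x] to points near [g1 x], so they coincide. *)
Lemma tube_unique : exists2 d, 0 < d &
  forall x x' h, G h -> tube d x x' -> tube d x (h x') -> h = id.
Proof.
pose K := [set x : V | `|x| <= r0].
have : \forall d \near 0^'+, (K `*` K) `<=` (fun xy => forall u u' g g', G g -> G g' ->
  `|xy.1 - u| < d -> `|xy.1 - u'| < d -> `|xy.2 - g u| < d -> `|xy.2 - g' u'| < d -> g = g').
  move/compact_near_coveringP: (compact_setX (@cball r0) (@cball r0)).
  move=> /(_ R (0^'+) (fun d xy => forall u u' g g', G g -> G g' ->
    `|xy.1 - u| < d -> `|xy.1 - u'| < d -> `|xy.2 - g u| < d -> `|xy.2 - g' u'| < d -> g = g')).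
  apply => -[x y] _.
  have [e e0 He] := proper_pair x y.
  have e2 : 0 < e / 2 by rewrite divr_gt0.
  exists ([set z | `|x - z.1| < e / 2 /\ `|y - z.2| < e / 2], [set d | d <= e / 2]).
    split => /=; last by exact: nbhs_right_le.
    by apply: filterI; [exact: (cvg_fst (near_dist_lt x e2))|exact: (cvg_snd (near_dist_lt y e2))].
  move=> [[x1 y1] d] /= [[xx1 yy1] de] u u' g g' Gg Gg' xu xu' yu yu'.
  have tri (a b c : V) : `|a - b| < e / 2 -> `|b - c| < d -> `|a - c| < e.
    move=> ab bc; rewrite -(subrK b a) -addrA (le_lt_trans (ler_normD _ _)) //.
    by rewrite (splitr e) ltrD // (lt_le_trans bc).
  by apply: (He u u' g g') => //; [exact: tri xx1 _|exact: tri xx1 _|exact: tri yy1 _|exact: tri yy1 _].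
move=> /near_right_ex[d d0 Hd]; exists d => // x x' h Gh [g0 [Gg0 g0x g0x']] [g1 [Gg1 g1x g1x']].
have [Gi gK giK] := act_inv Gg0.
have E : g1 \o fun_inv g0 = (g1 \o h) \o fun_inv g0.
  apply: (Hd (g0 x, g1 x) _ (g0 x) (g0 x')) => //=.
  - by split; rewrite /K /= ltW.
  - exact: act_comp.
  - by apply: act_comp => //; exact: act_comp.
  - by rewrite subrr normr0.
  - by rewrite gK subrr normr0.
  - by rewrite gK.
apply/funext => w; apply: (act_inj Gg1).
by have /(congr1 (fun f => f (g0 w))) := E; rewrite /= gK => <-.
Qed.

Lemma tube_act d g x x' : G g -> tube d (g x) (g x') -> tube d x x'.
Proof. by move=> Gg [h [Gh h1 h2]]; exists (h \o g); split => //; exact: act_comp. Qed.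

Definition lifts (f : M -> M) (F : V -> V) := forall x, p (F x) = f (p x).

Definition close_id (d : R) (f : M -> M) :=
  forall x, `|x| < r0 -> exists2 x', `|x - x'| < d & p x' = f (p x).

(** A basic condition of the compact-open topology sends the image of a closed ball into the image
    of a larger open ball; finitely many of them control the ball of radius [r0]. *)
Lemma near_close_id d : 0 < d ->
  \forall f \near (id : {compact-open, M -> M}), close_id d f.
Proof.
move=> d0.
have d2 : 0 < d / 2 by rewrite divr_gt0.
have : \forall f \near (id : {compact-open, M -> M}), [set x : V | `|x| <= r0] `<=`
    (fun x => exists2 x', `|x - x'| < d & p x' = f (p x)).
  move/compact_near_coveringP: (@cball r0) => /(_ {compact-open, M -> M} (nbhs (id : {compact-open, M -> M}))
    (fun f x => exists2 x', `|x - x'| < d & p x' = f (p x))).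
  apply => x _; pose C := p @` [set y | `|x - y| <= d / 4].
  pose O := p @` [set y | `|x - y| < d / 2].
  have d4 : 0 < d / 4 by rewrite divr_gt0.
  exists ([set y | `|x - y| < d / 4], [set f | f @` C `<=` O]).
    split => /=; first exact: near_dist_lt.
    have oO : open O.
      by apply: proj_open; exact: open_dist_lt.
    have cC : compact C.
      apply: continuous_compact; first by apply: continuous_subspaceT; exact: proj_cont.
      apply: (@subclosed_compact _ _ [set y : V | `|y| <= `|x| + d / 4]).
      - exact: closed_dist_le.
      - exact: (@cball (`|x| + d / 4)).
      move=> y /= xy; rewrite -[X in `|X|](subrK x) addrC (le_trans (ler_normD _ _)) // lerD2l.
        by rewrite distrC.
    apply: open_nbhs_nbhs; split; first exact: compact_open_open.
    move=> _ [_ [y xy <-] <-]; exists y => //=.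
    by apply: (le_lt_trans xy); rewrite ltr_pM2l // ltf_pV2 ?posrE // ltr_nat.
  move=> [y f] /= [xy fC]; have [|z xz pz] := fC (f (p y)).
    by exists (p y) => //; exists y => //; exact: ltW.
  exists z => //; rewrite -(subrK x y) -addrA (le_lt_trans (ler_normD _ _)) //.
  rewrite (splitr d) ltrD // distrC (lt_trans xy) //.
  by rewrite ltr_pM2l // ltf_pV2 ?posrE // ltr_nat.
by apply: filterS => f Hf x /ltW xr; exact: Hf.
Qed.

Variable d : R.
Hypothesis d0 : 0 < d.
Hypothesis tubeU : forall x x' h, G h -> tube d x x' -> tube d x (h x') -> h = id.

Lemma lift_tube_exists f F : close_id d f -> lifts f F -> forall x,
  exists2 h, G h & tube d x (h (F x)).
Proof.
move=> fd Ff x; have [g Gg gx] := cocomp x.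
have [x' gxx' px'] := fd _ gx.
have [Gi gK giK] := act_inv Gg.
have : p (F x) = p (fun_inv g x').
  by rewrite (proj_act _ Gi) px' Ff (proj_act _ Gg).
move=> /proj_eq[h Gh hF]; exists h => //; rewrite hF.
by exists g; split => //; rewrite giK.
Qed.

Lemma lift_tube_unique f F F' x : lifts f F -> lifts f F' -> tube d x (F x) ->
  tube d x (F' x) -> F x = F' x.
Proof.
move=> Ff Ff' t t'; have : p (F x) = p (F' x) by rewrite Ff Ff'.
move=> /proj_eq[h Gh hF]; rewrite -hF in t' *.
by rewrite (tubeU Gh t t').
Qed.

Lemma open_tube (F : V -> V) : continuous F -> open [set x | tube d x (F x)].
Proof.
move=> Fc; rewrite (_ : [set x | _] = \bigcup_(g in G)
    ([set x | `|g x| < r0] `&` [set x | `|g x - g (F x)| < d])); last first.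
  by apply/seteqP; split => x [g] => [[Gg ? ?]|Gg [? ?]]; exists g.
apply: bigcup_open => g Gg; have gc := act_cont Gg; apply: openI.
  apply: (@open_comp _ _ (fun x => `|g x|) [set y : R | y < r0]); last exact: open_lt.
  by move=> x _; apply: cvg_norm; exact: gc.
apply: (@open_comp _ _ (fun x => `|g x - g (F x)|) [set y : R | y < d]); last exact: open_lt.
move=> x _; apply: cvg_norm; apply: cvgB; first exact: gc.
by apply: cvg_app; [exact: gc|exact: Fc].
Qed.

(** On the segment from [x0] to [x] the tube condition is open. It is also closed: everywhere some
    translate of [F] by [h] is in the tube, and by uniqueness [F] is outside exactly where [h]
    differs from the identity. *)
Lemma lift_in_tube f F x0 : close_id d f -> lifts f F -> continuous F ->
  tube d x0 (F x0) -> forall x, tube d x (F x).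
Proof.
move=> fd Ff Fc t0 x.
pose gam (t : R) : V := x0 + t *: (x - x0).
have gamc : continuous gam.
  by move=> t; apply: cvgD; [exact: cvg_cst|apply: cvgZ; [exact: cvg_id|exact: cvg_cst]].
pose A := [set t : R | tube d (gam t) (F (gam t))].
have oA : open A.
  by apply: (@open_comp _ _ gam [set x | tube d x (F x)]) => [t _|]; [exact: gamc|exact: open_tube].
have cA : closed A.
  rewrite -[A]setCK; apply: open_closedC.
  rewrite (_ : ~` A = \bigcup_(h in G `\ id) (gam @^-1` [set x | tube d x (h (F x))])).
    apply: bigcup_open => h [Gh _]; apply: open_comp; first by move=> t _; exact: gamc.
    have hFc : continuous (fun x => h (F x)).
      by move=> y; apply: (@cvg_app _ _ _ V F h (F y)); [exact: (act_cont Gh)|exact: Fc].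
    exact: open_tube hFc.
  apply/seteqP; split => [t nA|t [h [Gh hid] th] tA].
    have [h Gh th] := lift_tube_exists fd Ff (gam t).
    by exists h => //; split => // hid; apply: nA; move: th; rewrite hid.
  by apply: hid; exact: tubeU tA th.
have cR : connected [set: R] by apply/connected_intervalP.
have : A = setT.
  apply: cR; first by exists 0; rewrite /A /= /gam scale0r addr0.
    by exists A => //; rewrite setTI.
  by exists A => //; rewrite setTI.
by move=> /(congr1 (fun S => S 1)) /=; rewrite /A /= /gam scale1r addrC subrK => ->.
Qed.

(** Conjugating [F] by [g] gives another lift of [f] in the invariant tube, and the lift in the tube
    is unique. *)
Lemma lift_tube_comm f F : lifts f F -> (forall x, tube d x (F x)) ->
  forall g x, G g -> F (g x) = g (F x).
Proof.
move=> Ff Ft g x Gg; have [Gi gK giK] := act_inv Gg.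
have t : tube d x (fun_inv g (F (g x))).
  by apply: (tube_act Gg); rewrite giK; exact: Ft.
have Ff' : lifts f (fun y => fun_inv g (F (g y))).
  by move=> y; rewrite (proj_act _ Gi) Ff (proj_act _ Gg).
by rewrite -[LHS]giK (lift_tube_unique Ff Ff' (Ft x) t).
Qed.

End Tube.

End Actions.

(** * A chart of a Lie group at the identity *)

Lemma prod_norm_lt {R : realType} {U V : normedModType R} (x : U * V) (r : R) :
  (`|x| < r) = (`|x.1| < r) && (`|x.2| < r).
Proof. by rewrite prod_normE gt_max. Qed.

Lemma derivable_row_along {R : realType} {V : normedModType R} {d : nat}
    (f : V -> 'rV[R]_d) (q w : V) (j : 'I_d) (t : R) :
  differentiable f (q + t *: w) ->
  is_derive t 1 (fun s => f (q + s *: w) ord0 j) ('D_w f (q + t *: w) ord0 j).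
Proof.
move=> df; set Q := q + t *: w.
have cv : (fun h : R => h^-1 *: ((f \o shift Q) (h *: w) - f Q)) @ 0^' --> 'D_w f Q.
  exact: (diff_derivable (v := w) df).
have {}cv := @cvg_entry R _ _ (dnbhs_filter (0 : R)) _ _ _ _ ord0 j cv.
pose g (s : R) : R := f (q + s *: w) ord0 j.
have E : (fun h : R => h^-1 *: ((g \o shift t) (h *: (1 : R)) - g t)) =
    (fun h : R => (h^-1 *: ((f \o shift Q) (h *: w) - f Q)) ord0 j).
  apply/funext => h; rewrite /g /= !mxE /Q /shift /=.
  congr (_ * (f _ _ _ - _)); rewrite [h *: 1]mulr1 scalerDl.
  by rewrite addrCA.
have cg : (fun h : R => h^-1 *: ((g \o shift t) (h *: (1 : R)) - g t)) @ 0^' -->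
    'D_w f Q ord0 j by rewrite E.
apply: DeriveDef; first by apply: cvgP; exact: cg.
by apply: cvg_lim => //; exact: cg.
Qed.

(** In the chart [e] centred at the identity, [E a b] represents [e a] times the inverse of [e b].
    It vanishes for [a = b], and its partial derivative in [a] is the identity at the origin; the
    mean value theorem from [(b, b)] to [(a, b)] turns the continuity of that derivative into an
    error relative to [a - b]. *)
Lemma local_lie {R : realType} {d : nat} {T : topologicalType} (H : set T)
    (mul : T -> T -> T) (one : T) (inv : T -> T) :
  lie_group_of_dim R d H mul one inv ->
  exists (r : R) (e : 'rV[R]_d -> T) (E : 'rV[R]_d -> 'rV[R]_d -> 'rV[R]_d),
  [/\ 0 < r /\ e 0 = one,
      forall a, `|a| < r -> H (e a) /\ {for a, continuous e},
      forall a b, `|a| < r -> `|b| < r -> e (E a b) = mul (e a) (inv (e b)) /\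
        (e a = e b -> a = b),
      forall eps, 0 < eps -> exists2 rho, 0 < rho & forall a b, `|a| < rho -> `|b| < rho ->
        `|E a b - (a - b)| <= eps * `|a - b|
    & forall rho, 0 < rho -> \forall f \near one, H f -> exists2 a, `|a| < rho & f = e a].
Proof.
move=> [[H1 HM HI HG] [A [[Acov _] Asm]]].
have [c Ac c1] := Acov _ H1.
set u0 := chart_map c one.
have dH f : chart_dom c f -> H f by case: (chart_dom_open c) => O _ -> [].
have iK u : chart_img c u -> chart_dom c (chart_inv c u) /\ chart_map c (chart_inv c u) = u.
  by move=> [f cf <-]; rewrite (chart_mapK (mem_set cf)).
have iu0 : chart_img c u0 by exists one.
have i1 : chart_inv c u0 = one by exact: (chart_mapK (mem_set c1)).
have inv1 : inv one = one.
  have [_ _ K _ _] := HG _ _ _ (HI _ H1) H1 H1; have [_ _ _ K' _] := HG _ _ _ H1 H1 H1.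
  by rewrite -[LHS]K.
have := Asm c c c Ac Ac Ac; cbv zeta.
set op := fun st : 'rV[R]_d * 'rV[R]_d => mul (chart_inv c st.1) (inv (chart_inv c st.2)).
set Dm := [set st | _]; move=> [oDm sm]; have [dif sm1] := sm 1%N.
have {}sm1 (v : 'rV[R]_d * 'rV[R]_d) x : Dm x ->
    {for x, continuous (fun y => 'D_v (chart_map c \o op) y)} by exact: sm1.
set D := chart_map c \o op in dif sm1.
have Dm0 : Dm (u0, u0).
  by split => //=; rewrite /op /= i1; have [_ _ _ _ ->] := HG _ _ _ H1 H1 H1.
have opv u : chart_img c u -> op (u, u) = one.
  move=> /iK[/dH Hu _]; rewrite /op /=.
  by have [_ _ _ _ ->] := HG _ _ _ Hu Hu Hu.
have opu u : chart_img c u -> op (u, u0) = chart_inv c u.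
  move=> /iK[/dH Hu _]; rewrite /op /= i1 inv1.
  by have [_ _ -> _ _] := HG _ _ _ Hu Hu Hu.
have [r r0 Hr] : exists2 r, 0 < r & forall a b, `|a| < r -> `|b| < r -> Dm (u0 + a, u0 + b).
  have /near_ball_ex[r r0 Hr] : \forall q \near (u0, u0), Dm q by exact: open_nbhs_nbhs.
  exists r => // a b ar br; apply: Hr; rewrite prod_norm_lt /=.
  by rewrite !opprD !addrA !subrr !sub0r !normrN ar br.
have rimg a : `|a| < r -> chart_img c (u0 + a).
  by move=> ar; have [] := Hr a a ar ar.
exists r, (fun a => chart_inv c (u0 + a)), (fun a b => D (u0 + a, u0 + b) - u0).
split.
- by rewrite addr0.
- move=> a ar; split; first by apply: dH; have [] := iK _ (rimg _ ar).
  have cont := @chart_inv_continuous _ _ _ _ c.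
  rewrite (continuous_open_subspace _ (@chart_img_open _ _ _ _ c)) in cont.
  apply: (@cvg_app _ _ _ _ (fun b => u0 + b) (chart_inv c) (u0 + a)).
    by apply: cont; apply/mem_set; exact: rimg.
  have FF := @nbhs_filter 'rV[R]_d a.
  by apply: cvgD; [exact: cvg_cst|exact: cvg_id].
- move=> a b ar br; rewrite addrC subrK; split.
    by have [_ _ /= hop] := Hr a b ar br; rewrite /D /= (chart_mapK (mem_set hop)).
  move=> eab; apply: (addrI u0).
  by rewrite -(iK _ (rimg _ ar)).2 eab (iK _ (rimg _ br)).2.
- move=> eps eps0.
  pose ei (i : 'I_d) : 'rV[R]_d * 'rV[R]_d := (delta_mx 0 i, 0).
  (* When the second argument is the identity of the group, the operation read in the chart is the
     identity map. *)
  have D0 (i : 'I_d) : 'D_(ei i) D (u0, u0) = delta_mx 0 i.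
    apply: cvg_lim => //; apply: cvg_near_cst; near=> h.
    have h0 : h != 0 by near: h; exact: nbhs_dnbhs_neq.
    have hr : `|h *: (delta_mx 0 i : 'rV[R]_d)| < r.
      near: h; apply: nbhs_dnbhs.
      have : (fun h : R => `|h *: (delta_mx 0 i : 'rV[R]_d)|) @ 0 --> (0 : R).
        rewrite -[X in _ --> X](normr0 'rV[R]_d) -(scale0r (delta_mx 0 i)).
        by apply: cvg_norm; apply: cvgZ; [exact: cvg_id|exact: cvg_cst].
      by move=> /cvgr_lt; apply.
    have Dv a : `|a| < r -> D (u0 + a, u0) = u0 + a.
      by move=> ar; rewrite /D /= opu ?(iK _ (rimg _ ar)).2 //; exact: rimg.
    have -> : (D \o shift (u0, u0)) (h *: ei i) = u0 + h *: delta_mx 0 i.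
      rewrite /= -Dv //; congr D; congr pair; first by rewrite addrC.
      by rewrite /= scaler0 add0r.
    have -> : D (u0, u0) = u0 by rewrite -[X in D (X, _)]addr0 Dv ?addr0 // normr0.
    by rewrite addrC addKr scalerA mulVf // scale1r.
  have [rho rho0 Hrho] : exists2 rho, 0 < rho & forall a b, `|a| < rho -> `|b| < rho ->
     forall i : 'I_d, `|'D_(ei i) D (u0 + a, u0 + b) - delta_mx 0 i| <= eps / d.+1%:R.
    have ed0 : 0 < eps / d.+1%:R by rewrite divr_gt0.
    have /near_ball_ex[rho rho0 Hrho] : \forall q \near (u0, u0), forall i : 'I_d,
        `|'D_(ei i) D q - delta_mx 0 i| <= eps / d.+1%:R.
      have FF := @nbhs_filter ('rV[R]_d * 'rV[R]_d)%type (u0, u0).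
      have K (i : 'I_d) : \forall q \near (u0, u0), `|'D_(ei i) D q - delta_mx 0 i| <= eps / d.+1%:R.
        have := sm1 (ei i) _ Dm0.
        by move=> /cvgr_distC_le; rewrite D0; apply.
      exact: (@filter_forall _ 'I_d _ _ FF K).
    exists rho => // a b ar br; apply: Hrho; rewrite prod_norm_lt /=.
    by rewrite !opprD !addrA !subrr !sub0r !normrN ar br.
  exists (Num.min rho r); first by rewrite lt_min rho0.
  move=> a b; rewrite !lt_min => /andP[aho ar] /andP[bho br].
  set w : 'rV[R]_d * 'rV[R]_d := (a - b, 0).
  set q : 'rV[R]_d * 'rV[R]_d := (u0 + b, u0 + b).
  have qE s : q + s *: w = (u0 + (b + s *: (a - b)), u0 + b).
    by rewrite /q /w; congr pair; rewrite /= ?scaler0 ?addr0 // addrA.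
  have cvx (s : R) k : 0 <= s <= 1 -> `|a| < k -> `|b| < k -> `|b + s *: (a - b)| < k.
    move=> /andP[s0 s1] ak bk.
    have -> : b + s *: (a - b) = (1 - s) *: b + s *: a.
      by rewrite scalerBl scalerBr scale1r addrA addrAC.
    apply: (le_lt_trans (ler_normD _ _)); rewrite !normrZ !ger0_norm ?subr_ge0 //.
    move: ak bk; move: (`|a|) (`|b|) => x y xk yk.
    have [->|s0'] := eqVneq s 0; first by rewrite mul0r addr0 subr0 mul1r.
    have {s0'} : 0 < s by rewrite lt_neqAle eq_sym s0' s0.
    by nra.
  have inDm (s : R) : 0 <= s <= 1 -> Dm (q + s *: w).
    by move=> s01; rewrite qE; apply: Hr => //; exact: cvx.
  have wE : w = \sum_i (a - b) ord0 i *: ei i.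
    rewrite /w {1}(row_sum_delta (a - b)) /ei.
    elim/big_rec2: _ => // i x y _ <-; congr pair => /=.
    by rewrite scaler0 addr0.
  apply: mx_norm_le => [|i0 j]; first by rewrite mulr_ge0 // ltW.
  rewrite [i0]ord1 {i0}.
  have Hd (s : R) : 0 <= s <= 1 -> is_derive s 1 (fun s : R => D (q + s *: w) ord0 j)
      ('D_w D (q + s *: w) ord0 j).
    by move=> s01; apply: derivable_row_along; apply: dif; exact: inDm.
  have [||xi xi01] := @MVT R (fun s : R => D (q + s *: w) ord0 j)
      (fun s : R => 'D_w D (q + s *: w) ord0 j) 0 1 ltr01.
  - move=> s; rewrite in_itv /= => /andP[s0 s1]; apply: Hd.
    by rewrite !ltW.
  - apply: derivable_within_continuous => s; rewrite in_itv /= => s01.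
    by have [] := Hd s s01.
  have {}xi01 : 0 <= xi <= 1 by move: xi01; rewrite in_itv /= => /andP[? ?]; rewrite !ltW.
  rewrite subr0 mulr1 !qE scale1r scale0r addr0 [b + _]addrC subrK => E1.
  have D00 : D (u0 + b, u0 + b) = u0.
    by rewrite /D /= opv //; exact: rimg.
  rewrite D00 deriveE in E1; last by apply: dif; rewrite -qE; exact: inDm.
  rewrite wE linear_sum in E1.
  have -> : (D (u0 + a, u0 + b) - u0 - (a - b)) ord0 j =
     \sum_i (a - b) ord0 i * (('D_(ei i) D (u0 + (b + xi *: (a - b)), u0 + b) - delta_mx 0 i) ord0 j).
    have subE (x y : 'rV[R]_d) : (x - y) ord0 j = x ord0 j - y ord0 j by rewrite !mxE.
    rewrite subE subE E1 [X in _ - X = _](_ : _ = (\sum_i (a - b) ord0 i *: delta_mx 0 i : 'rV[R]_d) ord0 j).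
      2: by rewrite -row_sum_delta.
    rewrite !summxE -sumrB.
    apply: eq_bigr => i _; rewrite linearZ /= subE mulrBr !mxE; congr (_ * _ - _).
    by rewrite deriveE //; apply: dif; rewrite -qE; exact: inDm.
  apply: (le_trans (ler_norm_sum _ _ _)).
  apply: (@le_trans _ _ (\sum_(i < d) `|a - b| * (eps / d.+1%:R))).
    apply: ler_sum => i _; rewrite normrM ler_pM ?normr_ge0 ?mx_entry_le //.
    apply: (le_trans (mx_entry_le _ _ _)); apply: Hrho => //; exact: cvx.
  rewrite sumr_const card_ord -[_ *+ d]mulr_natr.
  have -> : `|a - b| * (eps / d.+1%:R) * d%:R = eps * `|a - b| * (d%:R / d.+1%:R).
    by move: (`|a - b|) (d.+1%:R^-1) (d%:R) => x y z; ring.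
  by rewrite ler_piMr ?mulr_ge0 ?(ltW eps0) // ler_pdivrMr // mul1r ler_nat.
- move=> rho rho0.
  have [W oW dE] := chart_dom_open c.
  have : {within chart_dom c, continuous (chart_map c)} by exact: chart_map_continuous.
  move=> /subspace_continuousP/(_ one c1) cont.
  have : \forall f \near within (chart_dom c) (nbhs one), `|u0 - chart_map c f| < rho.
    exact: (cont _ (near_dist_lt u0 rho0)).
  rewrite near_withinE => h.
  have hW : \forall f \near one, W f.
    by apply: open_nbhs_nbhs; split => //; move: c1; rewrite dE => -[].
  near=> f => Hf.
  have cf : chart_dom c f by rewrite dE; split => //; near: f.
  exists (chart_map c f - u0); last by rewrite addrC subrK (chart_mapK (mem_set cf)).
  rewrite distrC; move: cf; near: f; exact: h.
Unshelve. all: by end_near.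
Qed.

(** The product is [E a (E 0 b)]. Its error is bounded by [a] alone because [a] equals
    [E (P a b) b], to which the estimate for [E] applies with difference [P a b - b]. *)
Lemma local_abelian {R : realType} {d : nat} {T : topologicalType} (H : set T)
    (mul : T -> T -> T) (one : T) (inv : T -> T) :
  lie_group_of_dim R d H mul one inv ->
  (forall x y, H x -> H y -> mul x y = mul y x) ->
  exists (r : R) (e : 'rV[R]_d -> T) (E P : 'rV[R]_d -> 'rV[R]_d -> 'rV[R]_d),
  [/\ 0 < r /\ e 0 = one,
      forall a, `|a| < r -> H (e a) /\ {for a, continuous e},
      forall a b, `|a| < r -> `|b| < r ->
        [/\ e (E a b) = mul (e a) (inv (e b)), e (P a b) = mul (e a) (e b) &
            e a = e b -> a = b],
      forall eps, 0 < eps -> exists2 rho, 0 < rho & forall a b, `|a| < rho -> `|b| < rho ->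
        `|E a b - (a - b)| <= eps * `|a - b| /\ `|P a b - (a + b)| <= eps * `|a|
    & forall rho, 0 < rho -> \forall f \near one, H f -> exists2 a, `|a| < rho & f = e a].
Proof.
move=> HL mulC; have [[H1 HM HI HG] _] := HL.
have [r [e [E [[r0 e0] He HE Eest Hnear]]]] := local_lie HL.
have [rho0 rho0_gt0 Hrho0] := Eest 2^-1 (ltac:(lra)).
pose r1 := Num.min r rho0.
have r1_gt0 : 0 < r1 by rewrite lt_min r0.
have r1r : r1 <= r by rewrite ge_min lexx.
have r1rho : r1 <= rho0 by rewrite ge_min lexx orbT.
have Ebd a b : `|a| < r1 -> `|b| < r1 -> `|E a b| <= 2 * (`|a| + `|b|).
  move=> ar br; have := Hrho0 a b (lt_le_trans ar r1rho) (lt_le_trans br r1rho).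
  move=> h; rewrite -(subrK (a - b) (E a b)) (le_trans (ler_normD _ _)) //.
  by move: h (ler_normB a b) (normr_ge0 a) (normr_ge0 b); move: (`|a - b|) (`|_ - _|) => x y; lra.
pose r2 := r1 / 16.
have r2_gt0 : 0 < r2 by rewrite divr_gt0.
have n0 : `|0 : 'rV[R]_d| < r1 by rewrite normr0.
have r21 : r2 <= r1 by rewrite /r2; lra.
have E0bd b : `|b| < r2 -> `|E 0 b| <= 2 * `|b|.
  by move=> br; have := Ebd 0 b n0 (lt_le_trans br r21); rewrite normr0 add0r.
have E0small b : `|b| < r2 -> `|E 0 b| < r1.
  by move=> br; apply: (le_lt_trans (E0bd b br)); move: br; rewrite /r2; move: (`|b|) => x; lra.
have eE0 b : `|b| < r2 -> e (E 0 b) = inv (e b).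
  move=> br; have b1 := lt_le_trans (lt_le_trans br r21) r1r.
  have [-> _] := HE 0 b (lt_le_trans n0 r1r) b1; rewrite e0.
  have Hb := (He b b1).1.
  by have [_ -> _ _ _] := HG _ _ _ (HI _ Hb) H1 H1.
pose P a b := E a (E 0 b).
have eP a b : `|a| < r2 -> `|b| < r2 -> e (P a b) = mul (e a) (e b).
  move=> ar br; have a1 := lt_le_trans (lt_le_trans ar r21) r1r.
  have b1 := lt_le_trans (lt_le_trans br r21) r1r.
  have [-> _] := HE a (E 0 b) a1 (lt_le_trans (E0small b br) r1r); rewrite eE0 //.
  congr mul; have Hb := (He b b1).1.
  have [_ _ _ K1 K2] := HG _ _ _ Hb Hb Hb.
  have [_ _ _ K3 K4] := HG _ _ _ (HI _ Hb) (HI _ Hb) (HI _ Hb).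
  have [K5 K6 _ _ _] := HG _ _ _ (HI _ (HI _ Hb)) (HI _ Hb) Hb.
  have [_ K7 _ _ _] := HG _ _ _ Hb Hb Hb.
  have [_ _ K8 _ _] := HG _ _ _ (HI _ (HI _ Hb)) (HI _ Hb) Hb.
  by rewrite -[LHS]K8 -K1 K5 K3 K7.
have Pbd a b : `|a| < r2 -> `|b| < r2 -> `|P a b| <= 2 * `|a| + 4 * `|b|.
  move=> ar br; have := Ebd a (E 0 b) (lt_le_trans ar r21) (E0small b br).
  by have := E0bd b br; rewrite /P; move: (`|E 0 b|) (`|E a _|) (`|a|) (`|b|) => x y z t; lra.
exists r2, e, E, P; split => //.
- by move=> a ar; apply: He; exact: lt_le_trans (lt_le_trans ar r21) r1r.
- move=> a b ar br; have [h1 h2] := HE a b (lt_le_trans (lt_le_trans ar r21) r1r) (lt_le_trans (lt_le_trans br r21) r1r).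
  by split => //; exact: eP.
- move=> eps eps0; pose eps' := Num.min (eps / 2) 2^-1.
  have eps'0 : 0 < eps' by rewrite lt_min divr_gt0 //= invr_gt0.
  have eps'1 : eps' <= 2^-1 by rewrite ge_min lexx orbT.
  have eps'2 : eps' <= eps / 2 by rewrite ge_min lexx.
  have [rho rho_gt0 Hrho] := Eest eps' eps'0.
  pose s := Num.min r2 (rho / 8).
  have s0 : 0 < s by rewrite lt_min r2_gt0 divr_gt0.
  have sr2 : s <= r2 by rewrite ge_min lexx.
  have srho : s <= rho / 8 by rewrite ge_min lexx orbT.
  exists s => // a b sa sb.
  have a2 := lt_le_trans sa sr2; have b2 := lt_le_trans sb sr2.
  have sarho : `|a| < rho by apply: (lt_le_trans sa); apply: (le_trans srho); lra.
  have sbrho : `|b| < rho by apply: (lt_le_trans sb); apply: (le_trans srho); lra.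
  split.
    apply: (le_trans (Hrho a b sarho sbrho)); rewrite ler_wpM2r //.
    by apply: (le_trans eps'2); lra.
  have Pab := Pbd a b a2 b2.
  have P1 : `|P a b| < r1.
    by apply: (le_lt_trans Pab); move: a2 b2; rewrite /r2; move: (`|a|) (`|b|) => x y; lra.
  have Prho : `|P a b| < rho.
    by apply: (le_lt_trans Pab); move: sa sb srho; move: (`|a|) (`|b|) => x y; lra.
  have b1 : `|b| < r1 := lt_le_trans b2 r21; have a1 : `|a| < r1 := lt_le_trans a2 r21.
  have aE : a = E (P a b) b.
    have EP := Ebd (P a b) b P1 b1.
    have EPr : `|E (P a b) b| < r.
      apply: (le_lt_trans EP); apply: lt_le_trans r1r; move: Pab a2 b2; rewrite /r2.
      by move: (`|a|) (`|b|) (`|P a b|) => x y z; lra.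
    have [_ inj] := HE a _ (lt_le_trans a1 r1r) EPr; apply: inj.
    have [-> _] := HE (P a b) b (lt_le_trans P1 r1r) (lt_le_trans b1 r1r).
    rewrite eP //; have Ha := (He a (lt_le_trans a1 r1r)).1; have Hb := (He b (lt_le_trans b1 r1r)).1.
    have [<- _ _ _ _] := HG _ _ _ Ha Hb (HI _ Hb).
    have [_ _ _ _ ->] := HG _ _ _ Hb Hb Hb.
    by have [_ _ -> _ _] := HG _ _ _ Ha Ha Ha.
  have := Hrho (P a b) b Prho sbrho; rewrite -aE.
  have -> : a - (P a b - b) = - (P a b - (a + b)) by rewrite !opprB addrA.
  rewrite normrN => h.
  have h2 : `|P a b - b| <= `|P a b - (a + b)| + `|a|.
    rewrite (_ : P a b - b = (P a b - (a + b)) + a); first exact: ler_normD.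
    by rewrite opprD [- a - b]addrC addrA subrK.
  move: h h2 eps'0 eps'1 eps'2 (normr_ge0 (P a b - (a + b))) (normr_ge0 a).
  move: (`|P a b - b|) (`|P a b - _|) (`|a|) => x y z.
  by move=> h1 h2 e1 e2 e3 y0 z0; nra.
Qed.

Lemma cvg_bigsum {R : realType} {W : normedModType R} {T : Type} {F : set_system T}
    {FF : Filter F} {I : Type} (r : seq I) (f : I -> T -> W) (a : I -> W) :
  (forall i, f i @ F --> a i) ->
  (fun t => \sum_(i <- r) f i t) @ F --> \sum_(i <- r) a i.
Proof.
move=> fa; elim: r => [|i r IH].
  by rewrite big_nil; under eq_fun do rewrite big_nil; exact: cvg_cst.
by rewrite big_cons; under eq_fun do rewrite big_cons; exact: cvgD.
Qed.

(** * Affine lifts of the elements of Aff(M)_0 near the identity *)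

Section AffineMaps.
Context {R : realType} {n : nat}.
Notation V := 'rV[R]_n.

(** Affineness as an identity between values of [f], so that it is a closed condition for pointwise
    convergence. *)
Definition is_affine (f : V -> V) :=
  forall x, f x = f 0 + \sum_i x ord0 i *: (f (delta_mx 0 i) - f 0).

Definition aff_mx (f : V -> V) : 'M[R]_n := \matrix_(i, j) (f (delta_mx 0 i) - f 0) ord0 j.

Lemma is_affineE f : is_affine f -> forall x, f x = x *m aff_mx f + f 0.
Proof.
move=> fa x; rewrite fa addrC; congr (_ + _).
rewrite {2}(row_sum_delta x) mulmx_suml; apply: eq_bigr => i _.
rewrite -scalemxAl; congr (_ *: _); apply/rowP => j.
by rewrite -rowE !mxE.
Qed.

Lemma affine_is_affine (A : 'M[R]_n) b : is_affine (fun x => x *m A + b).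
Proof.
move=> x; rewrite mul0mx add0r addrC; congr (_ + _).
rewrite {1}(row_sum_delta x) mulmx_suml; apply: eq_bigr => i _.
by rewrite -scalemxAl addrK.
Qed.

Lemma mulmx_norm_le {k l q} (A : 'M[R]_(k, l)) (B : 'M[R]_(l, q)) :
  `|A *m B| <= l%:R * `|A| * `|B|.
Proof.
apply: mx_norm_le => [|i j]; first by rewrite !mulr_ge0.
rewrite mxE (le_trans (ler_norm_sum _ _ _)) //.
apply: (@le_trans _ _ (\sum_(t < l) `|A| * `|B|)).
  by apply: ler_sum => t _; rewrite normrM ler_pM // mx_entry_le.
by rewrite sumr_const card_ord -[_ *+ l]mulr_natl mulrA.
Qed.

Lemma cvg_mulmx {T : Type} {F : set_system T} {FF : Filter F} {k l q}
    (f : T -> 'M[R]_(k, l)) (g : T -> 'M[R]_(l, q)) (A : 'M[R]_(k, l)) (B : 'M[R]_(l, q)) :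
  f @ F --> A -> g @ F --> B -> (fun t => f t *m g t) @ F --> A *m B.
Proof.
move=> fA gB; apply: cvg_mx => i j; rewrite mxE.
under eq_fun do rewrite mxE.
apply: (@cvg_bigsum R R T F FF _ _ (fun t x => f x i t * g x t j)) => t.
by apply: cvgM; exact: cvg_entry.
Qed.

End AffineMaps.

(** Completeness of the parameter space, required by [Baire]. *)
HB.instance Definition _ (R : realType) (m n : nat) :=
  Uniform_isComplete.Build 'M[R]_(m, n) cauchy_cvg.

Lemma homeo_fun_inv {X : topologicalType} (f : X -> X) : homeomorphism f ->
  [/\ continuous (fun_inv f), cancel f (fun_inv f) & cancel (fun_inv f) f].
Proof.
move=> [fc [g [gc fK gK]]]; suff -> : fun_inv f = g by [].
apply/funext => y; rewrite /fun_inv.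
have : [set x | f x = y] (xget y [set x | f x = y]) by apply: xgetPex; exists (g y) => /=.
by move=> /= fy; rewrite -[LHS]fK fy.
Qed.

Section AffineLifts.
Context {R : realType} {n m : nat} {M : topologicalType}.
Notation V := 'rV[R]_n.
Variables (G : set (V -> V)) (p : V -> M).
Hypothesis G_homeo : homeomorphism_group G.
Hypothesis G_fpd : free_properly_discontinuous G.
Hypothesis Gp : orbit_map G p.
Hypothesis M_hausdorff : hausdorff_space M.
Variables (r0 d : R).
Hypothesis cocomp : forall x, exists2 g, G g & `|g x| < r0.
Hypothesis d0 : 0 < d.
Hypothesis tubeU : forall x x' h, G h -> tube G r0 d x x' -> tube G r0 d x (h x') -> h = id.
Variables (r : R) (e : 'rV[R]_m -> {compact-open, M -> M}).
Hypothesis r_gt0 : 0 < r.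
Hypothesis e_cont : forall a, `|a| < r -> {for a, continuous e}.
Variable F : 'rV[R]_m -> V -> V.
Hypothesis F_cont : forall a, `|a| < r -> continuous (F a).
Hypothesis F_lift : forall a, `|a| < r -> lifts p (e a) (F a).
Hypothesis F_tube : forall a, `|a| < r -> forall x, tube G r0 d x (F a x).

Lemma F_comm a g x : `|a| < r -> G g -> F a (g x) = g (F a x).
Proof.
move=> ar Gg.
exact: (lift_tube_comm G_homeo Gp tubeU (F_lift ar) (F_tube ar)).
Qed.

(** For [a] near [a0], the image of [p (g x)] under [e a] has a preimage close to [g (F a0 x)]. That
    preimage is still in the tube over [g x], so by uniqueness it is [g (F a x)]. *)
Lemma F_cvg (a0 : 'rV[R]_m) x : `|a0| < r -> (fun a => F a x) @ a0 --> F a0 x.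
Proof.
move=> a0r; have FF := @nbhs_filter 'rV[R]_m a0.
have [g [Gg gx gFx]] := F_tube a0r x.
have [Gi gK giK] := act_inv G_homeo Gg.
suff K : (fun a => g (F a x)) @ a0 --> g (F a0 x).
  have := @cvg_app _ (nbhs a0) V V (fun a => g (F a x)) (fun_inv g) (g (F a0 x))
    (act_cont G_homeo Gi (x := _)) K.
  have -> : (fun t => fun_inv g (g (F t x))) = (fun a => F a x) by apply/funext => t; rewrite gK.
  by rewrite gK.
apply/cvgrPdist_lt => eps eps0.
pose eps' := Num.min eps (d - `|g x - g (F a0 x)|).
have eps'0 : 0 < eps' by rewrite lt_min eps0 subr_gt0.
pose U := p @` [set y | `|g (F a0 x) - y| < eps'].
have oU : open U by apply: (proj_open G_homeo Gp); exact: open_dist_lt.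
have cK : compact [set p (g x)] by exact: compact_set1.
have eU : [set f : {compact-open, M -> M} | f @` [set p (g x)] `<=` U] (e a0).
  move=> _ [_ /= -> <-]; exists (g (F a0 x)); first by rewrite /= subrr normr0.
  by rewrite -F_comm // F_lift.
have nU : \forall f \near e a0, [set f : {compact-open, M -> M} | f @` [set p (g x)] `<=` U] f.
  by apply: open_nbhs_nbhs; split => //; exact: compact_open_open.
have nr : \forall a \near a0, `|a| < r.
  by apply: open_nbhs_nbhs; split => //; exact: open_norm_lt.
have H := filterI nr (e_cont a0r nU).
refine (@filterS _ _ FF _ _ _ (H FF)) => a [ar] /= /(_ (e a (p (g x)))) [].
  by exists (p (g x)).
move=> y' /= y'1 y'2; have : p (g (F a x)) = p y' by rewrite y'2 -F_comm // F_lift.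
move=> /(proj_eq Gp)[h Gh hy].
suff hid : h = id.
  by move: y'1; rewrite -hy hid /eps' lt_min => /andP[].
apply: (tubeU Gh (x := g x) (x' := g (F a x))).
  by rewrite -F_comm //; exact: F_tube.
exists id; split => //; first exact: act_id.
rewrite hy -(subrK (g (F a0 x)) (g x)) -addrA (le_lt_trans (ler_normD _ _)) //.
by move: y'1; rewrite lt_min => /andP[_]; rewrite ltrBrDl.
Qed.

Lemma act_countable : exists s : nat -> V -> V, forall g, G g -> exists k, s k = g.
Proof.
have cG : countable G.
  apply: (@sub_countable _ _ _ (\bigcup_(k : nat)
      [set g | G g /\ exists x, `|x| <= k%:R /\ `|g x| <= (k%:R : R)])); last first.
    apply: bigcup_countable => // k _; apply: finite_set_countable.
    by apply: (act_proper _ G_homeo G_fpd Gp M_hausdorff) => t; exact: compact_norm_le.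
  apply: subset_card_le => g Gg; exists (Num.truncn `|g 0|).+1 => //; split => //.
  by exists 0; rewrite normr0 ler0n; split => //; apply/ltW/truncnS_gt.
have [f finj] := countable_injP _ cG.
exists (fun k => if pselect (exists g, G g /\ f g = k) is left H then projT1 (cid H) else id).
move=> g Gg; exists (f g); case: pselect => [H|[]]; last by exists g.
by case: cid => h /= [Gh /finj]; apply; exact/mem_set.
Qed.

Hypothesis F_aff : forall a, `|a| < r -> exists2 g, G g & is_affine (g \o F a).

(** For each [a] some element of the countable group [G] makes [F a] affine. For a given element the
    parameters of norm at most [s] that it serves form a closed set, so by Baire one of these sets
    has interior. *)
Lemma affine_somewhere s : 0 < s -> s < r -> exists g a2 t, [/\ G g, 0 < t, `|a2| < s &
  forall a, `|a2 - a| < t -> `|a| <= s /\ is_affine (g \o F a)].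
Proof.
move=> s0 sr; have [en Hen] := act_countable.
pose C k := [set a : 'rV[R]_m | `|a| <= s /\ (G (en k) /\ is_affine (en k \o F a))].
pose W k := ~` C k.
have oW k : open (W k).
  rewrite openE => a /= aC; rewrite /interior.
  have [as_|sa] := leP `|a| s; last first.
    have : \forall b \near a, s < `|b|.
      apply: open_nbhs_nbhs; split => //.
      apply: (@open_comp _ _ (fun x : 'rV[R]_m => `|x|) [set y : R | s < y]); last exact: open_gt.
      by move=> x _; exact: norm_continuous.
    by apply: filterS => b sb [/(lt_le_trans sb)]; rewrite ltxx.
  have ar : `|a| < r := le_lt_trans as_ sr.
  have [Gk|nGk] := pselect (G (en k)); last first.
    by apply: (@filterS _ _ _ setT); [move=> b _ [_ [Gk _]]; exact: nGk Gk|exact: filterT].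
  have [x nx] : exists x, ~ (en k \o F a) x = (en k \o F a) 0 +
      \sum_i x ord0 i *: ((en k \o F a) (delta_mx 0 i) - (en k \o F a) 0).
    by apply/existsNP => H; apply: aC.
  pose h b := (en k \o F b) x - ((en k \o F b) 0 +
      \sum_i x ord0 i *: ((en k \o F b) (delta_mx 0 i) - (en k \o F b) 0)).
  have FF := @nbhs_filter 'rV[R]_m a.
  have cF y : (fun b => (en k \o F b) y) @ a --> (en k \o F a) y.
    apply: (@cvg_app _ _ V V (fun b => F b y) (en k) (F a y)); first exact: (act_cont G_homeo Gk).
    exact: F_cvg.
  have ch : h @ a --> h a.
    apply: cvgB; first exact: cF; apply: cvgD; first exact: cF.
    apply: cvg_bigsum => i; apply: cvgZ; first exact: cvg_cst.
    by apply: cvgB; exact: cF.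
  have ha : 0 < `|h a| by rewrite normr_gt0 subr_eq0; apply/eqP.
  have : \forall b \near a, `|h a - h b| < `|h a| by move/cvgrPdist_lt: ch; apply.
  apply: filterS => b hb [_ [_ /(_ x) hx]]; move: hb.
  by rewrite {2}/h hx subrr subr0 ltxx.
have [k nd] : exists k, ~ dense (W k).
  apply/existsNP => dW.
  have /(_ [set a | `|a| < s]) := @Baire R 'rV[R]_m W (fun k => conj (oW k) (dW k)).
  have ne : [set a : 'rV[R]_m | `|a| < s] !=set0 by exists 0 => /=; rewrite normr0.
  move=> /(_ ne (@open_norm_lt _ _ _))[a [/= as_ Wa]].
  have [g Gg ga] := F_aff (lt_trans as_ sr).
  have [k gk] := Hen g Gg; apply: (Wa k I).
  by split; [exact: ltW|rewrite gk].
have [U [U0 oU UW]] : exists U, [/\ U !=set0, open U & U `&` W k = set0].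
  apply: contrapT => H; apply: nd => U U0 oU; apply/set0P/eqP => UW; apply: H; by exists U.
have UC a : U a -> C k a.
  by move=> Ua; apply: contrapT => nC; have : (U `&` W k) a by []; rewrite UW.
have [a1 Ua1] := U0.
(* The point found may have norm exactly [s]; shrinking it slightly keeps it in [U]. *)
have [a2 Ua2 a2s] : exists2 a2, U a2 & `|a2| < s.
  have [a1s _] := UC _ Ua1.
  have /near_ball_ex[t t0 Ht] : \forall a \near a1, U a by exact: open_nbhs_nbhs.
  pose q := Num.min 1 (t / (2 * s)).
  have q0 : 0 < q by rewrite lt_min ltr01 divr_gt0 // mulr_gt0.
  have q1 : q <= 1 by rewrite ge_min lexx.
  have qt : q * s < t.
    apply: (@le_lt_trans _ _ (t / (2 * s) * s)); first by rewrite ler_pM2r // ge_min lexx orbT.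
    by rewrite invfM mulrA mulfVK ?gt_eqF //; lra.
  exists ((1 - q) *: a1).
    apply: Ht; rewrite scalerBl scale1r opprB addrC subrK normrZ gtr0_norm //.
    by apply: le_lt_trans qt; rewrite ler_pM2l.
  rewrite normrZ ger0_norm ?subr_ge0 //; move: a1s q0 q1; move: (`|a1|) => x.
  by move=> xs q0' q1'; nra.
have /near_ball_ex[t t0 Ht] : \forall a \near a2, U a by exact: open_nbhs_nbhs.
have [_ [Gk _]] := UC _ Ua2.
by exists (en k), a2, t; split => // a /Ht/UC[as_ [_ aa]].
Qed.

End AffineLifts.

Lemma affine_inj_unit {R : realType} {n : nat} (f : 'rV[R]_n -> 'rV[R]_n) :
  is_affine f -> injective f -> aff_mx f \in unitmx.
Proof.
move=> fa finj; rewrite -row_free_unit -kermx_eq0; apply/rowV0P => v /sub_kermxP vA.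
by apply: finj; rewrite (is_affineE fa v) vA add0r.
Qed.

(** All that is kept of the chart: [F a] is the lift of [e a] that commutes with [G], and [P] and
    [E] describe product and quotient. *)
Record local_affine {R : realType} {n m : nat} {M : topologicalType}
    (G : set ('rV[R]_n -> 'rV[R]_n)) (p : 'rV[R]_n -> M) (H : set {compact-open, M -> M})
    (r : R) (e : 'rV[R]_m -> {compact-open, M -> M}) (E P : 'rV[R]_m -> 'rV[R]_m -> 'rV[R]_m)
    (F : 'rV[R]_m -> 'rV[R]_n -> 'rV[R]_n) : Prop := LocalAffine {
  la_pos : 0 < r;
  la_one : F 0 = id;
  la_in : forall a, `|a| < r -> H (e a);
  la_lift : forall a, `|a| < r -> lifts p (e a) (F a);
  la_comm : forall a g x, `|a| < r -> G g -> F a (g x) = g (F a x);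
  la_cvg : forall (a : 'rV[R]_m) x, `|a| < r -> (fun b => F b x) @ a --> F a x;
  la_aff : forall a, `|a| < r -> is_affine (F a);
  la_P : forall a b, `|a| < r -> `|b| < r -> `|P a b| < r -> F (P a b) = F a \o F b;
  la_E : forall a b, `|a| < r -> `|b| < r -> `|E a b| < r -> F a = F (E a b) \o F b;
  la_commute : forall a b, `|a| < r -> `|b| < r -> F a \o F b = F b \o F a;
  la_inj : forall a b, `|a| < r -> `|b| < r -> F a = F b -> a = b;
  la_est : forall eps, 0 < eps -> exists2 rho, 0 < rho &
    forall a b, `|a| < rho -> `|b| < rho ->
      `|E a b - (a - b)| <= eps * `|a - b| /\ `|P a b - (a + b)| <= eps * `|a|;
  la_near : forall rho, 0 < rho ->
    \forall f \near (id : {compact-open, M -> M}), H f -> exists2 a, `|a| < rho & f = e a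
}.

Section AffineLiftsExist.
Context {R : realType} {n m : nat} {M : topologicalType}.
Notation V := 'rV[R]_n.
Variables (G : set (V -> V)) (p : V -> M).
Hypothesis G_homeo : homeomorphism_group G.
Hypothesis G_fpd : free_properly_discontinuous G.
Hypothesis Gp : orbit_map G p.
Hypothesis M_hausdorff : hausdorff_space M.
Hypothesis M_compact : compact [set: M].
Hypothesis HL : lie_group_of_dim R m (Aff0 p) compose_co id fun_inv.
Hypothesis HC : forall f g, Aff0 p f -> Aff0 p g -> compose_co f g = compose_co g f.

Theorem affine_lifts : exists r e E P F, @local_affine R n m M G p (Aff0 p) r e E P F.
Proof.
have [r [e [E [P [[r_gt0 e0] He HE Hest Hnear]]]]] := local_abelian HL HC.
have [r0 r0_gt0 coc] := act_cocompact G_homeo Gp M_compact.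
have cb t : compact [set x : V | `|x| <= t] by exact: compact_norm_le.
have [d d0 tubeU] := tube_unique cb G_homeo G_fpd Gp M_hausdorff r0.
have Aff_homeo f : Aff0 p f -> Aff p f by exact: connected_component_sub.
have [r1 r1_gt0 Hr1] : exists2 r1, 0 < r1 & forall a, `|a| < r1 ->
    close_id p r0 d (e a).
  have [_ e0c] := He 0 (ltac:(by rewrite normr0)).
  have nc := near_close_id cb G_homeo Gp r0 d0.
  have /near_ball_ex[r1 r1_gt0 Hr1] : \forall a \near (0 : 'rV[R]_m), close_id p r0 d (e a).
    by apply: e0c; rewrite e0.
  by exists r1 => // a ar; apply: Hr1; rewrite sub0r normrN.
have [rho rho_gt0 Hrho] := Hest 2^-1 (ltac:(lra)).
pose rr := Num.min r1 (Num.min rho r).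
have rr_gt0 : 0 < rr by rewrite !lt_min r1_gt0 rho_gt0.
have rr1 (a : 'rV[R]_m) : `|a| < rr -> `|a| < r1 by rewrite !lt_min => /andP[].
have rr2 (a : 'rV[R]_m) : `|a| < rr -> `|a| < rho by rewrite !lt_min => /and3P[].
have rr3 (a : 'rV[R]_m) : `|a| < rr -> `|a| < r by rewrite !lt_min => /and3P[].
have e_inj a : `|a| < rr -> injective (e a).
  by move=> ar; have [_ K _] := homeo_fun_inv (Aff_homeo _ (He a (rr3 _ ar)).1).1; exact: can_inj K.
have : forall a, exists F : V -> V, `|a| < rr -> [/\ continuous F, lifts p (e a) F,
    forall x, tube G r0 d x (F x), injective F & exists2 g, G g & is_affine (g \o F)].
  move=> a; have [ar|ar] := pselect (`|a| < rr); last by exists id.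
  have [_ [fh [[A [b [Au fhE]]] [[fhc [fhi [_ fhK _]]] fhl]]]] := Aff_homeo _ (He a (rr3 _ ar)).1.
  have fhL : lifts p (e a) fh by move=> x; have /(congr1 (fun f => f x)) := fhl.
  have [h Gh th] := lift_tube_exists G_homeo Gp coc (Hr1 _ (rr1 _ ar)) fhL 0.
  have [Gi hK hiK] := act_inv G_homeo Gh.
  have hc : continuous (h \o fh).
    by move=> x; apply: (@cvg_app _ _ V V fh h (fh x)); [exact: (act_cont G_homeo Gh)|exact: fhc].
  have hL : lifts p (e a) (h \o fh) by move=> x; rewrite /= (proj_act Gp) // fhL.
  exists (h \o fh) => _; split => //.
  - exact: (lift_in_tube G_homeo Gp coc tubeU (Hr1 _ (rr1 _ ar)) hL hc th).
  - by move=> x y /= /(act_inj G_homeo Gh) /(can_inj fhK).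
  - exists (fun_inv h) => //; rewrite (_ : _ \o _ = (fun x => x *m A + b)).
      exact: affine_is_affine.
    by apply/funext => x; rewrite /= hK fhE.
move=> /choice[F HF].
have F_cont a : `|a| < rr -> continuous (F a) by move=> /HF[].
have F_lift a : `|a| < rr -> lifts p (e a) (F a) by move=> /HF[].
have F_tube a : `|a| < rr -> forall x, tube G r0 d x (F a x) by move=> /HF[].
have F_inj a : `|a| < rr -> injective (F a) by move=> /HF[].
have F_aff a : `|a| < rr -> exists2 g, G g & is_affine (g \o F a) by move=> /HF[].
have FC := F_comm G_homeo Gp tubeU F_lift F_tube.
have e_cont a : `|a| < rr -> {for a, continuous e} by move=> /rr3/He[].
have Fcvg := F_cvg G_homeo Gp tubeU e_cont F_lift F_tube.
have rr4 : 0 < rr / 4 by rewrite divr_gt0.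
have rr4' : rr / 4 < rr by lra.
(* Near [a2] the same [g] makes all lifts affine. For small [w] the lift [F w] is the inverse of
   [F a2] composed with [F (P w a2)]; [g] cancels there, and [F w] is affine. *)
have [g [a2 [t [Gg t_gt0 a2s Ht]]]] := affine_somewhere G_homeo G_fpd Gp M_hausdorff tubeU
  e_cont F_lift F_tube F_aff rr4 rr4'.
have a2r : `|a2| < rr := lt_trans a2s rr4'.
have ginj := act_inj G_homeo Gg.
set A2 := aff_mx (g \o F a2); set c2 := g (F a2 0).
have a2aff : is_affine (g \o F a2) by have [] := Ht a2 (ltac:(by rewrite subrr normr0)).
have A2u : A2 \in unitmx.
  by apply: affine_inj_unit => // x y /ginj; exact: F_inj.
have tube_close W : (forall h x, G h -> W (h x) = h (W x)) ->
    (forall x, `|x| < r0 -> `|x - W x| < d) -> forall x, tube G r0 d x (W x).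
  by move=> WC Wd x; have [h Gh hx] := coc x; exists h; split => //; rewrite -WC //; exact: Wd.
have F_uniq a W : `|a| < rr -> lifts p (e a) W -> (forall x, tube G r0 d x (W x)) -> W = F a.
  move=> ar WL Wt; apply/funext => x.
  exact: (lift_tube_unique Gp tubeU WL (F_lift _ ar) (Wt x) (F_tube _ ar x)).
have gF_cvg x : (fun u => g (F u x)) @ a2 --> g (F a2 x).
  apply: (@cvg_app _ _ V V (fun u => F u x) g (F a2 x)); first exact: (act_cont G_homeo Gg).
  exact: Fcvg.
have mx_cvg (D : 'rV[R]_m -> V -> V) (a : 'rV[R]_m) : (forall x, (fun u => D u x) @ a --> D a x) ->
    (fun u => aff_mx (D u)) @ a --> aff_mx (D a).
  move=> Dc; have FF := @nbhs_filter 'rV[R]_m a.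
  apply: cvg_mx => i j; rewrite mxE; under eq_fun do rewrite mxE.
  by apply: cvg_entry; apply: cvgB; exact: Dc.
pose N : R := n%:R * `|invmx A2|.
have N0 : 0 <= N by rewrite mulr_ge0.
(* If the linear part and the translation part change by at most [eta], then, after multiplication
   by [invmx A2], the points of the ball of radius [r0] move by less than [d]. *)
pose eta := d / ((N + 1) * (n%:R * r0 + 1)).
have nr0 : 0 <= n%:R * r0 by rewrite mulr_ge0 // ltW.
have eta0 : 0 < eta by rewrite divr_gt0 // mulr_gt0 // ltr_wpDl.
have [t' t'0 Ht'] : exists2 t', 0 < t' & forall u, `|a2 - u| < t' ->
    `|A2 - aff_mx (g \o F u)| <= eta /\ `|c2 - g (F u 0)| <= eta.
  have FF := @nbhs_filter 'rV[R]_m a2.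
  have h1 : \forall u \near a2, `|A2 - aff_mx (g \o F u)| <= eta.
    by move/cvgrPdist_le: (mx_cvg (fun u => g \o F u) a2 gF_cvg); apply.
  have h2 : \forall u \near a2, `|c2 - g (F u 0)| <= eta.
    by move/cvgrPdist_le: (gF_cvg 0); apply.
  by have [t' t'0 Ht'] := near_ball_ex (@filterI _ _ FF _ _ h1 h2); exists t'.
pose t2 := Num.min (rr / 4) (Num.min t t' / 2).
have t2_gt0 : 0 < t2 by rewrite lt_min rr4 divr_gt0 // lt_min t_gt0.
have F_affine w : `|w| < t2 -> is_affine (F w).
  move=> wt.
  have wrr4 : `|w| < rr / 4 by apply: lt_le_trans wt _; rewrite ge_min lexx.
  have wrr : `|w| < rr := lt_trans wrr4 rr4'.
  have [_ Pest] := Hrho w a2 (rr2 _ wrr) (rr2 _ a2r).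
  set u := P w a2 in Pest.
  have ua2 : `|a2 - u| <= 2 * `|w|.
    have -> : a2 - u = - (u - (w + a2)) - w by rewrite opprB addrAC [w + a2]addrC addrK.
    rewrite (le_trans (ler_normB _ _)) // normrN.
    by move: Pest (normr_ge0 w); move: (`|u - _|) (`|w|) => x y; lra.
  have ut : `|a2 - u| < Num.min t t'.
    apply: (le_lt_trans ua2); have : t2 <= Num.min t t' / 2 by rewrite ge_min lexx orbT.
    by move: wt; move: (`|w|) (Num.min t t') => x y; lra.
  have [utt utt'] : `|a2 - u| < t /\ `|a2 - u| < t' by move: ut; rewrite lt_min => /andP[].
  have [us uaff] := Ht u utt.
  have ur : `|u| < rr := le_lt_trans us rr4'.
  have [h1 h2] := Ht' u utt'.
  have [_ eu _] := HE w a2 (rr3 _ wrr) (rr3 _ a2r).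
  pose W x := (g (F u x) - c2) *m invmx A2.
  have FW x : F a2 (W x) = F u x.
    apply: ginj; have := is_affineE a2aff (W x); rewrite -/A2 -/c2 /= => ->.
    by rewrite /W mulmxKV // subrK.
  (* Commutativity puts [e a2] outermost in both compositions, where its injectivity removes it. *)
  have WL : lifts p (e w) W.
    move=> x; apply: (e_inj _ a2r); rewrite -(F_lift _ a2r) FW (F_lift _ ur) -/u eu.
    have /(congr1 (fun f => f (p x))) := HC (He _ (rr3 _ wrr)).1 (He _ (rr3 _ a2r)).1.
    by [].
  have WC h x : G h -> W (h x) = h (W x).
    by move=> Gh; apply: (F_inj _ a2r); rewrite FW (FC u h x ur Gh) (FC a2 h _ a2r Gh) FW.
  have Wd x : `|x| < r0 -> `|x - W x| < d.
    move=> xr; have xE : x = (x *m A2) *m invmx A2 by rewrite mulmxK.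
    have gE : g (F u x) = x *m aff_mx (g \o F u) + g (F u 0) := is_affineE uaff x.
    rewrite {1}xE /W gE -mulmxBl.
    have -> : x *m A2 - (x *m aff_mx (g \o F u) + g (F u 0) - c2) =
        x *m (A2 - aff_mx (g \o F u)) + (c2 - g (F u 0)).
      rewrite mulmxBr; move: (x *m _) (x *m _) => y z /=.
      by apply/rowP => j; rewrite !mxE; ring.
    apply: (le_lt_trans (mulmx_norm_le _ _)).
    apply: (@le_lt_trans _ _ (N * ((n%:R * r0 + 1) * eta))).
      rewrite /N mulrAC ler_wpM2l ?mulr_ge0 //.
      apply: (le_trans (ler_normD _ _)); rewrite mulrDl mul1r lerD //.
      apply: (le_trans (mulmx_norm_le _ _)); apply: ler_pM; rewrite ?mulr_ge0 //.
      by rewrite ler_wpM2l // ltW.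
    have D0 : 0 < n%:R * r0 + 1 by rewrite ltr_wpDl.
    have N1 : 0 < N + 1 by rewrite ltr_wpDl.
    rewrite /eta invfM !mulrA.
    rewrite (_ : N * _ * _ / _ / _ = d * (N / (N + 1))); last by field; rewrite !gt_eqF.
    by rewrite gtr_pMr // ltr_pdivrMr // mul1r ltrDl.
  rewrite -(F_uniq w W wrr WL (tube_close _ WC Wd)).
  suff -> : W = (fun x => x *m (aff_mx (g \o F u) *m invmx A2) + (g (F u 0) - c2) *m invmx A2).
    exact: affine_is_affine.
  by apply/funext => x; rewrite /W mulmxA -mulmxDl; congr (_ *m _); rewrite addrA; have := is_affineE uaff x => /= ->.
have t2rr : t2 <= rr by apply: (le_trans _ (ltW rr4')); rewrite ge_min lexx.
have id_lift : F 0 = id.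
  apply/esym; apply: (F_uniq 0); first by rewrite normr0.
    by move=> x; rewrite e0.
  by apply: tube_close => // x _; rewrite subrr normr0.
(* Each lift moves the relevant points by less than [d / 2], so that a composition of two lifts is
   still in the tube and is recognized by uniqueness. *)
have [t3 t3_gt0 Ht3] : exists2 t3, 0 < t3 & forall a, `|a| < t3 -> `|a| < t2 /\
    forall y, `|y| < r0 + d -> `|y - F a y| < d / 2.
  pose K : R := n%:R * (r0 + d) + 1.
  have K0 : 0 < K by rewrite ltr_wpDl // mulr_ge0 // addr_ge0 // ltW.
  pose q := d / 2 / (2 * K).
  have q0 : 0 < q by rewrite !divr_gt0 // mulr_gt0.
  have FF := @nbhs_filter 'rV[R]_m 0.
  have F0 x : (fun u => F u x) @ (0 : 'rV[R]_m) --> F 0 x by apply: Fcvg; rewrite normr0.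
  have h1 : \forall u \near (0 : 'rV[R]_m), `|aff_mx (F 0) - aff_mx (F u)| <= q.
    by move/cvgrPdist_le: (mx_cvg F 0 F0); apply.
  have h2 : \forall u \near (0 : 'rV[R]_m), `|F 0 0 - F u 0| <= q.
    by move/cvgrPdist_le: (F0 0); apply.
  have [t3 t3_gt0 Ht3] := near_ball_ex (@filterI _ _ FF _ _ h1 h2).
  exists (Num.min t3 t2); first by rewrite lt_min t3_gt0.
  move=> a; rewrite lt_min => /andP[at3 at2]; split => // y yr.
  have [|k1 k2] := Ht3 a; first by rewrite sub0r normrN.
  have yE : y = y *m aff_mx (F 0) + F 0 0.
    by rewrite -[LHS]/(id y) -{1}id_lift; apply: is_affineE; apply: F_affine; rewrite normr0.
  rewrite {1}yE (is_affineE (F_affine _ at2) y).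
  have -> : y *m aff_mx (F 0) + F 0 0 - (y *m aff_mx (F a) + F a 0) =
     y *m (aff_mx (F 0) - aff_mx (F a)) + (F 0 0 - F a 0).
    by rewrite mulmxBr opprD addrACA.
  apply: (@le_lt_trans _ _ (K * q)).
    apply: (le_trans (ler_normD _ _)); rewrite /K mulrDl mul1r lerD //.
    apply: (le_trans (mulmx_norm_le _ _)); apply: ler_pM; rewrite ?mulr_ge0 //.
    by rewrite ler_wpM2l // ltW.
  rewrite /q (_ : K * _ = d / 2 / 2); last by field; rewrite gt_eqF.
  by lra.
have t3rr (a : 'rV[R]_m) : `|a| < t3 -> `|a| < rr.
  by move=> /Ht3[h _]; exact: lt_le_trans h t2rr.
have comp_tube (a b : 'rV[R]_m) : `|a| < t3 -> `|b| < t3 -> forall x, tube G r0 d x ((F a \o F b) x).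
  move=> at3 bt3; apply: tube_close => [h x Gh|x xr] /=.
    by rewrite (FC b h x (t3rr _ bt3) Gh) (FC a h _ (t3rr _ at3) Gh).
  have [_ /(_ x) hb] := Ht3 b bt3; have [_ /(_ (F b x)) ha] := Ht3 a at3.
  have {}hb : `|x - F b x| < d / 2 by apply: hb; rewrite ltr_wpDr // ltW.
  have {}ha : `|F b x - F a (F b x)| < d / 2.
    apply: ha; rewrite -(subrK x (F b x)) (le_lt_trans (ler_normD _ _)) // distrC.
    by move: hb xr d0; move: (`|x - _|) (`|x|) => y z; lra.
  rewrite -{1}(subrK (F b x) x) -addrA (le_lt_trans (ler_normD _ _)) //.
  by rewrite (splitr d) ltrD.
have comp_lift (a b : 'rV[R]_m) : `|a| < t3 -> `|b| < t3 -> lifts p (compose_co (e a) (e b)) (F a \o F b).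
  by move=> at3 bt3 x; rewrite /= F_lift ?F_lift //; exact: t3rr.
exists t3, e, E, P, F; split => //.
- by move=> a /t3rr/rr3/He[].
- by move=> a /t3rr/F_lift.
- by move=> a h x /t3rr ar; exact: FC.
- by move=> a x /t3rr; exact: Fcvg.
- by move=> a /Ht3[/F_affine].
- move=> a b at3 bt3 Pt3; apply/esym/F_uniq; [exact: t3rr| |exact: comp_tube].
  have [_ -> _] := HE a b (rr3 _ (t3rr _ at3)) (rr3 _ (t3rr _ bt3)).
  exact: comp_lift.
- move=> a b at3 bt3 Et3; apply/esym/F_uniq; [exact: t3rr| |exact: comp_tube].
  have [eE _ _] := HE a b (rr3 _ (t3rr _ at3)) (rr3 _ (t3rr _ bt3)).
  move=> x; rewrite (comp_lift _ _ Et3 bt3) eE /compose_co.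
  by have [_ K _] := homeo_fun_inv (Aff_homeo _ (He b (rr3 _ (t3rr _ bt3))).1).1; rewrite K.
- move=> a b at3 bt3; apply/funext => x.
  apply: (lift_tube_unique Gp tubeU (comp_lift a b at3 bt3) _ (comp_tube a b at3 bt3 x)).
    rewrite (HC (He _ (rr3 _ (t3rr _ at3))).1 (He _ (rr3 _ (t3rr _ bt3))).1).
    exact: comp_lift.
  exact: comp_tube.
- move=> a b at3 bt3 Fab.
  have [_ _ inj] := HE a b (rr3 _ (t3rr _ at3)) (rr3 _ (t3rr _ bt3)); apply: inj.
  apply/funext => y; have [x <-] := proj_surj Gp y.
  by rewrite -(F_lift _ (t3rr _ at3)) -(F_lift _ (t3rr _ bt3)) Fab.
Qed.

End AffineLiftsExist.

(** * The exponential of a matrix *)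

Lemma bounded_ultra_cvg {R : realType} (U : set_system nat) (UU : UltraFilter U)
    (f : nat -> R) (C : R) : (\forall N \near U, `|f N| <= C) ->
  exists l : R, f @ U --> l.
Proof.
move=> fC; have [l [_ cl]] : [set x : R | x \in `[- C, C]] `&` cluster (f @ U) !=set0.
  apply: segment_compact; apply: filterS fC => N /=.
  by rewrite in_itv /= -ler_norml.
exists l => A nA; have [//|nU] := in_ultra_setVsetC (f @^-1` A) UU.
have [x [/= ? ?]] : (~` A) `&` A !=set0 by apply: cl.
by [].
Qed.

Lemma ultra_nat : exists2 U : set_system nat, UltraFilter U & \oo `<=` U.
Proof. by have [U [UU sU]] := ultraFilterLemma eventually_filter; exists U. Qed.

Lemma bounded_ultra_cvg_mx {R : realType} (U : set_system nat) (UU : UltraFilter U) {k l}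
    (f : nat -> 'M[R]_(k, l)) (C : R) : (\forall N \near U, `|f N| <= C) ->
  exists A : 'M[R]_(k, l), f @ U --> A.
Proof.
move=> fC; have H (ij : 'I_k * 'I_l) : exists x : R, (fun N => f N ij.1 ij.2) @ U --> x.
  apply: (@bounded_ultra_cvg R U UU _ C); apply: filterS fC => N.
  exact: le_trans (mx_entry_le _ _ _).
have [A HA] := choice H; exists (\matrix_(i, j) A (i, j)); apply: cvg_mx => i j.
by rewrite mxE; exact: (HA (i, j)).
Qed.

Lemma ultra_cvg_norm_le {R : realType} (U : set_system nat) (UU : UltraFilter U) {k l}
    (f : nat -> 'M[R]_(k, l)) (A : 'M[R]_(k, l)) (C : R) : f @ U --> A -> (\forall N \near U, `|f N| <= C) -> `|A| <= C.
Proof.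
move=> fA fC; rewrite leNgt; apply/negP => CA.
have : \forall N \near U, C < `|f N| by apply: (cvgr_gt `|A|) CA; exact: cvg_norm.
move=> /(filterI fC) /filter_ex[N [h1 h2]].
by have := le_lt_trans h1 h2; rewrite ltxx.
Qed.

(** A fixed non-principal ultrafilter: along it every bounded sequence of matrices converges, so
    exponentials and derivatives exist as soon as their approximations are bounded. *)
Definition nat_ultra : set_system nat := projT1 (cid2 ultra_nat).

Instance nat_ultra_ultra : UltraFilter nat_ultra.
Proof. by rewrite /nat_ultra; case: cid2. Qed.

Lemma nat_ultra_oo : \oo `<=` nat_ultra.
Proof. by rewrite /nat_ultra; case: cid2. Qed.

Lemma ultra_cvg_unique {R : realType} {k l} (f : nat -> 'M[R]_(k, l)) (A B : 'M[R]_(k, l)) :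
  f @ nat_ultra --> A -> f @ nat_ultra --> B -> A = B.
Proof. by move=> fA fB; apply: (cvg_unique (F := f @ nat_ultra) _ fA fB); exact: norm_hausdorff. Qed.

Lemma ultra_dist {R : realType} {k l} (f : nat -> 'M[R]_(k, l)) (A : 'M[R]_(k, l)) :
  (forall eps : R, 0 < eps -> \forall N \near nat_ultra, `|f N - A| <= eps) ->
  f @ nat_ultra --> A.
Proof.
move=> H; apply/cvgrPdist_le => eps eps0.
by apply: filterS (H _ eps0) => N; rewrite distrC.
Qed.

Lemma ultra_dist_inv {R : realType} {k l} (f : nat -> 'M[R]_(k, l)) (A : 'M[R]_(k, l)) :
  f @ nat_ultra --> A -> forall eps : R, 0 < eps -> \forall N \near nat_ultra, `|f N - A| <= eps.
Proof.
move=> /cvgrPdist_le H eps eps0.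
by apply: filterS (H _ eps0) => N; rewrite distrC.
Qed.

Lemma nat_ultra_inv_le {R : realType} (eps : R) : 0 < eps ->
  \forall N \near nat_ultra, (N.+1%:R)^-1 <= eps.
Proof.
move=> e0; apply: nat_ultra_oo; exists (Num.truncn eps^-1) => // N /= hN.
rewrite -[leRHS]invrK lef_pV2 ?posrE ?invr_gt0 ?ltr0n //.
apply: ltW; apply: (lt_le_trans (truncnS_gt _)).
by rewrite ler_nat ltnS.
Qed.

Section MatrixExp.
Context {R : realType} {k : nat}.
Implicit Types (A B : 'M[R]_k.+1).
Notation K := (k.+1%:R : R).
Let K0 : 0 < K. Proof. by rewrite ltr0n. Qed.
Let K1 : 1 <= K. Proof. by rewrite ler1n. Qed.

(** The norm is the largest entry, not an operator norm; each product costs a factor [K]. *)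
Lemma mx_mul_norm (A B : 'M[R]_k.+1) : `|A * B| <= K * `|A| * `|B|.
Proof. exact: mulmx_norm_le. Qed.

Lemma mx_one_norm : `|1 : 'M[R]_k.+1| <= 1.
Proof.
apply: mx_norm_le => // i j; rewrite !mxE.
by case: (i == j); rewrite ?normr1 ?normr0.
Qed.

Definition powN (B : 'M[R]_k.+1) (N : nat) := (1 + (N.+1%:R)^-1 *: B) ^+ N.+1.

Lemma pow1D_norm A i (c : R) : K * (i%:R * `|A|) <= c -> `|(1 + A) ^+ i| <= expR c.
Proof.
move=> h; apply: (@le_trans _ _ ((1 + K * `|A|) ^+ i)); last first.
  apply: (@le_trans _ _ (expR (K * `|A|) ^+ i)).
    by rewrite lerXn2r ?nnegrE ?expR_ge0 ?addr_ge0 ?mulr_ge0 ?(ltW K0) // expR_ge1Dx.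
  by rewrite -expRM_natl ler_expR mulrCA.
elim: i {h} => [|i IH]; first by rewrite !expr0 mx_one_norm.
rewrite !exprSr [X in `|X|]mulrDr mulr1 mulrDr mulr1 (le_trans (ler_normD _ _)) // lerD //.
apply: (le_trans (mx_mul_norm _ _)).
have -> : (1 + K * `|A|) ^+ i * (K * `|A|) = K * (1 + K * `|A|) ^+ i * `|A| by ring.
by rewrite ler_wpM2r // ler_wpM2l // ltW.
Qed.

Lemma pow1D_dist A B i (c : R) : K * (i%:R * `|A|) <= c -> K * (i%:R * `|B|) <= c ->
  `|(1 + A) ^+ i - (1 + B) ^+ i| <= i%:R * (K * expR c * expR c * `|A - B|).
Proof.
move=> hA hB; pose b := 1 + K * `|B|.
have b1 : 1 <= b by rewrite /b lerDl mulr_ge0 // ltW.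
have b0 : 0 <= b := le_trans ler01 b1.
have D0 : 0 <= K * expR c * `|A - B| by rewrite !mulr_ge0 ?expR_ge0 // ltW.
(* The factor [b ^+ j] absorbs the right multiplications by [1 + B] accumulated in the induction; at
   the end it is at most [expR c]. *)
have step j : (j <= i)%N -> `|(1 + A) ^+ j - (1 + B) ^+ j| <= j%:R * (K * expR c * `|A - B|) * b ^+ j.
  elim: j => [|j IH] ji; first by rewrite !expr0 subrr normr0 mul0r mul0r.
  have hAj : K * (j%:R * `|A|) <= c.
    apply: le_trans hA; rewrite ler_wpM2l ?(ltW K0) // ler_wpM2r // ler_nat; exact: ltnW.
  have -> : (1 + A) ^+ j.+1 - (1 + B) ^+ j.+1 =
      (1 + A) ^+ j * (A - B) + ((1 + A) ^+ j - (1 + B) ^+ j) * (1 + B).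
    have -> : A - B = (1 + A) - (1 + B) by rewrite opprD addrACA subrr add0r.
    by rewrite !exprSr mulrBr mulrBl addrA subrK.
  apply: (le_trans (ler_normD _ _)).
  have -> : j.+1%:R * (K * expR c * `|A - B|) * b ^+ j.+1 =
    K * expR c * `|A - B| * b ^+ j.+1 + j%:R * (K * expR c * `|A - B|) * b ^+ j * b.
    by rewrite -natr1 exprSr; ring.
  apply: lerD.
    apply: (le_trans (mx_mul_norm _ _)).
    apply: (@le_trans _ _ (K * expR c * `|A - B|)).
      by rewrite ler_wpM2r // ler_wpM2l ?(ltW K0) // pow1D_norm.
    by rewrite ler_peMr // exprn_ege1.
  rewrite [X in `|X|]mulrDr mulr1 (le_trans (ler_normD _ _)) //.
  apply: (@le_trans _ _ (`|(1 + A) ^+ j - (1 + B) ^+ j| * b)); last first.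
    by rewrite ler_wpM2r // IH // ltnW.
  rewrite /b mulrDr mulr1 lerD2l (le_trans (mx_mul_norm _ _)) //.
  by rewrite le_eqVlt; apply/orP; left; apply/eqP; ring.
apply: (le_trans (step i (leqnn _))).
have bi : b ^+ i <= expR c.
  apply: (@le_trans _ _ (expR (K * `|B|) ^+ i)).
    by rewrite lerXn2r ?nnegrE ?expR_ge0 // expR_ge1Dx.
  by rewrite -expRM_natl ler_expR mulrCA.
have -> : i%:R * (K * expR c * expR c * `|A - B|) = i%:R * (K * expR c * `|A - B|) * expR c by ring.
by rewrite ler_wpM2l // mulr_ge0.
Qed.

Lemma scaleN A N : N.+1%:R * `|(N.+1%:R : R)^-1 *: A| = `|A|.
Proof. by rewrite normrZ normfV normr_nat mulVKf // pnatr_eq0. Qed.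

Lemma powN_bound A N : `|powN A N| <= expR (K * `|A|).
Proof. by apply: pow1D_norm; rewrite scaleN. Qed.

Definition mexp A : 'M[R]_k.+1 := lim (powN A @ nat_ultra).

Lemma mexp_cvg A : powN A @ nat_ultra --> mexp A.
Proof.
have [l fl] := @bounded_ultra_cvg_mx R nat_ultra nat_ultra_ultra _ _ (powN A) (expR (K * `|A|))
  (@filterE _ nat_ultra _ _ (@powN_bound A)).
by rewrite /mexp; apply/cvg_ex; exists l.
Qed.

(** Only the limit of [N.+1 *: B N] matters to the limit of the powers. Both the addition formula
    and the exponential of a generator are obtained this way. *)
Lemma mexp_lim A (B : nat -> 'M[R]_k.+1) :
  (fun N => N.+1%:R *: B N) @ nat_ultra --> A -> (fun N => (1 + B N) ^+ N.+1) @ nat_ultra --> mexp A.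
Proof.
move=> BA; apply: ultra_dist => eps eps0.
pose c := K * (`|A| + 1); pose D := K * expR c * expR c.
have D0 : 0 < D by rewrite !mulr_gt0 ?expR_gt0.
have e1 := ultra_dist_inv BA ltr01.
have eD : 0 < eps / 2 / D by rewrite !divr_gt0.
have e2 := ultra_dist_inv BA eD.
have e3 := ultra_dist_inv (@mexp_cvg A) (ltac:(lra) : 0 < eps / 2).
near=> N; have h1 : `|N.+1%:R *: B N - A| <= 1 by near: N.
have h2 : `|N.+1%:R *: B N - A| <= eps / 2 / D by near: N.
have h3 : `|powN A N - mexp A| <= eps / 2 by near: N.
have -> : (1 + B N) ^+ N.+1 - mexp A = ((1 + B N) ^+ N.+1 - powN A N) + (powN A N - mexp A).
  by rewrite addrA subrK.
apply: (le_trans (ler_normD _ _)).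
have NN : N.+1%:R != 0 :> R by rewrite pnatr_eq0.
have BN : N.+1%:R * `|B N| = `|N.+1%:R *: B N| by rewrite normrZ normr_nat.
have : `|(1 + B N) ^+ N.+1 - powN A N| <= N.+1%:R * (K * expR c * expR c * `|B N - N.+1%:R^-1 *: A|).
  apply: pow1D_dist; rewrite ?scaleN ?BN /c ler_wpM2l ?(ltW K0) //; last by lra.
  by rewrite -(subrK A (N.+1%:R *: B N)) (le_trans (ler_normD _ _)) // addrC lerD2l.
have -> : N.+1%:R * (K * expR c * expR c * `|B N - N.+1%:R^-1 *: A|) = D * `|N.+1%:R *: B N - A|.
  have -> : N.+1%:R *: B N - A = N.+1%:R *: (B N - N.+1%:R^-1 *: A).
    by rewrite scalerBr scalerA mulfV // scale1r.
  by rewrite normrZ normr_nat /D; ring.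
have : D * `|N.+1%:R *: B N - A| <= D * (eps / 2 / D) by rewrite ler_pM2l.
by rewrite [D * (_ / _)]mulrC mulfVK ?gt_eqF //; lra.
Unshelve. all: by end_near.
Qed.

Lemma mexp0 : mexp 0 = 1.
Proof.
apply: (ultra_cvg_unique (@mexp_cvg 0)).
have -> : powN 0 = fun=> 1 by apply/funext => N; rewrite /powN scaler0 addr0 expr1n.
exact: cvg_cst.
Qed.

Lemma mexpD A B : A * B = B * A -> mexp (A + B) = mexp A * mexp B.
Proof.
move=> AB; apply: (@ultra_cvg_unique _ _ _ (fun N => powN A N * powN B N)); last first.
  by apply: cvg_mulmx; exact: mexp_cvg.
pose C N := N.+1%:R^-1 *: (A + B) + (N.+1%:R^-1 * N.+1%:R^-1) *: (A * B).
have -> : (fun N => powN A N * powN B N) = (fun N => (1 + C N) ^+ N.+1).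
  apply/funext => N; rewrite /powN -exprMn_comm; last first.
    by apply/eqP; rewrite /GRing.comm !mulrDr !mulrDl !mul1r !mulr1 -!scalerAl -!scalerAr AB addrACA.
  congr (_ ^+ _); rewrite /C mulrDr mulr1 mulrDl mul1r -scalerAl -scalerAr scalerA scalerDr.
  by rewrite -!addrA.
apply: mexp_lim; apply: ultra_dist => eps eps0.
have d0 : 0 < eps / (`|A * B| + 1) by rewrite divr_gt0 // ltr_wpDl.
apply: filterS (nat_ultra_inv_le d0) => N hN.
have NN : N.+1%:R != 0 :> R by rewrite pnatr_eq0.
rewrite /C scalerDr !scalerA mulrA mulfV // scale1r mul1r addrC addKr normrZ normfV normr_nat.
apply: (@le_trans _ _ (eps / (`|A * B| + 1) * (`|A * B| + 1))).
  by rewrite ler_pM // ?lerDl // invr_ge0.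
by rewrite mulfVK // gt_eqF // ltr_wpDl.
Qed.

Lemma mexp_lipschitz (r : R) A B : `|A| <= r -> `|B| <= r ->
  `|mexp A - mexp B| <= K * expR (K * r) * expR (K * r) * `|A - B|.
Proof.
move=> Ar Br; apply: (@ultra_cvg_norm_le R nat_ultra _ _ _ (fun N => powN A N - powN B N)).
  by apply: cvgB; exact: mexp_cvg.
apply: filterE => N; apply: (le_trans (pow1D_dist (c := K * r) _ _));
  rewrite ?scaleN ?ler_wpM2l ?(ltW K0) //.
by rewrite -scalerBr mulrCA scaleN.
Qed.

Lemma mexp_first_order : exists2 C : R, 0 < C & forall A, `|A| <= 1 ->
  `|mexp A - 1 - A| <= C * (`|A| * `|A|).
Proof.
pose C := K * (K * expR K * expR K); exists C; first by rewrite !mulr_gt0 ?expR_gt0.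
move=> A A1; apply: (@ultra_cvg_norm_le R nat_ultra _ _ _ (fun N => powN A N - 1 - A)).
  by apply: cvgB; [apply: cvgB; [exact: mexp_cvg|exact: cvg_cst]|exact: cvg_cst].
apply: filterE => N; pose B := N.+1%:R^-1 *: A.
have NN : N.+1%:R != 0 :> R by rewrite pnatr_eq0.
have -> : powN A N - 1 - A = B * \sum_(i < N.+1) ((1 + B) ^+ i - 1).
  rewrite /powN subrX1 -/B [1 + B]addrC addrK sumrB mulrBr sumr_const card_ord.
  congr (_ - _); by rewrite mulr_natr /B -scaler_nat scalerA mulfV // scale1r.
apply: (le_trans (mx_mul_norm _ _)).
have AN : N.+1%:R * `|B| = `|A| by exact: scaleN.
have S : `|\sum_(i < N.+1) ((1 + B) ^+ i - 1)| <= N.+1%:R * (K * expR K * expR K * `|A|).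
  apply: (le_trans (ler_norm_sum _ _ _)); rewrite mulr_natl -[X in _ *+ X]card_ord -sumr_const.
  apply: ler_sum => i _; rewrite -[X in _ - X](expr1n _ i) -[X in _ - X ^+ _]addr0.
  have iB : i%:R * `|B| <= `|A| by rewrite -AN ler_wpM2r // ler_nat ltnW.
  apply: (le_trans (pow1D_dist (c := K) _ _)).
  - by rewrite -[leRHS]mulr1 ler_pM2l // (le_trans iB).
  - by rewrite normr0 !mulr0 ltW.
  have -> : i%:R * (K * expR K * expR K * `|B - 0|) = K * expR K * expR K * (i%:R * `|B|) by rewrite subr0; ring.
  by rewrite ler_wpM2l // !mulr_ge0 ?expR_ge0 // ltW.
apply: (@le_trans _ _ (K * `|B| * (N.+1%:R * (K * expR K * expR K * `|A|)))).
  by rewrite ler_wpM2l // mulr_ge0 // ltW.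
by rewrite -AN /C le_eqVlt; apply/orP; left; apply/eqP; ring.
Qed.

End MatrixExp.

(** An additive function that vanishes at 1 has period 1, so the bound extends to the half-line; a
    nonzero value would be unbounded on its multiples. *)
Lemma additive_bounded_linear {R : realType} (f : R -> R) (B : R) :
  (forall s t, f (s + t) = f s + f t) -> f 1 = 0 -> (forall s, 0 <= s <= 1 -> `|f s| <= B) ->
  forall s, f s = 0.
Proof.
move=> fD f1 fB.
have f0 : f 0 = 0 by apply: (addrI (f 0)); rewrite -fD !addr0.
have fN s : f (- s) = - f s by apply: (addrI (f s)); rewrite -fD !subrr.
have fn n s : f (s *+ n) = f s *+ n by elim: n => [|n IH]; rewrite ?mulr0n // !mulrS fD IH.
have fk (n : nat) : f n%:R = 0 by rewrite fn f1 mul0rn.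
have fb s : 0 <= s -> `|f s| <= B.
  move=> s0; have /andP[h1 h2] := truncn_itv s0.
  rewrite -(subrK (Num.truncn s)%:R s) fD fk addr0; apply: fB.
  by rewrite subr_ge0 h1 /= lerBlDl natr1 ltW.
have f00 s : 0 <= s -> f s = 0.
  move=> s0; apply/eqP; rewrite -normr_eq0; apply: contraT => fs.
  have fs0 : 0 < `|f s| by rewrite lt_def fs normr_ge0.
  have := fb (s *+ (Num.truncn (B / `|f s|)).+1) (ltac:(by rewrite mulrn_wge0)).
  rewrite fn normrMn leNgt => /negP[]; rewrite -mulr_natl -ltr_pdivrMr //.
  exact: truncnS_gt.
by move=> s; have [/f00//|/ltW] := leP 0 s; rewrite -oppr_ge0 => /f00; rewrite fN => /eqP; rewrite oppr_eq0 => /eqP.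
Qed.

(** * One-parameter subgroups of a local group of matrices *)

Record local_mx_group {R : realType} {m k : nat} (r : R) (E P : 'rV[R]_m -> 'rV[R]_m -> 'rV[R]_m)
    (Z : 'rV[R]_m -> 'M[R]_k.+1) : Prop := LocalMxGroup {
  lg_pos : 0 < r;
  lg_0 : Z 0 = 1;
  lg_P : forall a b, `|a| < r -> `|b| < r -> `|P a b| < r -> Z (P a b) = Z a * Z b;
  lg_E : forall a b, `|a| < r -> `|b| < r -> `|E a b| < r -> Z a = Z (E a b) * Z b;
  lg_C : forall a b, `|a| < r -> `|b| < r -> Z a * Z b = Z b * Z a;
  lg_inj : forall a b, `|a| < r -> `|b| < r -> Z a = Z b -> a = b;
  lg_cvg : forall a : 'rV[R]_m, `|a| < r -> Z @ a --> Z a;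
  lg_est : forall eps, 0 < eps -> exists2 rho, 0 < rho &
    forall a b, `|a| < rho -> `|b| < rho ->
      `|E a b - (a - b)| <= eps * `|a - b| /\ `|P a b - (a + b)| <= eps * `|a|
}.

Section LocalGroup.
Context {R : realType} {m k : nat}.
Variables (r : R) (E P : 'rV[R]_m -> 'rV[R]_m -> 'rV[R]_m) (Z : 'rV[R]_m -> 'M[R]_k.+1).
Hypothesis LG : local_mx_group r E P Z.
Notation K := (k.+1%:R : R).
Let r_gt0 := lg_pos LG.
Let Z0 := lg_0 LG.
Let ZP := lg_P LG.
Let ZE := lg_E LG.
Let ZC := lg_C LG.
Let Z_inj := lg_inj LG.
Let Z_cvg := lg_cvg LG.
Let est := lg_est LG.
Let K0 : 0 < K. Proof. by rewrite ltr0n. Qed.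
Let K1 : 1 <= K. Proof. by rewrite ler1n. Qed.

(** The powers of [Z a] followed in the chart: each product with [a] adds an error of at most
    [eps * |a|], as long as the path stays in the chart. *)
Lemma walk eps : 0 < eps -> eps <= 1 -> exists2 rho, 0 < rho <= r &
  forall a q, (q%:R * `|a|) * 2 < rho -> exists w,
    [/\ `|w - q%:R *: a| <= eps * (q%:R * `|a|), `|w| <= 2 * (q%:R * `|a|) & Z w = Z a ^+ q].
Proof.
move=> eps0 eps1; have [rho rho0 Hrho] := est eps0.
exists (Num.min rho r); first by rewrite lt_min rho0 r_gt0 ge_min lexx orbT.
move=> a; elim=> [|q IH] hq.
  by exists 0; split; rewrite ?mul0r ?scale0r ?subr0 ?normr0 ?mulr0 ?expr0 ?Z0.
have qa : (q%:R * `|a|) + `|a| = q.+1%:R * `|a| by rewrite -natr1; ring.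
have q0 : 0 <= q%:R * `|a| by rewrite mulr_ge0.
have [w [h1 h2 h3]] := IH (ltac:(have := normr_ge0 a; lra)).
move: hq; rewrite lt_min => /andP[hq1 hq2].
have a0 := normr_ge0 a.
have [ar arho] : `|a| < r /\ `|a| < rho by split; lra.
have [wr wrho] : `|w| < r /\ `|w| < rho by split; lra.
have [_ Pe] := Hrho a w arho wrho.
have wq : `|P a w - q.+1%:R *: a| <= eps * (q.+1%:R * `|a|).
  have -> : P a w - q.+1%:R *: a = (P a w - (a + w)) + (w - q%:R *: a).
    by apply/rowP => j; rewrite !mxE -natr1; ring.
  by apply: (le_trans (ler_normD _ _)); rewrite -qa mulrDr addrC lerD.
have Pw : `|P a w| <= 2 * (q.+1%:R * `|a|).
  rewrite -(subrK (q.+1%:R *: a) (P a w)) (le_trans (ler_normD _ _)) //.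
  rewrite normrZ normr_nat; move: wq; rewrite -qa => wq.
  apply: (@le_trans _ _ (eps * (q%:R * `|a| + `|a|) + (q%:R * `|a| + `|a|))); first by rewrite lerD2r.
  have : eps * (q%:R * `|a| + `|a|) <= 1 * (q%:R * `|a| + `|a|) by rewrite ler_wpM2r // addr_ge0.
  by lra.
exists (P a w); split => //; rewrite ZP //; last by lra.
by rewrite h3 exprS.
Qed.

Lemma small_ex (x s : R) : 0 < x -> x <= s -> exists q : nat, [/\ (0 < q)%N, s <= q%:R * x * 2 & q%:R * x <= s].
Proof.
move=> x0 xs; exists (Num.truncn (s / x)).
have s0 : 0 < s := lt_le_trans x0 xs.
have h1 : (Num.truncn (s / x))%:R <= s / x by rewrite truncn_le // ltW // divr_gt0.
have h2 : s / x < (Num.truncn (s / x)).+1%:R by exact: truncnS_gt.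
have q0 : (0 < Num.truncn (s / x))%N by rewrite truncn_gt0 ler_pdivlMr // mul1r.
move: h1 h2; rewrite ler_pdivlMr // ltr_pdivrMr // => h1 h2; split => //.
have : x <= (Num.truncn (s / x))%:R * x by rewrite ler_peMl ?(ltW x0) // ler1n.
by move: h2; rewrite -natr1 mulrDl mul1r; lra.
Qed.

(** While the powers of [A] stay near 1, [A ^+ q - 1] is [q] times [A - 1] up to half the size of
    the latter. *)
Lemma pow_sub1 (A : 'M[R]_k.+1) q : (forall j, (j <= q)%N -> `|A ^+ j - 1| <= (2 * K)^-1) ->
  q%:R * `|A - 1| <= 2 * `|A ^+ q - 1| /\ `|A ^+ q - 1| <= 2 * K * (q%:R * `|A - 1|).
Proof.
move=> HA; have E1 : A ^+ q - 1 = q%:R *: (A - 1) + (A - 1) * \sum_(i < q) (A ^+ i - 1).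
  rewrite subrX1 sumrB sumr_const card_ord mulrBr mulr_natr scaler_nat.
  by rewrite [RHS]addrC subrK.
have S : `|(A - 1) * \sum_(i < q) (A ^+ i - 1)| <= q%:R * `|A - 1| / 2.
  apply: (le_trans (mx_mul_norm _ _)).
  have : `|\sum_(i < q) (A ^+ i - 1)| <= q%:R * (2 * K)^-1.
    apply: (le_trans (ler_norm_sum _ _ _)); rewrite mulr_natl -[X in _ *+ X]card_ord -sumr_const.
    by apply: ler_sum => i _; apply: HA; exact: ltnW.
  move=> h; apply: (@le_trans _ _ (K * `|A - 1| * (q%:R * (2 * K)^-1))).
    by rewrite ler_wpM2l // mulr_ge0 // ltW.
  by rewrite le_eqVlt; apply/orP; left; apply/eqP; field; rewrite gt_eqF.
have n0 : 0 <= q%:R * `|A - 1| by rewrite mulr_ge0.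
split.
  have : `|q%:R *: (A - 1)| <= `|A ^+ q - 1| + `|(A - 1) * \sum_(i < q) (A ^+ i - 1)|.
    by rewrite E1; set x := _ *: _; set y := _ * _; rewrite -{1}(addrK y x) (le_trans (ler_normB _ _)).
  by rewrite normrZ normr_nat; lra.
rewrite E1 (le_trans (ler_normD _ _)) // normrZ normr_nat.
apply: (@le_trans _ _ (2 * (q%:R * `|A - 1|))); first by lra.
by rewrite ler_wpM2r // ler_peMr.
Qed.

Lemma Z_near1 eps : 0 < eps -> exists2 rho, 0 < rho & forall w, `|w| < rho -> `|Z w - 1| <= eps.
Proof.
move=> eps0; have := Z_cvg (a := 0); rewrite normr0 => /(_ r_gt0) c.
have FF := @nbhs_filter 'rV[R]_m 0.
have /near_ball_ex[rho rho0 Hrho] : \forall w \near (0 : 'rV[R]_m), `|Z w - 1| <= eps.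
  by move/cvgrPdistC_le: c => /(_ eps eps0); rewrite Z0.
by exists rho => // w wr; apply: Hrho; rewrite sub0r normrN.
Qed.

(** Continuity and injectivity of [Z] suffice for linear bounds: a small [a] is multiplied by an
    integer [q] until its size is about [s], where compactness bounds [Z w - 1] from below, and
    [pow_sub1] brings the comparison back from [Z a ^+ q] to [Z a]. *)
Lemma Z_sub1_bounds : exists rho c1 c2, [/\ 0 < rho <= r, 0 < c1, 0 < c2 &
  forall a, `|a| < rho -> c1 * `|a| <= `|Z a - 1| /\ `|Z a - 1| <= c2 * `|a|].
Proof.
have [rho0 /andP[rho0_gt0 rho0r] Hw] := walk (ltac:(lra) : 0 < 2^-1 :> R) (ltac:(lra)).
have [rho1 rho1_gt0 Hrho1] := Z_near1 (ltac:(by rewrite invr_gt0 mulr_gt0) : 0 < (2 * K)^-1).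
pose s := Num.min rho0 rho1 / 8.
have s_gt0 : 0 < s by rewrite divr_gt0 // lt_min rho0_gt0.
have s0 : s * 8 <= rho0 by rewrite /s mulfVK // ge_min lexx.
have s1 : s * 8 <= rho1 by rewrite /s mulfVK // ge_min lexx orbT.
(* Away from the origin the map stays away from the identity, by compactness. *)
have [mu mu0 Hmu] : exists2 mu, 0 < mu & forall y, `|y| <= 2 * s -> s / 4 <= `|y| -> mu <= `|Z y - 1|.
  have : \forall mu \near 0^'+, [set y : 'rV[R]_m | `|y| <= 2 * s] `<=`
      (fun y => s / 4 <= `|y| -> mu <= `|Z y - 1|).
    move/compact_near_coveringP: (@compact_norm_le R m (2 * s)).
    move=> /(_ R 0^'+ (fun mu y => s / 4 <= `|y| -> mu <= `|Z y - 1|)); apply => y ys.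
    have yr : `|y| < r by move: ys => /= ys; lra.
    have [y0|yn0] := eqVneq y 0.
      exists ([set z | `|y - z| < s / 4], setT); first by split; [exact: (@near_dist_lt R 'rV[R]_m y (s / 4) (ltac:(lra)))|exact: filterT].
      move=> [z mu'] /= [yz _] sz; move: yz; rewrite y0 sub0r normrN => zs.
      by have := le_lt_trans sz zs; rewrite ltxx.
    have d0 : 0 < `|Z y - 1|.
      rewrite normr_gt0 subr_eq0; apply: contra yn0 => /eqP Zy; apply/eqP.
      by apply: Z_inj; rewrite ?normr0 // Z0.
    have FF := @nbhs_filter 'rV[R]_m y.
    exists ([set z | `|Z y - Z z| < `|Z y - 1| / 2], [set mu | mu <= `|Z y - 1| / 2]).
      split => /=; last by apply: nbhs_right_le; rewrite divr_gt0.
      by move/cvgrPdist_lt: (Z_cvg yr); apply; rewrite divr_gt0.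
    move=> [z mu'] /= [zy mu'y] _; apply: (le_trans mu'y).
    have : `|Z y - 1| <= `|Z y - Z z| + `|Z z - 1|.
      by rewrite -{1}(subrK (Z z) (Z y)) -addrA ler_normD.
    by lra.
  move=> /near_right_ex[mu mu0 Hmu]; exists mu => // y ys; exact: Hmu.
exists s, (mu / (4 * K * s)), (2 * (2 * K)^-1 * (2 / s)).
have Ks : 0 < 4 * K * s by apply: mulr_gt0 => //; exact: mulr_gt0.
split.
- by rewrite s_gt0 /=; lra.
- exact: divr_gt0.
- by apply: mulr_gt0; [rewrite mulr_gt0 // invr_gt0 mulr_gt0|exact: divr_gt0].
move=> a as_; have [->|an0] := eqVneq a 0; first by rewrite normr0 !mulr0 Z0 subrr normr0.
have a0 : 0 < `|a| by rewrite normr_gt0.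
have [q [q0 sq qs]] := small_ex a0 (ltW as_).
have HA j : (j <= q)%N -> `|Z a ^+ j - 1| <= (2 * K)^-1.
  move=> jq; have jqa : j%:R * `|a| <= q%:R * `|a| by rewrite ler_wpM2r // ler_nat.
  have [w [_ hw <-]] := Hw a j (ltac:(lra)).
  by apply: Hrho1; lra.
have [p1 p2] := pow_sub1 HA.
have qR : 0 < q%:R :> R by rewrite ltr0n.
split.
  have [w [h1 h2 h3]] := Hw a q (ltac:(lra)).
  have wl : s / 4 <= `|w|.
    have : `|q%:R *: a| <= `|w| + `|w - q%:R *: a|.
      by rewrite -{1}(subrK w (q%:R *: a)) addrC (le_trans (ler_normD _ _)) // lerD2l distrC.
    by rewrite normrZ normr_nat; lra.
  have wu : `|w| <= 2 * s by lra.
  have := Hmu w wu wl; rewrite h3 => muq.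
  rewrite mulrAC ler_pdivrMr; last exact: Ks.
  have : mu * `|a| <= (2 * K * (q%:R * `|Z a - 1|)) * `|a|.
    by rewrite ler_wpM2r // (le_trans muq).
  have : 2 * K * `|Z a - 1| * (q%:R * `|a|) <= 2 * K * `|Z a - 1| * s.
    by rewrite ler_wpM2l // !mulr_ge0 // ltW.
  have : 0 <= K * `|Z a - 1| * s by apply: mulr_ge0; [apply: mulr_ge0; [exact: ltW|exact: normr_ge0]|exact: ltW].
  by move: (`|Z a - 1|) (`|a|) => x y; lra.
have h := HA q (leqnn _).
rewrite -(ler_pM2l qR) (le_trans p1) //.
apply: (@le_trans _ _ (2 * (2 * K)^-1)); first by rewrite ler_pM2l.
have -> : q%:R * (2 * (2 * K)^-1 * (2 / s) * `|a|) = 2 * (2 * K)^-1 * (q%:R * `|a| * 2 / s) by ring.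
rewrite ler_peMr ?mulr_ge0 ?invr_ge0 ?mulr_ge0 ?(ltW K0) //.
by rewrite ler_pdivlMr // mul1r.
Qed.

(** Transport from the identity: [Z a - Z b] is [Z (E a b) - 1] times [Z b], and [E a b] is
    comparable to [a - b]. *)
Lemma Z_lipschitz : exists rho c1 c2, [/\ 0 < rho <= r, 0 < c1, 0 < c2 &
  forall a b, `|a| < rho -> `|b| < rho ->
    c1 * `|a - b| <= `|Z a - Z b| /\ `|Z a - Z b| <= c2 * `|a - b|].
Proof.
have [rho0 [c1 [c2 [/andP[rho0_gt0 rho0r] c10 c20 H]]]] := Z_sub1_bounds.
have [rho1 rho1_gt0 Hrho1] := Z_near1 ltr01.
have [rho2 rho2_gt0 Hrho2] := est (ltac:(lra) : 0 < 2^-1 :> R).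
pose s := Num.min rho0 (Num.min rho1 rho2) / 4.
have s_gt0 : 0 < s by rewrite divr_gt0 // !lt_min rho0_gt0 rho1_gt0.
have s0 : s * 4 <= rho0 by rewrite /s mulfVK // ge_min lexx.
have s1 : s * 4 <= rho1 by rewrite /s mulfVK // !ge_min lexx orbT.
have s2 : s * 4 <= rho2 by rewrite /s mulfVK // !ge_min lexx !orbT.
have [sl1 sl2 s2r] : [/\ s < rho1, s < rho2 & 2 * s < r] by split; lra.
have slr : s < r by lra.
have Zb b : `|b| < rho1 -> `|Z b| <= 2.
  move=> br; rewrite -(subrK 1 (Z b)) (le_trans (ler_normD _ _)) //.
  by have := Hrho1 b br; have := @mx_one_norm R k; lra.
exists s, (c1 / (4 * K)), (K * c2 * 4).
split.
- by rewrite s_gt0 /=; lra.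
- by rewrite divr_gt0 // mulr_gt0.
- by rewrite !mulr_gt0.
move=> a b as_ bs; have [Ee _] := Hrho2 a b (lt_trans as_ sl2) (lt_trans bs sl2).
have ab : `|a - b| < 2 * s by rewrite (le_lt_trans (ler_normB _ _)) //; lra.
have El : `|a - b| <= 2 * `|E a b|.
  have : `|a - b| <= `|E a b| + `|E a b - (a - b)|.
    by rewrite -{1}(subrK (E a b) (a - b)) addrC (le_trans (ler_normD _ _)) // lerD2l distrC.
  by lra.
have Eu : `|E a b| <= 2 * `|a - b|.
  rewrite -(subrK (a - b) (E a b)) (le_trans (ler_normD _ _)) //.
  by have := normr_ge0 (a - b); lra.
have Er : `|E a b| < rho0 by lra.
have [h1 h2] := H (E a b) Er.
have ZEab := ZE (lt_trans as_ slr) (lt_trans bs slr) (lt_le_trans Er rho0r).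
have ZD : Z a - Z b = (Z (E a b) - 1) * Z b by rewrite ZEab mulrBl mul1r.
split; last first.
  rewrite ZD (le_trans (mx_mul_norm _ _)) //.
  apply: (@le_trans _ _ (K * (c2 * `|E a b|) * 2)).
    by rewrite ler_pM ?mulr_ge0 ?(ltW K0) ?Zb ?ler_wpM2l ?(ltW K0) //; exact: lt_trans bs sl1.
  have : K * c2 * `|E a b| <= K * c2 * (2 * `|a - b|) by rewrite ler_wpM2l // mulr_ge0 // ltW.
  by lra.
have [E0 _] := Hrho2 0 b (ltac:(by rewrite normr0)) (lt_trans bs sl2).
have E0b : `|E 0 b| < 2 * s.
  rewrite -(subrK (0 - b) (E 0 b)) (le_lt_trans (ler_normD _ _)) //.
  by move: E0; rewrite sub0r normrN; lra.
have := ZE (a := 0) (b := b) (ltac:(by rewrite normr0)) (lt_trans bs slr) (lt_trans E0b s2r); rewrite Z0 => Z1.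
have ZbE : Z b * Z (E 0 b) = 1 by rewrite ZC; [rewrite -Z1|exact: lt_trans bs slr|exact: lt_trans E0b s2r].
have ZE1 : Z (E a b) - 1 = (Z a - Z b) * Z (E 0 b) by rewrite ZD -mulrA ZbE mulr1.
have : c1 * `|E a b| <= K * `|Z a - Z b| * 2.
  apply: (le_trans h1); rewrite ZE1 (le_trans (mx_mul_norm _ _)) //.
  by rewrite ler_wpM2l ?mulr_ge0 ?(ltW K0) // Zb //; lra.
have : c1 * `|a - b| <= c1 * (2 * `|E a b|) by rewrite ler_pM2l.
move=> h5 h6; rewrite mulrAC ler_pdivrMr ?mulr_gt0 //.
by move: h5 h6; set x := `|a - b|; set y := `|E a b|; set z := `|Z a - Z b|; lra.
Qed.

Let h (N : nat) : R := (N.+1%:R)^-1.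
Let h0 N : 0 < h N. Proof. by rewrite /h invr_gt0 ltr0n. Qed.
Let hK N (x : R) : N.+1%:R * (h N * x) = x.
Proof. by rewrite /h mulVKf // pnatr_eq0. Qed.

Let normh N (u : 'rV[R]_m) : `|h N *: u| = h N * `|u|.
Proof. by rewrite normrZ gtr0_norm. Qed.

Definition difference_quotient (u : 'rV[R]_m) (N : nat) : 'M[R]_k.+1 :=
  N.+1%:R *: (Z ((N.+1%:R)^-1 *: u) - 1).

Definition generator (u : 'rV[R]_m) : 'M[R]_k.+1 := lim (difference_quotient u @ nat_ultra).

Let near_scale (u : 'rV[R]_m) (s : R) : 0 < s -> \forall N \near nat_ultra, `|h N *: u| < s.
Proof.
move=> s0; have d0 : 0 < s / (`|u| + 1) by rewrite divr_gt0 // ltr_wpDl.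
apply: filterS (nat_ultra_inv_le d0) => N hN; rewrite normh.
apply: (@le_lt_trans _ _ (s / (`|u| + 1) * `|u|)); first by rewrite ler_wpM2r.
by rewrite -mulrA gtr_pMr // mulrC ltr_pdivrMr ?ltr_wpDl // mul1r ltrDl.
Qed.

Let quotient_bound : exists2 c : R, 0 < c &
  forall u, \forall N \near nat_ultra, `|difference_quotient u N| <= c * `|u|.
Proof.
have [rho [c1 [c2 [/andP[rho0 rhor] c10 c20 H]]]] := Z_lipschitz.
exists c2 => // u; apply: filterS (near_scale u rho0) => N hN.
have [_] := H (h N *: u) 0 hN (ltac:(by rewrite normr0)); rewrite Z0 subr0 normh => hb.
rewrite /difference_quotient normrZ normr_nat.
by apply: (le_trans (ler_wpM2l _ hb)); rewrite // mulrCA hK.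
Qed.

Lemma generator_cvg u : difference_quotient u @ nat_ultra --> generator u.
Proof.
have [c c0 H] := quotient_bound.
have [l fl] := bounded_ultra_cvg_mx _ (H u).
by rewrite /generator; apply/cvg_ex; exists l.
Qed.

Lemma generator_bound : exists2 c : R, 0 < c & forall u, `|generator u| <= c * `|u|.
Proof.
have [c c0 H] := quotient_bound; exists c => // u.
exact: ultra_cvg_norm_le (@generator_cvg u) (H u).
Qed.

(** At scale [1 / N.+1], replacing [P a b] by [a + b] costs a small multiple of [|a|], and the
    product of [Z a - 1] and [Z b - 1] is of second order; both errors vanish after multiplication
    by [N.+1]. *)
Lemma generatorD u v : generator (u + v) = generator u + generator v.
Proof.
have [rho [c1 [c2 [/andP[rho0 rhor] c10 c20 H]]]] := Z_lipschitz.
apply/eqP; rewrite -subr_eq0 -normr_eq0 eq_le normr_ge0 andbT; apply/ler_addgt0Pl => eps eps0.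
rewrite addr0.
pose e1 := eps / 2 / (c2 * (`|u| + 1)).
have e10 : 0 < e1 by rewrite /e1 divr_gt0 ?divr_gt0 // mulr_gt0 // ltr_wpDl.
have [rho2 rho20 Hrho2] := est e10.
pose s := Num.min rho rho2 / 4.
have s0 : 0 < s by rewrite divr_gt0 // lt_min rho0.
have sr : s * 4 <= rho by rewrite /s mulfVK // ge_min lexx.
have sr2 : s * 4 <= rho2 by rewrite /s mulfVK // ge_min lexx orbT.
have [sl sl2 s2l] : [/\ s < rho, s < rho2 & 2 * s < rho] by split; lra.
pose D := K * (c2 * c2) * (`|u| * `|v|) + 1.
have D0 : 0 < D by rewrite /D ltr_wpDl // !mulr_ge0 // ltW.
have d0 : 0 < eps / 2 / D by rewrite !divr_gt0.
have [rho3 rho30 Hrho3] := est (ltr01 : 0 < 1 :> R).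
have s30 : 0 < rho3 by [].
pose dq := difference_quotient.
apply: (@ultra_cvg_norm_le R nat_ultra _ _ _ (fun N => dq (u + v) N - (dq u N + dq v N))).
  by apply: cvgB; [exact: generator_cvg|apply: cvgD; exact: generator_cvg].
near=> N.
have as_ : `|h N *: u| < s by near: N; exact: near_scale.
have bs : `|h N *: v| < s by near: N; exact: near_scale.
have a3 : `|h N *: u| < rho3 by near: N; exact: near_scale.
have b3 : `|h N *: v| < rho3 by near: N; exact: near_scale.
have hd : h N <= eps / 2 / D by near: N; exact: nat_ultra_inv_le.
move: as_ bs a3 b3; set a := h N *: u; set b := h N *: v => as_ bs a3 b3.
have a0 := normr_ge0 a; have b0 := normr_ge0 b.
have [_ Pe] := Hrho2 a b (lt_trans as_ sl2) (lt_trans bs sl2).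
have [_ P1] := Hrho3 a b a3 b3.
have ab : `|a + b| < 2 * s by rewrite mulr_natl mulr2n (le_lt_trans (ler_normD _ _)) // ltrD.
have Pr : `|P a b| < rho.
  rewrite -(subrK (a + b) (P a b)) (le_lt_trans (ler_normD _ _)) //; lra.
have ZPab := ZP (lt_le_trans (lt_trans as_ sl) rhor) (lt_le_trans (lt_trans bs sl) rhor) (lt_le_trans Pr rhor).
have [_ l1] := H (a + b) (P a b) (lt_trans ab s2l) Pr.
have [_] := H a 0 (lt_trans as_ sl) (ltac:(by rewrite normr0)); rewrite Z0 subr0 => l2.
have [_] := H b 0 (lt_trans bs sl) (ltac:(by rewrite normr0)); rewrite Z0 subr0 => l3.
have -> : dq (u + v) N - (dq u N + dq v N) =
    N.+1%:R *: ((Z (a + b) - Z (P a b)) + (Z a - 1) * (Z b - 1)).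
  have hab : N.+1%:R^-1 *: (u + v) = a + b by rewrite scalerDr.
  rewrite /dq /difference_quotient hab -[_ *: u]/a -[_ *: v]/b -[X in _ - X]scalerDr -[LHS]scalerBr; congr (_ *: _).
  rewrite ZPab mulrBl mul1r mulrBr mulr1; set w := Z a * Z b.
  by apply/matrixP => i j; rewrite !mxE; ring.
rewrite normrZ normr_nat.
have q1 : `|Z (a + b) - Z (P a b)| <= c2 * (e1 * `|a|).
  by apply: (le_trans l1); rewrite ler_pM2l // distrC.
have q2 : `|(Z a - 1) * (Z b - 1)| <= K * (c2 * `|a|) * (c2 * `|b|).
  by apply: (le_trans (mx_mul_norm _ _)); rewrite ler_pM // ?mulr_ge0 // ?ler_wpM2l // ltW.
apply: (@le_trans _ _ (N.+1%:R * (c2 * (e1 * `|a|) + K * (c2 * `|a|) * (c2 * `|b|)))).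
  by rewrite ler_wpM2l // (le_trans (ler_normD _ _)) // lerD.
have -> : N.+1%:R * (c2 * (e1 * `|a|) + K * (c2 * `|a|) * (c2 * `|b|)) =
    c2 * e1 * `|u| + K * (c2 * c2) * (`|u| * `|v|) * h N.
  rewrite /a /b !normh; transitivity (N.+1%:R * (h N * (c2 * e1 * `|u| + K * (c2 * c2) * (`|u| * `|v|) * h N))).
    by ring.
  exact: hK.
have : c2 * e1 * `|u| <= eps / 2.
  apply: (@le_trans _ _ (c2 * e1 * (`|u| + 1))); first by rewrite ler_wpM2l ?lerDl // mulr_ge0 // ltW.
  have -> : c2 * e1 * (`|u| + 1) = e1 * (c2 * (`|u| + 1)) by ring.
  by rewrite /e1 mulfVK // gt_eqF // mulr_gt0 // ltr_wpDl.
have : K * (c2 * c2) * (`|u| * `|v|) * h N <= D * (eps / 2 / D).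
  by rewrite ler_pM // ?(ltW (h0 _)) // ?lerDl // !mulr_ge0 // ltW.
by rewrite [D * (_ / _)]mulrC mulfVK ?gt_eqF //; lra.
Unshelve. all: by end_near.
Qed.

(** Real homogeneity follows, entry by entry, from additivity and boundedness on [[0, 1]]. *)
Lemma generatorZ (s : R) u : generator (s *: u) = s *: generator u.
Proof.
have [c c0 H] := generator_bound.
apply/matrixP => i j; apply/eqP; rewrite -subr_eq0 mxE; apply/eqP; move: s.
apply: (@additive_bounded_linear _ _ (c * `|u| + `|generator u|)).
- by move=> s t; rewrite scalerDl generatorD mxE mulrDl opprD addrACA.
- by rewrite scale1r mul1r subrr.
move=> s /andP[s0 s1]; rewrite (le_trans (ler_normB _ _)) // lerD //.
  rewrite (le_trans (mx_entry_le _ _ _)) // (le_trans (H _)) // normrZ ger0_norm //.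
  by rewrite ler_pM2l // ler_piMl.
by rewrite normrM ger0_norm // (le_trans (ler_piMl _ s1)) // mx_entry_le.
Qed.

Lemma generator_commute u v : generator u * generator v = generator v * generator u.
Proof.
pose f u v N := difference_quotient u N * difference_quotient v N.
have c u' v' : f u' v' @ nat_ultra --> generator u' * generator v'.
  by apply: cvg_mulmx; exact: generator_cvg.
apply: (ultra_cvg_unique (c u v)); apply: cvg_trans (c v u); apply: near_eq_cvg.
near=> N.
have ur : `|h N *: u| < r by near: N; exact: near_scale.
have vr : `|h N *: v| < r by near: N; exact: near_scale.
rewrite /f /difference_quotient -!scalerAl -!scalerAr; congr (_ *: (_ *: _)).
exact: (commrB (commr_sym (commrB (ZC ur vr) (commr1 _))) (commr1 _)).
Unshelve. all: by end_near.
Qed.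

Lemma mexp_generator_cvg v : (fun N => Z (h N *: v) ^+ N.+1) @ nat_ultra --> mexp (generator v).
Proof.
have -> : (fun N => Z (h N *: v) ^+ N.+1) = (fun N => (1 + (Z (h N *: v) - 1)) ^+ N.+1).
  by apply/funext => N; rewrite addrC subrK.
apply: mexp_lim; exact: generator_cvg.
Qed.

(** The exponential is the limit of the powers of [Z] at small multiples of [v]. By [walk] these
    powers are values of [Z] at points within a relative error of [v], and [w] is the limit of these
    points. *)
Lemma mexp_generator_near (eps : R) : 0 < eps -> exists2 rho : R, 0 < rho &
  forall v : 'rV[R]_m, `|v| < rho -> exists2 w : 'rV[R]_m, `|w - v| <= eps * `|v| & mexp (generator v) = Z w.
Proof.
move=> eps0; pose e := Num.min eps 1.
have e0 : 0 < e by rewrite lt_min eps0 ltr01.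
have e1 : e <= 1 by rewrite ge_min lexx orbT.
have [rho /andP[rho0 rhor] H] := walk e0 e1.
exists (rho / 4); first lra.
move=> v vr; have v0 := normr_ge0 v.
have Hw N : exists w : 'rV[R]_m, [/\ `|w - v| <= e * `|v|, `|w| <= 2 * `|v| & Z w = Z (h N *: v) ^+ N.+1].
  have := H (h N *: v) N.+1; rewrite normh hK scalerA /h mulfV ?pnatr_eq0 // scale1r.
  by apply; lra.
have [w wP] := choice Hw.
have [l wl] : exists l : 'rV[R]_m, w @ nat_ultra --> l.
  by apply: bounded_ultra_cvg_mx; apply: filterE => N; have [_ + _] := wP N; exact.
have lv : `|l - v| <= e * `|v|.
  apply: (@ultra_cvg_norm_le R nat_ultra _ _ _ (fun N => w N - v)).
    by apply: cvgB => //; exact: cvg_cst.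
  by apply: filterE => N; have [] := wP N.
exists l; first by rewrite (le_trans lv) // ler_wpM2r // ge_min lexx.
apply: (ultra_cvg_unique (@mexp_generator_cvg v)).
have -> : (fun N => Z (h N *: v) ^+ N.+1) = Z \o w by apply/funext => N; have [_ _ /= <-] := wP N.
have lr : `|l| < r.
  apply: (@le_lt_trans _ _ (2 * `|v|)); last lra.
  by apply: (@ultra_cvg_norm_le R nat_ultra _ _ _ w) => //; apply: filterE => N; have [] := wP N.
by apply: cvg_comp wl _; exact: Z_cvg.
Qed.

(** In the chart the exponential becomes a map [w] at distance at most [|v| / 2] from the identity.
    It is continuous because [mexp] is Lipschitz and [Z] expands distances by a definite factor, so
    Poincaré-Miranda yields a small ball in its image. *)
Lemma mexp_generator_onto : exists2 rho : R, 0 < rho &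
  forall a : 'rV[R]_m, `|a| < rho -> exists v, Z a = mexp (generator v).
Proof.
have [rho0 [c1 [c2 [/andP[rho0_gt0 rhor] c10 c20 H]]]] := Z_lipschitz.
have [rho1 rho1_gt0 Hw] := mexp_generator_near (ltac:(lra) : 0 < 2^-1 :> R).
have [c c0 gb] := generator_bound.
pose s := Num.min rho0 rho1 / 4.
have s0 : 0 < s by rewrite divr_gt0 // lt_min rho0_gt0.
have sr0 : s * 4 <= rho0 by rewrite /s mulfVK // ge_min lexx.
have sr1 : s * 4 <= rho1 by rewrite /s mulfVK // ge_min lexx orbT.
pose ra x : R := Num.max (- s) (Num.min x s).
(* Truncation of the coordinates extends [w] continuously to the whole space, as [poincare_miranda]
   requires. *)
pose clamp (v : 'rV[R]_m) : 'rV[R]_m := \row_i ra (v ord0 i).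
have clamp_le v : `|clamp v| <= s.
  apply: mx_norm_le; first exact: ltW.
  move=> i j; rewrite mxE ler_norml /ra le_max lexx /= ge_max ge_min lexx orbT andbT.
  lra.
have clamp_id (v : 'rV[R]_m) : `|v| <= s -> clamp v = v.
  move=> vs; apply/rowP => i; rewrite mxE /ra.
  have := le_trans (mx_entry_le v ord0 i) vs; rewrite ler_norml => /andP[h1 h2].
  by rewrite (min_idPl h2) (max_idPr h1).
have clamp_cont : continuous clamp.
  move=> v; have FF := @nbhs_filter 'rV[R]_m v.
  apply: cvg_mx => i j; rewrite mxE.
  have -> : (fun x : 'rV[R]_m => clamp x i j) = (fun x => Num.max (- s) (Num.min (x ord0 j) s)).
    by apply/funext => x; rewrite mxE.
  apply: cvg_maxr; first exact: cvg_cst.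
  apply: cvg_minr; last exact: cvg_cst.
  by apply: cvg_entry; exact: cvg_id.
have Hex v : exists w : 'rV[R]_m, `|w - clamp v| <= 2^-1 * `|clamp v| /\ mexp (generator (clamp v)) = Z w.
  by have := clamp_le v => ?; have [w ? ?] := Hw (clamp v) (ltac:(lra)); exists w.
have [w wP] := choice Hex.
have wr v : `|w v| < rho0.
  have [hv _] := wP v; have := clamp_le v; rewrite -(subrK (clamp v) (w v)) => ?.
  by rewrite (le_lt_trans (ler_normD _ _)) //; lra.
pose L := K * expR (K * (c * s)) * expR (K * (c * s)) * c / c1.
have L0 : 0 < L by rewrite /L !mulr_gt0 ?expR_gt0 ?invr_gt0.
have w_lip v v' : `|w v - w v'| <= L * `|clamp v - clamp v'|.
  have [h1 _] := H _ _ (wr v) (wr v').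
  have [_ e1] := wP v; have [_ e2] := wP v'; move: h1; rewrite -e1 -e2 => h1.
  have gs x : `|generator (clamp x)| <= c * s by rewrite (le_trans (gb _)) // ler_pM2l.
  have h2 := mexp_lipschitz (gs v) (gs v').
  rewrite /L mulrAC ler_pdivlMr // mulrC (le_trans h1) // (le_trans h2) //.
  rewrite -!mulrA !ler_pM2l ?expR_gt0 //.
  have -> : generator (clamp v) - generator (clamp v') = generator (clamp v - clamp v').
    by rewrite generatorD -[- clamp v']scaleN1r generatorZ scaleN1r.
  exact: gb.
have w_cont : continuous w.
  move=> v; have FF := @nbhs_filter 'rV[R]_m v.
  apply/cvgrPdist_le => eps eps0.
  have e0 : 0 < eps / L by rewrite divr_gt0.
  move/cvgrPdist_le: (clamp_cont v) => /(_ _ e0); apply: filterS => x hx.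
  by rewrite (le_trans (w_lip _ _)) // mulrC -ler_pdivlMr.
exists (s / 4); first lra.
move=> a as_.
have ai i : `|a ord0 i| <= s / 4 by rewrite (le_trans (mx_entry_le a ord0 i)) // ltW.
have wi (x : 'rV[R]_m) i : `|x| <= s -> `|w x ord0 i - x ord0 i| <= s / 2.
  move=> xs; have [hx _] := wP x; move: hx; rewrite clamp_id // => hx.
  have := mx_entry_le (w x - x) ord0 i; rewrite !mxE; lra.
have [|||x xs hx] := @poincare_miranda R m (fun x => w x - a) s s0.
- by move=> x; have FF := @nbhs_filter 'rV[R]_m x; apply: cvgB; [exact: (w_cont x)|exact: cvg_cst].
- move=> x i xs xi; have h1 := wi x i xs; have h2 := ai i.
  by move: h1 h2; rewrite !ler_norml !mxE xi => /andP[h1 h2] /andP[h3 h4]; lra.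
- move=> x i xs xi; have h1 := wi x i xs; have h2 := ai i.
  by move: h1 h2; rewrite !ler_norml !mxE xi => /andP[h1 h2] /andP[h3 h4]; lra.
exists x; have [_] := wP x; rewrite clamp_id // => ->.
by congr Z; apply/eqP; rewrite eq_sym -subr_eq0 hx.
Qed.

End LocalGroup.

(** * Flows of commuting affine vector fields *)

Section Homogeneous.
Context {R : realType} {n : nat}.

(* Affine maps of ['rV_n] are [n.+1]-matrices acting on the rows [(1, x)]. *)
Definition hom (x : 'rV[R]_n) : 'rV[R]_n.+1 :=
  \row_j if unlift ord0 j is Some i then x ord0 i else 1.

Definition rsub (y : 'rV[R]_n.+1) : 'rV[R]_n := \row_j y ord0 (lift ord0 j).

Lemma rsubD y z : rsub (y + z) = rsub y + rsub z.
Proof. by apply/rowP => j; rewrite !mxE. Qed.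

Lemma rsubB y z : rsub (y - z) = rsub y - rsub z.
Proof. by apply/rowP => j; rewrite !mxE. Qed.

Lemma rsubZ a y : rsub (a *: y) = a *: rsub y.
Proof. by apply/rowP => j; rewrite !mxE. Qed.

Lemma homK x : rsub (hom x) = x.
Proof. by apply/rowP => j; rewrite !mxE liftK. Qed.

Lemma hom0E x : hom x ord0 ord0 = 1.
Proof. by rewrite mxE unlift_none. Qed.

Lemma homP (y : 'rV[R]_n.+1) : y ord0 ord0 = 1 -> hom (rsub y) = y.
Proof. by move=> y1; apply/rowP => j; rewrite mxE; case: unliftP => [i ->|->]; rewrite ?mxE. Qed.

Lemma rsub_norm y : `|rsub y| <= `|y|.
Proof.
apply: mx_norm_le => // i j; rewrite mxE; exact: mx_entry_le.
Qed.

Lemma hom_norm x : `|hom x| <= `|x| + 1.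
Proof.
apply: mx_norm_le => [|i j]; first by rewrite addr_ge0.
rewrite mxE; case: unliftP => [i' _|_]; last by rewrite normr1 lerDr.
by rewrite (le_trans (mx_entry_le _ _ _)) // lerDl.
Qed.

Lemma rsub_inj (y z : 'rV[R]_n.+1) : y ord0 ord0 = z ord0 ord0 -> rsub y = rsub z -> y = z.
Proof.
move=> e1 /rowP e2; apply/rowP => j; case: (unliftP ord0 j) => [i ->|->] //.
by have := e2 i; rewrite !mxE.
Qed.

Lemma hom_comb (s : R) x y : hom (x + s *: (y - x)) = hom x + s *: (hom y - hom x).
Proof.
apply/rowP => j; rewrite !mxE; case: unliftP => [i _|_]; rewrite ?mxE //.
by rewrite subrr mulr0 addr0.
Qed.

Lemma hom_mul_inj (W W' : 'M[R]_n.+1) : (forall x, hom x *m W = hom x *m W') -> W = W'.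
Proof.
move=> H; apply/row_matrixP => i; rewrite !rowE.
have e0 : hom 0 = delta_mx 0 ord0.
  by apply/rowP => j; rewrite !mxE eqxx /=; case: unliftP => [i' ->|->]; rewrite ?mxE ?eqxx // lift_eqF.
case: (unliftP ord0 i) => [i' ->|->]; last by rewrite -e0.
have -> : delta_mx 0 (lift ord0 i') = hom (delta_mx 0 i') - hom 0 :> 'rV[R]_n.+1.
  apply/rowP => j; rewrite !mxE eqxx /=; case: unliftP => [i'' ->|->]; rewrite ?mxE ?eqxx ?subr0 //=.
    by rewrite ?(inj_eq (@lift_inj _ _)) ?subrr.
by rewrite !mulmxBl !H.
Qed.

End Homogeneous.

Section Flow.
Context {R : realType} {n d : nat}.
Implicit Types (X : 'rV[R]_d -> 'M[R]_n.+1) (x y : 'rV[R]_n) (u v : 'rV[R]_d).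

(** The vanishing first column makes the exponentials preserve the rows of first entry 1, that is,
    act as affine maps. *)
Definition affine_family X : Prop :=
  [/\ forall u v, X (u + v) = X u + X v,
      forall (s : R) u, X (s *: u) = s *: X u,
      forall u v, X u * X v = X v * X u
    & forall u i, X u i ord0 = 0].

Definition field X u x : 'rV[R]_n := rsub (hom x *m X u).
Definition flow X v x : 'rV[R]_n := rsub (hom x *m mexp (X v)).

Variable X : 'rV[R]_d -> 'M[R]_n.+1.
Hypothesis XA : affine_family X.

Lemma family0 : X 0 = 0.
Proof. by have [_ XZ _ _] := XA; rewrite -(scale0r 0) XZ scale0r. Qed.

Lemma familyN u : X (- u) = - X u.
Proof. by have [_ XZ _ _] := XA; rewrite -scaleN1r XZ scaleN1r. Qed.

Lemma mul_family0 (y : 'rV[R]_n.+1) u : (y *m X u) ord0 ord0 = 0.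
Proof. by have [_ _ _ X0] := XA; rewrite mxE big1 // => i _; rewrite X0 mulr0. Qed.

Lemma fieldD u v x : field X (u + v) x = field X u x + field X v x.
Proof. by have [XD _ _ _] := XA; rewrite /field XD mulmxDr rsubD. Qed.

Lemma fieldZ (s : R) u x : field X (s *: u) x = s *: field X u x.
Proof. by have [_ XZ _ _] := XA; rewrite /field XZ -scalemxAr rsubZ. Qed.

Lemma family_bound : exists2 c : R, 0 < c & forall u, `|X u| <= c * `|u|.
Proof.
have [XD XZ _ _] := XA.
exists (\sum_(i < d) `|X (delta_mx 0 i)| + 1); first by rewrite ltr_wpDl // sumr_ge0.
move=> u; have X0 := family0.
have -> : X u = \sum_i u ord0 i *: X (delta_mx 0 i).
  rewrite {1}(row_sum_delta u) (big_morph X (fun u v => XD u v) X0).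
  by apply: eq_bigr => i _; rewrite XZ.
apply: (le_trans (ler_norm_sum _ _ _)); rewrite mulrDl mul1r -[leLHS]addr0 lerD // mulr_suml.
by apply: ler_sum => i _; rewrite normrZ mulrC ler_wpM2l // mx_entry_le.
Qed.

Lemma mexp_col u i : mexp (X u) i ord0 = (i == ord0)%:R.
Proof.
have c := @mexp_cvg R n (X u).
have c' := cvg_entry (i := i) (j := ord0) c.
apply: (@cvg_unique R^o (@norm_hausdorff _ _) ((fun N => powN (X u) N i ord0) @ nat_ultra)); first exact: c'.
have -> : (fun N => powN (X u) N i ord0) = (fun=> (i == ord0)%:R); last exact: cvg_cst.
apply/funext => N; rewrite /powN; move: (N.+1%:R^-1) => s; elim: N.+1 {c c'} i => [|q IH] i; first by rewrite expr0 mxE.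
rewrite exprSr mxE (bigD1 ord0) //= big1 => [|j j0]; last first.
  by have [_ _ _ X0] := XA; rewrite !mxE X0 mulr0 addr0 (negPf j0) mulr0.
by have [_ _ _ X0] := XA; rewrite IH !mxE X0 mulr0 !addr0 eqxx mulr1.
Qed.

Lemma flow_hom v x : hom (flow X v x) = hom x *m mexp (X v).
Proof.
apply: homP; rewrite mxE (bigD1 ord0) //= big1 => [|j j0]; last first.
  by rewrite mexp_col (negPf j0) mulr0.
by rewrite mexp_col hom0E mul1r addr0.
Qed.

Lemma flow0 x : flow X 0 x = x.
Proof. by rewrite /flow family0 mexp0 mulmx1 homK. Qed.

Lemma flowD u v x : flow X (u + v) x = flow X u (flow X v x).
Proof.
have [XD _ XC _] := XA.
by rewrite {1 2}/flow flow_hom -mulmxA addrC XD -[_ *m mexp (X u)]mexpD.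
Qed.

Lemma flowK v : cancel (flow X v) (flow X (- v)).
Proof. by move=> x; rewrite -flowD addNr flow0. Qed.

Lemma flowC u v x : flow X u (flow X v x) = flow X v (flow X u x).
Proof. by rewrite -!flowD addrC. Qed.

Lemma flow_comb v (s : R) x y :
  flow X v (x + s *: (y - x)) = flow X v x + s *: (flow X v y - flow X v x).
Proof. by rewrite /flow hom_comb mulmxDl -scalemxAl mulmxBl rsubD rsubZ rsubB. Qed.

Lemma flow_zero v x : field X v x = 0 -> flow X v x = x.
Proof.
move=> f0; have hX : hom x *m X v = 0.
  by apply: rsub_inj; [rewrite mul_family0 mxE|rewrite -/(field X v x) f0; apply/rowP => j; rewrite !mxE].
have c : (fun N => hom x *m powN (X v) N) @ nat_ultra --> hom x *m mexp (X v).
  by apply: cvg_mulmx; [exact: cvg_cst|exact: mexp_cvg].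
have E : (fun N => hom x *m powN (X v) N) = fun=> hom x.
  apply/funext => N; rewrite /powN; move: (N.+1%:R^-1) => s; elim: N.+1 => [|q IH]; first by rewrite expr0 mulmx1.
  by rewrite exprSr -[_ * _]/(_ *m _) mulmxA IH mulmxDr mulmx1 -scalemxAr hX scaler0 addr0.
rewrite E in c; have h : hom x *m mexp (X v) = hom x by apply: (ultra_cvg_unique c); exact: cvg_cst.
by rewrite /flow h homK.
Qed.

Lemma flow_first_order (r : R) : exists2 C : R, 0 < C & forall v x, `|v| <= C^-1 -> `|x| <= r ->
  `|flow X v x - x - field X v x| <= C * (`|v| * `|v|).
Proof.
have [c c0 Xb] := family_bound; have [D D0 HD] := @mexp_first_order R n.
pose C := c + n.+1%:R * (`|r| + 1) * (D * (c * c)) + 1.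
have C0 : 0 < C by rewrite /C ltr_wpDl // addr_ge0 ?mulr_ge0 ?addr_ge0 // ltW.
exists C => // v x vC xr.
have -> : flow X v x - x - field X v x = rsub (hom x *m (mexp (X v) - 1 - X v)).
  by rewrite !mulmxBr mulmx1 !rsubB homK.
have Xv1 : `|X v| <= 1.
  apply: (le_trans (Xb v)); apply: (@le_trans _ _ (c * C^-1)); first by rewrite ler_pM2l.
  rewrite ler_pdivrMr // mul1r /C -addrA lerDl addr_ge0 // !mulr_ge0 ?addr_ge0 //; exact: ltW.
apply: (le_trans (rsub_norm _)); apply: (le_trans (mulmx_norm_le _ _)).
have h1 : `|hom x| <= `|r| + 1.
  by rewrite (le_trans (hom_norm _)) // lerD2r (le_trans xr) // ler_norm.
have h2 : `|X v| * `|X v| <= c * c * (`|v| * `|v|).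
  have -> : c * c * (`|v| * `|v|) = (c * `|v|) * (c * `|v|) by ring.
  by rewrite ler_pM.
have h3 := HD _ Xv1.
apply: (@le_trans _ _ (n.+1%:R * (`|r| + 1) * (D * (c * c * (`|v| * `|v|))))).
  rewrite ler_pM ?mulr_ge0 //; first by rewrite ler_wpM2l.
  by rewrite (le_trans h3) // ler_pM2l.
have -> : n.+1%:R * (`|r| + 1) * (D * (c * c * (`|v| * `|v|))) =
  (n.+1%:R * (`|r| + 1) * (D * (c * c))) * (`|v| * `|v|) by ring.
by rewrite ler_wpM2r ?mulr_ge0 // /C addrAC lerDr addr_ge0 // ltW.
Qed.

Lemma flow_lipschitz (r : R) : exists2 C : R, 0 < C & forall u v x y,
  `|u| <= r -> `|v| <= r -> `|x| <= r -> `|y| <= r ->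
  `|flow X u x - flow X v y| <= C * (`|u - v| + `|x - y|).
Proof.
have [c c0 Xb] := family_bound; have [XD _ _ _] := XA.
pose K : R := n.+1%:R; have K0 : 0 < K by rewrite ltr0n.
pose e := expR (K * (c * r)).
pose C := K * (`|r| + 1) * (K * e * e * c) + K * e + 1.
have Ci : 0 <= K * (`|r| + 1) * (K * e * e * c).
  by rewrite !mulr_ge0 ?expR_ge0 ?addr_ge0 // ltW.
have Ce : 0 <= K * e by rewrite mulr_ge0 ?expR_ge0 // ltW.
exists C; first by rewrite /C ltr_wpDl // addr_ge0.
move=> u v x y ur vr xr yr.
have Xr w : `|w| <= r -> `|X w| <= c * r by move=> wr; rewrite (le_trans (Xb w)) // ler_pM2l.
have -> : flow X u x - flow X v y = rsub (hom x *m (mexp (X u) - mexp (X v))) + rsub ((hom x - hom y) *m mexp (X v)).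
  by rewrite -rsubD mulmxBr mulmxBl addrA subrK rsubB.
apply: (le_trans (ler_normD _ _)).
have h1 : `|rsub (hom x *m (mexp (X u) - mexp (X v)))| <= K * (`|r| + 1) * (K * e * e * c) * `|u - v|.
  apply: (le_trans (rsub_norm _)); apply: (le_trans (mulmx_norm_le _ _)).
  rewrite -[leRHS]mulrA ler_pM ?mulr_ge0 //.
    by rewrite ler_wpM2l // (le_trans (hom_norm _)) // lerD2r (le_trans xr) // ler_norm.
  apply: (le_trans (mexp_lipschitz (Xr _ ur) (Xr _ vr))).
  rewrite -[leRHS]mulrA ler_wpM2l ?mulr_ge0 ?expR_ge0 //.
  by rewrite -familyN -XD.
have h2 : `|rsub ((hom x - hom y) *m mexp (X v))| <= K * e * `|x - y|.
  apply: (le_trans (rsub_norm _)); apply: (le_trans (mulmx_norm_le _ _)).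
  rewrite mulrAC -mulrA -[leRHS]mulrA ler_wpM2l //; apply: ler_pM => //.
    apply: (@ultra_cvg_norm_le R nat_ultra _ _ _ (powN (X v))); first exact: mexp_cvg.
    apply: filterE => N; apply: (le_trans (powN_bound _ _)).
    by rewrite ler_expR ler_wpM2l ?(ltW K0) // Xr.
  apply: mx_norm_le => // i j; rewrite !mxE; case: unliftP => [j' _|_]; last by rewrite subrr normr0.
  by have := mx_entry_le (x - y) ord0 j'; rewrite !mxE.
apply: (le_trans (lerD h1 h2)); rewrite /C !mulrDl !mulrDr mul1r.
have := normr_ge0 (u - v); have := normr_ge0 (x - y).
have : 0 <= K * (`|r| + 1) * (K * e * e * c) * `|x - y| by rewrite mulr_ge0.
have : 0 <= K * e * `|u - v| by rewrite mulr_ge0.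
lra.
Qed.

End Flow.

(** * The free flow on the universal cover generated by Aff(M)_0 *)

Section GroupFlow.
Context {R : realType} {n m : nat} {M : topologicalType}.
Notation V := 'rV[R]_n.
Variables (G : set (V -> V)) (p : V -> M).
Hypothesis G_homeo : homeomorphism_group G.
Hypothesis G_fpd : free_properly_discontinuous G.
Hypothesis Gp : orbit_map G p.
Hypothesis M_hausdorff : hausdorff_space M.
Hypothesis M_compact : compact [set: M].

Lemma invariant_affine_full (C : set V) (v0 : V) :
  (forall x y (t : R), C x -> C y -> 0 <= t <= 1 -> C (x + t *: (y - x))) ->
  (forall g x, G g -> C x -> C (g x)) -> C v0 -> forall z, C z.
Proof.
move=> C_convex C_inv C0.
have cb r : compact [set x : V | `|x| <= r] by exact: compact_norm_le.
have [r0 r0_gt0 coc] := act_cocompact G_homeo Gp M_compact.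
apply: (@invariant_convex_full R n G fun_inv r0 _ _ _ _ _ C v0) => //.
- by move=> g /(act_cont G_homeo).
- by move=> g h; exact: act_comp.
- by move=> g; exact: act_inv.
- by move=> r; apply: (act_proper cb G_homeo G_fpd Gp M_hausdorff).
- by move=> x; have [g Gg gx] := coc x; exists g => //; exact: ltW.
move=> x y t Cx Cy t01; have -> : (1 - t) *: x + t *: y = x + t *: (y - x).
  by apply/rowP => j; rewrite !mxE; ring.
exact: C_convex.
Qed.

Definition affine_matrix (f : V -> V) : 'M[R]_n.+1 :=
  \matrix_(i, j) if unlift ord0 i is Some i' then (hom (f (delta_mx 0 i')) - hom (f 0)) ord0 j
                 else hom (f 0) ord0 j.

Lemma affine_matrixE f x : is_affine f -> hom x *m affine_matrix f = hom (f x).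
Proof.
move=> fa; apply/rowP => j; rewrite mxE big_ord_recl hom0E mul1r mxE unlift_none.
rewrite [in RHS]fa.
under eq_bigr do rewrite !mxE !liftK.
rewrite !mxE; case Ej: (unlift ord0 j) => [j'|].
  by rewrite !mxE summxE; congr (_ + _); apply: eq_bigr => i _; rewrite !mxE ?Ej ?mxE.
by rewrite big1 ?addr0 // => i _; rewrite !mxE ?Ej subrr mulr0.
Qed.

(** The last clause is all that is retained of the group: its orbits in [M] are the images of the
    orbits of a flow upstairs. *)
Definition generates_flow (H : set {compact-open, M -> M}) (X : 'rV[R]_m -> 'M[R]_n.+1) : Prop :=
  [/\ affine_family X,
      forall v g x, G g -> flow X v (g x) = g (flow X v x),
      forall v x, flow X v x = x -> v = 0
    & forall x y, (exists2 f, H f & f (p x) = p y) <-> exists v, p y = p (flow X v x)].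

Section FlowOfLocalAffine.
Variables (r : R) (e : 'rV[R]_m -> {compact-open, M -> M}) (E P : 'rV[R]_m -> 'rV[R]_m -> 'rV[R]_m)
    (F : 'rV[R]_m -> V -> V).
Hypothesis H_group : is_group (Aff0 p) compose_co id fun_inv.
Hypothesis LA : local_affine G p (Aff0 p) r e E P F.

Let Z a := affine_matrix (F a).
Let r_gt0 : 0 < r := la_pos LA.

Let ZE a x : `|a| < r -> hom x *m Z a = hom (F a x).
Proof. by move=> ar; apply: affine_matrixE; exact: (la_aff LA ar). Qed.

Let Z0 : Z 0 = 1.
Proof. by apply: hom_mul_inj => x; rewrite ZE ?normr0 // (la_one LA) mulmx1. Qed.

(** Rows are multiplied on the right, so a composition becomes the reversed product; the commutation
    of the lifts restores the order. *)
Let ZP a b : `|a| < r -> `|b| < r -> `|P a b| < r -> Z (P a b) = Z a * Z b.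
Proof.
move=> ar br Pr; apply: hom_mul_inj => x.
by rewrite ZE // (la_P LA) // (la_commute LA) // [_ * _]/(_ *m _) mulmxA !ZE.
Qed.

Let ZEE a b : `|a| < r -> `|b| < r -> `|E a b| < r -> Z a = Z (E a b) * Z b.
Proof.
move=> ar br Er; apply: hom_mul_inj => x.
by rewrite ZE // (la_E LA ar br Er) (la_commute LA) // [_ * _]/(_ *m _) mulmxA !ZE.
Qed.

Let ZC a b : `|a| < r -> `|b| < r -> Z a * Z b = Z b * Z a.
Proof.
move=> ar br; apply: hom_mul_inj => x.
rewrite ![_ * _]/(_ *m _) !mulmxA !ZE //; congr hom.
by have /(congr1 (fun f => f x)) /= := la_commute LA ar br.
Qed.

Let Z_inj a b : `|a| < r -> `|b| < r -> Z a = Z b -> a = b.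
Proof.
move=> ar br ab; apply: (la_inj LA) => //; apply/funext => x.
by rewrite -[LHS]homK -[RHS]homK -!ZE // ab.
Qed.

Let Z_cvg (a : 'rV[R]_m) : `|a| < r -> Z @ a --> Z a.
Proof.
move=> ar; have FF := @nbhs_filter 'rV[R]_m a.
have hc x j : (fun b => hom (F b x) ord0 j) @ a --> hom (F a x) ord0 j.
  rewrite mxE; have -> : (fun b => hom (F b x) ord0 j) =
      (fun b => if unlift ord0 j is Some i then F b x ord0 i else 1).
    by apply/funext => b; rewrite mxE.
  case: unliftP => [i _|_]; last exact: cvg_cst.
  by apply: cvg_entry; exact: (la_cvg LA).
apply: cvg_mx => i j; rewrite mxE.
have -> : (fun x => Z x i j) = (fun b => if unlift ord0 i is Some i' then
    hom (F b (delta_mx 0 i')) ord0 j - hom (F b 0) ord0 j else hom (F b 0) ord0 j).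
  by apply/funext => b; rewrite mxE; case: unliftP => // i' _; rewrite !mxE.
case: unliftP => [i' _|_]; last exact: hc.
by rewrite [X in _ --> X]mxE [X in _ + X]mxE; apply: cvgB; exact: hc.
Qed.

Let LG : local_mx_group r E P Z. Proof. by split => //; exact: la_est LA. Qed.

Let X := generator Z.

Let XA : affine_family X.
Proof.
split.
- exact: generatorD LG.
- exact: generatorZ LG.
- exact: generator_commute LG.
move=> u i.
have c := @generator_cvg _ _ _ _ _ _ _ LG u.
have c' : (fun N => difference_quotient Z u N i ord0) @ nat_ultra --> X u i ord0 by apply: cvg_entry.
apply: (@cvg_unique R^o (@norm_hausdorff _ _) _ _ _ _ c').
have -> : (fun N => difference_quotient Z u N i ord0) = fun=> 0; last exact: cvg_cst.
apply/funext => N; case: (unliftP ord0 i) => [i' ->|->]; rewrite !mxE ?liftK ?unlift_none ?mxE ?unlift_none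
  ?eqxx ?lift_eqF ?subrr ?subr0 ?mulr0 //.
Qed.

Let iter_hom v q x : `|v| < r -> hom x *m (Z v ^+ q) = hom (iter q (F v) x).
Proof.
move=> vr; elim: q => [|q IH]; first by rewrite expr0 mulmx1.
by rewrite exprSr [_ * _]/(_ *m _) mulmxA IH ZE.
Qed.

(** Each lift commutes with [G], whose elements are only homeomorphisms; writing the flow as a limit
    of iterated lifts passes this on to it. *)
Let flow_lim v x : (fun N => iter N.+1 (F ((N.+1%:R)^-1 *: v)) x) @ nat_ultra --> flow X v x.
Proof.
have c := @mexp_generator_cvg _ _ _ _ _ _ _ LG v.
have c1 : (fun N => rsub (hom x *m Z ((N.+1%:R)^-1 *: v) ^+ N.+1)) @ nat_ultra --> flow X v x.
  have c2 : (fun N => hom x *m Z ((N.+1%:R)^-1 *: v) ^+ N.+1) @ nat_ultra --> hom x *m mexp (X v).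
    by apply: cvg_mulmx => //; exact: cvg_cst.
  apply: ultra_dist => eps eps0; apply: filterS (ultra_dist_inv c2 eps0) => N.
  by apply: le_trans; rewrite /flow -rsubB rsub_norm.
apply: cvg_trans c1; apply: near_eq_cvg.
have d0 : 0 < r / (`|v| + 1) by rewrite divr_gt0 // ltr_wpDl.
apply: filterS (nat_ultra_inv_le d0) => N hN.
rewrite iter_hom ?homK // normrZ gtr0_norm ?invr_gt0 //.
apply: (@le_lt_trans _ _ (r / (`|v| + 1) * `|v|)); first by rewrite ler_wpM2r.
by rewrite -mulrA gtr_pMr // mulrC ltr_pdivrMr ?ltr_wpDl // mul1r ltrDl.
Qed.

Let flow_comm v g x : G g -> flow X v (g x) = g (flow X v x).
Proof.
move=> Gg; have H1 := @flow_lim v (g x); apply: (@ultra_cvg_unique R 1 n _ _ _ H1).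
have gc : g @ flow X v x --> g (flow X v x) by exact: (act_cont G_homeo Gg).
have c := cvg_comp _ _ (@flow_lim v x) gc.
apply: cvg_trans c; apply: near_eq_cvg.
have d0 : 0 < r / (`|v| + 1) by rewrite divr_gt0 // ltr_wpDl.
apply: filterS (nat_ultra_inv_le d0) => N hN /=.
have Nr : `|N.+1%:R^-1 *: v| < r.
  rewrite normrZ gtr0_norm ?invr_gt0 //.
  apply: (@le_lt_trans _ _ (r / (`|v| + 1) * `|v|)); first by rewrite ler_wpM2r.
  by rewrite -mulrA gtr_pMr // mulrC ltr_pdivrMr ?ltr_wpDl // mul1r ltrDl.
have H q : g (iter q (F (N.+1%:R^-1 *: v)) x) = iter q (F (N.+1%:R^-1 *: v)) (g x).
  elim: q => [|q IH] //; by rewrite !iterS -IH (la_comm LA _ Nr Gg).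
by rewrite -iterS H.
Qed.

(* An affine map commuting with [G] and fixing a point is the identity, so an
   involution [flow X (v / 2)] is the identity, since it fixes midpoints. *)
Let flow_free v x : flow X v x = x -> v = 0.
Proof.
have full w y : flow X w y = y -> forall z, flow X w z = z.
  move=> wy; apply: (invariant_affine_full (C := [set z | flow X w z = z]) _ _ wy).
  - by move=> a b t /= ha hb _; rewrite /= flow_comb ha hb.
  - by move=> g a Gg /= ha; rewrite flow_comm // ha.
move=> vx; have half k : forall z, flow X ((2^-1 ^+ k) *: v) z = z.
  elim: k => [|k IH]; first by rewrite expr0 scale1r; exact: full vx.
  set w := 2^-1 ^+ k.+1 *: v.
  have ww : w + w = 2^-1 ^+ k *: v.
    by rewrite /w -scalerDl exprS; congr (_ *: _); lra.
  have wwz z : flow X w (flow X w z) = z by rewrite -(flowD XA) ww IH.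
  apply: (full w (x + 2^-1 *: (flow X w x - x))); rewrite flow_comb wwz.
  by apply/rowP => j; rewrite !mxE; lra.
(* A small dyadic multiple [w] of [v] acts as the identity, while its exponential is [Z w'] with
   [w'] within [|w| / 2] of [w]; injectivity of [Z] gives [w' = 0], hence [w = 0]. *)
have [rho rho0 Hrho] := @mexp_generator_near _ _ _ _ _ _ _ LG 2^-1 (ltac:(lra)).
have [k hk] : exists k : nat, `|2^-1 ^+ k *: v| < Num.min rho (r / 2).
  have c : (fun k => (2^-1 : R) ^+ k * `|v|) @ \oo --> 0.
    rewrite -[X in _ --> X](mul0r `|v|); apply: cvgM; last exact: cvg_cst.
    by apply: cvg_expr; rewrite ger0_norm ?invr_ge0 // invf_lt1 // ltr1n.
  have m0 : 0 < Num.min rho (r / 2) by rewrite lt_min rho0 divr_gt0.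
  move/cvgrPdist_lt: c => /(_ _ m0) [k _ /(_ k (leqnn k)) hk]; exists k.
  by move: hk; rewrite sub0r normrN normrM normr_id -normrZ.
move: hk; set w := _ *: v; rewrite lt_min => /andP[wrho wr].
have [w' ww' mw] := Hrho w wrho.
have w'r : `|w'| < r.
  rewrite -(subrK w w') (le_lt_trans (ler_normD _ _)) //; move: ww'; have := normr_ge0 w; lra.
have Z1 : Z w' = Z 0.
  rewrite Z0; apply: hom_mul_inj => z; rewrite -mw mulmx1 -(flow_hom XA).
  by rewrite half.
have w'0 : w' = 0 by apply: Z_inj; rewrite ?normr0.
move: ww'; rewrite w'0 sub0r normrN => ww'.
have : `|w| <= 0 by have := normr_ge0 w; lra.
rewrite normr_le0 scaler_eq0 expf_eq0 invr_eq0 pnatr_eq0 /= andbF /= => /eqP -> //.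
Qed.

Let local_flow : exists2 rho, 0 < rho & forall v, `|v| < rho ->
  exists2 f, Aff0 p f & forall x, f (p x) = p (flow X v x).
Proof.
have [rho rho0 Hrho] := @mexp_generator_near _ _ _ _ _ _ _ LG 1 (ltac:(lra)).
exists (Num.min rho (r / 2)); first by rewrite lt_min rho0 divr_gt0.
move=> v; rewrite lt_min => /andP[vrho vr].
have [w wv mw] := Hrho v vrho.
have wr : `|w| < r.
  by rewrite -(subrK v w) (le_lt_trans (ler_normD _ _)) //; lra.
exists (e w); first exact: (la_in LA).
move=> x; rewrite /flow -/X mw ZE // homK; exact/esym/(la_lift LA).
Qed.

Let global_flow v : exists2 f, Aff0 p f & forall x, f (p x) = p (flow X v x).
Proof.
have [H1 HM _ _] := H_group.
have [rho rho0 Hrho] := local_flow.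
have [N hN] : exists N : nat, `|N.+1%:R^-1 *: v| < rho.
  have d0 : 0 < rho / (`|v| + 1) by rewrite divr_gt0 // ltr_wpDl.
  have [N hN] := filter_ex (nat_ultra_inv_le d0); exists N.
  rewrite normrZ gtr0_norm ?invr_gt0 //.
  apply: (@le_lt_trans _ _ (rho / (`|v| + 1) * `|v|)); first by rewrite ler_wpM2r.
  by rewrite -mulrA gtr_pMr // mulrC ltr_pdivrMr ?ltr_wpDl // mul1r ltrDl.
have [f Hf fE] := Hrho _ hN.
have K q : exists2 f, Aff0 p f & forall x, f (p x) = p (flow X (q%:R *: (N.+1%:R^-1 *: v)) x).
  elim: q => [|q [f' Hf' f'E]]; first by exists (id : {compact-open, M -> M}); [exact: H1|move=> x; rewrite scale0r (flow0 XA)].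
  exists (compose_co f f'); first exact: HM.
  by move=> x; rewrite /compose_co f'E fE -(flowD XA) -[in X in X + _](scale1r (_ *: v)) -scalerDl addrC natr1.
have [f' Hf' f'E] := K N.+1; exists f'; first exact: Hf'.
move=> x; rewrite f'E scalerA mulfV ?scale1r //; exact: lt0r_neq0.
Qed.

(** With [h] the inverse of [f0], this carries a neighbourhood of the identity to one of [f0]. *)
Let compose_near (f0 : {compact-open, M -> M}) (h : M -> M) (A : set {compact-open, M -> M}) :
  continuous h -> nbhs (compose_co f0 h : {compact-open, M -> M}) A ->
  \forall f \near f0, A (compose_co f h).
Proof.
move=> hc; have FF := nbhs_filter f0.
have F2 : Filter ((fun f : {compact-open, M -> M} => compose_co f h) @ f0) by exact: fmap_filter.
move: A; apply/compact_open_cvgP => K O Kc Oo KO.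
have Kh : compact (h @` K) by apply: continuous_compact => //; exact: continuous_subspaceT.
have /compact_open_cvgP H : (id : {compact-open, M -> M} -> {compact-open, M -> M}) @ f0 --> f0 by exact: cvg_id.
have KO' : [set f0 x | x in h @` K] `<=` O by move=> _ [_ [x Kx <-] <-]; apply: KO; exists x.
have := H _ _ Kh Oo KO'; apply: (@filterS _ (nbhs f0) FF) => f fK y [x Kx <-].
by apply: fK; exists (h x) => //; exists x.
Qed.

(** Elements close to the identity come from the flow. By translation, an element and its neighbours
    in Aff(M)_0 come from the flow together or not at all, so those that do form an open and closed
    subset of a connected set. *)
Let all_flow f : Aff0 p f -> exists v, forall x, f (p x) = p (flow X v x).
Proof.
move=> Hf; have [H1 HM HV HA] := H_group.
have [psurj _ _] := Gp.
pose S := [set f : {compact-open, M -> M} | Aff0 p f /\ exists v, forall x, f (p x) = p (flow X v x)].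
have nearS : \forall f \near (id : {compact-open, M -> M}), Aff0 p f -> S f.
  have [rho rho0 Hrho] := @mexp_generator_onto _ _ _ _ _ _ _ LG.
  have rr : 0 < Num.min rho r by rewrite lt_min rho0.
  apply: filterS (la_near LA rr) => f' fH Hf'; split=> //.
  have [a + fe] := fH Hf'; rewrite lt_min => /andP[arho ar].
  have [v Zv] := Hrho a arho; exists v => x; rewrite fe /flow -/X -Zv ZE // homK.
  exact/esym/(la_lift LA).
have Hcont f' : Aff0 p f' -> continuous (f' : M -> M).
  by move=> /(@connected_component_sub _ _ _ _) [[]].
have near f0 : Aff0 p f0 -> \forall f \near (f0 : {compact-open, M -> M}),
    Aff0 p f -> S (compose_co f (fun_inv f0)).
  move=> H0; have E0 : compose_co f0 (fun_inv f0) = id by have [] := HA f0 f0 f0 H0 H0 H0.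
  have := @compose_near f0 (fun_inv f0) (fun f => Aff0 p f -> S f) (Hcont _ (HV _ H0)).
  rewrite E0 => /(_ nearS); apply: filterS => f' H' Hf'; apply: H'.
  by apply: HM => //; exact: HV.
have invK f0 x : Aff0 p f0 -> fun_inv f0 (f0 x) = x.
  move=> H0; have [_ _ _ + _] := HA f0 f0 f0 H0 H0 H0.
  by move=> /(congr1 (fun f => f x)).
have open_step f0 f1 : Aff0 p f0 -> Aff0 p f1 -> S (compose_co f1 (fun_inv f0)) -> (S f0 <-> S f1).
  move=> H0 H1' [_ [w wE]].
  have f1E x : f1 (p x) = p (flow X w (let: exist y _ := cid (psurj (f0 (p x))) in y)).
    by case: cid => y hy; rewrite -wE hy /compose_co invK.
  split=> [[_ [v vE]]|[_ [v vE]]]; split=> //.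
    exists (w + v) => x; rewrite (flowD XA) -wE -vE /compose_co invK //.
  exists (- w + v) => x; have [y hy] := psurj (f0 (p x)).
  have : f1 (p x) = p (flow X w y) by rewrite -wE hy /compose_co invK.
  rewrite vE -hy => /(proj_eq Gp)[g Gg gE].
  transitivity (p (g (flow X (- w + v) x))); last exact: (proj_act Gp).
  by rewrite (flowD XA) -flow_comm // gE (flowK XA).
have SH : S = Aff0 p.
  apply: (@component_connected _ (Aff p) (id : {compact-open, M -> M}) S).
  - by exists id; split => //; exists 0 => x; rewrite (flow0 XA).
  - exists (interior (~` Aff0 p `|` S)); first exact: open_interior.
    apply/seteqP; split => f0 /=.
      move=> [H0 S0]; split => //; apply: filterS (near _ H0) => f1 h1.
      have [H1'|nH] := pselect (Aff0 p f1); [right|by left].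
      by have [h2 _] := open_step f0 f1 H0 H1' (h1 H1'); apply: h2; split.
    by move=> [H0 /interior_subset[]].
  - exists (~` interior (~` Aff0 p `|` ~` S)); first exact/open_closedC/open_interior.
    apply/seteqP; split => f0 /=.
      by move=> Sf0; have [H0 _] := Sf0; split => // /interior_subset[/(_ H0)|/(_ Sf0)].
    move=> [H0 nI]; apply: contrapT => nS; apply: nI.
    apply: filterS (near _ H0) => f1 h1.
    have [H1'|nH] := pselect (Aff0 p f1); [right|by left].
    by move=> S1; apply: nS; have [_ h2] := open_step f0 f1 H0 H1' (h1 H1'); exact: h2.
by move: Hf; rewrite -SH => -[].
Qed.

Theorem flow_of_local_affine : exists X, generates_flow (Aff0 p) X.
Proof.
exists X; split; [exact: XA|exact: flow_comm|exact: flow_free|move=> x y; split].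
  by move=> [f /all_flow[v vE] <-]; exists v.
by move=> [v ->]; have [f Hf fE] := global_flow v; exists f.
Qed.

End FlowOfLocalAffine.

End GroupFlow.

(** * A global slice of a free affine action in codimension one *)

Lemma linear_unit {R : realType} {n : nat} (g : 'rV[R]_n -> 'rV[R]_n) :
  (forall u v, g (u + v) = g u + g v) -> (forall (s : R) u, g (s *: u) = s *: g u) ->
  (forall u, g u = 0 -> u = 0) -> exists2 D, D \in unitmx & forall u, g u = u *m D.
Proof.
move=> gD gZ g0; pose D : 'M[R]_n := \matrix_i g (delta_mx 0 i).
have gE u : g u = u *m D.
  have g00 : g 0 = 0 by have := gZ 0 0; rewrite !scale0r.
  rewrite {1}(row_sum_delta u) (big_morph g (fun u v => gD u v) g00) mulmx_sum_row.
  by apply: eq_bigr => i _; rewrite gZ rowK.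
exists D => //; rewrite -row_free_unit -kermx_eq0; apply/rowV0P => v /sub_kermxP vD.
by apply: g0; rewrite gE.
Qed.

(** The surjective half of the inverse function theorem, from differentiability at a single point:
    [f] followed by the inverse derivative is close to the identity, and Poincaré-Miranda
    applies. *)
Lemma local_onto {R : realType} {n : nat} (f : 'rV[R]_n -> 'rV[R]_n) (D : 'M[R]_n) :
  continuous f -> D \in unitmx ->
  (forall eps : R, 0 < eps -> exists2 rho : R, 0 < rho & forall z : 'rV[R]_n, `|z| < rho ->
     `|f z - f 0 - z *m D| <= eps * `|z|) ->
  forall eps : R, 0 < eps -> exists2 delta : R, 0 < delta & forall y, `|y - f 0| < delta ->
    exists2 z : 'rV[R]_n, `|z| <= eps & f z = y.
Proof.
move=> fc Du fD eps eps0; pose D' := invmx D.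
pose L := n%:R * (`|D'| + 1) + 1.
have L0 : 0 < L by rewrite /L ltr_wpDl // mulr_ge0 // addr_ge0.
have Lb (y : 'rV[R]_n) : `|y *m D'| <= L * `|y|.
  apply: (le_trans (mulmx_norm_le _ _)); rewrite mulrAC ler_wpM2r // /L.
  by rewrite -[leLHS]addr0 lerD // ler_wpM2l // lerDl.
have eL : 0 < (4 * L)^-1 by rewrite invr_gt0 mulr_gt0.
have [rho rho0 Hrho] := fD _ eL.
pose r := Num.min eps (rho / 2).
have r0 : 0 < r by rewrite lt_min eps0 divr_gt0.
have r1 : r < rho by rewrite gt_min; apply/orP; right; lra.
have re : r <= eps by rewrite ge_min lexx.
exists (r / (4 * L)); first by rewrite divr_gt0 // mulr_gt0.
move=> y yd; pose h z := (f z - y) *m D'.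
have hE z i : `|z| <= r -> `|h z ord0 i - z ord0 i| <= r / 2.
  move=> zr; have -> : h z ord0 i - z ord0 i = ((f z - f 0 - z *m D - (y - f 0)) *m D') ord0 i.
    have -> : f z - f 0 - z *m D - (y - f 0) = (f z - y) - z *m D.
      by apply/rowP => j; rewrite !mxE; ring.
    by rewrite mulmxBl mulmxK // /h !mxE.
  apply: (le_trans (mx_entry_le _ _ _)); apply: (le_trans (Lb _)).
  have h1 := Hrho z (le_lt_trans zr r1).
  have : `|f z - f 0 - z *m D - (y - f 0)| <= (4 * L)^-1 * r + r / (4 * L).
    apply: (le_trans (ler_normB _ _)); apply: lerD; last exact: ltW.
    by rewrite (le_trans h1) // ler_wpM2l // ltW.
  move=> /(ler_wpM2l (ltW L0)) /le_trans; apply.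
  by rewrite le_eqVlt; apply/orP; left; apply/eqP; field; rewrite gt_eqF.
have [|||z zr hz] := @poincare_miranda R n h r r0.
- move=> z; have FF := @nbhs_filter 'rV[R]_n z.
  apply: cvg_mulmx; last exact: cvg_cst.
  by apply: cvgB; [exact: (fc z)|exact: cvg_cst].
- by move=> z i zr zi; have := hE z i zr; rewrite ler_norml zi => /andP[_]; lra.
- by move=> z i zr zi; have := hE z i zr; rewrite ler_norml zi => /andP[+ _]; lra.
exists z; first exact: le_trans re.
have := congr1 (fun w => w *m D) hz; rewrite /h mulmxKV // mul0mx => /eqP.
by rewrite subr_eq0 => /eqP.
Qed.

(** On a segment from [x] the supremum of the times related to [x] is attained, and it can be
    exceeded unless it is 1. *)
Lemma convex_single_class {R : realType} {n : nat} (S : set 'rV[R]_n) (rel : 'rV[R]_n -> 'rV[R]_n -> Prop) :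
  (forall x y (t : R), S x -> S y -> 0 <= t <= 1 -> S (x + t *: (y - x))) ->
  (forall x y, rel x y -> rel y x) -> (forall x y z, rel x y -> rel y z -> rel x z) ->
  (forall x, S x -> exists2 d : R, 0 < d & forall y, S y -> `|y - x| < d -> rel x y) ->
  forall x y, S x -> S y -> rel x y.
Proof.
move=> Sc rs rt loc x y Sx Sy.
pose q (t : R) := x + t *: (y - x).
pose A := [set t : R | t \in `[0, 1] /\ rel x (q t)].
have q0 : q 0 = x by rewrite /q scale0r addr0.
have q1 : q 1 = y by rewrite /q scale1r addrC subrK.
have xx : rel x x by have [d d0 Hd] := loc x Sx; apply: Hd; rewrite ?subrr ?normr0.
have near t : 0 <= t <= 1 -> exists2 d : R, 0 < d & forall s, 0 <= s <= 1 -> `|s - t| < d -> rel (q t) (q s).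
  move=> t01; have [d d0 Hd] := loc (q t) (Sc _ _ _ Sx Sy t01).
  exists (d / (`|y - x| + 1)); first by rewrite divr_gt0 // ltr_wpDl.
  move=> s s01 st; apply: Hd; first exact: Sc.
  have -> : q s - q t = (s - t) *: (y - x) by apply/rowP => j; rewrite !mxE; ring.
  rewrite normrZ; apply: (@le_lt_trans _ _ (`|s - t| * (`|y - x| + 1))).
    by rewrite ler_wpM2l // lerDl.
  by rewrite -ltr_pdivlMr // ltr_wpDl.
have : has_sup A.
  by split; [exists 0; rewrite /A /= q0 in_itv /= lexx ler01|exists 1 => t [/=]; rewrite in_itv /= => /andP[]].
move=> supA; have [A0 [b Ab]] := supA; pose c := sup A.
have c0 : 0 <= c by apply: sup_upper_bound => //; rewrite /A /= q0 in_itv /= lexx ler01.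
have c1 : c <= 1.
  apply: sup_le_ub => // t [/=]; rewrite in_itv /= => /andP[] //.
have [d d0 Hd] := near c (ltac:(by rewrite c0)).
have xc : rel x (q c).
  have [t [t01 xt] tc] := sup_adherent d0 supA.
  have t01' : 0 <= t <= 1 by move: t01; rewrite in_itv.
  have tc' : t <= c by apply: sup_upper_bound.
  apply: rt xt _; apply: rs; apply: Hd => //.
  by rewrite ler0_norm ?subr_le0 // opprB; move: tc; rewrite -/c; lra.
have [c1'|] := ltP c 1; last first.
  by move=> h; have ce : c = 1 by [apply/eqP; rewrite eq_le c1]; move: xc; rewrite ce q1.
pose t := Num.min 1 (c + d / 2).
have t1 : t <= 1 by rewrite ge_min lexx.
have td : t <= c + d / 2 by rewrite ge_min lexx orbT.
have ct : c < t by rewrite lt_min c1' /=; lra.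
have : A t.
  rewrite /A /= in_itv /= t1 andbT; split; first lra.
  by apply: rt xc _; apply: Hd; rewrite ?t1 ?andbT ?ger0_norm; lra.
by move=> /(sup_upper_bound supA); rewrite -/c leNgt ct.
Qed.

Section LocalSlice.
Context {R : realType} {n d : nat}.
Variable X : 'rV[R]_d -> 'M[R]_n.+1.
Hypothesis XA : affine_family X.

Lemma flow_continuous (v : 'rV[R]_d) : continuous (flow X v).
Proof.
move=> x; have FF := @nbhs_filter 'rV[R]_n x.
have [C C0 H] := flow_lipschitz XA (Num.max `|v| (`|x| + 1)).
apply/cvgrPdist_le => eps eps0.
have e0 : 0 < Num.min 1 (eps / C) by rewrite lt_min ltr01 divr_gt0.
apply: filterS (near_dist_lt x e0) => y; rewrite lt_min => /andP[xy1 xy].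
have yx : `|y| <= `|x| + 1.
  rewrite -(subrK x y) (le_trans (ler_normD _ _)) // addrC lerD2l distrC ltW //.
apply: (le_trans (H v v x y _ _ _ _)); rewrite ?le_max ?lexx ?lerDl ?ler01 ?yx ?orbT //.
by rewrite subrr normr0 add0r mulrC -ler_pdivlMr // ltW.
Qed.

Lemma flow_continuous_time (x : 'rV[R]_n) : continuous (fun v => flow X v x).
Proof.
move=> v; have FF := @nbhs_filter 'rV[R]_d v.
have [C C0 H] := flow_lipschitz XA (Num.max `|x| (`|v| + 1)).
apply/cvgrPdist_le => eps eps0.
have e0 : 0 < Num.min 1 (eps / C) by rewrite lt_min ltr01 divr_gt0.
apply: filterS (near_dist_lt v e0) => y; rewrite lt_min => /andP[xy1 xy].
have yx : `|y| <= `|v| + 1.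
  rewrite -(subrK v y) (le_trans (ler_normD _ _)) // addrC lerD2l distrC ltW //.
apply: (le_trans (H v y x x _ _ _ _)); rewrite ?le_max ?lexx ?lerDl ?ler01 ?yx ?orbT //.
by rewrite subrr normr0 addr0 mulrC -ler_pdivlMr // ltW.
Qed.

Lemma flow_expansion (x : 'rV[R]_n) (eps : R) : 0 < eps -> exists2 rho : R, 0 < rho &
  forall v : 'rV[R]_d, `|v| < rho -> `|flow X v x - x - field X v x| <= eps * `|v|.
Proof.
move=> eps0; have [C C0 H] := flow_first_order XA `|x|.
exists (Num.min C^-1 (eps / C)); first by rewrite lt_min invr_gt0 C0 divr_gt0.
move=> v; rewrite lt_min => /andP[v1 v2].
apply: (le_trans (H v x (ltW v1) (lexx _))); rewrite mulrA ler_wpM2r //.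
by rewrite mulrC -ler_pdivlMr // ltW.
Qed.

End LocalSlice.

Lemma rank1_multiple {F : fieldType} {n q} (K : 'M[F]_(q, n)) (a b : 'rV[F]_n) :
  (\rank K <= 1)%N -> (a <= K)%MS -> a != 0 -> (b <= K)%MS -> exists k, b = k *: a.
Proof.
move=> K1 aK an0 bK; have Ka : (K <= a)%MS.
  have /leqifP := mxrank_leqif_sup aK; case: ifP => // _.
  by rewrite rank_rV an0 ltnNge K1.
by have /sub_rVP[k ->] := submx_trans bK Ka; exists k.
Qed.

Section GlobalSlice.
Context {R : realType} {m : nat}.
Notation V := 'rV[R]_m.+1.
Variable X : 'rV[R]_m -> 'M[R]_m.+2.
Hypothesis XA : affine_family X.
Hypothesis X_free : forall v x, flow X v x = x -> v = 0.

(** The curve [c] meets each orbit once; [L] and [S] are the time and height coordinates of the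
    resulting homeomorphism of the space with R^m × R. *)
Definition global_slice : Prop := exists (c : R -> V) (L : V -> 'rV[R]_m) (S : V -> R),
  [/\ continuous c, continuous L, continuous S,
      forall v s, L (flow X v (c s)) = v /\ S (flow X v (c s)) = s
    & forall x, flow X (L x) (c (S x)) = x].

Lemma field_zero_free u x : field X u x = 0 -> u = 0.
Proof. by move=> /(flow_zero XA)/X_free. Qed.

(** Local surjectivity with small parameters at the points of the curve is continuity of the inverse
    there, and the flow carries it to every other point. *)
Lemma slice_from_local (c : R -> V) : continuous c ->
  (forall v s v' s', flow X v (c s) = flow X v' (c s') -> v = v' /\ s = s') ->
  (forall x, exists v s, flow X v (c s) = x) ->
  (forall s (eps : R), 0 < eps -> exists2 delta : R, 0 < delta & forall y : V, `|y - c s| < delta ->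
     exists v t, [/\ `|v| <= eps, `|t| <= eps & flow X v (c (s + t)) = y]) ->
  global_slice.
Proof.
move=> cc inj onto loc.
have H (x : V) : exists vs : 'rV[R]_m * R, flow X vs.1 (c vs.2) = x.
  by have [v [s vs]] := onto x; exists (v, s).
have [Z ZP] := choice H.
have near (x : V) (eps : R) : 0 < eps -> \forall y \near x, `|(Z x).1 - (Z y).1| <= eps /\ `|(Z x).2 - (Z y).2| <= eps.
  move=> eps0; have FF := @nbhs_filter V x.
  have [d d0 Hd] := loc (Z x).2 eps eps0.
  move/cvgrPdist_lt: (@flow_continuous R m.+1 m X XA (- (Z x).1) x) => /(_ d d0).
  have Zx : flow X (- (Z x).1) x = c (Z x).2.
    by have := flowK XA (Z x).1 (c (Z x).2); rewrite ZP.
  rewrite Zx; apply: filterS => y; rewrite distrC => /Hd[v [t [v1 t1 vt]]].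
  have yE : flow X ((Z x).1 + v) (c ((Z x).2 + t)) = y by rewrite (flowD XA) vt -(flowD XA) subrr (flow0 XA).
  have [-> ->] := inj _ _ _ _ (etrans (ZP y) (esym yE)).
  have e1 (a b : 'rV[R]_m) : a - (a + b) = - b by rewrite opprD addrA subrr sub0r.
  have e2 (a b : R) : a - (a + b) = - b by rewrite opprD addrA subrr sub0r.
  by rewrite e1 e2; split; rewrite normrN.
exists c, (fun x => (Z x).1), (fun x => (Z x).2); split => //.
- move=> x; have FF := @nbhs_filter V x.
  by apply/cvgrPdist_le => eps eps0; apply: filterS (near x eps eps0) => y [].
- move=> x; have FF := @nbhs_filter V x.
  by apply/cvgrPdist_le => eps eps0; apply: filterS (near x eps eps0) => y [].
by move=> v s; have [] := inj _ _ _ _ (ZP (flow X v (c s))).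
Qed.

Lemma field_bound : exists2 C : R, 0 < C & forall v x, `|field X v x| <= C * `|v| * (`|x| + 1).
Proof.
have [c c0 Xb] := family_bound XA.
exists (m.+2%:R * c); first by rewrite mulr_gt0.
move=> v x; apply: (le_trans (rsub_norm _)); apply: (le_trans (mulmx_norm_le _ _)).
have -> : m.+2%:R * c * `|v| * (`|x| + 1) = m.+2%:R * (`|x| + 1) * (c * `|v|) by ring.
by rewrite ler_pM ?mulr_ge0 // ler_wpM2l // hom_norm.
Qed.

Definition cons_mx (t : R) (v : 'rV[R]_m) : V := \row_j if unlift ord0 j is Some i then v ord0 i else t.

Lemma cons_mx0 t v : cons_mx t v ord0 ord0 = t.
Proof. by rewrite mxE unlift_none. Qed.

Lemma rsub_cons t v : rsub (cons_mx t v) = v.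
Proof. by apply/rowP => j; rewrite !mxE liftK. Qed.

Lemma rsub0_inj (z : V) : z ord0 ord0 = 0 -> rsub z = 0 -> z = 0.
Proof. by move=> z0 z1; apply: rsub_inj; rewrite ?z0 ?z1 ?mxE //; apply/rowP => j; rewrite !mxE. Qed.

(** The slice is a straight line. The last hypothesis is injectivity of the derivative of the
    parametrization along this line; between spaces of equal dimension it gives an invertible
    matrix, and [local_onto] applies. *)
Lemma linear_slice (x0 w : V) :
  (forall v s v' s', flow X v (x0 + s *: w) = flow X v' (x0 + s' *: w) -> v = v' /\ s = s') ->
  (forall x, exists v s, flow X v (x0 + s *: w) = x) ->
  (forall s v t, field X v (x0 + s *: w) + t *: w = 0 -> v = 0 /\ t = 0) ->
  global_slice.
Proof.
move=> inj onto dinj; apply: (@slice_from_local (fun s => x0 + s *: w)) => //.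
  by move=> s; apply: cvgD; [exact: cvg_cst|apply: cvgZl; exact: cvg_id].
move=> s; set xs := x0 + s *: w.
pose g (z : V) := field X (rsub z) xs + z ord0 ord0 *: w.
have [|||D Du gE] := @linear_unit R m.+1 g.
- by move=> u v; rewrite /g rsubD (fieldD XA) mxE scalerDl addrACA.
- by move=> t u; rewrite /g rsubZ (fieldZ XA) mxE scalerDr scalerA.
- by move=> u /dinj[h1 h2]; exact: rsub0_inj.
pose f (z : V) := flow X (rsub z) (x0 + (s + z ord0 ord0) *: w).
have fE z : f z = flow X (rsub z) xs + z ord0 ord0 *: (flow X (rsub z) (xs + w) - flow X (rsub z) xs).
  rewrite /f -(flow_comb X); congr flow.
  by rewrite /xs; apply/rowP => j; rewrite !mxE; ring.
have f0 : f 0 = xs.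
  have r0 : rsub (0 : V) = 0 by apply/rowP => j; rewrite !mxE.
  by rewrite /f r0 (flow0 XA) mxE addr0.
have rsubc : continuous (@rsub R m).
  move=> z; have FF := @nbhs_filter V z.
  apply/cvgrPdist_le => eps eps0; apply: filterS (near_dist_lt z eps0) => y zy.
  by rewrite -rsubB (le_trans (rsub_norm _)) // ltW.
have fc : continuous f.
  move=> z; have FF := @nbhs_filter V z.
  have tc x : (fun z : V => flow X (rsub z) x) @ z --> flow X (rsub z) x.
    have h := @flow_continuous_time _ _ _ X XA x (rsub z).
    exact: (cvg_comp _ _ (rsubc z) h).
  have fE' : f = (fun z : V => flow X (rsub z) xs + z ord0 ord0 *: (flow X (rsub z) (xs + w) - flow X (rsub z) xs)).
    by apply/funext => z'; rewrite fE.
  rewrite fE'; apply: cvgD; first exact: tc.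
  apply: cvgZ; last by apply: cvgB; exact: tc.
  by apply: cvg_entry; exact: cvg_id.
have Df (eps : R) : 0 < eps -> exists2 rho : R, 0 < rho & forall z : V, `|z| < rho ->
     `|f z - f 0 - z *m D| <= eps * `|z|.
  move=> eps0; have e2 : 0 < eps / 4 by rewrite divr_gt0.
  have [rho1 rho10 H1] := flow_expansion XA xs e2.
  have [rho2 rho20 H2] := flow_expansion XA (xs + w) (ltr01 : 0 < 1 :> R).
  have [rho4 rho40 H4] := flow_expansion XA xs (ltr01 : 0 < 1 :> R).
  have [C C0 HC] := field_bound.
  pose B := 2 + C * (`|xs + w| + 1) + C * (`|xs| + 1).
  have B0 : 0 < B by rewrite /B !ltr_wpDr // mulr_ge0 ?addr_ge0 // ltW.
  pose rho := Num.min (Num.min rho1 rho2) (Num.min rho4 (eps / 2 / B)).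
  exists rho; first by rewrite !lt_min rho10 rho20 rho40 !divr_gt0.
  move=> z; rewrite !lt_min => /andP[/andP[z1 z2] /andP[z4 z3]].
  have rz : `|rsub z| <= `|z| by exact: rsub_norm.
  have tz : `|z ord0 ord0| <= `|z| by exact: mx_entry_le.
  set v := rsub z; set t := z ord0 ord0.
  have -> : f z - f 0 - z *m D = (flow X v xs - xs - field X v xs) + t *: (flow X v (xs + w) - flow X v xs - w).
    rewrite f0 -gE fE -/v -/t /g -/v -/t; apply/rowP => j; rewrite !mxE; ring.
  apply: (le_trans (ler_normD _ _)).
  have h1 : `|flow X v xs - xs - field X v xs| <= eps / 4 * `|z|.
    by rewrite (le_trans (H1 v (le_lt_trans rz z1))) // ler_wpM2l // ltW.
  have h2 : `|flow X v (xs + w) - flow X v xs - w| <= B * `|z|.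
    have -> : flow X v (xs + w) - flow X v xs - w =
       (flow X v (xs + w) - (xs + w) - field X v (xs + w)) - (flow X v xs - xs - field X v xs)
       + (field X v (xs + w) - field X v xs).
      by apply/rowP => j; rewrite !mxE; ring.
    apply: (le_trans (ler_normD _ _)).
    have q1 := H2 v (le_lt_trans rz z2); have q2 := H4 v (le_lt_trans rz z4).
    have q3 := HC v (xs + w); have q4 := HC v xs.
    have q5 : C * `|v| * (`|xs + w| + 1) <= C * (`|xs + w| + 1) * `|z|.
      by rewrite mulrAC ler_wpM2l // mulr_ge0 ?addr_ge0 // ltW.
    have q6 : C * `|v| * (`|xs| + 1) <= C * (`|xs| + 1) * `|z|.
      by rewrite mulrAC ler_wpM2l // mulr_ge0 ?addr_ge0 // ltW.
    have q7 := ler_normB (flow X v (xs + w) - (xs + w) - field X v (xs + w)) (flow X v xs - xs - field X v xs).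
    have q8 := ler_normB (field X v (xs + w)) (field X v xs).
    rewrite /B !mulrDl; lra.
  have h3 : `|t *: (flow X v (xs + w) - flow X v xs - w)| <= eps / 2 * `|z|.
    rewrite normrZ; apply: (@le_trans _ _ (`|z| * (B * `|z|))); first by rewrite ler_pM.
    have : `|z| * (B * `|z|) <= `|z| * (eps / 2).
      by rewrite ler_wpM2l // -ler_pdivlMl // mulrC ltW.
    by rewrite [`|z| * (eps / 2)]mulrC.
  have : 0 <= eps * `|z| by rewrite mulr_ge0 // ltW.
  lra.
move=> eps eps0; have [d d0 Hd] := local_onto fc Du Df eps0.
exists d => // y; rewrite -f0 => /Hd[z zeps fz].
exists (rsub z), (z ord0 ord0); split.
- exact: le_trans (rsub_norm _) zeps.
- exact: le_trans (mx_entry_le _ _ _) zeps.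
exact: fz.
Qed.

Lemma rsub_row_shift (y : 'rV[R]_m.+2) : y ord0 ord0 = 0 -> forall x : V, hom (x + rsub y) = hom x + y.
Proof.
move=> y0 x; apply/rowP => j; rewrite !mxE; case: (unliftP ord0 j) => [i ->|->]; rewrite ?mxE //.
by rewrite y0 addr0.
Qed.

Section Eigenform.
Variables (al : 'cV[R]_m.+2) (k : 'rV[R]_m -> R).
Hypothesis al_eigen : forall u, X u *m al = k u *: al.
(** An affine function that the flow multiplies by scalars, as [al] is a common eigenvector of the
    family. *)
Let alpha (x : V) : R := (hom x *m al) ord0 ord0.

Let mexp_eigen u : exists e : R, mexp (X u) *m al = e *: al.
Proof.
have powal N : exists e : R, powN (X u) N *m al = e *: al.
  rewrite /powN; move: (N.+1%:R^-1) => s; elim: N.+1 => [|q [e IH]].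
    by exists 1; rewrite expr0 mul1mx scale1r.
  exists ((1 + s * k u) * e); rewrite exprSr [_ * _]/(_ *m _) -mulmxA mulmxDl mul1mx -scalemxAl al_eigen.
  by rewrite scalerA -{1}(scale1r al) -scalerDl -scalemxAr IH scalerA.
have [al0|aln0] := eqVneq al 0; first by exists 0; rewrite al0 mulmx0 scaler0.
have [i ai] : exists i, al i ord0 != 0.
  apply: contrapT => H; case/eqP: aln0; apply/colP => i; rewrite mxE.
  by apply/eqP; apply: contrapT => /negP h; apply: H; exists i.
exists ((mexp (X u) *m al) i ord0 / al i ord0); apply/matrixP => j z; rewrite ord1 {z}.
have c : (fun N => powN (X u) N *m al) @ nat_ultra --> mexp (X u) *m al.
  by apply: cvg_mulmx; [exact: mexp_cvg|exact: cvg_cst].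
have c1 j' : (fun N => (powN (X u) N *m al) j' ord0) @ nat_ultra --> (mexp (X u) *m al) j' ord0.
  by apply: cvg_entry.
rewrite [RHS]mxE; apply: (@cvg_unique R^o (@norm_hausdorff _ _) _ _ _ _ (c1 j)).
have -> : (fun N => (powN (X u) N *m al) j ord0) = (fun N => (powN (X u) N *m al) i ord0 / al i ord0 * al j ord0).
  by apply/funext => N; have [e ->] := powal N; rewrite !mxE mulfK.
by apply: cvgM; [apply: cvgM; [exact: c1|exact: cvg_cst]|exact: cvg_cst].
Qed.

Lemma alpha_flow u : exists2 e : R, e != 0 & forall x, alpha (flow X u x) = e * alpha x.
Proof.
have [e He] := mexp_eigen u; have [e' He'] := mexp_eigen (- u).
have E x : alpha (flow X u x) = e * alpha x.
  by rewrite /alpha (flow_hom XA) -mulmxA He -scalemxAr mxE.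
have E' x : alpha (flow X (- u) x) = e' * alpha x.
  by rewrite /alpha (flow_hom XA) -mulmxA He' -scalemxAr mxE.
have [e0|e0] := eqVneq e 0; last by exists e.
exists 1; first exact: oner_neq0.
have a0 x : alpha x = 0 by rewrite -[x](flowK XA u) E' E e0 mul0r mulr0.
by move=> x; rewrite !a0 mulr0.
Qed.

Variable w : V.
Hypothesis w1 : forall x (s : R), alpha (x + s *: w) = alpha x + s.

Lemma alpha_field u x : (hom x *m X u *m al) ord0 ord0 = k u * alpha x.
Proof. by rewrite -mulmxA al_eigen -scalemxAr mxE. Qed.

Lemma alpha_add_field u x y : alpha (y + field X u x) = alpha y + k u * alpha x.
Proof.
rewrite /alpha rsub_row_shift ?mul_family0 // mulmxDl mxE; congr (_ + _).
exact: alpha_field.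
Qed.

(** The [m] fields are independent and tangent to the level, which has dimension [m], so the orbits
    are open in it; a level is convex, hence a single orbit. *)
Lemma level_transitive (s : R) : (forall u x, alpha x = s -> alpha (flow X u x) = s) ->
  (forall u, k u * s = 0) -> forall x y, alpha x = s -> alpha y = s -> exists v, flow X v x = y.
Proof.
move=> Fs ks; apply: (@convex_single_class R m.+1 [set x | alpha x = s]).
- move=> x y t /= xs ys _.
  have aE : alpha (x + t *: (y - x)) = alpha x + t * (alpha y - alpha x).
    rewrite /alpha hom_comb mulmxDl -scalemxAl mulmxBl mxE; congr (_ + _).
    by rewrite mxE; congr (_ * _); rewrite mxE; congr (_ + _); rewrite mxE.
  by rewrite aE xs ys subrr mulr0 addr0.
- by move=> x y [v <-]; exists (- v); rewrite (flowK XA).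
- by move=> x y z [v <-] [u <-]; exists (u + v); rewrite (flowD XA).
move=> x xs.
pose f (z : V) := flow X (rsub z) x + z ord0 ord0 *: w.
pose g (z : V) := field X (rsub z) x + z ord0 ord0 *: w.
have r0 : rsub (0 : V) = 0 by apply/rowP => j; rewrite !mxE.
have f0 : f 0 = x by rewrite /f r0 (flow0 XA) mxE scale0r addr0.
have g0 (z : V) : g z = 0 -> z = 0.
  move=> gz; have a0 := w1 (field X (rsub z) x + x) (z ord0 ord0).
  have e1 : field X (rsub z) x + x + z ord0 ord0 *: w = x.
    by rewrite addrAC; move: gz; rewrite /g => ->; rewrite add0r.
  move: a0; rewrite e1 [_ + x]addrC alpha_add_field xs ks addr0 => /eqP.
  rewrite -subr_eq0 opprD addrA subrr sub0r oppr_eq0 => /eqP z0.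
  apply: rsub0_inj => //; apply: (field_zero_free (x := x)).
  by move: gz; rewrite /g z0 scale0r addr0.
have [||D Du gE] := @linear_unit R m.+1 g _ _ g0.
- by move=> u v; rewrite /g rsubD (fieldD XA) mxE scalerDl addrACA.
- by move=> t u; rewrite /g rsubZ (fieldZ XA) mxE scalerDr scalerA.
have fc : continuous f.
  move=> z; have FF := @nbhs_filter V z.
  apply: cvgD; last by apply: cvgZl; apply: cvg_entry; exact: cvg_id.
  have rsubc : rsub @ z --> rsub z.
    apply/cvgrPdist_le => eps eps0; apply: filterS (near_dist_lt z eps0) => y zy.
    by rewrite -rsubB (le_trans (rsub_norm _)) // ltW.
  have h := @flow_continuous_time _ _ _ X XA x (rsub z).
  exact: (cvg_comp _ _ rsubc h).
have Df (eps : R) : 0 < eps -> exists2 rho : R, 0 < rho & forall z : V, `|z| < rho ->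
     `|f z - f 0 - z *m D| <= eps * `|z|.
  move=> eps0; have [rho rho0 H] := flow_expansion XA x eps0.
  exists rho => // z zr.
  have -> : f z - f 0 - z *m D = flow X (rsub z) x - x - field X (rsub z) x.
    by rewrite f0 -gE /f /g; apply/rowP => j; rewrite !mxE; ring.
  by rewrite (le_trans (H _ (le_lt_trans (rsub_norm _) zr))) // ler_wpM2l ?rsub_norm // ltW.
have [d d0 Hd] := local_onto fc Du Df (ltr01 : 0 < 1 :> R).
exists d => // y ys; rewrite -f0 => /Hd[z _ fz]; exists (rsub z).
have : alpha y = s + z ord0 ord0 by rewrite -fz w1 Fs.
rewrite ys => /eqP; rewrite -subr_eq0 opprD addrA subrr sub0r oppr_eq0 => /eqP z0.
by rewrite f0; move: fz; rewrite /f z0 scale0r addr0.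
Qed.

(** Each level of the invariant function is one orbit, so a line on which [alpha] is a coordinate
    meets each orbit once. *)
Lemma slice_invariant_form : (forall u, k u = 0) -> global_slice.
Proof.
move=> k0.
have Fa u x : alpha (flow X u x) = alpha x.
  have mal : mexp (X u) *m al = al.
    apply: (@ultra_cvg_unique _ _ _ (fun N => powN (X u) N *m al)).
      by apply: cvg_mulmx; [exact: mexp_cvg|exact: cvg_cst].
    have -> : (fun N => powN (X u) N *m al) = fun=> al; last exact: cvg_cst.
    apply/funext => N; rewrite /powN; move: (N.+1%:R^-1) => s; elim: N.+1 => [|q IH].
      by rewrite expr0 mul1mx.
    by rewrite exprSr [_ * _]/(_ *m _) -mulmxA mulmxDl mul1mx -scalemxAl al_eigen k0 scale0r scaler0 addr0 IH.
  by rewrite /alpha (flow_hom XA) -mulmxA mal.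
pose x0 : V := - alpha 0 *: w.
have ax0 : alpha x0 = 0 by rewrite /x0 -[_ *: w]add0r w1 subrr.
have axs s : alpha (x0 + s *: w) = s by rewrite w1 ax0 add0r.
apply: (@linear_slice x0 w).
- move=> v s v' s' E.
  have ss : s = s' by rewrite -[LHS]axs -[LHS](Fa v) E (Fa v') axs.
  split; last exact: ss.
  apply/eqP; rewrite -subr_eq0; apply/eqP; apply: (X_free (x := x0 + s' *: w)).
  by rewrite addrC (flowD XA) -ss E ss (flowK XA).
- move=> x; have [v hv] := @level_transitive (alpha x) (fun u y h => etrans (Fa u y) h)
    (fun u => ltac:(by rewrite k0 mul0r)) _ x (axs (alpha x)) erefl.
  by exists v, (alpha x).
move=> s v t E; have t0 : t = 0.
  have := w1 (field X v (x0 + s *: w) + 0) t.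
  rewrite addrAC E add0r [_ + 0]addrC alpha_add_field k0 mul0r addr0 => /eqP.
  by rewrite -subr_eq0 opprD addrA subrr sub0r oppr_eq0 => /eqP.
split => //; apply: (field_zero_free (x := x0 + s *: w)).
by move: E; rewrite t0 scale0r addr0.
Qed.

(* Here [w] spans an invariant line complementary to the invariant
   hyperplane [alpha = 0]. *)
Lemma slice_eigenvector : (forall u x (s : R), field X u (x + s *: w) = field X u x + (s * k u) *: w) -> global_slice.
Proof.
move=> kw.
have Fw u : exists e : R, forall x (s : R), flow X u (x + s *: w) = flow X u x + (s * e) *: w.
  have powE N : exists e : R, forall x, rsub (hom (x + w) *m powN (X u) N) - rsub (hom x *m powN (X u) N) = e *: w /\
     True.
    rewrite /powN; move: (N.+1%:R^-1) => s; elim: N.+1 => [|q [e IH]].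
      by exists 1 => x; rewrite expr0 !mulmx1 !homK addrAC subrr add0r scale1r.
    exists (e * (1 + s * k u)) => x; split => //.
    have hy z : hom z *m (1 + s *: X u) = hom (z + s *: field X u z).
      rewrite mulmxDr mulmx1 -scalemxAr -rsub_row_shift ?rsubZ //.
      by rewrite mxE mul_family0 // mulr0.
    rewrite exprS ![_ * _]/(_ *m _) !mulmxA !hy.
    have := kw u x 1; rewrite scale1r mul1r => ->.
    have -> : x + w + s *: (field X u x + k u *: w) = x + s *: field X u x + (1 + s * k u) *: w.
      by apply/rowP => j; rewrite !mxE; ring.
    set z := x + s *: field X u x.
    have [IHz _] := IH z.
    have -> : hom (z + (1 + s * k u) *: w) = hom z + (1 + s * k u) *: (hom (z + w) - hom z).
      by rewrite -hom_comb [z + w]addrC addrK.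
    rewrite mulmxDl -scalemxAl mulmxBl rsubD rsubZ rsubB IHz addrAC subrr add0r scalerA.
    by rewrite mulrC.
  have [w0|wn0] := eqVneq w 0; first by exists 0 => x s; rewrite w0 !scaler0 !addr0.
  pose e0 := flow X u w - flow X u 0.
  have [i wi] : exists i, w ord0 i != 0.
    apply: contrapT => H; case/eqP: wn0; apply/rowP => i; rewrite mxE.
    by apply/eqP; apply: contrapT => /negP h; apply: H; exists i.
  pose e := e0 ord0 i / w ord0 i; exists e => x s.
  have flow_w y : flow X u (y + w) - flow X u y = e0.
    rewrite /e0 /flow -!rsubB -!mulmxBl; congr (rsub (_ *m _)).
    by apply/rowP => j; rewrite !mxE; case: unliftP => [i' _|_]; rewrite ?subrr // !mxE; ring.
  have -> : flow X u (x + s *: w) = flow X u x + s *: e0.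
    by rewrite -(flow_w x) -flow_comb [x + w]addrC addrK.
  rewrite -scalerA; congr (_ + _ *: _); apply/rowP => j.
  have c z : (fun N => rsub (hom z *m powN (X u) N)) @ nat_ultra --> flow X u z.
    have c2 : (fun N => hom z *m powN (X u) N) @ nat_ultra --> hom z *m mexp (X u).
      by apply: cvg_mulmx; [exact: cvg_cst|exact: mexp_cvg].
    apply: ultra_dist => eps eps0; apply: filterS (ultra_dist_inv c2 eps0) => N.
    by apply: le_trans; rewrite /flow -rsubB rsub_norm.
  pose h N := rsub (hom (0 + w) *m powN (X u) N) - rsub (hom 0 *m powN (X u) N).
  have ch : h @ nat_ultra --> e0 by rewrite /e0 -{1}(add0r w); apply: cvgB; exact: c.
  have chj j' : (fun N => h N ord0 j') @ nat_ultra --> e0 ord0 j' by apply: cvg_entry.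
  rewrite [RHS]mxE; apply: (@cvg_unique R^o (@norm_hausdorff _ _) _ _ _ _ (chj j)).
  have -> : (fun N => h N ord0 j) = (fun N => h N ord0 i / w ord0 i * w ord0 j).
    by apply/funext => N; have [eN /(_ 0)[hE _]] := powE N; rewrite /h hE !mxE mulfK.
  by apply: cvgM; [apply: cvgM; [exact: chj|exact: cvg_cst]|exact: cvg_cst].
pose x0 : V := - alpha 0 *: w.
have ax0 : alpha x0 = 0 by rewrite /x0 -[_ *: w]add0r w1 subrr.
have F0 u x : alpha x = 0 -> alpha (flow X u x) = 0.
  by move=> x00; have [e _ ->] := alpha_flow u; rewrite x00 mulr0.
have axs s : alpha (x0 + s *: w) = s by rewrite w1 ax0 add0r.
have inv0 v x s s' : alpha x = 0 -> flow X v (x + s *: w) = flow X v x + s' *: w -> True by [].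
apply: (@linear_slice x0 w).
- move=> v s v' s' E.
  have [e He] := Fw v; have [e' He'] := Fw v'.
  have [a Ha] : exists a : R, flow X v x0 + a *: w = flow X v' x0.
    exists (s * e - s' * e'); move: E; rewrite He He' => E.
    have -> : flow X v' x0 = flow X v x0 + (s * e) *: w - (s' * e') *: w by rewrite E addrK.
    by rewrite scalerBl addrA.
  have a0 : a = 0 by rewrite -[LHS]add0r -[X in X + _](F0 v x0 ax0) -w1 Ha; exact: F0.
  have vv : v = v'.
    apply/eqP; rewrite -subr_eq0; apply/eqP; apply: (X_free (x := x0)).
    by rewrite addrC (flowD XA) -[flow X v x0]addr0 -(scale0r w) -a0 Ha (flowK XA).
  split; first exact: vv.
  have E2 : x0 + s *: w = x0 + s' *: w by rewrite -[LHS](flowK XA v') -vv E vv (flowK XA).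
  by rewrite -[LHS]axs E2 axs.
- move=> x; have [v hv] := @level_transitive 0 (fun u y h => F0 u y h) (fun u => mulr0 _) x0
    (x - alpha x *: w) ax0 (ltac:(by rewrite -scaleNr w1 subrr)).
  exists v; have [e He] := Fw (- v).
  exists (alpha x * e).
  have -> : x0 + (alpha x * e) *: w = flow X (- v) x.
    have -> : x = (x - alpha x *: w) + alpha x *: w by rewrite subrK.
    rewrite He -hv (flowK XA); congr (_ + (_ * _) *: _).
    by rewrite hv subrK.
  by rewrite -(flowD XA) subrr (flow0 XA).
move=> s v t; rewrite kw => E.
have fx0 : field X v x0 = 0.
  have t0 : s * k v + t = 0.
    have := w1 (field X v x0) (s * k v + t); rewrite scalerDl addrA E.
    have := alpha_add_field v x0 0; rewrite add0r ax0 mulr0 addr0 => -> /eqP.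
    by rewrite -subr_eq0 opprD addrA subrr sub0r oppr_eq0 => /eqP.
  by move: E; rewrite -addrA -scalerDl t0 scale0r addr0.
have v0 := field_zero_free fx0; split => //.
have : k v = 0.
  by have := alpha_add_field v (x0 + 1 *: w) 0; rewrite v0 /field family0 // mulmx0;
     rewrite axs mulr1 add0r; have -> : rsub 0 = 0 :> V; [by apply/rowP => j; rewrite !mxE|move=> /eqP; rewrite -subr_eq0 opprD addrA subrr sub0r oppr_eq0 => /eqP].
move=> kv; move: E; rewrite fx0 kv mulr0 scale0r addr0 add0r => tw.
by have := w1 0 t; rewrite tw addr0 => /eqP; rewrite -subr_eq0 opprD addrA subrr sub0r oppr_eq0 => /eqP.
Qed.

End Eigenform.

Section NilpotentExtension.
Variable W : 'M[R]_m.+2.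
Hypothesis WX : forall u, X u * W = W * X u.
Hypothesis W0 : forall i, W i ord0 = 0.
Hypothesis X_nil : forall u, exists k, X u ^+ k = 0.
Hypothesis W_nil : exists k, W ^+ k = 0.
Hypothesis W_free : forall u (t : R), hom 0 *m X u + t *: (hom 0 *m W) = 0 -> u = 0 /\ t = 0.

Lemma nilpotentD (A B : 'M[R]_m.+2) k l : A * B = B * A -> A ^+ k = 0 -> B ^+ l = 0 -> (A + B) ^+ (k + l) = 0.
Proof.
move=> AB Ak Bl; rewrite exprDn_comm //; apply: big1 => i _.
have [li|il] := leqP l i.
  by rewrite -(subnK li) exprD Bl mulr0 mulr0 mul0rn.
have ki : (k <= k + l - i)%N by rewrite -addnBA ?leq_addr // ltnW.
by rewrite -(subnK ki) exprD Ak mulr0 mul0r mul0rn.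
Qed.

Lemma nilpotent1D (A : 'M[R]_m.+2) k (y : 'rV[R]_m.+2) : A ^+ k = 0 -> y *m (1 + A) = 0 -> y = 0.
Proof.
move=> Ak yA; have y1 : y = - (y *m A).
  by apply/eqP; rewrite -addr_eq0 -{1}(mulmx1 y) -mulmxDr yA.
have yk j : y = (-1) ^+ j *: (y *m A ^+ j).
  elim: j => [|j IH]; first by rewrite !expr0 scale1r mulmx1.
  rewrite {1}IH {1}y1 exprSr mulrN1 scaleNr mulNmx scalerN exprS [_ * _]/(_ *m _) mulmxA //.
by rewrite (yk k) Ak mulmx0 scaler0.
Qed.

(** With [W] the family has as many parameters as the space has dimensions. It turns out to act
    simply transitively, and the trajectory of the origin under [W] is then a slice for [X]. *)
Let Y (z : V) : 'M[R]_m.+2 := X (rsub z) + z ord0 ord0 *: W.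

Let YA : affine_family Y.
Proof.
have [XD XZ XC X0] := XA; split.
- by move=> u v; rewrite /Y rsubD XD mxE scalerDl addrACA.
- by move=> s u; rewrite /Y rsubZ XZ mxE scalerDr scalerA.
- move=> u v; rewrite /Y !mulrDl !mulrDr XC -!scalerAl -!scalerAr !WX.
  by rewrite -!addrA; congr (_ + _); rewrite addrCA [in RHS]scalerA [in LHS]scalerA [in LHS]mulrC.
by move=> u i; rewrite !mxE X0 W0 mulr0 addr0.
Qed.

Let Y_nil z : exists k, Y z ^+ k = 0.
Proof.
have [k Xk] := X_nil (rsub z); have [l Wl] := W_nil.
exists (k + l)%N; apply: nilpotentD => //; first by rewrite -scalerAr -scalerAl WX.
by rewrite exprZn Wl scaler0.
Qed.

Let Y_free0 (z : V) : hom 0 *m Y z = 0 -> z = 0.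
Proof. by rewrite /Y mulmxDr -scalemxAr => /W_free[z1 z0]; exact: rsub0_inj. Qed.

Let field_hom0 z (x : V) : field Y z x = 0 -> hom x *m Y z = 0.
Proof.
move=> f0; apply: rsub_inj; first by rewrite (mul_family0 YA) mxE.
by rewrite -/(field Y z x) f0; apply/rowP => j; rewrite !mxE.
Qed.

(** The fields span at the origin, so [hom x] is [hom 0] times [1 + Y z'] for some [z']. This factor
    commutes with [Y z] and is injective, being 1 plus a nilpotent; a zero at [x] is therefore a
    zero at the origin. *)
Let Y_zero_free z (x : V) : field Y z x = 0 -> z = 0.
Proof.
move=> /field_hom0 zx.
have [|||D Du gE] := @linear_unit R m.+1 (fun z => field Y z 0).
- exact: (fun u v => fieldD YA u v 0).
- exact: (fun s u => fieldZ YA s u 0).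
- by move=> u /field_hom0/Y_free0.
have xE : hom x = hom 0 *m (1 + Y (x *m invmx D)).
  rewrite mulmxDr mulmx1 -rsub_row_shift ?(mul_family0 YA) // add0r.
  by rewrite -/(field Y _ 0) gE mulmxKV.
have [_ _ YC _] := YA; have [k Yk] := Y_nil (x *m invmx D).
apply: Y_free0; apply: (nilpotent1D Yk).
rewrite -mulmxA -[Y z *m _]/(Y z * (1 + Y (x *m invmx D))).
have -> : Y z * (1 + Y (x *m invmx D)) = (1 + Y (x *m invmx D)) * Y z.
  exact: (commrD (commr1 _) (YC _ _)).
by rewrite [_ * _]/(_ *m _) mulmxA -xE.
Qed.

Let Y_linear x : exists2 D, D \in unitmx & forall z, field Y z x = z *m D.
Proof.
apply: linear_unit; [exact: (fun u v => fieldD YA u v x)|exact: (fun s u => fieldZ YA s u x)|].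
by move=> u /Y_zero_free.
Qed.

Let Y_local (x : V) (eps : R) : 0 < eps -> exists2 d : R, 0 < d & forall y, `|y - x| < d ->
  exists2 z : V, `|z| <= eps & flow Y z x = y.
Proof.
move=> eps0; have [D Du gE] := Y_linear x.
have f0 : flow Y 0 x = x by rewrite (flow0 YA).
have [|e e0|d d0 Hd] := @local_onto R m.+1 (fun z => flow Y z x) D _ Du _ eps eps0.
- exact: flow_continuous_time YA x.
- have [rho rho0 H] := flow_expansion YA x e0; exists rho => // z zr.
  by rewrite f0 -gE; exact: H.
by exists d => // y; rewrite -{1}f0 => /Hd.
Qed.

Let Y_transitive (x y : V) : exists z, flow Y z x = y.
Proof.
apply: (@convex_single_class R m.+1 setT (fun x y => exists z, flow Y z x = y)) => //.
- by move=> a b [z <-]; exists (- z); rewrite (flowK YA).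
- by move=> a b c [z <-] [z' <-]; exists (z' + z); rewrite (flowD YA).
move=> a _; have [d d0 Hd] := Y_local a ltr01.
by exists d => // b _ /Hd[z _ zE]; exists z.
Qed.

(** The halving argument used for [flow_free]; transitivity of the commuting flow now spreads one
    fixed point to the whole space. *)
Let Y_freeflow z (x : V) : flow Y z x = x -> z = 0.
Proof.
have full w y : flow Y w y = y -> forall x', flow Y w x' = x'.
  by move=> wy x'; have [z' <-] := Y_transitive y x'; rewrite (flowC YA) wy.
move=> zx; have half k : forall y, flow Y ((2^-1 ^+ k) *: z) y = y.
  elim: k => [|k IH]; first by rewrite expr0 scale1r; exact: full zx.
  set w := 2^-1 ^+ k.+1 *: z.
  have ww : w + w = 2^-1 ^+ k *: z.
    by rewrite /w -scalerDl exprS; congr (_ *: _); lra.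
  have wwz y : flow Y w (flow Y w y) = y by rewrite -(flowD YA) ww IH.
  apply: (full w (x + 2^-1 *: (flow Y w x - x))); rewrite flow_comb wwz.
  by apply/rowP => j; rewrite !mxE; lra.
have [D Du gE] := Y_linear x.
pose L : R := m.+1%:R * (`|invmx D| + 1).
have L0 : 0 < L by rewrite /L mulr_gt0 // ltr_wpDl.
have Lb (y : V) : `|y *m invmx D| <= L * `|y|.
  by apply: (le_trans (mulmx_norm_le _ _)); rewrite mulrAC ler_wpM2r // ler_wpM2l // lerDl.
have eL : 0 < (2 * L)^-1 by rewrite invr_gt0 mulr_gt0.
have [rho rho0 Hrho] := flow_expansion YA x eL.
have [k hk] : exists k : nat, `|2^-1 ^+ k *: z| < rho.
  have c : (fun k => (2^-1 : R) ^+ k * `|z|) @ \oo --> 0.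
    rewrite -[X in _ --> X](mul0r `|z|); apply: cvgM; last exact: cvg_cst.
    by apply: cvg_expr; rewrite ger0_norm ?invr_ge0 // invf_lt1 // ltr1n.
  move/cvgrPdist_lt: c => /(_ _ rho0) [k _ /(_ k (leqnn k)) hk]; exists k.
  by move: hk; rewrite sub0r normrN normrM normr_id -normrZ.
have := Hrho _ hk; rewrite half; set w := _ *: z.
rewrite subrr sub0r normrN => hw.
have : `|w| <= L * `|field Y w x| by rewrite -{1}(mulmxK Du w) -gE.
have : L * `|field Y w x| <= L * ((2 * L)^-1 * `|w|) by rewrite ler_pM2l.
have -> : L * ((2 * L)^-1 * `|w|) = `|w| / 2 by field; rewrite gt_eqF.
move=> h1 h2; have : `|w| <= 0 by have := normr_ge0 w; lra.
rewrite normr_le0 scaler_eq0 expf_eq0 invr_eq0 pnatr_eq0 /= andbF /= => /eqP -> //.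
Qed.

Lemma slice_nilpotent_extension : global_slice.
Proof.
pose c (s : R) : V := flow Y (cons_mx s 0) 0.
have cE v s : flow X v (c s) = flow Y (cons_mx s v) 0.
  have -> : flow X v (c s) = flow Y (cons_mx 0 v) (c s).
    by rewrite {1}/flow /flow /Y rsub_cons cons_mx0 scale0r addr0.
  have E : cons_mx 0 v + cons_mx s 0 = cons_mx s v.
    by apply/rowP => j; rewrite !mxE; case: unliftP => [i _|_]; rewrite ?mxE ?addr0 ?add0r.
  exact: (etrans (esym (flowD YA (cons_mx 0 v) (cons_mx s 0) 0)) (congr1 (fun z => flow Y z 0) E)).
have Yinj z z' : flow Y z 0 = flow Y z' 0 -> z = z'.
  move=> E; apply/eqP; rewrite -subr_eq0; apply/eqP; apply: (Y_freeflow (x := 0)).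
  by rewrite addrC (flowD YA) E (flowK YA).
have consE (z : V) : cons_mx (z ord0 ord0) (rsub z) = z.
  by apply: rsub_inj; rewrite ?cons_mx0 ?rsub_cons.
apply: (@slice_from_local c).
- move=> s; have cc : (fun s : R => cons_mx s (0 : 'rV[R]_m)) @ s --> cons_mx s 0.
    apply: cvg_mx => i j; rewrite !mxE; case Ej: (unlift ord0 j) => [i'|].
      have -> : (fun x : R => cons_mx x 0 i j) = (fun=> (0 : 'rV[R]_m) ord0 i').
        by apply/funext => x; rewrite mxE Ej.
      exact: cvg_cst.
    have -> : (fun x : R => cons_mx x (0 : 'rV[R]_m) i j) = id.
      by apply/funext => x; rewrite mxE Ej.
    exact: cvg_id.
  have h := @flow_continuous_time _ _ _ Y YA 0 (cons_mx s 0).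
  exact: (cvg_comp _ _ cc h).
- move=> v s v' s'; rewrite !cE => /Yinj E.
  by split; [rewrite -(rsub_cons s v) E rsub_cons|rewrite -(cons_mx0 s v) E cons_mx0].
- by move=> x; have [z zx] := Y_transitive 0 x; exists (rsub z), (z ord0 ord0); rewrite cE consE.
move=> s eps eps0; have [d d0 Hd] := Y_local (c s) eps0.
exists d => // y /Hd[z zeps zy]; exists (rsub z), (z ord0 ord0); split.
- exact: le_trans (rsub_norm _) zeps.
- exact: le_trans (mx_entry_le _ _ _) zeps.
have E : cons_mx (s + z ord0 ord0) (rsub z) = z + cons_mx s 0.
  by apply/rowP => j; rewrite !mxE; case: (unliftP ord0 j) => [i ->|->]; rewrite ?mxE ?addr0 // addrC.
rewrite cE -zy E; exact: (flowD YA z (cons_mx s 0) 0).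
Qed.

End NilpotentExtension.

Definition orbit_matrix (x : V) : 'M[R]_(m, m.+2) := \matrix_i (hom x *m X (delta_mx 0 i)).

Lemma orbit_matrixE x u : hom x *m X u = u *m orbit_matrix x.
Proof.
have [XD XZ _ _] := XA; have X0 := family0 XA.
rewrite {1}(row_sum_delta u) (big_morph X (fun u v => XD u v) X0) mulmx_sumr mulmx_sum_row.
by apply: eq_bigr => i _; rewrite XZ -scalemxAr rowK.
Qed.

Lemma orbit_matrix_inj x (u : 'rV[R]_m) : u *m orbit_matrix x = 0 -> u = 0.
Proof.
rewrite -orbit_matrixE => ux; apply: (field_zero_free (x := x)).
by rewrite /field ux; apply/rowP => j; rewrite !mxE.
Qed.

Lemma orbit_col_free x : row_free (col_mx (hom x) (orbit_matrix x)).
Proof.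
rewrite -kermx_eq0; apply/rowV0P => y /sub_kermxP; rewrite -[y]hsubmxK mul_row_col => E.
have l0 : lsubmx y = 0.
  have := congr1 (fun z : 'rV[R]_m.+2 => z ord0 ord0) E.
  rewrite mxE -orbit_matrixE (mul_family0 XA) addr0 mxE big_ord1 hom0E mulr1 [RHS]mxE => h.
  by apply/rowP => j; rewrite ord1 h mxE.
move: E; rewrite l0 mul0mx add0r => /orbit_matrix_inj ->.
by rewrite row_mx0.
Qed.

(** Let [B] span the tangent space of the orbit of the origin. If no product [X u * X u'] takes
    [hom 0] out of [B], the span of [hom 0] and [B] is an invariant hyperplane, and its annihilator
    is an eigenform, of eigenvalue 0 by nilpotence. A product that does is the additional commuting
    nilpotent. *)
Lemma slice_nilpotent : (forall u, exists k, X u ^+ k = 0) -> global_slice.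
Proof.
move=> X_nil; have [_ _ XC X0] := XA; pose B := orbit_matrix 0.
have [closedB|] := pselect (forall u u', (hom 0 *m X u *m X u' <= B)%MS); last first.
  move=> /existsNP[u /existsNP[u' nB]].
  apply: (@slice_nilpotent_extension (X u * X u')) => //.
  - by move=> v; rewrite mulrA XC -mulrA XC mulrA.
  - move=> i; rewrite mxE big1 // => j _; by rewrite X0 mulr0.
  - have [k Xk] := X_nil u; exists k; rewrite exprMn_comm ?Xk ?mul0r //; exact: XC.
  move=> v t E; have t0 : t = 0.
    apply: contrapT => /eqP tn0; apply: nB.
    have -> : hom 0 *m X u *m X u' = (- t^-1 *: v) *m B.
      rewrite -scalemxAl -orbit_matrixE; apply: (scalerI tn0); rewrite scalerA mulrN mulfV //.
      rewrite scaleN1r; apply/eqP; rewrite -addr_eq0 addrC -mulmxA; exact/eqP.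
    exact: submxMl.
  split => //; apply: (orbit_matrix_inj (x := 0)); rewrite -orbit_matrixE.
  by move: E; rewrite t0 scale0r addr0.
pose W := col_mx (hom 0) B.
have Wfree : row_free W := orbit_col_free 0.
have WX u : (W *m X u <= W)%MS.
  rewrite mul_col_mx col_mx_sub; apply/andP; split.
    rewrite orbit_matrixE; apply: (submx_trans (submxMl _ _)).
    by rewrite -addsmxE addsmxSr.
  apply/row_subP => i; rewrite row_mul rowK -/B.
  by apply: (submx_trans (closedB _ _)); rewrite -addsmxE addsmxSr.
pose K := kermx W^T.
have Krank : \rank K = 1%N.
  by rewrite mxrank_ker mxrank_tr (eqP Wfree) -[m.+2]addn1 addKn.
have [a aK an0] : exists2 a : 'rV[R]_m.+2, (a <= K)%MS & a != 0.
  have Kn0 : K != 0 by rewrite -mxrank_eq0 Krank.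
  by have /rowV0Pn[a aK an0] := Kn0; exists a.
pose al := a^T.
have Wal : W *m al = 0.
  by move/sub_kermxP: aK => /(congr1 trmx); rewrite trmx_mul trmxK trmx0.
have alX u : exists k, X u *m al = k *: al.
  have Wu : W *m (X u *m al) = 0.
    by rewrite mulmxA; have /submxP[D ->] := WX u; rewrite -mulmxA Wal mulmx0.
  have ubK : ((X u *m al)^T <= K)%MS.
    by apply/sub_kermxP; rewrite -trmx_mul Wu trmx0.
  have [k E] := rank1_multiple (eq_leq Krank) aK an0 ubK; exists k.
  by rewrite -[LHS]trmxK E linearZ.
have aln0 : al != 0.
  by apply: contra an0 => /eqP E; rewrite -[a]trmxK -/al E trmx0.
have alX0 u : X u *m al = 0 *: al.
  have [k kE] := alX u; have [N XN] := X_nil u.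
  have pw q : X u ^+ q *m al = k ^+ q *: al.
    elim: q => [|q IH]; first by rewrite !expr0 mul1mx scale1r.
    by rewrite exprSr [_ * _]/(_ *m _) -mulmxA kE -scalemxAr IH scalerA exprS.
  have := pw N; rewrite XN mul0mx => /esym/eqP; rewrite scaler_eq0 (negPf aln0) orbF expf_eq0.
  by move=> /andP[_ /eqP k0]; rewrite kE k0.
have al0 : al ord0 ord0 = 0.
  have hal : hom 0 *m al = 0.
    by move: Wal; rewrite mul_col_mx => /(congr1 usubmx); rewrite col_mxKu linear0.
  have := congr1 (fun z : 'M[R]_1 => z ord0 ord0) hal.
  rewrite /= mxE big_ord_recl hom0E mul1r big1 => [|i _]; last by rewrite mxE liftK mxE mul0r.
  by rewrite addr0 => ->; rewrite mxE.
have [i ai] : exists i, al (lift ord0 i) ord0 != 0.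
  apply: contrapT => H; case/eqP: aln0; apply/colP => j; rewrite [RHS]mxE.
  case: (unliftP ord0 j) => [i ->|->]; last exact: al0.
  by apply/eqP; apply: contrapT => /negP h; apply: H; exists i.
apply: (@slice_invariant_form al (fun=> 0) alX0 ((al (lift ord0 i) ord0)^-1 *: delta_mx 0 i)) => //.
have hm (y : V) : (hom y *m al) ord0 ord0 = \sum_j y ord0 j * al (lift ord0 j) ord0.
  rewrite mxE big_ord_recl hom0E al0 mulr0 add0r; apply: eq_bigr => j _; by rewrite mxE liftK.
move=> x s; rewrite !hm.
transitivity (\sum_j (x ord0 j * al (lift ord0 j) ord0 + (if j == i then s else 0))).
  apply: eq_bigr => j _; rewrite !mxE eqxx /=; case: eqP => [->|_]; last by rewrite !mulr0 addr0 addr0.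
  by move: ai; rewrite mxE => ai; rewrite /= ?mulr1n mulr1 mulrDl -mulrA mulVf // mulr1.
by rewrite big_split /= -big_mkcond /= big_pred1_eq.
Qed.

(** A power [N] of minimal rank has complementary image and kernel. Its kernel contains some
    [hom x0], hence also the tangent space of the orbit of [x0] because [N] commutes with the
    family; freeness makes it a hyperplane. The image is then an invariant line, and factoring [N]
    through it gives the eigenform. *)
Lemma slice_not_nilpotent u0 : (forall k, X u0 ^+ k <> 0) -> global_slice.
Proof.
move=> nnil; have [_ _ XC X0] := XA.
pose P r := `[< exists k, \rank (X u0 ^+ k.+1) = r >].
have exP : exists r, P r by exists (\rank (X u0 ^+ 1)); apply/asboolP; exists 0%N.
case: (ex_minnP exP) => r /asboolP[k rk] rmin.
pose N := X u0 ^+ k.+1.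
have NN : \rank (N *m N) = \rank N.
  apply/eqP; rewrite eqn_leq mxrankM_maxr /= rk; apply: rmin; apply/asboolP.
  by exists (k.+1 + k)%N; rewrite -addnS exprD.
have NX u : N *m X u = X u *m N by apply: esym; apply: commrX; exact: XC.
have N0 i : N i ord0 = 0.
  rewrite /N exprSr mxE big1 // => j _; by rewrite X0 mulr0.
have Nn0 : N != 0 by apply/eqP; exact: nnil.
pose K := kermx N.
have NK0 : \rank (N :&: K)%MS = 0%N.
  have := mxrank_mul_ker N N; rewrite NN => /eqP.
  by rewrite -[X in _ == X]addn0 eqn_add2l => /eqP.
have NKfull : row_full (N + K)%MS.
  rewrite /row_full; have := mxrank_sum_cap N K; rewrite NK0 addn0 => ->.
  by rewrite mxrank_ker subnKC // rank_leq_col.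
have [x0 hx0] : exists x0 : V, hom x0 *m N = 0.
  have /sub_addsmxP[[D1 D2] /= hD] : (hom (0 : V) <= N + K)%MS by exact: submx_full.
  exists (rsub (D2 *m K)); rewrite homP.
    by rewrite -mulmxA mulmx_ker mulmx0.
  have := congr1 (fun z : 'rV[R]_m.+2 => z ord0 ord0) hD; rewrite hom0E mxE => ->.
  by rewrite [X in X + _]mxE big1 ?add0r // => i _; rewrite N0 mulr0.
have Nrank : (\rank N <= 1)%N.
  pose W := col_mx (hom x0) (orbit_matrix x0).
  have WK : (W <= K)%MS.
    rewrite col_mx_sub; apply/andP; split; first exact/sub_kermxP.
    apply/row_subP => i; apply/sub_kermxP; rewrite rowK -mulmxA -NX mulmxA hx0 mul0mx //.
  have := mxrankS WK; rewrite (eqP (orbit_col_free x0)) mxrank_ker.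
  have := rank_leq_col N; lia.
have /rowV0Pn[w wN wn0] := Nn0.
have Nw : (N <= w)%MS.
  have /leqifP := mxrank_leqif_sup wN; case: ifP => // _.
  by rewrite rank_rV wn0 ltnNge Nrank.
pose al0 := N *m pinvmx w.
have Nal : N = al0 *m w by rewrite /al0 mulmxKpV.
have wX u : exists k, w *m X u = k *: w.
  have h : (w *m X u <= w)%MS.
    apply: (submx_trans _ Nw); apply: (@submx_trans _ _ _ _ _ _ (N *m X u)).
      exact: submxMr.
    by rewrite NX submxMl.
  by have /sub_rVP[k' ->] := h; exists k'.
have [kk kkE] := choice wX.
have colw (c : 'cV[R]_m.+2) : c *m w = 0 -> c = 0.
  move=> cw; have [i wi] : exists i, w ord0 i != 0.
    apply: contrapT => H; case/eqP: wn0; apply/rowP => i; rewrite mxE.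
    by apply/eqP; apply: contrapT => /negP h; apply: H; exists i.
  apply/matrixP => j z; rewrite ord1 {z}; apply: (mulIf wi).
  by have /matrixP /(_ j i) := cw; rewrite !mxE big_ord1 mul0r.
have alX0 u : X u *m al0 = kk u *: al0.
  apply/eqP; rewrite -subr_eq0; apply/eqP; apply: colw.
  by rewrite mulmxBl -mulmxA -Nal -NX Nal -mulmxA kkE -scalemxAr -scalemxAl subrr.
pose a := (w *m al0) ord0 ord0.
have an0 : a != 0.
  apply: contra Nn0 => /eqP a0; rewrite -mxrank_eq0 -NN Nal mulmxA -[al0 *m w *m al0]mulmxA.
  have -> : w *m al0 = 0 by apply/matrixP => i j; rewrite !ord1 [LHS]a0 mxE.
  by rewrite mulmx0 mul0mx mxrank0.
pose al := a^-1 *: al0.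
have alX u : X u *m al = kk u *: al by rewrite /al -scalemxAr alX0 !scalerA mulrC.
have w00 : w ord0 ord0 = 0.
  by have /submxP[D ->] := wN; rewrite mxE big1 // => i _; rewrite N0 mulr0.
have homw (x : V) (s : R) : hom (x + s *: rsub w) = hom x + s *: w.
  by rewrite -rsubZ rsub_row_shift // mxE w00 mulr0.
apply: (@slice_eigenvector al kk alX (rsub w)).
  move=> x s; rewrite homw mulmxDl mxE -scalemxAl [X in _ + X]mxE; congr (_ + _).
  by rewrite /al -scalemxAr mxE -/a mulVf // mulr1.
by move=> u x s; rewrite /field homw mulmxDl -scalemxAl kkE scalerA rsubD rsubZ.
Qed.

Theorem global_sliceP : global_slice.
Proof.
have [nil|] := pselect (forall u, exists k, X u ^+ k = 0); first exact: slice_nilpotent.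
move=> /existsNP[u nu]; apply: (@slice_not_nilpotent u) => k Xk.
by apply: nu; exists k.
Qed.

End GlobalSlice.

(** * Multilinear interpolation *)

Section Interpolation.
Context {R : realType} {W : normedModType R}.

Definition interp1 (f : int -> W) (x : R) : W :=
  f (Num.floor x) + (x - (Num.floor x)%:~R) *: (f (Num.floor x + 1) - f (Num.floor x)).

Definition consz {T : Type} {m} (z : T) (k : 'rV[T]_m) : 'rV[T]_m.+1 :=
  \row_j if unlift ord0 j is Some i then k ord0 i else z.

Definition tailz {T : Type} {m} (k : 'rV[T]_m.+1) : 'rV[T]_m := \row_j k ord0 (lift ord0 j).

(** Extends a function on Z^m to R^m, one coordinate at a time. The construction is compatible with
    integer translations and exact on linear maps, which is what equivariant charts require. *)
Fixpoint interp m : ('rV[int]_m -> W) -> 'rV[R]_m -> W :=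
  if m is m'.+1 then fun f t =>
    interp1 (fun z => interp (fun k => f (consz z k)) (tailz t)) (t ord0 ord0)
  else fun f _ => f 0.

Definition ir {m} (k : 'rV[int]_m) : 'rV[R]_m := map_mx (fun z : int => z%:~R) k.

Lemma irD m (k l : 'rV[int]_m) : ir (k + l) = ir k + ir l.
Proof. by apply/rowP => j; rewrite !mxE intrD. Qed.

Lemma irN m (k : 'rV[int]_m) : ir (- k) = - ir k.
Proof. by apply/rowP => j; rewrite !mxE intrN. Qed.

Lemma ir0 m : ir (0 : 'rV[int]_m) = 0.
Proof. by apply/rowP => j; rewrite !mxE. Qed.

Lemma ir_inj m : injective (@ir m).
Proof. by move=> k l /rowP H; apply/rowP => j; have := H j; rewrite !mxE => /intr_inj. Qed.

Lemma consz_tail {T : Type} m (k : 'rV[T]_m.+1) : consz (k ord0 ord0) (tailz k) = k.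
Proof. by apply/rowP => j; rewrite !mxE; case: unliftP => [i ->|->]; rewrite ?mxE. Qed.

Lemma consz0 {T : Type} m z (k : 'rV[T]_m) : consz z k ord0 ord0 = z.
Proof. by rewrite mxE unlift_none. Qed.

Lemma tail_norm m (t : 'rV[R]_m.+1) : `|tailz t| <= `|t|.
Proof. by apply: mx_norm_le => // i j; rewrite mxE; exact: mx_entry_le. Qed.

Lemma frac01 (x : R) : 0 <= x - (Num.floor x)%:~R <= 1.
Proof. by rewrite subr_ge0 floor_le /= lerBlDl ltW // -intrD1 floorD1_gt. Qed.

Lemma segmentE (s : R) (u v : W) : u + s *: (v - u) = (1 - s) *: u + s *: v.
Proof. by rewrite scalerBr scalerBl scale1r addrA addrAC. Qed.

Lemma interp1_comb f x : interp1 f x =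
  (1 - (x - (Num.floor x)%:~R)) *: f (Num.floor x) + (x - (Num.floor x)%:~R) *: f (Num.floor x + 1).
Proof. exact: segmentE. Qed.

Lemma interp1D f (x : R) (z : int) : interp1 f (x + z%:~R) = interp1 (fun k => f (k + z)) x.
Proof.
have E : Num.floor (x + z%:~R) = Num.floor x + z.
  by rewrite floorDrz ?intr_int // intrKfloor.
by rewrite /interp1 E intrD opprD addrACA subrr addr0 addrAC.
Qed.

Lemma interp1_local f g x : f (Num.floor x) = g (Num.floor x) ->
  f (Num.floor x + 1) = g (Num.floor x + 1) -> interp1 f x = interp1 g x.
Proof. by rewrite /interp1 => -> ->. Qed.

Lemma interp1_lipschitz_cell f (D x x' : R) : (forall k, `|f (k + 1) - f k| <= D) ->
  Num.floor x = Num.floor x' -> `|interp1 f x - interp1 f x'| <= D * `|x - x'|.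
Proof.
move=> fD E; rewrite /interp1 E opprD addrACA subrr add0r -scalerBl normrZ.
by rewrite opprB addrA subrK mulrC ler_wpM2r.
Qed.

Lemma interp1_lipschitz f (D : R) : (forall k, `|f (k + 1) - f k| <= D) ->
  forall x x', `|interp1 f x - interp1 f x'| <= D * `|x - x'|.
Proof.
move=> fD; have D0 : 0 <= D := le_trans (normr_ge0 _) (fD 0).
have up x : `|interp1 f x - f (Num.floor x + 1)| <= D * ((Num.floor x + 1)%:~R - x).
  have /andP[h1 h2] := frac01 x.
  have -> : interp1 f x - f (Num.floor x + 1) = (1 - (x - (Num.floor x)%:~R)) *: (f (Num.floor x) - f (Num.floor x + 1)).
    rewrite /interp1; set s := x - _; set u := f _; set v := f _.
    by rewrite [RHS]scalerBl scale1r -[v - u]opprB scalerN addrAC.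
  rewrite normrZ ger0_norm ?subr_ge0 // intrD1 mulrC.
  have -> : (Num.floor x)%:~R + 1 - x = 1 - (x - (Num.floor x)%:~R) by ring.
  by rewrite ler_wpM2r ?subr_ge0 // distrC.
have down x : `|interp1 f x - f (Num.floor x)| <= D * (x - (Num.floor x)%:~R).
  have /andP[h1 h2] := frac01 x.
  by rewrite /interp1 addrC addKr normrZ ger0_norm // mulrC ler_wpM2r.
have chain (z : int) (q : nat) : `|f (z + q%:Z) - f z| <= D * q%:R.
  elim: q => [|q IH]; first by rewrite addr0 subrr normr0 mulr0.
  rewrite -(subrK (f (z + q%:Z)) (f (z + q.+1%:Z))) -addrA (le_trans (ler_normD _ _)) //.
  rewrite -natr1 mulrDr mulr1 [leRHS]addrC lerD //.
  have -> : z + q.+1%:Z = z + q%:Z + 1 by rewrite -addrA -PoszD addn1.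
  exact: fD.
have main x x' : x <= x' -> `|interp1 f x - interp1 f x'| <= D * (x' - x).
  move=> xx'; have [E|nE] := eqVneq (Num.floor x) (Num.floor x').
    by rewrite (le_trans (interp1_lipschitz_cell fD E)) // distrC ger0_norm ?subr_ge0.
  have lt : Num.floor x < Num.floor x' by rewrite lt_neqAle nE le_floor.
  have [q Hq] : exists q : nat, Num.floor x' = Num.floor x + 1 + q%:Z.
    have : 0 <= Num.floor x' - (Num.floor x + 1) by rewrite subr_ge0 lezD1.
    move=> h; exists (absz (Num.floor x' - (Num.floor x + 1))%R).
    by rewrite gez0_abs // addrCA subrr addr0.
  have -> : interp1 f x - interp1 f x' = (interp1 f x - f (Num.floor x + 1)) - (f (Num.floor x') - f (Num.floor x + 1))
      - (interp1 f x' - f (Num.floor x')).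
    by rewrite [- (_ - f (_ + 1))]opprB addrA subrK opprB addrA subrK.
  apply: (le_trans (ler_normB _ _)); apply: (le_trans (lerD (ler_normB _ _) (lexx _))).
  have := up x; have := down x'; have := chain (Num.floor x + 1) q; rewrite -Hq => h1 h2 h3.
  have -> : D * (x' - x) = D * ((Num.floor x + 1)%:~R - x) + D * q%:R + D * (x' - (Num.floor x')%:~R).
    by rewrite Hq [in RHS]intrD pmulrn; ring.
  by rewrite lerD // lerD.
move=> x x'; have [h|/ltW h] := leP x x'.
  by rewrite [`|x - x'|]distrC [`|x' - x|]ger0_norm ?subr_ge0 // main.
by rewrite distrC [`|x - x'|]ger0_norm ?subr_ge0 // main.
Qed.

Lemma interp_shift m (f : 'rV[int]_m -> W) (t : 'rV[R]_m) (l : 'rV[int]_m) :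
  interp f (t + ir l) = interp (fun k => f (k + l)) t.
Proof.
elim: m f t l => [|m IH] f t l /=; first by congr f; apply/rowP; case.
have -> : (t + ir l) ord0 ord0 = t ord0 ord0 + (l ord0 ord0)%:~R by rewrite !mxE.
have -> : tailz (t + ir l) = tailz t + ir (tailz l) by apply/rowP => j; rewrite !mxE.
rewrite interp1D; congr interp1; apply/funext => z; rewrite IH; congr interp.
apply/funext => k; congr f; apply/rowP => j; rewrite !mxE.
by case: unliftP => [i ->|->]; rewrite ?mxE.
Qed.

Lemma interp_local m (f g : 'rV[int]_m -> W) (t : 'rV[R]_m) :
  (forall k : 'rV[int]_m, (forall i, k ord0 i = Num.floor (t ord0 i) \/ k ord0 i = Num.floor (t ord0 i) + 1) -> f k = g k) ->
  interp f t = interp g t.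
Proof.
elim: m f g t => [|m IH] f g t H /=; first by apply: H => -[].
by apply: interp1_local; apply: IH => k Hk; apply: H => i; rewrite mxE;
   case: (unliftP ord0 i) => [j ->|->]; [have := Hk j; rewrite mxE|auto|have := Hk j; rewrite mxE|auto].
Qed.



Lemma combB (a b : R) (u v u' v' : W) :
  a *: (u - v) + b *: (u' - v') = (a *: u + b *: u') - (a *: v + b *: v').
Proof. by rewrite !scalerBr opprD addrACA. Qed.

Lemma interp1B f g x : interp1 (fun k => f k - g k) x = interp1 f x - interp1 g x.
Proof.
by rewrite !interp1_comb combB.
Qed.

Lemma interpB m (f g : 'rV[int]_m -> W) (t : 'rV[R]_m) :
  interp (fun k => f k - g k) t = interp f t - interp g t.
Proof.
elim: m f g t => [|m IH] f g t //=; rewrite -interp1B; congr interp1.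
by apply/funext => z; rewrite IH.
Qed.

Lemma interp1_norm_le f (e x : R) : `|f (Num.floor x)| <= e -> `|f (Num.floor x + 1)| <= e -> `|interp1 f x| <= e.
Proof.
move=> h1 h2; have /andP[x0 x1] := frac01 x; rewrite interp1_comb.
apply: (le_trans (ler_normD _ _)); rewrite !normrZ ger0_norm ?subr_ge0 // ger0_norm //.
set s := x - _ in x0 x1 *; have -> : e = (1 - s) * e + s * e by ring.
by rewrite lerD // ler_wpM2l // subr_ge0.
Qed.

Lemma interp_norm_le m (f : 'rV[int]_m -> W) (t : 'rV[R]_m) (e : R) :
  (forall k : 'rV[int]_m, (forall i, k ord0 i = Num.floor (t ord0 i) \/ k ord0 i = Num.floor (t ord0 i) + 1) -> `|f k| <= e) ->
  `|interp f t| <= e.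
Proof.
elim: m f t => [|m IH] f t H /=; first by apply: H => -[].
by apply: interp1_norm_le; apply: IH => k Hk; apply: H => i; rewrite mxE;
   case: (unliftP ord0 i) => [j ->|->]; [have := Hk j; rewrite mxE|auto|have := Hk j; rewrite mxE|auto].
Qed.

Lemma interp_cst m (c : W) (t : 'rV[R]_m) : interp (fun=> c) t = c.
Proof. by elim: m t => [|m IH] t //=; rewrite /interp1 !IH subrr scaler0 addr0. Qed.

Lemma interp_lipschitz m (f : 'rV[int]_m -> W) (e : R) : (forall k, `|f k| <= e) ->
  forall t t', `|interp f t - interp f t'| <= 2 * e * m%:R * `|t - t'|.
Proof.
elim: m f => [|m IH] f fe t t' /=; first by rewrite subrr normr0 mulr0 mul0r.
have e0 : 0 <= e := le_trans (normr_ge0 _) (fe 0).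
pose h u z := interp (fun k => f (consz z k)) (tailz u).
have hE (u : 'rV[R]_m.+1) z : `|h u z| <= e by apply: interp_norm_le.
rewrite -/(h t) -/(h t') -(subrK (interp1 (h t) (t' ord0 ord0)) (interp1 (h t) _)) -addrA.
apply: (le_trans (ler_normD _ _)); rewrite -[m.+1%:R]natr1 mulrDr mulr1 mulrDl [leRHS]addrC; apply: lerD; last first.
  rewrite -interp1B; apply: (@le_trans _ _ (2 * e * m%:R * `|tailz t - tailz t'|)).
    by apply: interp1_norm_le; apply: IH => k; exact: fe.
  rewrite ler_wpM2l ?mulr_ge0 //.
  have -> : tailz t - tailz t' = tailz (t - t') by apply/rowP => j; rewrite !mxE.
  exact: tail_norm.
apply: (@le_trans _ _ (2 * e * `|t ord0 ord0 - t' ord0 ord0|)).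
  apply: interp1_lipschitz => k; rewrite mulrDl mul1r (le_trans (ler_normB _ _)) //.
  by rewrite lerD.
rewrite ler_wpM2l ?mulr_ge0 //.
by have := mx_entry_le (t - t') ord0 ord0; rewrite !mxE.
Qed.

Lemma floor_box m (t : 'rV[R]_m) (k : 'rV[int]_m) (q : nat) : `|t| <= q%:R ->
  (forall i, k ord0 i = Num.floor (t ord0 i) \/ k ord0 i = Num.floor (t ord0 i) + 1) ->
  `|ir k| <= q.+1%:R.
Proof.
move=> tq H; apply: mx_norm_le => // i j; rewrite mxE ord1 {i}.
have := le_trans (mx_entry_le t ord0 j) tq; rewrite !ler_norml => /andP[h1 h2].
have /andP[f1 f2] := floor_itv (t ord0 j).
have g1 : - q%:Z <= Num.floor (t ord0 j) by rewrite floor_ge_int intrN.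
have g2 : Num.floor (t ord0 j) <= q%:Z by rewrite -(ler_int R) (le_trans f1).
have e1 : q.+1%:R = (q.+1%:Z)%:~R :> R by [].
by rewrite e1 -intrN !ler_int; case: (H j) => ->; lia.
Qed.

Lemma interp_lipschitz_local m (f : 'rV[int]_m -> W) (e : R) (q : nat) :
  (forall k, `|ir k| <= q.+1%:R -> `|f k| <= e) -> 0 <= e ->
  forall t t', `|t| <= q%:R -> `|t'| <= q%:R -> `|interp f t - interp f t'| <= 2 * e * m%:R * `|t - t'|.
Proof.
move=> fe e0 t t' tq tq'; pose g k := if `|ir k| <= q.+1%:R then f k else 0.
have fg u : `|u| <= q%:R -> interp f u = interp g u.
  by move=> uq; apply: interp_local => k Hk; rewrite /g (floor_box uq Hk).
rewrite !fg //; apply: interp_lipschitz => k; rewrite /g; case: ifP => [|_]; first exact: fe.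
by rewrite normr0.
Qed.

(** The integer vectors of norm at most [q] are finite in number: their entries, shifted by [q], lie
    in an ordinal of size [2 q + 1]. *)
Lemma near_box m (Y : topologicalType) (P : 'rV[int]_m -> Y -> Prop) (y : Y) (q : nat) :
  (forall k, \forall z \near y, P k z) -> \forall z \near y, forall k, `|ir k| <= q%:R -> P k z.
Proof.
move=> H; pose D (e : 'rV['I_(q.*2.+1)]_m) : 'rV[int]_m := map_mx (fun i : 'I__ => i%:Z - q%:Z) e.
have : \forall z \near y, forall e, P (D e) z by apply: filter_forall => e; exact: H.
apply: filterS => z Hz k kq.
have kE i : 0 <= k ord0 i + q%:Z <= q.*2%:Z.
  have := le_trans (mx_entry_le (ir k) ord0 i) kq; rewrite mxE ler_norml.
  rewrite -[q%:R]/((q%:Z)%:~R) -!intrN !ler_int => /andP[h1 h2]; lia.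
have -> : k = D (\row_i inord (absz (k ord0 i + q%:Z)%R)); last exact: Hz.
apply/rowP => i; rewrite !mxE; have /andP[h1 h2] := kE i.
by rewrite inordK ?ltnS -?lez_nat gez0_abs // addrK.
Qed.

Lemma interp_continuous m (f : 'rV[int]_m -> R -> W) : (forall k, continuous (f k)) ->
  forall (t : 'rV[R]_m) (y eps : R), 0 < eps -> exists2 d : R, 0 < d & forall t' y',
    `|t' - t| < d -> `|y' - y| < d -> `|interp (f^~ y') t' - interp (f^~ y) t| <= eps.
Proof.
move=> fc t y eps eps0; pose q := (Num.truncn (`|t| + 1)).+1.
have tq : `|t| + 1 <= q%:R by rewrite ltW // truncnS_gt.
have [e e0 He] : exists2 e : R, 0 < e & forall k, `|ir k| <= q.+1%:R -> `|f k y| <= e.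
  pose e := \sum_(i : 'rV['I_(q.+1.*2.+1)]_m) `|f (map_mx (fun i : 'I__ => i%:Z - q.+1%:Z) i) y| + 1.
  exists e; first by rewrite ltr_wpDl // sumr_ge0.
  have h (i : 'rV['I_(q.+1.*2.+1)]_m) : `|f (map_mx (fun i : 'I__ => i%:Z - q.+1%:Z) i) y| <= e.
    by rewrite /e (bigD1 i) //= -addrA lerDl addr_ge0 // sumr_ge0.
  have /(_ y) N := @near_box m R (fun k _ => `|f k y| <= e).
  move=> k kq; have kE i : 0 <= k ord0 i + q.+1%:Z <= q.+1.*2%:Z.
    have := le_trans (mx_entry_le (ir k) ord0 i) kq; rewrite mxE ler_norml.
    rewrite -[q.+1%:R]/((q.+1%:Z)%:~R) -!intrN !ler_int => /andP[h1 h2]; lia.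
  have -> : k = map_mx (fun i : 'I_(q.+1.*2.+1) => (nat_of_ord i)%:Z - q.+1%:Z) (\row_i inord (absz (k ord0 i + q.+1%:Z)%R)).
    by apply/rowP => i; rewrite !mxE; have /andP[h1 h2] := kE i; rewrite inordK ?ltnS -?lez_nat gez0_abs // addrK.
  exact: h.
have : \forall y' \near y, forall k, `|ir k| <= q.+1%:R -> `|f k y' - f k y| <= eps / 2.
  apply: near_box => k; move/cvgrPdistC_le: (fc k y) => /(_ (eps / 2)); apply; lra.
move=> /near_ball_ex[d1 d10 Hd1].
pose L := 2 * e * m%:R + 1; have L0 : 0 < L by rewrite ltr_wpDl // !mulr_ge0 // ltW.
exists (Num.min (Num.min 1 d1) (eps / 2 / L)); first by rewrite !lt_min ltr01 d10 !divr_gt0.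
move=> t' y'; rewrite !lt_min => /andP[/andP[t1 _] t2] /andP[/andP[_ y1] _].
have t'q : `|t'| <= q%:R.
  rewrite -(subrK t t') (le_trans (ler_normD _ _)) //; lra.
have tq' : `|t| <= q%:R by lra.
rewrite -(subrK (interp (f^~ y) t') (interp (f^~ y') t')) -addrA (le_trans (ler_normD _ _)) //.
have h1 : `|interp (f^~ y') t' - interp (f^~ y) t'| <= eps / 2.
  rewrite -interpB; apply: interp_norm_le => k Hk; apply: Hd1; first by rewrite distrC.
  exact: floor_box Hk.
have h2 := interp_lipschitz_local He (ltW e0) t'q tq'.
have h3 : 2 * e * m%:R * `|t' - t| <= L * (eps / 2 / L).
  by rewrite ler_pM ?mulr_ge0 ?(ltW e0) // /L ?lerDl // ltW.
by move: h3; rewrite [L * _]mulrC mulfVK ?gt_eqF //; lra.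
Qed.

End Interpolation.

Lemma interp_linear {R : realType} {m q} (A : 'M[R]_(m, q)) (t : 'rV[R]_m) :
  interp (fun k => ir k *m A : 'rV[R]_q) t = t *m A.
Proof.
elim: m A t => [|m IH] A t /=.
  by apply/rowP => j; rewrite !mxE !big_ord0.
have E (z : R) (k : 'rV[R]_m) : consz z k *m A = z *: row ord0 A + k *m (\matrix_(i, j) A (lift ord0 i) j).
  apply/rowP => j; rewrite !mxE big_ord_recl consz0; congr (_ * _ + _).
  by apply: eq_bigr => i _; rewrite !mxE liftK.
have irc z k : ir (consz z k) = consz z%:~R (ir k) :> 'rV[R]_m.+1.
  by apply/rowP => j; rewrite !mxE; case: unliftP => [i _|_]; rewrite ?mxE.
have h z : interp (fun k => ir (consz z k) *m A : 'rV[R]_q) (tailz t) =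
   z%:~R *: row ord0 A + tailz t *m (\matrix_(i, j) A (lift ord0 i) j).
  have -> : (fun k => ir (consz z k) *m A : 'rV[R]_q) =
     (fun k => ir k *m (\matrix_(i, j) A (lift ord0 i) j) - (- (z%:~R *: row ord0 A))).
    by apply/funext => k; rewrite irc E opprK addrC.
  by rewrite interpB IH interp_cst opprK addrC.
rewrite -[in RHS](consz_tail t) E /interp1 !h intrD.
set x := t ord0 ord0; set u := row _ _; set v := _ *m _.
by apply/rowP => j; rewrite !mxE; ring.
Qed.

Lemma interp_lt {R : realType} {m} (f g : 'rV[int]_m -> R^o) (t : 'rV[R]_m) :
  (forall k, f k < g k) -> interp f t < interp g t.
Proof.
elim: m f g t => [|m IH] f g t fg //=; rewrite !interp1_comb.
set a := fun z => interp (fun k => f (consz z k)) (tailz t).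
set b := fun z => interp (fun k => g (consz z k)) (tailz t).
have ab z : a z < b z by apply: IH.
have /andP[x0 x1] := frac01 (t ord0 ord0); set s := _ - _ in x0 x1 *; set z := Num.floor _.
change ((1 - s) * a z + s * a (z + 1) < (1 - s) * b z + s * b (z + 1)).
have a1 := ab z; have a2 := ab (z + 1); move: a1 a2; move: (a z) (a (z + 1)) (b z) (b (z + 1)) => p q u v pu qv.
have [s0|] := ltP 0 s; last by move=> s0; have -> : s = 0 by [lra]; lra.
have h1 : s * q < s * v by rewrite ltr_pM2l.
have h2 : (1 - s) * p <= (1 - s) * u by rewrite ler_wpM2l ?subr_ge0 // ltW.
lra.
Qed.

(** * Cocycles over an action of Z^m on an interval *)

Lemma box_enum {R : realType} m (q : nat) : exists s : seq 'rV[int]_m,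
  forall k : 'rV[int]_m, `|ir k : 'rV[R]_m| <= q%:R -> k \in s.
Proof.
pose D (e : 'rV['I_(q.*2.+1)]_m) : 'rV[int]_m := map_mx (fun i : 'I_(q.*2.+1) => (nat_of_ord i)%:Z - q%:Z) e.
exists [seq D e | e <- enum {: 'rV['I_(q.*2.+1)]_m}] => k kq.
have kE i : 0 <= k ord0 i + q%:Z <= q.*2%:Z.
  have := le_trans (mx_entry_le (ir k) ord0 i) kq; rewrite mxE ler_norml.
  rewrite -[q%:R]/((q%:Z)%:~R) -!intrN !ler_int => /andP[h1 h2]; lia.
apply/mapP; exists (\row_i inord (absz (k ord0 i + q%:Z)%R)); first by rewrite mem_enum.
apply/rowP => i; rewrite !mxE; have /andP[h1 h2] := kE i.
by rewrite inordK ?ltnS -?lez_nat gez0_abs // addrK.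
Qed.

Lemma seq_uniform {T : eqType} {R : realType} (s : seq T) (P : T -> R -> Prop) :
  (forall t x y, x <= y -> P t x -> P t y) -> (forall t, exists x, P t x) ->
  exists2 x : R, 0 < x & forall t, t \in s -> P t x.
Proof.
move=> Pm Pex; elim: s => [|t s [x x0 IH]]; first by exists 1.
have [y Py] := Pex t; exists (Num.max x y); first by rewrite lt_max x0.
move=> t'; rewrite inE => /orP[/eqP ->|/IH Px].
  by apply: Pm Py; rewrite le_max lexx orbT.
by apply: Pm Px; rewrite le_max lexx.
Qed.

Lemma segment_bounded {R : realType} {W : normedModType R} (f : R -> W) (a b : R) :
  continuous f -> exists2 B : R, 0 < B & forall y, a <= y <= b -> `|f y| <= B.
Proof.
move=> fc; have : compact (f @` `[a, b]).
  by apply: continuous_compact; [exact: continuous_subspaceT|exact: segment_compact].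
move=> /compact_bounded[B [_ HB]]; exists (`|B| + 1); first by rewrite ltr_wpDl.
move=> y yab; apply: (HB (`|B| + 1)).
  by rewrite (le_lt_trans (ler_norm _)) // ltrDl.
by exists y => //=; rewrite in_itv.
Qed.

Lemma segment_uniform {R : realType} {W : normedModType R} (f : R -> W) (a b eps : R) :
  continuous f -> 0 < eps -> exists2 d : R, 0 < d &
  forall y y', a <= y <= b -> `|y - y'| < d -> `|f y - f y'| <= eps.
Proof.
move=> fc eps0.
have : \forall d \near 0^'+, `[a, b] `<=` (fun y => forall y', `|y - y'| < d -> `|f y - f y'| <= eps).
  move/compact_near_coveringP: (@segment_compact R a b) => /(_ R 0^'+
    (fun d y => forall y', `|y - y'| < d -> `|f y - f y'| <= eps)); apply => y yab.
  have e2 : 0 < eps / 2 by rewrite divr_gt0.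
  move/cvgrPdist_le: (fc y) => /(_ _ e2) /near_ball_ex[r r0 Hr].
  exists ([set z | `|y - z| < r / 2], [set d | d <= r / 2]).
    split; first by apply: (@near_dist_lt R R^o y (r / 2)); rewrite divr_gt0.
    by apply: nbhs_right_le; rewrite divr_gt0.
  move=> [z d] /= [yz dr] y' zy'.
  have h1 : `|f y - f z| <= eps / 2 by apply: Hr; lra.
  have h2 : `|f y - f y'| <= eps / 2.
    by apply: Hr; have := ler_normD (y - z) (z - y'); rewrite addrA subrK; lra.
  by have := ler_normD (f z - f y) (f y - f y'); rewrite addrA subrK [`|f z - f y|]distrC; lra.
move=> /near_right_ex[d d0 Hd]; exists d => // y y' yab; apply: Hd.
by rewrite /= in_itv.
Qed.

Lemma additive_int_row {U : zmodType} m (f : 'rV[int]_m -> U) :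
  (forall k l, f (k + l) = f k + f l) -> forall k, f k = \sum_i f (delta_mx 0 i) *~ k ord0 i.
Proof.
move=> fD k.
have f0 : f 0 = 0 by apply: (addrI (f 0)); rewrite -fD !addr0.
have fN u : f (- u) = - f u by apply: (addrI (f u)); rewrite -fD !subrr.
have fn u (n : nat) : f (u *+ n) = f u *+ n by elim: n => [|n IH]; rewrite ?mulr0n // !mulrS fD IH.
have fz u (z : int) : f (z *: u) = f u *~ z.
  have fp (n : nat) : f (n%:Z *: u) = f u *+ n by rewrite -[n%:Z]natz scaler_nat fn.
  by case: z => n; rewrite ?fp // NegzE scaleNr fN fp.
rewrite {1}(row_sum_delta k) (big_morph f fD f0); apply: eq_bigr => i _; exact: fz.
Qed.

Lemma closed_fixed_points {R : realType} (f : R -> R) : continuous f -> closed [set y | f y = y].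
Proof.
move=> fc y cy; apply: contrapT => /eqP fy.
have d0 : 0 < `|f y - y| by rewrite normr_gt0 subr_eq0.
have gc : (fun z => f z - z) @ y --> f y - y by apply: cvgB; [exact: fc|exact: cvg_id].
move/cvgrPdist_lt: gc => /(_ _ d0) /cy[z [/= -> ]].
by rewrite subrr subr0 ltxx.
Qed.

Lemma inf_lower_bound {R : realType} (S : set R) x : has_inf S -> S x -> inf S <= x.
Proof. by move=> [_ lS] Sx; exact: ge_inf. Qed.

Lemma closed_sup {R : realType} (S : set R) : closed S -> has_sup S -> S (sup S).
Proof.
move=> cS supS; apply: cS => B [e /= e0 eB].
have [x Sx xe] := sup_adherent e0 supS; exists x; split => //; apply: eB => /=.
rewrite ger0_norm ?subr_ge0; last exact: sup_upper_bound.
by move: xe; lra.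
Qed.

Lemma closed_inf {R : realType} (S : set R) : closed S -> has_inf S -> S (inf S).
Proof.
move=> cS infS; apply: cS => B [e /= e0 eB].
have [x Sx xe] := inf_adherent e0 infS; exists x; split => //; apply: eB => /=.
rewrite distrC ger0_norm ?subr_ge0; last exact: (inf_lower_bound infS).
by move: xe; lra.
Qed.

Lemma expanding_unit {R : realType} {m : nat} (Z : 'M[R]_m) (K : R) :
  (forall w : 'rV[R]_m, `|w| <= K * `|w *m Z|) -> Z \in unitmx.
Proof.
move=> H; rewrite -row_free_unit -kermx_eq0; apply/eqP/row_matrixP => i; rewrite row0.
by apply/eqP; rewrite -normr_le0 (le_trans (H _)) // -row_mul mulmx_ker row0 normr0 mulr0.
Qed.

(** By Poincaré-Miranda, from any value of [f] every target within [(2 * K)^-1] is reached,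
    uniformly in [t]. Steps of that length along the segment from [f 0] reach any [v]. *)
Lemma near_linear_onto {R : realType} {m : nat} (f : 'rV[R]_m -> 'rV[R]_m) (K : R) : 0 < K -> continuous f ->
  (forall t, exists2 Z : 'M[R]_m, forall w : 'rV[R]_m, `|w| <= K * `|w *m Z| &
    forall d, `|d| <= 1 -> `|f (t + d) - f t - d *m Z| <= (2 * K)^-1 * `|d|) ->
  forall v, exists t, f t = v.
Proof.
move=> K0 fc H; have K20 : 0 < 2 * K by lra.
have loc t v : `|v - f t| <= (2 * K)^-1 -> exists t', f t' = v.
  have [Z HZ Hd] := H t; have Zu := expanding_unit HZ.
  move=> vt; pose w := (v - f t) *m invmx Z.
  have w1 : `|w| <= 1 / 2.
    apply: (le_trans (HZ _)); rewrite mulmxKV //.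
    by rewrite mulrC -ler_pdivlMr // (le_trans vt) // invfM mul1r.
  pose g (d : 'rV[R]_m) : 'rV[R]_m := (f (t + d) - f t) *m invmx Z - w.
  have gd (d : 'rV[R]_m) i : `|d| <= 1 -> d ord0 i - 1 <= g d ord0 i <= d ord0 i + 1.
    move=> d1; have h : `|g d + w - d| <= 1 / 2.
      rewrite subrK; apply: (le_trans (HZ _)); rewrite mulmxBl mulmxKV //.
      rewrite mulrC -ler_pdivlMr //; apply: (le_trans (Hd d d1)).
      by rewrite invfM mul1r -[leRHS]mulr1 ler_wpM2l // mulr_ge0 ?invr_ge0 ?ltW.
    have := le_trans (mx_entry_le _ ord0 i) h; have := le_trans (mx_entry_le _ ord0 i) w1.
    by rewrite !mxE !ler_norml => /andP[h1 h2] /andP[h3 h4]; lra.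
  have gc : continuous g.
    move=> d; have FF := @nbhs_filter 'rV[R]_m d.
    apply: (@cvgB _ _ _ (nbhs d) _ _ (fun=> w)); [|exact: cvg_cst].
    have h1 : (fun d => t + d) @ d --> t + d by apply: cvgD; [exact: cvg_cst|exact: cvg_id].
    have h2 : f @ (t + d) --> f (t + d) by exact: fc.
    have h3 : (fun d => f (t + d)) @ d --> f (t + d) by exact: (cvg_comp _ _ h1 h2).
    have h4 : (fun d => f (t + d) - f t) @ d --> f (t + d) - f t by apply: cvgB h3 _; exact: cvg_cst.
    by apply: cvg_mulmx h4 _; exact: cvg_cst.
  have [||d _ gd0] := poincare_miranda (ltr01 : 0 < 1 :> R) gc.
  - by move=> d i d1 di; have /andP[_] := gd d i d1; rewrite di; lra.
  - by move=> d i d1 di; have /andP[+ _] := gd d i d1; rewrite di; lra.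
  exists (t + d); move/eqP: gd0; rewrite /g /w -mulmxBl => /eqP h.
  have : f (t + d) - f t - (v - f t) = 0 by rewrite -[LHS](mulmxKV Zu) h mul0mx.
  by rewrite opprB addrA subrK => /eqP; rewrite subr_eq0 => /eqP.
move=> v; pose r := (2 * K)^-1; have r0 : 0 < r by rewrite invr_gt0.
have [n] : exists n : nat, `|v - f 0| <= n%:R * r.
  by exists (Num.truncn (`|v - f 0| / r)).+1; rewrite -ler_pdivrMr // ltW // truncnS_gt.
elim: n v => [|n IH] v; first by rewrite mul0r normr_le0 subr_eq0 => /eqP ->; exists 0.
move=> vn; pose v' := f 0 + (n%:R / n.+1%:R) *: (v - f 0).
have n0 : 0 < n.+1%:R :> R by rewrite ltr0n.
have [|t ft] := IH v'.
  rewrite /v' addrAC subrr add0r normrZ ger0_norm ?divr_ge0 // mulrAC ler_pdivrMr //.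
  by rewrite mulrAC -mulrA ler_wpM2l // mulrC.
apply: (loc t); rewrite ft /v'.
have -> : v - (f 0 + (n%:R / n.+1%:R) *: (v - f 0)) = n.+1%:R^-1 *: (v - f 0).
  by apply/rowP => j; rewrite !mxE -natr1; field; rewrite natr1 gt_eqF.
by rewrite normrZ normfV normr_nat mulrC ler_pdivrMr // mulrC.
Qed.

Lemma continuous_dist {R : realType} {W : normedModType R} (f : R -> W) (x eps : R) : continuous f -> 0 < eps ->
  exists2 d : R, 0 < d & forall y, `|y - x| < d -> `|f y - f x| <= eps.
Proof.
move=> fc e0; have h : f @ x --> f x by exact: fc.
have n : \forall y \near (x : R^o), `|f x - f y| <= eps by move/cvgrPdist_le: h; exact.
have [d d0 H] := near_ball_ex n.
by exists d => // y yx; rewrite distrC; apply: H; rewrite distrC.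
Qed.

(** All visits lie in the window of length [J] that begins with the first one. *)
Lemma count_gap (b : nat -> bool) (J : nat) : (forall j j', b j -> (j + J <= j')%N -> ~~ b j') ->
  forall L, (\sum_(j < L) b j <= J)%N.
Proof.
move=> H L; rewrite -(big_mkord xpredT (fun j => nat_of_bool (b j))) /index_iota subn0.
have -> : (\sum_(j <- iota 0 L) b j)%N = size [seq j <- iota 0 L | b j].
  by rewrite size_filter -sum1_count [RHS]big_mkcond /=; apply: eq_bigr => j _; case: (b j).
case E : [seq j <- iota 0 L | b j] => [|j0 s] //.
have exb : exists j, b j by exists j0; have : j0 \in [seq j <- iota 0 L | b j] by [rewrite E mem_head]; rewrite mem_filter => /andP[].
case: (ex_minnP exb) => j1 bj1 jmin; rewrite -E -(size_iota j1 J); apply: uniq_leq_size.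
  by rewrite filter_uniq // iota_uniq.
move=> j; rewrite mem_filter !mem_iota => /andP[bj _]; apply/andP; split; first exact: jmin.
by rewrite ltnNge; apply/negP => h; have := H _ _ bj1 h; rewrite bj.
Qed.

(* [lra] inspects the whole context, which is expensive below. *)
Ltac qlra := first [solve [repeat match goal with
  | H : is_true (Order.le _ _) |- _ => revert H
  | H : is_true (Order.lt _ _) |- _ => revert H
  | H : is_true (_ && _) |- _ => revert H
  | H : @eq (Real.sort _) _ _ |- _ => revert H
  end; clear; intros; lra] | lra].

(** The lattice acts on [[a, b]] × R^m through [psi] on heights and the cocycle [c] on vectors;
    [sa_proper] and [sa_dense] are its properness and cocompactness, uniform in the height. *)
Record strip_action {R : realType} {m : nat} (psi : 'rV[int]_m -> R -> R)
    (c : 'rV[int]_m -> R -> 'rV[R]_m) (a b : R) : Prop := StripAction {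
  sa_lt : a < b;
  sa_psi0 : forall y, psi 0 y = y;
  sa_psiD : forall k l y, psi (k + l) y = psi k (psi l y);
  sa_psi_cont : forall k, continuous (psi k);
  sa_psi_incr : forall k x y, x < y -> psi k x < psi k y;
  sa_psi_a : forall k, psi k a = a;
  sa_psi_b : forall k, psi k b = b;
  sa_cD : forall k l y, c (k + l) y = c k (psi l y) + c l y;
  sa_c_cont : forall k, continuous (c k);
  sa_proper : forall r : R, exists N : R, forall k y, a <= y <= b -> `|c k y| <= r -> `|ir k : 'rV[R]_m| <= N;
  sa_dense : exists r : R, forall y (v : 'rV[R]_m), a <= y <= b -> exists k, `|v - c k y| <= r
}.

Section Strip.
Context {R : realType} {m : nat}.
Variables (psi : 'rV[int]_m -> R -> R) (c : 'rV[int]_m -> R -> 'rV[R]_m) (a b : R).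
Hypothesis SA : strip_action psi c a b.
Notation e i := (delta_mx 0 i : 'rV[int]_m).
Let ab := sa_lt SA.
Let psi0 := sa_psi0 SA.
Let psiD := sa_psiD SA.
Let psi_cont := sa_psi_cont SA.
Let psi_incr := sa_psi_incr SA.
Let psi_a := sa_psi_a SA.
Let psi_b := sa_psi_b SA.
Let cD := sa_cD SA.
Let c_cont := sa_c_cont SA.
Let c_proper := sa_proper SA.
Let c_dense := sa_dense SA.

Lemma psiK k y : psi (- k) (psi k y) = y.
Proof. by rewrite -psiD addNr psi0. Qed.

Lemma psiNK k y : psi k (psi (- k) y) = y.
Proof. by rewrite -psiD subrr psi0. Qed.

Lemma psi_fixN k y : psi k y = y -> psi (- k) y = y.
Proof. by move=> h; rewrite -{1}h psiK. Qed.

Lemma psiC k l y : psi k (psi l y) = psi l (psi k y).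
Proof. by rewrite -!psiD addrC. Qed.

Lemma psi_le k x y : x <= y -> psi k x <= psi k y.
Proof. by rewrite le_eqVlt => /orP[/eqP ->|/(psi_incr k)/ltW]. Qed.

Lemma psi_ab k y : a <= y <= b -> a <= psi k y <= b.
Proof. by move=> /andP[h1 h2]; rewrite -{1}(psi_a k) -{1}(psi_b k) !psi_le. Qed.

Lemma c0 y : c 0 y = 0.
Proof. by apply: (addIr (c 0 y)); rewrite add0r -{1}(psi0 y) -cD addr0. Qed.

(** The Milnor-Švarc argument: the vector [c k y] is cut into unit steps, each approximated within
    [r] by a lattice element. Consecutive elements differ by one whose cocycle value is at most
    [2 * r + 1], hence of norm at most [N]. *)
Lemma quasi_isometry : exists2 K : R, 0 < K & forall k y, a <= y <= b ->
  `|ir k : 'rV[R]_m| <= K * (`|c k y| + 1).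
Proof.
have [r Hr] := c_dense; have [N0 HN0] := c_proper (2 * r + 1).
have r0 : 0 <= r.
  by have [k hk] := Hr a 0 (ltac:(by rewrite lexx ltW)); exact: le_trans hk.
pose N := `|N0| + 1; have N_gt0 : 0 < N by rewrite ltr_wpDl.
have HN k y : a <= y <= b -> `|c k y| <= 2 * r + 1 -> `|ir k : 'rV[R]_m| <= N.
  by move=> yab h; rewrite (le_trans (HN0 k y yab h)) // (le_trans (ler_norm _)) // lerDl.
exists (3 * N); first by rewrite mulr_gt0.
move=> k y yab; set v := c k y.
pose q := (Num.truncn `|v|).+1.
have qv : `|v| <= q%:R by rewrite ltW // truncnS_gt.
have q0 : 0 < q%:R :> R by rewrite ltr0n.
have step i : exists2 k', `|(i%:R / q%:R) *: v - c k' y| <= r & `|ir k' : 'rV[R]_m| <= i%:R * N.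
  elim: i => [|i [k' h1 h2]].
    by exists 0; rewrite ?c0 ?mul0r ?scale0r ?subrr ?normr0 // ir0 normr0.
  have [k2 h3] := Hr y ((i.+1%:R / q%:R) *: v) yab; exists k2 => //.
  have h4 : `|ir (k2 - k') : 'rV[R]_m| <= N.
    apply: (HN _ (psi k' y)); first exact: psi_ab.
    have -> : c (k2 - k') (psi k' y) = c k2 y - c k' y.
      by apply/eqP; rewrite eq_sym subr_eq -cD subrK.
    have -> : c k2 y - c k' y = ((i.+1%:R / q%:R) *: v - (i%:R / q%:R) *: v)
        + (((i%:R / q%:R) *: v - c k' y) - ((i.+1%:R / q%:R) *: v - c k2 y)).
      by apply/rowP => j; rewrite !mxE; ring.
    have h5 : `|(i.+1%:R / q%:R) *: v - (i%:R / q%:R) *: v| <= 1.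
      rewrite -scalerBl -mulrBl -natr1 addrAC subrr add0r normrZ mul1r ger0_norm ?invr_ge0 ?ltW //.
      by rewrite mulrC ltr_pdivrMr // mul1r truncnS_gt.
    have := ler_normB ((i%:R / q%:R) *: v - c k' y) ((i.+1%:R / q%:R) *: v - c k2 y).
    have := ler_normD ((i.+1%:R / q%:R) *: v - (i%:R / q%:R) *: v) (((i%:R / q%:R) *: v - c k' y) - ((i.+1%:R / q%:R) *: v - c k2 y)).
    lra.
  rewrite -[k2](subrK k') irD (le_trans (ler_normD _ _)) //.
  by rewrite -natr1 mulrDl mul1r addrC lerD.
have [k' h1 h2] := step q.
have h4 : `|ir (k - k') : 'rV[R]_m| <= N.
  apply: (HN _ (psi k' y)); first exact: psi_ab.
  have -> : c (k - k') (psi k' y) = c k y - c k' y.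
    by apply/eqP; rewrite eq_sym subr_eq -cD subrK.
  by move: h1; rewrite divff ?gt_eqF // scale1r -/v; lra.
rewrite -[k](subrK k') irD (le_trans (ler_normD _ _)) //.
apply: (@le_trans _ _ (N + q%:R * N)); first by rewrite lerD.
have qle : q%:R <= `|v| + 1 by rewrite /q -natr1 lerD2r truncn_le.
have : q%:R * N <= (`|v| + 1) * N by rewrite ler_wpM2r // ltW.
have : 0 <= `|v| * N by rewrite mulr_ge0 // ltW.
move: N_gt0; set x := `|v|; move: (q%:R * N) => Q; nra.
Qed.

Definition fixed (y : R) := forall k, psi k y = y.

(** At a common fixed height the cocycle is a homomorphism, and this is its matrix. *)
Definition end_matrix (y : R) : 'M[R]_m := \matrix_i c (delta_mx 0 i) y.

Lemma c_fixed y k : fixed y -> c k y = ir k *m end_matrix y.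
Proof.
move=> fy; rewrite (@additive_int_row _ m (fun k => c k y)); last first.
  by move=> k' l; rewrite cD fy.
rewrite mulmx_sum_row; apply: eq_bigr => i _; rewrite rowK mxE scaler_int //.
Qed.

Lemma end_matrix_bound : exists2 B : R, 0 < B & forall y, a <= y <= b -> `|end_matrix y| <= B.
Proof.
have [|t|B B0 HB] := @seq_uniform _ R (enum 'I_m) (fun i B => forall y, a <= y <= b -> `|c (delta_mx 0 i) y| <= B).
- by move=> t x y xy H z zab; exact: le_trans (H z zab) xy.
- by have [B _ H] := segment_bounded a b (@c_cont (delta_mx 0 t)); exists B.
exists B => // y yab; apply: mx_norm_le => [|i j]; first exact: ltW.
by rewrite mxE (le_trans (mx_entry_le _ _ _)) // HB ?mem_enum.
Qed.

(** The closure of a gap in the set of common fixed heights, or a single such height when [al = be];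
    the blocks cover [[a, b]]. *)
Definition block (al be : R) : Prop :=
  [/\ a <= al, al <= be, be <= b, fixed al & fixed be] /\ forall x, al < x < be -> ~ fixed x.

Lemma fixed_closed : closed [set y | fixed y].
Proof.
have -> : [set y | fixed y] = \bigcap_(k in setT) [set y | psi k y = y].
  by apply/seteqP; split => y /= H k; [move=> _; exact: H|exact: (H k I)].
by apply: closed_bigI => k _; apply: closed_fixed_points; exact: psi_cont.
Qed.

Lemma block_exists y : a <= y <= b -> exists al be, block al be /\ al <= y <= be.
Proof.
move=> /andP[ay yb].
pose S := [set x | fixed x /\ x <= y]; pose T := [set x | fixed x /\ y <= x].
have supS : has_sup S by split; [exists a; split|exists y => x []].
have infT : has_inf T by split; [exists b; split|exists y => x []].
have cS : closed S by apply: closedI; [exact: fixed_closed|exact: closed_le].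
have cT : closed T by apply: closedI; [exact: fixed_closed|exact: closed_ge].
have [fS Sy] : S (sup S) by exact: closed_sup.
have [fT Ty] : T (inf T) by exact: closed_inf.
exists (sup S), (inf T); split; last by rewrite Sy.
split; first split => //.
- by apply: sup_upper_bound.
- exact: le_trans Sy Ty.
- by apply: inf_lower_bound.
move=> x /andP[x1 x2] fx; have [xy|yx] := leP x y.
  by have := sup_upper_bound supS (conj fx xy); rewrite leNgt x1.
by have := inf_lower_bound infT (conj fx (ltW yx)); rewrite leNgt x2.
Qed.

Lemma psi_block al be k y : block al be -> al <= y <= be -> al <= psi k y <= be.
Proof.
by move=> [[_ _ _ fa fb] _] /andP[h1 h2]; rewrite -{1}(fa k) -{1}(fb k) !psi_le.
Qed.

(* If every basis element has a fixed point in the block, moving a common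
   fixed point of some of them towards a fixed point of the next one yields
   a common fixed point of all of them. *)
Lemma free_direction al be : block al be -> al < be ->
  exists i : 'I_m, forall x, al < x < be -> psi (delta_mx 0 i) x <> x.
Proof.
move=> blk albe; apply: contrapT => H.
have Hz i : exists z, al < z < be /\ psi (delta_mx 0 i) z = z.
  apply: contrapT => nz; apply: H; exists i => x xab xE; apply: nz; by exists x.
have extremal (F : set R) (g h : R -> R) x z : closed F -> (forall u, F u -> F (g u)) -> (forall u, F u -> F (h u)) ->
    (forall u v, u <= v -> g u <= g v) -> (forall u v, u <= v -> h u <= h v) -> cancel g h -> cancel h g ->
    g z = z -> F x -> exists u, [/\ F u, g u = u & Num.min x z <= u <= Num.max x z].
  move=> Fc Fg Fh gm hm gh hg gz Fx; have hz : h z = z by rewrite -{1}gz gh.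
  have [xz|/ltW zx] := leP x z.
    pose S := [set u | F u /\ u <= z].
    have supS : has_sup S by split; [exists x; split|exists z => u []].
    have cS : closed S by apply: closedI => //; exact: closed_le.
    have [FS Sz] : S (sup S) by exact: closed_sup.
    exists (sup S); split => //; last by rewrite Sz (sup_upper_bound supS).
    have g1 : g (sup S) <= sup S by apply: (sup_upper_bound supS); split; [exact: Fg|rewrite -gz gm].
    have h1 : h (sup S) <= sup S by apply: (sup_upper_bound supS); split; [exact: Fh|rewrite -hz hm].
    by apply/eqP; rewrite eq_le g1 -{1}(hg (sup S)) gm.
  pose S := [set u | F u /\ z <= u].
  have infS : has_inf S by split; [exists x; split|exists z => u []].
  have cS : closed S by apply: closedI => //; exact: closed_ge.
  have [FS Sz] : S (inf S) by exact: closed_inf.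
  exists (inf S); split => //; last by rewrite Sz /= (inf_lower_bound infS).
  have g1 : inf S <= g (inf S) by apply: (inf_lower_bound infS); split; [exact: Fg|rewrite -gz gm].
  have h1 : inf S <= h (inf S) by apply: (inf_lower_bound infS); split; [exact: Fh|rewrite -hz hm].
  by apply/eqP; rewrite eq_le g1 andbT -{2}(hg (inf S)) gm.
have common (r : nat) : exists x, al < x < be /\ forall i : 'I_m, (i < r)%N -> psi (delta_mx 0 i) x = x.
  elim: r => [|r [x [xab xr]]]; first by exists ((al + be) / 2); split => //; lra.
  have [rm|mr] := ltnP r m; last first.
    by exists x; split => // i _; apply: xr; exact: leq_trans (ltn_ord i) mr.
  pose i0 := Ordinal rm; have [z [zab zE]] := Hz i0.
  pose F := [set u | forall i : 'I_m, (i < r)%N -> psi (delta_mx 0 i) u = u].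
  have Fc : closed F.
    have -> : F = \bigcap_(i in [set i : 'I_m | (i < r)%N]) [set u | psi (delta_mx 0 i) u = u].
      by apply/seteqP; split => u /= Hu i ir_; exact: Hu.
    by apply: closed_bigI => i _; apply: closed_fixed_points; exact: psi_cont.
  have [||||||||u [Fu uE ub]] := extremal F (psi (delta_mx 0 i0)) (psi (- delta_mx 0 i0)) x z Fc.
  - by move=> u Fu i ir_; rewrite psiC Fu.
  - by move=> u Fu i ir_; rewrite psiC Fu.
  - exact: psi_le.
  - exact: psi_le.
  - exact: psiK.
  - exact: psiNK.
  - exact: zE.
  - exact: xr.
  exists u; split.
    move: ub xab zab => /andP[u1 u2] /andP[x1 x2] /andP[z1 z2].
    by rewrite (lt_le_trans _ u1) ?lt_min ?x1 // (le_lt_trans u2) // gt_max x2.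
  move=> i; rewrite ltnS leq_eqVlt => /orP[/eqP ir_|]; last exact: Fu.
  by have -> : i = i0 by exact: val_inj.
have [x [xab xm]] := common m.
apply: (proj2 blk x xab) => k.
have fixe i : psi (delta_mx 0 i) x = x by apply: xm.
have fixD u v : psi u x = x -> psi v x = x -> psi (u + v) x = x by move=> hu hv; rewrite psiD hv.
have fixz u (z : int) : psi u x = x -> psi (z *: u) x = x.
  have fixn (n : nat) : psi u x = x -> psi (n%:Z *: u) x = x.
    move=> hu; elim: n => [|n IH]; first by rewrite scale0r psi0.
    have -> : n.+1%:Z *: u = n%:Z *: u + u by rewrite intS scalerDl scale1r addrC.
    exact: fixD.
  by case: z => n hu; [exact: fixn|rewrite NegzE scaleNr; apply: psi_fixN; exact: fixn].
rewrite (row_sum_delta k); elim/big_ind: _ => //.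
by move=> i _; exact: fixz.
Qed.

(** Otherwise the increasing orbit would have a supremum below [be], and that supremum would be
    fixed by [k]. *)
Lemma orbit_escapes al be (k : 'rV[int]_m) y (d : R) : fixed be -> 0 < d ->
  (forall x, al < x < be -> psi k x <> x) -> al < y < be -> y < psi k y ->
  exists J : nat, forall j, (J <= j)%N -> be - d < psi (k *+ j) y.
Proof.
move=> fbe d0 free /andP[aly ybe] yk.
have up j : psi (k *+ j) y <= psi (k *+ j.+1) y.
  by rewrite mulrSr psiD ltW // psi_incr.
have mono i j : (i <= j)%N -> psi (k *+ i) y <= psi (k *+ j) y.
  move=> /subnK <-; elim: (j - i)%N => [|q IH]; first by rewrite add0n.
  exact: le_trans IH (up _).
have ltbe j : psi (k *+ j) y < be by rewrite -(fbe (k *+ j)) psi_incr.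
apply: contrapT => H.
have ub j : psi (k *+ j) y <= be - d.
  rewrite leNgt; apply/negP => h; apply: H; exists j => i ji.
  exact: lt_le_trans h (mono _ _ ji).
pose S := [set x | exists j, x = psi (k *+ j) y].
have supS : has_sup S by split; [exists y, 0%N; rewrite mulr0n psi0|exists (be - d) => _ [j ->]].
have Sj j : psi (k *+ j) y <= sup S by apply: (sup_upper_bound supS); exists j.
have Sbe : sup S <= be - d by apply: sup_le_ub => [|_ [j ->] //]; case: supS.
have yS : y < sup S by rewrite (lt_le_trans yk) // -[k in psi k]mulr1n.
apply: (free (sup S)); first by rewrite (lt_trans aly yS) /=; lra.
apply/eqP; rewrite eq_le; apply/andP; split.
  rewrite -[leRHS](psiNK k) (psi_le) //.
  apply: sup_le_ub => [|_ [j ->]]; first by case: supS.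
  rewrite -[leLHS](psiK k) (psi_le) //.
  by rewrite -psiD -mulrS.
apply: sup_le_ub => [|_ [j ->]]; first by case: supS.
apply: (le_trans (up j)); rewrite mulrS psiD (psi_le) //.
Qed.

Lemma upward_direction (k : 'rV[int]_m) y : psi k y <> y -> exists2 k', k' = k \/ k' = - k & y < psi k' y.
Proof.
move=> ky; have [up|down] := ltP y (psi k y); first by exists k; [left|].
exists (- k); first by right.
by rewrite -[ltLHS](psiK k) psi_incr // lt_neqAle down andbT; apply/eqP.
Qed.

Lemma fixed_near (N : nat) (k : 'I_N -> 'rV[int]_m) (x0 : R) (U : set R) : fixed x0 -> (\forall x \near x0, U x) ->
  exists2 d : R, 0 < d & forall x, `|x0 - x| < d -> forall j, U (psi (k j) x).
Proof.
move=> fx Ux; have FF := @nbhs_filter R^o x0.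
have H j : \forall x \near x0, U (psi (k j) x) by apply: (@psi_cont (k j) x0); rewrite fx.
have H2 := @filter_forall _ _ _ _ FF H; exact: near_ball_ex H2.
Qed.

Lemma free_dirP al be : exists i : option 'I_m, block al be -> al < be ->
  exists2 i', i = Some i' & forall x, al < x < be -> psi (e i') x <> x.
Proof.
have [[blk albe]|H] := pselect (block al be /\ al < be); last first.
  by exists None => blk albe; case: H.
have [i Hi] := free_direction blk albe.
by exists (Some i) => _ _; exists i.
Qed.

Definition middle (d al be y : R) := al + d <= y <= be - d.

(** There may be infinitely many blocks, so [J] comes from compactness of [[a, b]]. Within [d] of a
    common fixed height no point is in the middle of any block; near any other height the block does
    not change, and the escape time of one orbit serves its neighbours. *)
Lemma uniform_escape (d : R) : 0 < d -> exists J : nat, forall al be, block al be -> al < be ->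
  exists i : 'I_m, (forall x, al < x < be -> psi (e i) x <> x) /\
    forall y j, middle d al be y -> (J <= j)%N -> ~ middle d al be (psi (e i *+ j) y).
Proof.
(* A fixed-point-free direction is selected once for each block, so that the property [P], uniform
   over blocks, can refer to it. *)
move=> d0; have [fd fdP] := choice (fun albe : R * R => free_dirP albe.1 albe.2).
pose P (J : nat) y := forall al be i k j, block al be -> fd (al, be) = Some i -> k = e i \/ k = - e i ->
  y < psi k y -> middle d al be y -> (J <= j)%N -> ~ middle d al be (psi (k *+ j) y).
have : \forall J \near \oo, `[a, b] `<=` P J.
  move/compact_near_coveringP: (@segment_compact R a b) => /(_ nat \oo P); apply => y.
  rewrite /= in_itv /= => yab.
  have FF := nbhs_filter y.
  have [fy|nfy] := pselect (fixed y).
    exists ([set z | `|y - z| < d], setT).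
      by split; [exact: (@near_dist_lt R R^o y d d0)|exact: filterT].
    move=> [z J] /= [yz _] al be i k j [[_ _ _ fa fb] nofix] _ _ _ /andP[m1 m2].
    move: yz; rewrite ltr_norml => /andP[y1 y2].
    have yin : al < y < be by qlra.
    by case: (nofix y yin fy).
  have [al [be [blk /andP[aly ybe]]]] := block_exists yab.
  have [[h1 h2 h3 fa fb] nofix] := blk.
  have aly' : al < y by rewrite lt_neqAle aly andbT; apply: contra_notN nfy => /eqP <-.
  have ybe' : y < be by rewrite lt_neqAle ybe andbT; apply: contra_notN nfy => /eqP ->.
  have [i Ei free] := fdP (al, be) blk (lt_trans aly' ybe').
  have yin : al < y < be by rewrite aly' ybe'.
  have uniq al' be' z : block al' be' -> al' < z < be' -> al < z < be -> al' = al /\ be' = be.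
    move=> [[_ _ _ fa' fb'] nofix'] /andP[z1 z2] /andP[z3 z4].
    split; apply/eqP; rewrite eq_le !leNgt; apply/andP; split; apply/negP => h.
    - by apply: (nofix al') => //; rewrite h (lt_trans z1 z4).
    - by apply: (nofix' al) => //; rewrite h (lt_trans z3 z2).
    - by apply: (nofix' be) => //; rewrite h (lt_trans z1 z4).
    - by apply: (nofix be') => //; rewrite h (lt_trans z3 z2).
  have inside : \forall z \near y, al < z < be.
    by near=> z; apply/andP; split; near: z; [exact: lt_nbhsr|exact: lt_nbhsl].
  have [k kE lt] := upward_direction (free y yin).
  have kfree x : al < x < be -> psi k x <> x.
    by move=> /free fx kx; apply: fx; case: kE => h; rewrite -?h // -[e i]opprK -h; exact: psi_fixN.
  have [J HJ] := orbit_escapes (al := al) (d := d) fb d0 kfree yin lt.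
  have n1 : \forall z \near y, be - d < psi (k *+ J) z.
    by apply: (cvgr_gt _ (@psi_cont (k *+ J) y)); exact: HJ.
  have c2 : (fun z => psi k z - z) @ y --> psi k y - y by apply: cvgB; [exact: psi_cont|exact: cvg_id].
  have n2 : \forall z \near y, 0 < psi k z - z by apply: (cvgr_gt _ c2); rewrite subr_gt0.
  exists ([set z | [/\ al < z < be, be - d < psi (k *+ J) z & 0 < psi k z - z]], [set j | (J <= j)%N]).
    split; last by exists J.
    by near=> z; split; near: z.
  move=> [z J'] /= [[zin z1 z2] JJ'] al' be' i' k' j blk' Ei' kE' up mid J'j.
  have al'z : al' < z < be' by move: mid; rewrite /middle; qlra.
  have [ea eb] := uniq _ _ _ blk' al'z zin; move: Ei' mid; rewrite ea eb Ei => -[Ei'] mid.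
  rewrite subr_gt0 in z2.
  have {kE kE'} ek : k' = k.
    have nup : k' = - k -> k' = k by move=> E; move: up; rewrite E -{1}(psiK k z) ltNge psi_le ?ltW.
    by move: kE' nup; rewrite -Ei'; case: kE => -> [] -> //; rewrite ?opprK; apply.
  rewrite ek => /andP[_]; rewrite leNgt => /negP; apply; apply: (lt_le_trans z1).
  have := leq_trans JJ' J'j => /subnK <-; elim: (j - J)%N => [|q IH]; first by rewrite add0n.
  by apply: (le_trans IH); rewrite addSn mulrSr psiD ltW // psi_incr.
move=> [J _ /(_ J (leqnn J)) HJ]; have {}HJ y : a <= y <= b -> P J y by move=> h; apply: HJ; rewrite /= in_itv.
exists J => al be blk albe.
have [i Ei free] := fdP (al, be) blk albe; exists i; split => // y j mid Jj mid'.
have mid_ab z : middle d al be z -> a <= z <= b.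
  move: blk => [[h1 _ h3 _ _] _] /andP[m1 m2]; qlra.
have yin : al < y < be by move: mid; rewrite /middle; lra.
have [k kE up] := upward_direction (free y yin).
case: (kE) => E; first by apply: (HJ y (mid_ab _ mid) al be i k j) => //; rewrite E.
(* When the direction moves heights down, the path is read backwards from its last point. *)
apply: (HJ _ (mid_ab _ mid') al be i k j) => //.
  by rewrite psiC psi_incr.
by rewrite -psiD E mulNrn addNr psi0.
Unshelve. all: by end_near.
Qed.

Section Operators.
Context {W : normedModType R}.
Variable L : nat.

Definition average (i : 'I_m) (F : R -> W) (y : R) : W := L.+1%:R^-1 *: \sum_(j < L.+1) F (psi (e i *+ j) y).

Definition averages (s : seq 'I_m) (F : R -> W) : R -> W := foldr average F s.

Lemma averageB i F G y : average i (fun x => F x - G x) y = average i F y - average i G y.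
Proof. by rewrite /average sumrB scalerBr. Qed.

Lemma averagesB s F G y : averages s (fun x => F x - G x) y = averages s F y - averages s G y.
Proof.
elim: s y => [|i s IH] y //=; rewrite -averageB; congr average; exact/funext.
Qed.

Lemma average_psi i F l y : average i (F \o psi l) y = average i F (psi l y).
Proof.
by rewrite /average; congr (_ *: _); apply: eq_bigr => j _ /=; rewrite psiC.
Qed.

Lemma averages_psi s F l y : averages s (F \o psi l) y = averages s F (psi l y).
Proof.
elim: s y => [|i s IH] y //=; rewrite -average_psi; congr average; exact/funext.
Qed.

Lemma averageC i j F : average i (average j F) = average j (average i F).
Proof.
apply/funext => y; rewrite /average -!scaler_sumr [in RHS]exchange_big /=; congr (_ *: (_ *: _)).
by apply: eq_bigr => p _; apply: eq_bigr => q _; rewrite psiC.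
Qed.

(** The averages commute, so the escaping direction of the block at hand can be applied to [F]
    first. *)
Lemma averages_rem s i F : i \in s -> averages s F = averages (rem i s) (average i F).
Proof.
elim: s => [|j s IH] //=; rewrite inE; have [->|ji] := eqVneq i j.
  move=> _; elim: s {IH} => [|j' s IH] //=; by rewrite averageC IH.
by move=> /= /IH ->.
Qed.

Lemma average_cont i F : continuous F -> continuous (average i F).
Proof.
move=> Fc y; rewrite /average.
have : (fun y => \sum_(j < L.+1) F (psi (e i *+ j) y)) @ y --> \sum_(j < L.+1) F (psi (e i *+ j) y); last exact: cvgZl_tmp.
apply: cvg_bigsum => j.
have h : F @ psi (e i *+ j) y --> F (psi (e i *+ j) y) by exact: Fc.
exact: (cvg_comp _ _ (@psi_cont (e i *+ j) y) h).
Qed.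

Lemma averages_cont s F : continuous F -> continuous (averages s F).
Proof. by move=> Fc; elim: s => [|i s IH] //=; exact: average_cont. Qed.

Lemma average_le i F (S : set R) (B : R) : (forall k y, S y -> S (psi k y)) ->
  (forall y, S y -> `|F y| <= B) -> forall y, S y -> `|average i F y| <= B.
Proof.
move=> Sinv FB y Sy; rewrite /average normrZ normfV normr_nat mulrC ler_pdivrMr ?ltr0n //.
apply: (le_trans (ler_norm_sum _ _ _)); rewrite mulr_natr -[X in _ *+ X]card_ord -sumr_const.
by apply: ler_sum => j _; apply: FB; exact: Sinv.
Qed.

Lemma averages_le s F (S : set R) (B : R) : (forall k y, S y -> S (psi k y)) ->
  (forall y, S y -> `|F y| <= B) -> forall y, S y -> `|averages s F y| <= B.
Proof. by move=> Sinv FB; elim: s => [|i s IH] //=; exact: average_le. Qed.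

End Operators.

Definition left_half (al be y : R) : R^o := if y < (al + be) / 2 then 1 else 0.

Definition cav (L : nat) (k : 'rV[int]_m) : R -> 'rV[R]_m := averages L (enum 'I_m) (c k).
(** The proportion of averaging points in the left half of the block, which is the coefficient of
    the left end matrix in the averaged cocycle. *)
Definition weight (L : nat) (al be : R) : R -> R^o := averages L (enum 'I_m) (left_half al be).
Notation A := end_matrix.
Definition mix (al be s : R) : 'M[R]_m := s *: A al + (1 - s) *: A be.

Lemma mulmx_mix al be s (k : 'rV[R]_m) : k *m mix al be s = s *: (k *m A al - k *m A be) + k *m A be.
Proof.
rewrite /mix mulmxDr -!scalemxAr scalerBr scalerBl scale1r.
by rewrite addrA addrAC.
Qed.

Lemma average_middle (L : nat) al be i (J : nat) (d eps B : R) (F : R -> 'rV[R]_m) : block al be ->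
  0 <= eps -> 0 <= B ->
  (forall y j, middle d al be y -> (J <= j)%N -> ~ middle d al be (psi (e i *+ j) y)) ->
  (forall y, al <= y <= be -> ~ middle d al be y -> `|F y| <= eps) ->
  (forall y, al <= y <= be -> `|F y| <= B) ->
  forall y, al <= y <= be -> `|average L i F y| <= eps + J%:R * B / L.+1%:R.
Proof.
move=> blk e0 B0 gap Fe FB y yab.
have L0 : 0 < L.+1%:R :> R by rewrite ltr0n.
rewrite /average normrZ normfV normr_nat mulrC ler_pdivrMr // mulrDl mulfVK ?gt_eqF //.
pose mid j : bool := al + d <= psi (e i *+ j) y <= be - d.
apply: (le_trans (ler_norm_sum _ _ _)).
apply: (@le_trans _ _ (\sum_(j < L.+1) (eps + (mid j)%:R * B))).
  apply: ler_sum => j _; have yj := psi_block (e i *+ j) blk yab.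
  case E : (mid j); first by rewrite mul1r (le_trans (FB _ yj)) // lerDr.
  by rewrite mul0r addr0 Fe // /middle -/(mid j) E.
rewrite big_split /= sumr_const card_ord -[eps *+ _]mulr_natr lerD2l -mulr_suml ler_wpM2r //.
rewrite -natr_sum ler_nat; apply: count_gap => j j' mj jj'.
apply/negP => mj'; have := gap _ (j' - j)%N mj (ltac:(by rewrite leq_subRL // (leq_trans _ jj') // leq_addr)).
by rewrite -psiD -mulrnDr subnK ?(leq_trans _ jj') ?leq_addr.
Qed.

Lemma averages_half (L : nat) s al be (u v : 'rV[R]_m) y :
  averages L s (fun x => left_half al be x *: (u - v) + v) y = averages L s (left_half al be) y *: (u - v) + v.
Proof.
elim: s y => [|i s IH] y //=.
rewrite /average; under eq_bigr do rewrite IH.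
rewrite big_split /= -scaler_suml sumr_const card_ord scalerDr scalerA; congr (_ + _).
by rewrite -[v *+ _]scaler_nat scalerA mulVf ?scale1r // pnatr_eq0.
Qed.

(** In the escaping direction all but [J] averaging points lie near the ends of the block, where
    [c k] is close to its linear value at the nearer end. [F] is the difference between [c k] and
    the step function with these two values. *)
Lemma cav_estimate (q : nat) (eps : R) : 0 < eps -> exists L0 : nat, forall L, (L0 <= L)%N ->
  forall al be y k, block al be -> al <= y <= be -> `|ir k : 'rV[R]_m| <= q%:R ->
  `|cav L k y - ir k *m mix al be (weight L al be y)| <= eps.
Proof.
move=> eps0; have [s sP] := @box_enum R m q.
have [||x x0 Hx] := @seq_uniform _ R s (fun k x => 0 < x /\ forall y y', a <= y <= b -> `|y - y'| < x^-1 ->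
  `|c k y - c k y'| <= eps / 2).
- move=> k x y xy [x0 H]; split; first exact: lt_le_trans xy.
  by move=> z z' zab zz; apply: H => //; rewrite (lt_le_trans zz) // lef_pV2 ?posrE // (lt_le_trans x0).
- move=> k; have [d d0 H] := segment_uniform a b (@c_cont k) (ltac:(lra) : 0 < eps / 2).
  by exists d^-1; rewrite invr_gt0 invrK.
have [||B B0 HB] := @seq_uniform _ R s (fun k B => forall y, a <= y <= b -> `|c k y| <= B).
- by move=> k B B' BB H y yab; exact: le_trans (H y yab) BB.
- by move=> k; have [B _ H] := segment_bounded a b (@c_cont k); exists B.
have d0 : 0 < x^-1 by rewrite invr_gt0.
have [J HJ] := uniform_escape d0.
(* Makes the share of the at most [J] middle points, where [F] is only bounded by [2 * B], at most
   [eps / 2]. *)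
exists (Num.truncn (J%:R * (2 * B) / (eps / 2))) => L L0 al be y k blk yab kq.
have L1 : J%:R * (2 * B) / L.+1%:R <= eps / 2.
  have e2 : 0 < eps / 2 by rewrite divr_gt0.
  rewrite ler_pdivrMr ?ltr0n // [leRHS]mulrC -ler_pdivrMr // ltW //.
  by apply: (lt_le_trans (truncnS_gt _)); rewrite ler_nat ltnS.
have ks := sP k kq; have [_ Hk] := Hx k ks; have HBk := HB k ks.
have [[aal albe beb fa fb] _] := blk.
have ca := c_fixed k fa; have cb := c_fixed k fb.
pose F (z : R) : 'rV[R]_m := c k z - (left_half al be z *: (c k al - c k be) + c k be).
have -> : cav L k y - ir k *m mix al be (weight L al be y) = averages L (enum 'I_m) F y.
  by rewrite /F averagesB averages_half mulmx_mix -ca -cb.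
have inab z : al <= z <= be -> a <= z <= b.
  by move=> /andP[z1 z2]; rewrite (le_trans aal z1) (le_trans z2 beb).
have Sinv k' z : al <= z <= be -> al <= psi k' z <= be by exact: (psi_block k' blk).
have aab : a <= al <= b by apply: inab; rewrite lexx albe.
have bab : a <= be <= b by apply: inab; rewrite albe lexx.
have [eqab|neqab] := eqVneq al be.
  apply: (@averages_le 'rV[R]_m L _ F [set z | al <= z <= be] eps Sinv _ y yab) => z /= /andP[z1 z2].
  have -> : z = al by apply/eqP; rewrite eq_le z1 {1}eqab z2.
  by rewrite /F eqab subrr scaler0 add0r subrr normr0 ltW.
have albe' : al < be by rewrite lt_neqAle neqab.
have [i [_ gap]] := HJ al be blk albe'.
have ie : i \in enum 'I_m by rewrite mem_enum.
rewrite (averages_rem L F ie).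
apply: (@averages_le 'rV[R]_m L _ _ [set z | al <= z <= be] eps Sinv _ y yab) => z /= zab.
apply: (@le_trans _ _ (eps / 2 + J%:R * (2 * B) / L.+1%:R)); last by rewrite [leRHS]splitr lerD2l.
have e20 : 0 <= eps / 2 by lra.
have B20 : 0 <= 2 * B by lra.
apply: (@average_middle L al be i J x^-1 (eps / 2) (2 * B) F blk e20 B20 gap) => //.
- move=> w wab nmid; have wab' := inab w wab; move: wab => /andP[w1 w2].
  rewrite /F /left_half; case: ifPn => [wm|]; rewrite ?scale1r ?subrK ?scale0r ?add0r.
    apply: Hk => //; rewrite ger0_norm ?subr_ge0 // ltNge; apply/negP => h.
    by apply: nmid; rewrite /middle; qlra.
  rewrite -leNgt => wm; apply: Hk => //; rewrite distrC ger0_norm ?subr_ge0 // ltNge; apply/negP => h.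
  by apply: nmid; rewrite /middle; qlra.
move=> w wab; apply: (le_trans (ler_normB _ _)).
have h1 := HBk w (inab w wab); have h2 := HBk al aab; have h3 := HBk be bab.
by rewrite /left_half; case: ifP => _; rewrite ?scale1r ?subrK ?scale0r ?add0r; lra.
Qed.

Lemma averages_itv (L : nat) s (F : R -> R^o) : (forall y, 0 <= (F y : R) <= 1) ->
  forall y, 0 <= (averages L s F y : R) <= 1.
Proof.
move=> F01; elim: s => [|i s IH] y //=; have -> : average L i (averages L s F) y = L.+1%:R^-1 * \sum_(j < L.+1) averages L s F (psi (e i *+ j) y) by [].
have L0 : 0 < L.+1%:R :> R by rewrite ltr0n.
have s0 : 0 <= \sum_(j < L.+1) averages L s F (psi (e i *+ j) y) :> R.
  by apply: sumr_ge0 => j _; case/andP: (IH (psi (e i *+ j) y)).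
have s1 : \sum_(j < L.+1) averages L s F (psi (e i *+ j) y) <= L.+1%:R :> R.
  rewrite -[X in _ <= X%:R]card_ord -sumr_const.
  by apply: ler_sum => j _; case/andP: (IH (psi (e i *+ j) y)).
by rewrite mulr_ge0 ?invr_ge0 ?(ltW L0) //= mulrC ler_pdivrMr // mul1r.
Qed.

Lemma left_half01 al be y : 0 <= (left_half al be y : R) <= 1.
Proof. by rewrite /left_half; case: ifP => _; rewrite lexx ler01. Qed.

Lemma weight01 L al be y : 0 <= (weight L al be y : R) <= 1.
Proof. by apply: averages_itv => z; exact: left_half01. Qed.

(** The average in direction [i] telescopes to two boundary terms divided by [L.+1]. *)
Lemma weight_step L al be i y : `|weight L al be (psi (e i) y) - weight L al be y| <= L.+1%:R^-1 :> R.
Proof.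
have ie : i \in enum 'I_m by rewrite mem_enum.
rewrite /weight (averages_rem L _ ie) -(averages_psi) -averagesB.
apply: (@averages_le R^o L _ _ setT) => // z _ /=.
rewrite /average -scalerBr.
have -> : \sum_(j < L.+1) left_half al be (psi (e i *+ j) (psi (e i) z)) - \sum_(j < L.+1) left_half al be (psi (e i *+ j) z) =
  left_half al be (psi (e i *+ L.+1) z) - left_half al be z.
  under eq_bigr do rewrite -psiD -mulrSr.
  rewrite big_ord_recr [in X in _ - X]big_ord_recl /= mulr0n psi0 opprD addrA addrAC.
  by congr (_ - _); rewrite addrAC subrr add0r.
rewrite normrZ normfV normr_nat ler_piMr ?invr_ge0 //.
have /andP[h1 h2] := left_half01 al be (psi (e i *+ L.+1) z).
have /andP[h3 h4] := left_half01 al be z.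
rewrite ler_norml; qlra.
Qed.

(** Close enough to the fixed height [al], the finitely many averaging points are all in the left
    half. *)
Lemma weight_left L al be : block al be -> al < be ->
  exists2 th : R, al < th & forall x, al < x -> x < th -> weight L al be x = 1.
Proof.
move=> [[_ _ _ fa _] _] albe; rewrite /weight; elim: (enum 'I_m) => [|i s [th th0 IH]] /=.
  by exists ((al + be) / 2); [lra|move=> x _ xm; rewrite /left_half xm].
have [d d0 Hd] := fixed_near (fun j : 'I_L.+1 => e i *+ j) fa (lt_nbhsl th0).
exists (al + d); first lra.
move=> x xal xd; rewrite /average (eq_bigr (fun=> 1)) => [|j _].
  by rewrite sumr_const card_ord; exact: (mulVf (ltac:(by rewrite pnatr_eq0) : L.+1%:R != 0 :> R)).
apply: IH; first by rewrite -(fa (e i *+ j)) psi_incr.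
by apply: Hd; rewrite /= distrC gtr0_norm; lra.
Qed.

Lemma weight_right L al be : block al be -> al < be ->
  exists2 th : R, th < be & forall x, th < x -> x < be -> weight L al be x = 0.
Proof.
move=> [[_ _ _ _ fb] _] albe; rewrite /weight; elim: (enum 'I_m) => [|i s [th th0 IH]] /=.
  by exists ((al + be) / 2); [lra|move=> x xm _; rewrite /left_half ltNge ltW].
have [d d0 Hd] := fixed_near (fun j : 'I_L.+1 => e i *+ j) fb (lt_nbhsr th0).
exists (be - d); first lra.
move=> x xd xbe; rewrite /average (eq_bigr (fun=> 0)) => [|j _].
  by rewrite sumr_const mul0rn scaler0.
apply: IH; last by rewrite -(fb (e i *+ j)) psi_incr.
by apply: Hd; rewrite /= gtr0_norm; lra.
Qed.

(* The averaged cocycle differs from [c] by the coboundary of [shift]. *)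
Fixpoint shift_seq (L : nat) (s : seq 'I_m) (y : R) : 'rV[R]_m :=
  if s is i :: s' then L.+1%:R^-1 *: \sum_(j < L.+1) (c (e i *+ j) y + shift_seq L s' (psi (e i *+ j) y)) else 0.

Definition shift L := shift_seq L (enum 'I_m).

Lemma cav_coboundary L l y : c l y = cav L l y + shift L y - shift L (psi l y).
Proof.
rewrite /cav /shift; elim: (enum 'I_m) y => [|i s IH] y /=; first by rewrite addr0 subr0.
rewrite /average -scalerDr -scalerBr -big_split -sumrB /=.
have n0 : L.+1%:R != 0 :> R by rewrite pnatr_eq0.
apply: (scalerI n0); rewrite scalerA mulfV // scale1r scaler_nat -[X in _ *+ X]card_ord -sumr_const.
apply: eq_bigr => j _; set k := e i *+ j.
have h1 := IH (psi k y); have h2 := cD k l y; have h3 := cD l k y.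
have h4 : c l (psi k y) = c k (psi l y) + c l y - c k y.
  by apply/eqP; rewrite eq_sym subr_eq -h3 -h2 addrC.
move: h1; rewrite h4 (psiC l k) => h1.
by apply/rowP => z; move/rowP: h1 => /(_ z); rewrite !mxE; lra.
Qed.

Lemma shift_cont L : continuous (shift L).
Proof.
rewrite /shift; elim: (enum 'I_m) => [|i s IH] y /=; first exact: cvg_cst.
have : (fun y => \sum_(j < L.+1) (c (e i *+ j) y + shift_seq L s (psi (e i *+ j) y))) @ y -->
  \sum_(j < L.+1) (c (e i *+ j) y + shift_seq L s (psi (e i *+ j) y)); last exact: cvgZl_tmp.
apply: cvg_bigsum => j; apply: cvgD; first exact: c_cont.
have h : shift_seq L s @ psi (e i *+ j) y --> shift_seq L s (psi (e i *+ j) y) by exact: IH.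
exact: (cvg_comp _ _ (@psi_cont (e i *+ j) y) h).
Qed.

Lemma cavD L k l y : cav L (k + l) y = cav L k (psi l y) + cav L l y.
Proof.
have h := cav_coboundary L (k + l) y; have h1 := cav_coboundary L k (psi l y); have h2 := cav_coboundary L l y.
move: h; rewrite cD h1 h2 psiD => h.
by apply/rowP => z; move/rowP: h => /(_ z); rewrite !mxE; lra.
Qed.

(** Up to the term [shift], the vector coordinate of the future chart at height [y]. *)
Definition chart0 L (t : 'rV[R]_m) (y : R) : 'rV[R]_m := interp (fun k => cav L k y) t.

Lemma chart0_shift L t l y : chart0 L (t + ir l) y = chart0 L t (psi l y) + cav L l y.
Proof.
rewrite /chart0 interp_shift.
have -> : (fun k => cav L (k + l) y) = (fun k => cav L k (psi l y) - (- cav L l y)).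
  by apply/funext => k; rewrite cavD opprK.
by rewrite interpB interp_cst opprK.
Qed.

Definition fl (t : 'rV[R]_m) : 'rV[int]_m := \row_i Num.floor (t ord0 i).

Lemma fl_norm t : `|t - ir (fl t)| <= 1.
Proof.
apply: mx_norm_le => // i j; rewrite !mxE ord1.
by have /andP[h1 h2] := frac01 (t ord0 j); rewrite ger0_norm.
Qed.

(** Equivariance moves [t] to the unit cube and the height to [psi (fl t) y]. Points of norm at most
    2 involve lattice vectors of norm at most 3, on which [cav] is linear up to [eps]; interpolation
    is exact on the linear part and Lipschitz on the error. *)
Lemma chart0_local L (eps : R) al be y : 0 <= eps -> block al be -> al <= y <= be ->
  (forall y k, al <= y <= be -> `|ir k : 'rV[R]_m| <= 3%:R ->
     `|cav L k y - ir k *m mix al be (weight L al be y)| <= eps) ->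
  forall t t' : 'rV[R]_m, `|t' - t| <= 1 ->
  `|chart0 L t' y - chart0 L t y - (t' - t) *m mix al be (weight L al be (psi (fl t) y))| <= 2 * eps * m%:R * `|t' - t|.
Proof.
move=> e0 blk yab H t t' tt'; set k := fl t; set Z := mix _ _ _.
pose u := t - ir k; pose u' := t' - ir k; pose y1 := psi k y.
have u1 : `|u| <= 2%:R by rewrite (le_trans (fl_norm t)) // ler1n.
have u'1 : `|u'| <= 2%:R.
  have -> : u' = u + (t' - t) by apply/rowP => j; rewrite !mxE; ring.
  by apply: (le_trans (ler_normD _ _)); have := fl_norm t; rewrite -/k -/u; lra.
have y1ab : al <= y1 <= be by exact: (psi_block k blk).
have et' : t' = u' + ir k by rewrite subrK.
have et : t = u + ir k by rewrite subrK.
have -> : t' - t = u' - u by apply/rowP => j; rewrite !mxE; ring.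
clearbody u u'.
rewrite et et' !chart0_shift !opprD !addrA -/y1.
have -> : chart0 L u' y1 + cav L k y - chart0 L u y1 - cav L k y - (u' - u) *m Z
   = interp (fun k' => cav L k' y1 - ir k' *m Z) u' - interp (fun k' => cav L k' y1 - ir k' *m Z) u.
  rewrite !interpB !interp_linear /chart0; set x := interp _ u'; set x' := interp _ u.
  by rewrite mulmxBl; apply/rowP => j; rewrite !mxE; ring.
by apply: (interp_lipschitz_local (q := 2)) => // k' k'3; exact: H.
Qed.

Definition mean_weight L al be y N (k : nat -> 'rV[int]_m) : R :=
  N.+1%:R^-1 * \sum_(j < N.+1) weight L al be (psi (k j) y).

Lemma mean01 N (w : 'I_N.+1 -> R) : (forall j, 0 <= w j <= 1) -> 0 <= N.+1%:R^-1 * \sum_j w j <= 1.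
Proof.
move=> w01; rewrite mulr_ge0 ?invr_ge0 ?ler0n ?sumr_ge0 //=; last by move=> j _; case/andP: (w01 j).
rewrite mulrC ler_pdivrMr ?ltr0n // mul1r -[X in _ <= X%:R]card_ord -sumr_const.
by apply: ler_sum => j _; case/andP: (w01 j).
Qed.

Lemma mulmx_mixB (d : 'rV[R]_m) al be s s' : d *m mix al be s - d *m mix al be s' = (s - s') *: (d *m A al - d *m A be).
Proof. by rewrite !mulmx_mix scalerBl opprD addrACA subrr addr0. Qed.

(** The segment is cut into [N.+1] pieces of length at most 1. As [mix] is affine in its
    coefficient, the pieces add up to the mixture for the mean of their weights. *)
Lemma chart0_segment L (eps : R) al be y (t d : 'rV[R]_m) N : 0 <= eps -> block al be -> al <= y <= be ->
  (forall y k, al <= y <= be -> `|ir k : 'rV[R]_m| <= 3%:R ->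
     `|cav L k y - ir k *m mix al be (weight L al be y)| <= eps) ->
  `|d| <= N.+1%:R ->
  `|chart0 L (t + d) y - chart0 L t y - d *m mix al be (mean_weight L al be y N (fun j => fl (t + (j%:R / N.+1%:R) *: d)))|
    <= 2 * eps * m%:R * `|d|.
Proof.
move=> e0 blk yab H dN; have N0 : 0 < N.+1%:R :> R by rewrite ltr0n.
pose z := N.+1%:R^-1 *: d; pose q j := t + (j%:R / N.+1%:R) *: d.
have qS j : q j.+1 - q j = z by apply/rowP => i; rewrite !mxE -natr1; ring.
have z1 : `|z| <= 1 by rewrite normrZ normfV normr_nat mulrC ler_pdivrMr // mul1r.
have -> : chart0 L (t + d) y - chart0 L t y = \sum_(j < N.+1) (chart0 L (q j.+1) y - chart0 L (q j) y).
  rewrite -(big_mkord xpredT (fun j => chart0 L (q j.+1) y - chart0 L (q j) y)).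
  rewrite (telescope_sumr (fun j => chart0 L (q j) y)) // /q mul0r scale0r addr0 mulfV ?gt_eqF //.
  by rewrite scale1r.
have -> : d *m mix al be (mean_weight L al be y N (fun j => fl (q j))) =
    \sum_(j < N.+1) z *m mix al be (weight L al be (psi (fl (q j)) y)).
  under eq_bigr do rewrite mulmx_mix -!scalemxAl -scalerBr scalerA.
  rewrite big_split /= -scaler_suml sumr_const card_ord mulmx_mix; congr (_ + _).
    by rewrite -mulr_suml /mean_weight mulrC.
  by rewrite -[_ *+ _]scaler_nat scalerA mulfV ?scale1r ?gt_eqF.
rewrite -sumrB; apply: (le_trans (ler_norm_sum _ _ _)).
have -> : 2 * eps * m%:R * `|d| = \sum_(j < N.+1) 2 * eps * m%:R * `|z|.
  rewrite sumr_const card_ord normrZ normfV normr_nat -[RHS]mulr_natr.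
  by rewrite -[RHS]mulrA; congr (_ * _); rewrite mulrC mulrA mulfV ?gt_eqF // mul1r.
apply: ler_sum => j _; rewrite -(qS j).
by apply: chart0_local => //; rewrite qS.
Qed.

Lemma discrete_ivt (f : nat -> R) (d th : R) n : (forall j, `|f j.+1 - f j| <= d) -> 0 <= d -> th <= f 0%N -> f n <= th ->
  exists j, `|f j - th| <= d.
Proof.
move=> fd d0 f0; elim: n => [|n IH] fn.
  by exists 0%N; have -> : f 0%N = th; [apply/eqP; rewrite eq_le fn|rewrite subrr normr0].
have [/IH //|h] := leP (f n) th; exists n; move: (fd n); rewrite !ler_norml => /andP[h1 h2].
by qlra.
Qed.

Lemma weight_stepN L al be i y : `|weight L al be (psi (- e i) y) - weight L al be y| <= L.+1%:R^-1.
Proof.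
rewrite distrC -[X in weight _ _ _ X - _](psiNK (e i)).
exact: (weight_step).
Qed.

(** The mean weight is 1 near [al] and 0 near [be]. Along the orbit of one lattice direction that
    climbs from one to the other, it changes by at most [L.+1%:R^-1] per step, so it passes that
    close to [th]. *)
Lemma mean_weight_dense L al be N (k : nat -> 'rV[int]_m) (th : R) : block al be -> 0 <= th <= 1 ->
  exists2 y, al <= y <= be & al < be -> `|mean_weight L al be y N k - th| <= L.+1%:R^-1.
Proof.
move=> blk /andP[th0 th1]; have [[_ albe _ fa fb] _] := blk.
have [eqab|neqab] := eqVneq al be.
  by exists al; rewrite ?lexx ?albe // eqab ltxx.
have lt : al < be by rewrite lt_neqAle neqab.
have N0 : 0 < N.+1%:R :> R by rewrite ltr0n.
have [i free] := free_direction blk lt.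
have [u ual Hu] := weight_left L blk lt; have [v vbe Hv] := weight_right L blk lt.
have [y0 /andP[ay0 y0b] Hy0] : exists2 y, al < y < be & mean_weight L al be y N k = 1.
  have [d d0 Hd] := fixed_near (fun j : 'I_N.+1 => k j) fa (lt_nbhsl ual).
  pose x := Num.min (al + d / 2) ((al + be) / 2).
  have [x1 x2] : x <= al + d / 2 /\ x <= (al + be) / 2 by rewrite !ge_min !lexx orbT.
  have alx : al < x by rewrite lt_min; qlra.
  exists x; first by rewrite alx /=; lra.
  rewrite /mean_weight (eq_bigr (fun=> 1)) => [|j _].
    by rewrite sumr_const card_ord mulVf ?gt_eqF.
  apply: Hu; first by rewrite -(fa (k j)) psi_incr.
  by apply: Hd; rewrite distrC gtr0_norm ?subr_gt0 //; lra.
have [d d0 Hd] : exists2 d : R, 0 < d & forall y, be - d < y -> y < be -> mean_weight L al be y N k = 0.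
  have [d d0 Hd] := fixed_near (fun j : 'I_N.+1 => k j) fb (lt_nbhsr vbe).
  exists d => // x xd xbe; rewrite /mean_weight (eq_bigr (fun=> 0)) => [|j _].
    by rewrite sumr_const mul0rn mulr0.
  apply: Hv; last by rewrite -(fb (k j)) psi_incr.
  by apply: Hd; rewrite gtr0_norm ?subr_gt0 //; lra.
have [l [lfree lstep lup]] : exists l : 'rV[int]_m, [/\ forall x, al < x < be -> psi l x <> x,
    forall y, `|weight L al be (psi l y) - weight L al be y| <= L.+1%:R^-1 & y0 < psi l y0].
  have [l lE up] := upward_direction (free y0 (ltac:(by rewrite ay0) : al < y0 < be)).
  exists l; split => // [x /free + lx|y].
    by apply; case: lE => h; rewrite -?h // -[e i]opprK -h; exact: psi_fixN.
  by case: lE => ->; [exact: weight_step|exact: weight_stepN].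
have y0in : al < y0 < be by rewrite ay0.
have [J HJ] := orbit_escapes fb d0 lfree y0in lup.
have [] := @discrete_ivt (fun j => mean_weight L al be (psi (l *+ j) y0) N k) L.+1%:R^-1 th J.
- move=> j; rewrite /mean_weight -mulrBr -sumrB normrM normfV normr_nat mulrC ler_pdivrMr //.
  apply: (le_trans (ler_norm_sum _ _ _)); rewrite mulr_natr -[X in _ <= _ *+ X]card_ord -sumr_const.
  apply: ler_sum => q _; rewrite mulrS psiD psiC; exact: lstep.
- by rewrite invr_ge0 ler0n.
- by rewrite mulr0n psi0 Hy0.
- rewrite Hd ?HJ //.
  by rewrite -(fb (l *+ J)) psi_incr.
move=> j Hj; exists (psi (l *+ j) y0) => //.
by apply: (psi_block (l *+ j) blk); rewrite !ltW.
Qed.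

Lemma averages_ab_bounded (s : seq 'I_m) L (F : R -> 'rV[R]_m) (B : R) : (forall y, a <= y <= b -> `|F y| <= B) ->
  forall y, a <= y <= b -> `|averages L s F y| <= B.
Proof.
move=> FB y yab.
apply: (@averages_le 'rV[R]_m L _ F [set y | a <= y <= b] B) => // k z /= zab.
exact: psi_ab.
Qed.

(** Averaging changes the cocycle by the coboundary of [shift], which is bounded on [[a, b]], so the
    quasi-isometry bound survives. *)
Lemma chart0_proper L (K0 : R) : 0 < K0 -> (forall k y, a <= y <= b -> `|ir k : 'rV[R]_m| <= K0 * (`|c k y| + 1)) ->
  exists D : R, forall t y, a <= y <= b -> `|t| <= K0 * `|chart0 L t y - chart0 L 0 y| + D.
Proof.
move=> K00 QI.
have [s sP] := @box_enum R m 2.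
have [||B B0 HB] := @seq_uniform _ R s (fun k B => forall y, a <= y <= b -> `|c k y| <= B).
- by move=> k B B' BB H y yab; exact: le_trans (H y yab) BB.
- by move=> k; have [B _ H] := segment_bounded a b (@c_cont k); exists B.
have [S S0 HS] := segment_bounded a b (@shift_cont L).
have small y u : a <= y <= b -> `|u| <= 1 -> `|chart0 L u y| <= B.
  move=> yab u1; apply: interp_norm_le => k Hk; apply: averages_ab_bounded => // z zab.
  by apply: HB => //; apply: sP; exact: (@floor_box _ _ u k 1 u1 Hk).
exists (K0 * (B + B + S + S + 1) + 1) => t y yab; set k := fl t.
have kab : a <= psi k y <= b by exact: psi_ab.
have E : chart0 L t y = chart0 L (t - ir k) (psi k y) + cav L k y by rewrite -(chart0_shift) subrK.
have h1 := small _ _ kab (fl_norm t).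
have h2 : `|chart0 L 0 y| <= B by apply: small => //; rewrite normr0.
have h3 := HS _ yab; have h4 := HS _ kab; have h5 := QI k y yab.
have h6 : `|c k y| <= `|chart0 L t y - chart0 L 0 y| + (B + B + S + S).
  have -> : c k y = (chart0 L t y - chart0 L 0 y) + (chart0 L 0 y - chart0 L (t - ir k) (psi k y) + shift L y - shift L (psi k y)).
    by rewrite (cav_coboundary L k y) E /cav; apply/rowP => j; rewrite !mxE; ring.
  apply: (le_trans (ler_normD _ _)); rewrite lerD2l.
  apply: (le_trans (ler_normB _ _)); apply: lerD => //.
  apply: (le_trans (ler_normD _ _)); apply: lerD => //.
  by apply: (le_trans (ler_normB _ _)); apply: lerD.
have h7 : `|t| <= `|ir k : 'rV[R]_m| + 1.
  have E' : t = ir k + (t - ir k) by rewrite addrC subrK.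
  by rewrite [X in `|X|]E' (le_trans (ler_normD _ _)) // lerD2l; exact: fl_norm.
apply: (le_trans h7); rewrite addrA lerD2r; apply: (le_trans h5).
by rewrite -mulrDr ler_wpM2l ?(ltW K00) //; lra.
Qed.

Lemma mulmx_mix_dist (B : R) al be s s' (d : 'rV[R]_m) : `|A al| <= B -> `|A be| <= B ->
  `|d *m mix al be s - d *m mix al be s'| <= `|s - s'| * (2 * m%:R * B * `|d|).
Proof.
move=> hA hB; rewrite mulmx_mixB normrZ ler_wpM2l //; apply: (le_trans (ler_normB _ _)).
have H (Z : 'M[R]_m) : `|Z| <= B -> `|d *m Z| <= m%:R * B * `|d|.
  by move=> ZB; apply: (le_trans (mulmx_norm_le _ _)); rewrite mulrAC ler_wpM2r // ler_wpM2l.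
by have := H _ hA; have := H _ hB; lra.
Qed.

(** The crux is a uniform lower bound for all mixtures of the two end matrices of a block. Any
    coefficient is nearly the mean weight along an arbitrarily long segment in a given direction,
    started at a suitable height; there [chart0] grows at least linearly by properness, and its
    growth rate is given by the mixture. *)
Lemma chart0_bilipschitz : exists L, exists2 K : R, 0 < K &
  (forall al be th (d : 'rV[R]_m), block al be -> 0 <= th <= 1 -> `|d| <= K * `|d *m mix al be th|) /\
  forall y, a <= y <= b ->
  (forall t d, `|d| <= K * `|chart0 L (t + d) y - chart0 L t y|) /\
  forall t, exists2 Z : 'M[R]_m, forall w : 'rV[R]_m, `|w| <= K * `|w *m Z| &
    forall d, `|d| <= 1 -> `|chart0 L (t + d) y - chart0 L t y - d *m Z| <= (2 * K)^-1 * `|d|.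
Proof.
have [K K0 QI] := quasi_isometry.
have [B B0 HB] := end_matrix_bound.
have m0 : 0 < m.+1%:R :> R by rewrite ltr0n.
(* Chosen so that the interpolation error [2 * eps * m] is at most [(2 * (4 * K))^-1], the accuracy
   that surjectivity demands for the final constant [4 * K]. *)
pose eps := (16%:R * K * m.+1%:R)^-1.
have eps0 : 0 < eps by rewrite invr_gt0 !mulr_gt0.
have [L0 HL0] := cav_estimate 3 eps0.
pose L := maxn L0 (Num.truncn (8%:R * K * m%:R * B)).
have HL := HL0 L (leq_maxl _ _).
have L1 : 8%:R * K * m%:R * B * L.+1%:R^-1 <= 1.
  rewrite ler_pdivrMr ?ltr0n // mul1r ltW // (lt_le_trans (truncnS_gt _)) // ler_nat ltnS.
  exact: leq_maxr.
have L10 : 0 <= L.+1%:R^-1 :> R by rewrite invr_ge0.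
have em8 : 2 * eps * m%:R <= (2 * (4%:R * K))^-1.
  have E : eps * (16%:R * K * m.+1%:R) = 1 by rewrite mulVf // gt_eqF ?mulr_gt0.
  rewrite -[leRHS]mul1r ler_pdivlMr; last by rewrite !mulr_gt0.
  move: E; rewrite -natr1; set x := m%:R => E.
  have : 0 < eps * K by rewrite mulr_gt0.
  by lra.
have K40 : 0 < (4%:R * K)^-1 by rewrite invr_gt0 mulr_gt0.
have em : 2 * eps * m%:R <= (4%:R * K)^-1.
  by apply: (le_trans em8); rewrite invfM; lra.
have K4 x : K * ((4%:R * K)^-1 * x) = x / 4%:R by field; rewrite gt_eqF.
have inv al be th (d : 'rV[R]_m) : block al be -> 0 <= th <= 1 -> `|d| <= 2 * K * `|d *m mix al be th|.
  move=> blk th01; have [[aal albe beb fa fb] _] := blk.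
  have alab : a <= al <= b by rewrite aal (le_trans albe beb).
  have beab : a <= be <= b by rewrite beb (le_trans aal albe).
  have [D HD] := chart0_proper L K0 QI.
  (* The constant [D] is independent of [s], so the bracket cannot be positive. *)
  have key (s : nat) : s%:R * (`|d| / 2 - K * `|d *m mix al be th|) <= D.
    pose N := Num.truncn (`|s%:R *: d|).
    have sN : `|s%:R *: d| <= N.+1%:R by rewrite ltW // truncnS_gt.
    have [y yab Hy] := mean_weight_dense L N (fun j => fl (0 + (j%:R / N.+1%:R) *: (s%:R *: d))) blk th01.
    have yab' : a <= y <= b by move/andP: yab => [y1 y2]; rewrite (le_trans aal y1) (le_trans y2 beb).
    have := chart0_segment 0 (ltW eps0) blk yab (fun y k yab k3 => HL al be y k blk yab k3) sN.
    set th' := mean_weight _ _ _ _ _ _ in Hy *; rewrite add0r => h1.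
    have h2 := HD (s%:R *: d) y yab'.
    have h3 : `|d *m mix al be th' - d *m mix al be th| <= (4%:R * K)^-1 * `|d|.
      have [eqab|neqab] := eqVneq al be.
        by rewrite mulmx_mixB eqab subrr scaler0 normr0 mulr_ge0 // ltW.
      have lt : al < be by rewrite lt_neqAle neqab.
      apply: (le_trans (mulmx_mix_dist th' th d (HB _ alab) (HB _ beab))).
      rewrite mulrA ler_wpM2r //; apply: (@le_trans _ _ (L.+1%:R^-1 * (2 * m%:R * B))).
        by rewrite ler_wpM2r ?Hy // !mulr_ge0 // ltW.
      rewrite -[leRHS]mul1r ler_pdivlMr; last by rewrite mulr_gt0.
      by move: L1; set x := L.+1%:R^-1; set z := m%:R; lra.
    have h4 : `|chart0 L (s%:R *: d) y - chart0 L 0 y| <= s%:R * (`|d *m mix al be th| + (4%:R * K)^-1 * `|d| + (4%:R * K)^-1 * `|d|).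
      have -> : chart0 L (s%:R *: d) y - chart0 L 0 y = (chart0 L (s%:R *: d) y - chart0 L 0 y - (s%:R *: d) *m mix al be th') + (s%:R *: d) *m mix al be th' by rewrite subrK.
      apply: (le_trans (ler_normD _ _)); rewrite addrC mulrDr; apply: lerD.
        rewrite -scalemxAl normrZ normr_nat ler_wpM2l //.
        have -> : d *m mix al be th' = d *m mix al be th + (d *m mix al be th' - d *m mix al be th) by rewrite addrC subrK.
        by rewrite (le_trans (ler_normD _ _)) // lerD2l.
      apply: (le_trans h1); rewrite normrZ normr_nat mulrCA ler_wpM2l //.
      by rewrite ler_wpM2r.
    move: h2; rewrite normrZ normr_nat => h2.
    have : s%:R * `|d| <= K * (s%:R * (`|d *m mix al be th| + (4%:R * K)^-1 * `|d| + (4%:R * K)^-1 * `|d|)) + D.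
      by apply: (le_trans h2); rewrite lerD2r ler_wpM2l ?(ltW K0).
    by rewrite mulrCA !mulrDr K4; lra.
  rewrite leNgt; apply/negP => h.
  have x0 : 0 < `|d| / 2 - K * `|d *m mix al be th| by lra.
  have := key (Num.truncn (D / (`|d| / 2 - K * `|d *m mix al be th|))).+1.
  rewrite leNgt => /negP; apply.
  by rewrite -ltr_pdivrMr // truncnS_gt.
exists L, (4%:R * K); first by rewrite mulr_gt0.
have inv4 al be th (d : 'rV[R]_m) : block al be -> 0 <= th <= 1 -> `|d| <= 4%:R * K * `|d *m mix al be th|.
  move=> blk th01; have := inv al be th d blk th01; set x := `|d *m _| => h.
  have x0 : 0 <= K * x.
    apply: mulr_ge0; [exact: ltW|exact: normr_ge0].
  by move: h x0; set z := K * x; rewrite -!mulrA -/z; lra.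
split=> [|y yab]; first exact: inv4.
have [al [be [blk yin]]] := block_exists yab.
have seg (t d : 'rV[R]_m) : exists2 th : R, 0 <= th <= 1 & `|chart0 L (t + d) y - chart0 L t y - d *m mix al be th| <= (4%:R * K)^-1 * `|d|.
  pose N := Num.truncn `|d|; have dN : `|d| <= N.+1%:R by rewrite ltW // truncnS_gt.
  have := chart0_segment t (ltW eps0) blk yin (fun y k yab k3 => HL al be y k blk yab k3) dN.
  set th := mean_weight _ _ _ _ _ _ => h; exists th; first by apply: mean01 => j; exact: weight01.
  by apply: (le_trans h); rewrite ler_wpM2r.
split.
  move=> t d; have [th th01 h] := seg t d; have h1 := inv al be th d blk th01.
  have h2 : `|d *m mix al be th| <= `|chart0 L (t + d) y - chart0 L t y| + (4%:R * K)^-1 * `|d|.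
    have -> : d *m mix al be th = (chart0 L (t + d) y - chart0 L t y) - (chart0 L (t + d) y - chart0 L t y - d *m mix al be th) by rewrite opprB addrC subrK.
    by rewrite (le_trans (ler_normB _ _)) // lerD2l.
  have : `|d| <= 2 * (K * `|chart0 L (t + d) y - chart0 L t y| + K * ((4%:R * K)^-1 * `|d|)).
    by apply: (le_trans h1); rewrite -mulrA ler_wpM2l // -mulrDr ler_wpM2l // ltW.
  by rewrite K4; lra.
move=> t; exists (mix al be (weight L al be (psi (fl t) y))) => [w|d d1].
  exact: inv4 (weight01 _ _ _ _).
have dd : `|t + d - t| <= 1 by rewrite addrC addKr.
have := chart0_local (ltW eps0) blk yin (fun y k yab k3 => HL al be y k blk yab k3) dd.
have -> : t + d - t = d by rewrite addrC addKr.
move=> h; apply: (le_trans h).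
by rewrite ler_wpM2r.
Qed.

(** A homeomorphism of R^m × [[0, 1]] with the strip, given by height and vector part, under which
    the lattice acts by integer translations of [t]. The last two clauses record that it is affine
    on the two ends, for the gluing. *)
Definition strip_parametrization (Y : 'rV[R]_m -> R -> R) (V : 'rV[R]_m -> R -> 'rV[R]_m) : Prop :=
  [/\ forall t s eps, 0 < eps -> 0 <= s <= 1 -> exists2 d : R, 0 < d & forall t' s', 0 <= s' <= 1 ->
        `|t' - t| < d -> `|s' - s| < d -> `|Y t' s' - Y t s| <= eps /\ `|V t' s' - V t s| <= eps,
      (forall t s, 0 <= s <= 1 -> a <= Y t s <= b) /\
      (forall y v, a <= y <= b -> exists t s, [/\ 0 <= s <= 1, Y t s = y & V t s = v]),
      forall t t' s s', 0 <= s <= 1 -> 0 <= s' <= 1 -> Y t s = Y t' s' -> V t s = V t' s' -> t = t' /\ s = s',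
      forall t l s, 0 <= s <= 1 -> psi l (Y (t + ir l) s) = Y t s /\ V (t + ir l) s = V t s + c l (Y (t + ir l) s)
    & (forall t, Y t 0 = a /\ Y t 1 = b) /\ forall t s, 0 < s < 1 -> a < Y t s < b] /\
  (exists w, forall t, V t 0 = t *m end_matrix a + w) /\
  (exists w, forall t, V t 1 = t *m end_matrix b + w).

(** Interpolating the increasing maps [psi k] gives, for each [t], an increasing function of the
    height that is equivariant in [t]; its levels are the sheets of constant [s], and the lattice
    permutes their points. *)
Definition height (t : 'rV[R]_m) (y : R) : R := interp (fun k => psi k y : R^o) t.

Lemma height_lt t y y' : y < y' -> height t y < height t y'.
Proof. by move=> yy; apply: (@interp_lt R) => k; exact: psi_incr. Qed.

Lemma height_inj t : injective (height t).
Proof.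
move=> y y' E; apply/eqP; rewrite eq_le !leNgt; apply/andP; split; apply/negP => /(height_lt t);
by rewrite E ltxx.
Qed.

Lemma height_ltr t y y' : height t y < height t y' -> y < y'.
Proof.
move=> h; rewrite ltNge; apply/negP; rewrite le_eqVlt => /orP[/eqP E|/(height_lt t)].
  by rewrite E ltxx in h.
by rewrite ltNge ltW.
Qed.

Lemma height_continuous (t : 'rV[R]_m) (y eps : R) : 0 < eps -> exists2 d : R, 0 < d & forall t' y',
  `|t' - t| < d -> `|y' - y| < d -> `|height t' y' - height t y| <= eps.
Proof. exact: (@interp_continuous R R^o m (fun k y => psi k y) (@psi_cont) t y). Qed.

Lemma height_shift t l y : height (t + ir l) y = height t (psi l y).
Proof.
rewrite /height interp_shift; congr interp; apply/funext => k; exact: psiD.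
Qed.

Lemma height_fixed t y : fixed y -> height t y = y.
Proof.
move=> fy; rewrite /height.
have -> : (fun k => psi k y : R^o) = (fun=> (y : R^o)) by apply/funext => k; exact: fy.
exact: (@interp_cst R).
Qed.

Definition level (t : 'rV[R]_m) (s : R) : R := xget a [set y | height t y = a + s * (b - a)].

Lemma levelP t s : 0 <= s <= 1 -> height t (level t s) = a + s * (b - a) /\ a <= level t s <= b.
Proof.
move=> /andP[s0 s1].
have ha : height t a = a by apply: height_fixed => k; exact: psi_a.
have hb : height t b = b by apply: height_fixed => k; exact: psi_b.
have v1 : a <= a + s * (b - a) by rewrite lerDl mulr_ge0 // subr_ge0 ltW.
have v2 : a + s * (b - a) <= b.
  have h : s * (b - a) <= b - a by rewrite ler_piMl // subr_ge0 ltW.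
  by lra.
have hc : {within `[a, b], continuous (height t)}.
  apply: continuous_subspaceT => y; apply/(@cvgrPdist_le R R^o) => eps e0.
  have [d d0 H] := height_continuous t y e0.
  apply: filterS (@near_dist_lt R R^o y d d0) => z yz.
  by rewrite distrC; apply: H; rewrite ?subrr ?normr0 // distrC.
have [|y _ Hy] := @IVT R (height t) a b (a + s * (b - a)) (ltW ab) hc.
  by rewrite ha hb min_l ?max_r ?(ltW ab) // v1.
have ex : height t (level t s) = a + s * (b - a) by rewrite /level; case: xgetP => [z -> //|/(_ y)].
split => //; apply/andP; split; rewrite leNgt; apply/negP => /(height_lt t); rewrite ex ?ha ?hb ltNge ?v1 ?v2 //.
Qed.

Lemma level_uniq t s y : 0 <= s <= 1 -> height t y = a + s * (b - a) -> level t s = y.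
Proof. by move=> s01 E; apply: (@height_inj t); rewrite E; case: (levelP t s01). Qed.

Lemma level_continuous t s (eps : R) : 0 < eps -> 0 <= s <= 1 -> exists2 d : R, 0 < d & forall t' s', 0 <= s' <= 1 ->
  `|t' - t| < d -> `|s' - s| < d -> `|level t' s' - level t s| <= eps.
Proof.
move=> e0 s01; set y := level t s; have [Hy _] := levelP t s01; rewrite -/y in Hy.
have ba0 : 0 < b - a by rewrite subr_gt0 ab.
pose up := height t (y + eps) - height t y; pose dn := height t y - height t (y - eps).
have up0 : 0 < up by rewrite subr_gt0 height_lt // ltrDl.
have dn0 : 0 < dn by rewrite subr_gt0 height_lt // gtrDl oppr_lt0.
have [d1 d10 H1] := height_continuous t (y + eps) (ltac:(lra) : 0 < up / 2).
have [d2 d20 H2] := height_continuous t (y - eps) (ltac:(lra) : 0 < dn / 2).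
pose d3 := Num.min (up / 2) (dn / 2) / (b - a).
have d30 : 0 < d3 by rewrite divr_gt0 // lt_min; qlra.
exists (Num.min (Num.min d1 d2) d3); first by rewrite !lt_min d10 d20.
move=> t' s' s'01; rewrite !lt_min => /andP[/andP[t1 t2] _] /andP[_ s3].
have [Hy' _] := levelP t' s'01; set y' := level t' s' in Hy' *.
have hs : `|height t' y' - height t y| < Num.min (up / 2) (dn / 2).
  rewrite Hy Hy' opprD addrACA subrr add0r -mulrBl normrM (gtr0_norm ba0) -ltr_pdivlMr //.
move: hs; rewrite lt_min !ltr_norml => /andP[/andP[_ h1] /andP[h2 _]].
have n1 : `|y + eps - (y + eps)| < d1 by rewrite subrr normr0.
have n2 : `|y - eps - (y - eps)| < d2 by rewrite subrr normr0.
have := H1 t' _ t1 n1; have := H2 t' _ t2 n2; rewrite !ler_norml /up /dn in h1 h2 * => /andP[_ h3] /andP[h4 _].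
apply/andP; split.
  have : y - eps < y' by apply: (@height_ltr t'); lra.
  by lra.
have : y' < y + eps by apply: (@height_ltr t'); lra.
by lra.
Qed.

(** At a given height [y] the map [C t y] is a bijection in [t], and [s] is then read off from
    [height t y]: this order of solving gives injectivity and surjectivity together. Adding [shift]
    to [chart0] restores the original cocycle in the equivariance. *)
Theorem strip_parametrizationP : exists Y V, strip_parametrization Y V.
Proof.
have [L [K K0 [_ HL]]] := chart0_bilipschitz.
pose C t y := chart0 L t y + shift L y.
have ba0 : 0 < b - a by rewrite subr_gt0 ab.
have Cc t y eps : 0 < eps -> exists2 d : R, 0 < d & forall t' y', `|t' - t| < d -> `|y' - y| < d -> `|C t' y' - C t y| <= eps.
  move=> e0; have e20 : 0 < eps / 2 by lra.
  have cavc k : continuous (cav L k) by apply: (averages_cont); exact: c_cont.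
  have [d1 d10 H1] := interp_continuous cavc t y e20.
  have [d2 d20 H2] := continuous_dist y (@shift_cont L) e20.
  exists (Num.min d1 d2) => [|t' y']; first by rewrite lt_min d10.
  rewrite !lt_min => /andP[t1 _] /andP[y1 y2]; rewrite /C opprD addrACA.
  rewrite [leRHS]splitr; apply: (le_trans (ler_normD _ _)); apply: lerD; [exact: H1|exact: H2].
have Cinj t t' y : a <= y <= b -> C t y = C t' y -> t = t'.
  move=> /HL[H _] /addIr E; have := H t (t' - t).
  have -> : t + (t' - t) = t' by rewrite addrC subrK.
  by rewrite E subrr normr0 mulr0 normr_le0 subr_eq0 => /eqP.
have Conto y v : a <= y <= b -> exists t, C t y = v.
  move=> yab; have [_ H] := HL y yab.
  have [|t Ht] := @near_linear_onto R m (fun t => chart0 L t y) K K0 _ H (v - shift L y).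
    move=> t; have FF := @nbhs_filter 'rV[R]_m t.
    apply/cvgrPdist_le => eps e0.
    have cavc k : continuous (cav L k) by apply: (averages_cont); exact: c_cont.
    have [d1 d10 H1] := interp_continuous cavc t y e0.
    apply: filterS (@near_dist_lt R 'rV[R]_m t d1 d10) => z tz.
    by rewrite distrC; apply: H1; rewrite ?subrr ?normr0 // distrC.
  by exists t; rewrite /C Ht subrK.
have Cfix y : fixed y -> forall t, C t y = t *m end_matrix y + shift L y.
  move=> fy t; congr (_ + _); rewrite /chart0 -[RHS]interp_linear; congr interp.
  apply/funext => k; rewrite -(c_fixed k fy).
  by have := cav_coboundary L k y; rewrite fy addrK.
exists level, (fun t s => C t (level t s)); split; [split|split].
- move=> t s eps e0 s01; have [d1 d10 H1] := Cc t (level t s) eps e0.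
  have [d2 d20 H2] := level_continuous t (ltac:(by rewrite lt_min e0; lra) : 0 < Num.min eps (d1 / 2)) s01.
  exists (Num.min d1 d2) => [|t' s' s'01]; first by rewrite lt_min d10.
  rewrite !lt_min => /andP[t1 t2] /andP[s1 s2]; have := H2 t' s' s'01 t2 s2.
  by rewrite le_min => /andP[h1 h2]; split => //; apply: H1 => //; lra.
- split => [t s s01|y v yab]; first by case: (levelP t s01).
  have [t Ht] := Conto y v yab; move/andP: yab => [ya yb].
  have ha : height t a = a by apply: height_fixed => k; exact: psi_a.
  have hb : height t b = b by apply: height_fixed => k; exact: psi_b.
  have mono z z' : z <= z' -> height t z <= height t z'.
    by rewrite le_eqVlt => /orP[/eqP -> //|/(height_lt t)/ltW].
  have := mono _ _ ya; have := mono _ _ yb; rewrite ha hb => h1 h2.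
  have s01 : 0 <= (height t y - a) / (b - a) <= 1.
    by rewrite divr_ge0 ?subr_ge0 ?(ltW ab) //= ler_pdivrMr // mul1r lerB.
  have E : level t ((height t y - a) / (b - a)) = y.
    by apply: level_uniq => //; rewrite mulfVK ?gt_eqF // addrC subrK.
  by exists t, ((height t y - a) / (b - a)); rewrite E.
- move=> t t' s s' s01 s'01 E1; rewrite E1 => E2.
  have tt : t = t' by apply: Cinj E2; case: (levelP t' s'01).
  split => //; have [h1 _] := levelP t s01; have [h2 _] := levelP t' s'01.
  move: h1; rewrite E1 tt h2 => /addrI/esym E; have ne : b - a != 0 by rewrite gt_eqF.
  exact: (mulIf ne E).
- move=> t l s s01; have [h1 h2] := levelP (t + ir l) s01.
  have E : psi l (level (t + ir l) s) = level t s.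
    by apply/esym/level_uniq => //; rewrite -height_shift.
  split => //; rewrite /C (chart0_shift) E -!addrA; congr (_ + _).
  by rewrite [in RHS](cav_coboundary L) E [RHS]addrC subrK.
- split; last first.
    move=> t s /andP[s0 s1]; have s01 : 0 <= s <= 1 by rewrite !ltW.
    have [h _] := levelP t s01.
    apply/andP; split; apply: (@height_ltr t); rewrite h height_fixed.
    + by rewrite ltrDl mulr_gt0.
    + by move=> k; exact: psi_a.
    + have : s * (b - a) < b - a by rewrite gtr_pMl.
      by lra.
    + by move=> k; exact: psi_b.
  move=> t; split; apply: level_uniq; rewrite ?lexx ?ler01 //; rewrite height_fixed ?mul0r ?addr0 ?mul1r 1?addrC ?subrK //.
- exists (shift L a) => t; have -> : level t 0 = a.
    by apply: level_uniq; rewrite ?lexx ?ler01 // mul0r addr0 height_fixed // => k; exact: psi_a.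
  by rewrite Cfix // => k; exact: psi_a.
exists (shift L b) => t; have -> : level t 1 = b.
  by apply: level_uniq; rewrite ?lexx ?ler01 // mul1r addrC subrK height_fixed // => k; exact: psi_b.
by rewrite Cfix // => k; exact: psi_b.
Qed.

End Strip.

(** * Changing coordinates in a group action; countable closed sets *)

Lemma fun_invE {X : choiceType} (f : X -> X) x y : injective f -> f x = y -> fun_inv f y = x.
Proof.
move=> fi fx; apply: fi; rewrite fx /fun_inv; case: xgetP => [z _ //|/(_ x)]; by rewrite /= fx.
Qed.

Section Conjugation.
Context {R : realType} {V : normedModType R} {M : topologicalType}.
Variables (G : set (V -> V)) (p : V -> M) (f f' : V -> V).
Hypothesis G_homeo : homeomorphism_group G.
Hypothesis fc : continuous f.
Hypothesis f'c : continuous f'.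
Hypothesis fK : cancel f f'.
Hypothesis f'K : cancel f' f.

Definition conj_group : set (V -> V) := [set f \o g \o f' | g in G].

Lemma comp_continuous (g h : V -> V) : continuous g -> continuous h -> continuous (g \o h).
Proof. by move=> gc hc x; apply: continuous_comp; [exact: hc|exact: gc]. Qed.

Lemma conj_homeomorphism_group : homeomorphism_group conj_group.
Proof.
have inv g : G g -> fun_inv (f \o g \o f') = f \o fun_inv g \o f'.
  move=> Gg; have [_ K1 K2] := act_inv G_homeo Gg.
  apply/funext => y; apply: fun_invE => /=; last by rewrite fK K2 f'K.
  by move=> a b /= /(can_inj fK)/(act_inj G_homeo Gg)/(can_inj f'K).
split.
  move=> _ [g Gg <-]; have [Gi K1 K2] := act_inv G_homeo Gg; split.
    by apply: comp_continuous => //; apply: comp_continuous => //; exact: (act_cont G_homeo).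
  exists (f \o fun_inv g \o f'); split.
  - by apply: comp_continuous => //; apply: comp_continuous => //; exact: (act_cont G_homeo).
  - by move=> x /=; rewrite fK K1 f'K.
  - by move=> x /=; rewrite fK K2 f'K.
split.
- by exists id; [exact: act_id G_homeo|apply/funext => x /=; rewrite f'K].
- move=> _ _ [g Gg <-] [h Gh <-]; exists (g \o h); first exact: (act_comp G_homeo).
  by apply/funext => x /=; rewrite fK.
- move=> _ [g Gg <-]; rewrite inv //; have [Gi _ _] := act_inv G_homeo Gg.
  by exists (fun_inv g).
move=> _ h k [g Gg <-] _ _; have [Gi K1 K2] := act_inv G_homeo Gg; rewrite inv //; split => //.
  by apply/funext => x /=; rewrite fK K1 f'K.
by apply/funext => x /=; rewrite fK K2 f'K.
Qed.

Lemma conj_fpd : free_properly_discontinuous G -> free_properly_discontinuous conj_group.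
Proof.
move=> [free PD]; split.
  move=> x _ [g Gg <-] /= /(congr1 f'); rewrite fK => /free -> //.
  by apply/funext => y /=; rewrite f'K.
move=> x; have [U [oU Ux HU]] := PD (f' x); exists (f' @^-1` U); split => //.
  by apply: open_comp => // y _; exact: f'c.
move=> _ [g Gg <-] [_ [[y Uy <-] /= Uy']].
have -> : g = id by apply: HU => //; exists (g (f' y)); split; [exists (f' y)|rewrite -[X in U X]fK].
by apply/funext => z /=; rewrite f'K.
Qed.

Lemma conj_orbit_map : orbit_map G p -> orbit_map conj_group (p \o f').
Proof.
move=> [surj op rel]; split.
- by move=> y; have [x <-] := surj y; exists (f x); rewrite /= fK.
- move=> U; rewrite op; split => oU.
    by apply: (@open_comp _ _ f' (p @^-1` U)) => // y _; exact: f'c.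
  have -> : p @^-1` U = f @^-1` ((p \o f') @^-1` U) by apply/seteqP; split => y /=; rewrite fK.
  by apply: open_comp => // y _; exact: fc.
move=> x y /=; rewrite rel; split.
  by move=> [g Gg gE]; exists (f \o g \o f'); [exists g|rewrite /= gE f'K].
by move=> [_ [g Gg <-] /= <-]; exists g => //; rewrite fK.
Qed.

End Conjugation.

(** The situation after conjugation by the slice: the flow has become translation by the vectors
    [cons_mx 0 v], with which the group commutes. *)
Record leaf_action {R : realType} {m : nat} {M : topologicalType} (G : set ('rV[R]_m.+1 -> 'rV[R]_m.+1))
    (p : 'rV[R]_m.+1 -> M) : Prop := LeafAction {
  lf_homeo : homeomorphism_group G;
  lf_fpd : free_properly_discontinuous G;
  lf_orbit : orbit_map G p;
  lf_hausdorff : hausdorff_space M;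
  lf_compact : compact [set: M];
  lf_trans : forall g z v, G g -> g (z + cons_mx 0 v) = g z + cons_mx 0 v
}.

(** A Baire argument: in a closed set without isolated points, nested intervals centred in [D] can
    avoid [s 0], [s 1] and so on in turn, and their common point belongs to [D] without being
    enumerated. *)
Lemma closed_countable_isolated {R : realType} (D : set R) (s : nat -> R) (x0 : R) : closed D -> D x0 ->
  (forall y, D y -> exists k, s k = y) ->
  exists2 y, D y & exists2 d : R, 0 < d & forall z, D z -> `|z - y| < d -> z = y.
Proof.
move=> Dc Dx0 Ds; apply: contrapT => iso.
have H y (d : R) : D y -> 0 < d -> exists2 z, D z & `|z - y| < d /\ z <> y.
  move=> Dy d0; apply: contrapT => nz; apply: iso; exists y => //; exists d => // z Dz zy.
  by apply: contrapT => zy'; apply: nz; exists z.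
pose ok (u : R * R) := D u.1 /\ 0 < u.2.
have step (ku : nat * (R * R)) : exists u' : R * R, ok ku.2 ->
    ok u' /\ [/\ `|u'.1 - ku.2.1| + u'.2 <= ku.2.2, u'.2 <= ku.2.2 / 2 & u'.2 < `|s ku.1 - u'.1|].
  case: ku => k [x d] /=; have [[Dx d0]|nok] := pselect (ok (x, d)); last by exists (x, d).
  rewrite /= in Dx d0; have d20 : 0 < d / 2 by lra.
  have [z Dz [zx zx']] := H x (d / 2) Dx d20.
  have [x' [Dx' xx' ne]] : exists x', [/\ D x', `|x' - x| <= d / 2 & s k != x'].
    have [E|ne] := eqVneq (s k) x; last by exists x; rewrite subrr normr0 ltW.
    by exists z; split => //; [exact: ltW|rewrite E eq_sym; apply/eqP].
  have n0 : 0 < `|s k - x'| by rewrite normr_gt0 subr_eq0.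
  exists (x', Num.min (d / 2) (`|s k - x'| / 2)) => _ /=; split; first by split => //=; rewrite lt_min d20; lra.
  have := ge_min (d / 2) (d / 2) (`|s k - x'| / 2); have := ge_min (`|s k - x'| / 2) (d / 2) (`|s k - x'| / 2).
  by rewrite !lexx orbT /= => h1 h2; split => //; lra.
have [f Hf] := choice step.
pose u := fix u k := if k is k'.+1 then f (k', u k') else (x0, 1 : R).
have uok k : ok (u k) by elim: k => [|k IH]; [split => /=|have [] := Hf (k, u k) IH].
have uS k : [/\ `|(u k.+1).1 - (u k).1| + (u k.+1).2 <= (u k).2, (u k.+1).2 <= (u k).2 / 2 & (u k.+1).2 < `|s k - (u k.+1).1|].
  by have [_] := Hf (k, u k) (uok k).
have near k j : `|(u (k + j)%N).1 - (u k).1| + (u (k + j)%N).2 <= (u k).2.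
  elim: j => [|j IH]; first by rewrite addn0 subrr normr0 add0r.
  rewrite addnS; have [h _ _] := uS (k + j)%N.
  have := ler_distD (u (k + j)%N).1 (u (k + j).+1).1 (u k).1; lra.
have small k : (u k).2 <= k.+1%:R^-1.
  elim: k => [|k IH]; first by rewrite invr1.
  have [_ h _] := uS k; apply: (le_trans h); apply: (@le_trans _ _ (k.+1%:R^-1 / 2)); first by rewrite ler_pM2r.
  by rewrite -invfM lef_pV2 ?posrE ?mulr_gt0 // -natrM ler_nat; lia.
pose S := [set x | exists k, x = (u k).1 - (u k).2].
have cmp j k : (u j).1 - (u j).2 <= (u k).1 + (u k).2.
  have [_ dj] := uok j; have [_ dk] := uok k; have [jk|kj] := leqP j k.
    have := near j (k - j)%N; rewrite subnKC // => h.
    by move: (ler_norm ((u j).1 - (u k).1)); rewrite distrC; lra.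
  have := near k (j - k)%N; rewrite subnKC ?(ltnW kj) // => h.
  by move: (ler_norm ((u j).1 - (u k).1)); lra.
have supS : has_sup S by split; [exists ((u 0%N).1 - (u 0%N).2), 0%N|exists ((u 0%N).1 + (u 0%N).2) => _ [j ->]].
have yk k : `|(u k).1 - sup S| <= (u k).2.
  have h1 : (u k).1 - (u k).2 <= sup S by apply: (sup_upper_bound supS); exists k.
  have h2 : sup S <= (u k).1 + (u k).2 by apply: sup_le_ub => [|_ [j ->]]; [case: supS|].
  by rewrite ler_norml; lra.
have DS : D (sup S).
  apply: contrapT => nD; have oC : open (~` D) by exact: closed_openC.
  have n : \forall z \near (sup S : R^o), ~ D z by apply: (open_nbhs_nbhs (conj oC nD)).
  have [e e0 He] := near_ball_ex n.
  pose k := Num.truncn e^-1; have [Dk _] := uok k; apply: (He (u k).1) => //.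
  rewrite distrC (le_lt_trans (yk k)) // (le_lt_trans (small k)) //.
  by rewrite -[ltRHS]invrK ltf_pV2 ?posrE ?invr_gt0 // truncnS_gt.
have [k sk] := Ds _ DS; have [_ _] := uS k; have := yk k.+1.
by rewrite sk distrC => h1 h2; move: (lt_le_trans h2 h1); rewrite ltxx.
Qed.

Lemma finite_upper_bound {T : choiceType} {R : realType} (S : set T) (f : T -> R) : finite_set S ->
  exists N : R, forall x, S x -> f x <= N.
Proof.
move=> /finite_seqP[s ->]; elim: s => [|x s [N IH]]; first by exists 0.
exists (Num.max (f x) N) => y; rewrite /= inE => /orP[/eqP ->|ys]; first by rewrite le_max lexx.
by rewrite le_max IH ?orbT.
Qed.

(** * Bases of discrete cocompact subgroups of R^m *)

Section Lattice.
Context {R : realType} {m : nat}.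
Variable T : set 'rV[R]_m.
Hypothesis T0 : T 0.
Hypothesis TB : forall s t, T s -> T t -> T (s - t).
Hypothesis T_discrete : forall r, finite_set [set t | T t /\ `|t| <= r].
Variable r : R.
Hypothesis T_cocompact : forall v, exists2 t, T t & `|v - t| <= r.

Lemma lattice_opp t : T t -> T (- t).
Proof. by move=> Tt; rewrite -sub0r; exact: TB. Qed.

Lemma lattice_add s t : T s -> T t -> T (s + t).
Proof. by move=> Ts /lattice_opp Tt; rewrite -[t]opprK; exact: TB. Qed.

Lemma lattice_int t (z : int) : T t -> T (t *~ z).
Proof.
move=> Tt; have H (k : nat) : T (t *+ k) by elim: k => [|k IH]; rewrite ?mulr0n ?mulrS //; exact: lattice_add.
by case: z => k; [exact: H|rewrite NegzE mulrNz; apply/lattice_opp/H].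
Qed.

Lemma lattice_comb (B : 'M[R]_m) (k : 'rV[int]_m) : (forall i, T (row i B)) -> T (ir k *m B).
Proof.
move=> TBi; rewrite mulmx_sum_row; elim/big_ind: _ => //; first exact: lattice_add.
by move=> i _; rewrite mxE scaler_int; exact: lattice_int.
Qed.

(** Lattice vectors within [r] of the multiples [N] of the basis vectors form [N] times the identity
    up to a bounded matrix, which is invertible for large [N]. *)
Lemma rough_basis : exists2 B : 'M[R]_m, B \in unitmx & forall i, T (row i B).
Proof.
have r0 : 0 <= r by have [t _ h] := T_cocompact 0; exact: le_trans h.
pose N := (Num.truncn (m%:R * r + 1)).+1; have N1 : m%:R * r + 1 <= N%:R by rewrite ltW // truncnS_gt.
have [b Hb] := choice (fun i : 'I_m => (let: ex_intro2 t Tt h := T_cocompact (N%:R *: delta_mx 0 i) in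
  ex_intro _ t (conj Tt h)) : exists t, T t /\ `|N%:R *: delta_mx 0 i - t| <= r).
pose B := \matrix_i b i.
exists B => [|i]; last by rewrite rowK; case: (Hb i).
apply: (@expanding_unit R m B 1) => w; rewrite mul1r.
have h : `|N%:R *: w - w *m B| <= m%:R * r * `|w|.
  have -> : N%:R *: w - w *m B = w *m (N%:R%:M - B) by rewrite mulmxBr mul_mx_scalar.
  apply: (le_trans (mulmx_norm_le _ _)); rewrite mulrAC ler_wpM2r // ler_wpM2l //.
  apply: mx_norm_le => // i j; have [_ hi] := Hb i.
  apply: le_trans hi; apply: le_trans (mx_entry_le _ ord0 j).
  by rewrite !mxE eqxx /= mulr_natr eq_sym.
have h2 : N%:R * `|w| <= m%:R * r * `|w| + `|w *m B|.
  rewrite -[N%:R]normr_nat -normrZ.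
  have -> : N%:R *: w = (N%:R *: w - w *m B) + w *m B by rewrite subrK.
  by rewrite (le_trans (ler_normD _ _)) // lerD2r.
have : (m%:R * r + 1) * `|w| <= N%:R * `|w| by rewrite ler_wpM2r.
by lra.
Qed.

Lemma fl_unit_interval (x : 'rV[R]_m) i : 0 <= (x - ir (fl x)) ord0 i < 1.
Proof. by rewrite !mxE subr_ge0 floor_le /= ltrBlDl -[1]/(1%:~R) -intrD floorD1_gt. Qed.

(* A common denominator: the classes of the multiples of [t] modulo the
   sublattice of [B] are represented by finitely many elements. *)
Lemma common_denominator (B : 'M[R]_m) : B \in unitmx -> (forall i, T (row i B)) ->
  exists2 d : nat, (0 < d)%N & forall t, T t -> exists k, d%:R *: t *m invmx B = ir k.
Proof.
move=> Bu TBi; pose rho := m%:R * 1 * `|B|.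
have /finite_seqP[s Hs] := T_discrete rho.
pose frac t := t - ir (fl (t *m invmx B)) *m B.
have fracs t : T t -> frac t \in s.
  move=> Tt; have : [set` s] (frac t); last by [].
  rewrite -Hs; split; first by apply: TB => //; exact: lattice_comb.
  have -> : frac t = (t *m invmx B - ir (fl (t *m invmx B))) *m B by rewrite mulmxBl mulmxKV.
  by apply: (le_trans (mulmx_norm_le _ _)); rewrite ler_wpM2r // ler_wpM2l //; exact: fl_norm.
exists (size s)`!; first exact: fact_gt0.
move=> t Tt; pose L := mkseq (fun j => frac (t *+ j)) (size s).+1.
have nu : ~~ uniq L.
  apply/negP => u; have := uniq_leq_size u (s2 := s); rewrite size_mkseq ltnn => h.
  suff : false by []; apply: h => _ /mapP[j _ ->]; apply: fracs; rewrite pmulrn; exact: lattice_int.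
have [i [j [ij]]] := uniqPn (0 : 'rV[R]_m) nu; rewrite size_mkseq => js.
rewrite !nth_mkseq //; last exact: ltn_trans js.
move=> E; have ji0 : (0 < j - i)%N by rewrite subn_gt0.
have : (j - i)%:R *: t *m invmx B = ir (fl (t *+ j *m invmx B) - fl (t *+ i *m invmx B)).
  have -> : (j - i)%:R *: t = (ir (fl (t *+ j *m invmx B)) - ir (fl (t *+ i *m invmx B))) *m B.
    rewrite mulmxBl scaler_nat mulrnBr ?(ltnW ij) //; move: E; rewrite /frac.
    by move=> /rowP E; apply/rowP => z; have := E z; rewrite !mxE; lra.
  by rewrite mulmxK // irD irN.
set k0 := _ - _ => H.
have /dvdnP[q Hq] : (j - i %| (size s)`!)%N by apply: dvdn_fact; rewrite ji0 /= (leq_trans (leq_subr _ _)).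
exists (k0 *+ q); rewrite Hq natrM -scalerA -scalemxAl H.
elim: (q) => [|q' IH]; first by rewrite mulr0n ir0 scale0r.
by rewrite -natr1 scalerDl scale1r IH -irD; congr ir; rewrite -mulrSr.
Qed.

Lemma det_replace_row (u : 'rV[R]_m) (i : 'I_m) :
  \det (\matrix_(a, b) (if a == i then u ord0 b else (a == b)%:R)) = u ord0 i.
Proof.
set E := \matrix_(_, _) _; rewrite (expand_det_row E i) (bigD1 i) //= big1 ?addr0.
  rewrite mxE eqxx; suff -> : cofactor E i i = 1 by rewrite mulr1.
  have -> : cofactor E i i = (\adj (1%:M : 'M[R]_m)) i i.
    rewrite [RHS]mxE /cofactor; congr (_ * \det _); apply/matrixP => a b; rewrite !mxE.
    by rewrite eq_sym (negbTE (neq_lift _ _)).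
  by rewrite adj1 mxE eqxx.
move=> b bi; suff -> : cofactor E i b = 0 by rewrite mulr0.
have -> : cofactor E i b = (\adj (1%:M : 'M[R]_m)) b i.
  rewrite [RHS]mxE /cofactor; congr (_ * \det _); apply/matrixP => a b'; rewrite !mxE.
  by rewrite eq_sym (negbTE (neq_lift _ _)).
by rewrite adj1 mxE (negbTE bi).
Qed.

(** Scaled by the common denominator, volumes of lattice bases of R^m are natural numbers, so one is
    minimal. A lattice vector with a fractional coordinate [u ord0 i] would replace row [i] and
    multiply the volume by a number in []0, 1[]. *)
Theorem lattice_basis : exists2 B : 'M[R]_m, B \in unitmx & forall t, T t <-> exists k, t = ir k *m B.
Proof.
have [B0 B0u TB0] := rough_basis.
have [d d0 Hd] := common_denominator B0u TB0.
pose vol (B : 'M[R]_m) : R := `|\det (d%:R *: (B *m invmx B0))|.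
have volN B : (forall i, T (row i B)) -> exists n : nat, vol B = n%:R.
  move=> TBi; have [k Hk] := choice (fun i => Hd _ (TBi i)).
  pose K : 'M[int]_m := \matrix_(i, j) (k i) ord0 j.
  exists `|\det K|%N; rewrite /vol.
  have -> : d%:R *: (B *m invmx B0) = map_mx intr K.
    apply/matrixP => i j; have /rowP/(_ j) := Hk i.
    have h : (d%:R *: row i B *m invmx B0) ord0 j = (d%:R *: (B *m invmx B0)) i j.
      by rewrite -scalemxAl -row_mul !mxE.
    by rewrite h => ->; rewrite !mxE.
  by rewrite det_map_mx /= -intr_norm.
pose P n := exists B : 'M[R]_m, [/\ B \in unitmx, forall i, T (row i B) & vol B = n%:R].
have exP : exists n, `[< P n >].
  by have [n Hn] := volN _ TB0; exists n; apply/asboolP; exists B0.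
case: (ex_minnP exP) => n /asboolP[B [Bu TBi volB]] nmin.
exists B => // t; split=> [Tt|[k ->]]; last exact: lattice_comb.
pose x := t *m invmx B; exists (fl x).
have xB : t = x *m B by rewrite mulmxKV.
apply/eqP; rewrite xB -subr_eq0 -mulmxBl; set u := x - ir (fl x).
suff -> : u = 0 by rewrite mul0mx.
apply/rowP => i; rewrite [RHS]mxE; apply: contrapT => ui.
have /andP[u0 u1] := fl_unit_interval x i; rewrite -/u in u0 u1.
pose E := \matrix_(a, b) (if a == i then u ord0 b else (a == b)%:R) : 'M[R]_m.
have detE : \det E = u ord0 i := det_replace_row u i.
have rowEB a : row a (E *m B) = if a == i then u *m B else row a B.
  rewrite row_mul; case: ifPn => ai.
    by congr (_ *m _); apply/rowP => b; rewrite !mxE ai.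
  by rewrite [in RHS]rowE; congr (_ *m _); apply/rowP => b; rewrite !mxE (negbTE ai) eqxx eq_sym.
have TE a : T (row a (E *m B)).
  rewrite rowEB; case: ifP => // _; rewrite mulmxBl -xB; apply: TB => //; exact: lattice_comb.
have [n' Hn'] := volN _ TE.
have volE : vol (E *m B) = u ord0 i * vol B.
  by rewrite /vol -mulmxA scalemxAr det_mulmx normrM detE (ger0_norm u0).
have : (n <= n')%N.
  apply: nmin; apply/asboolP; exists (E *m B); split => //.
  by rewrite unitmx_mul Bu andbT unitmxE detE unitfE; apply/eqP.
apply/negP; rewrite -ltnNge -(ltr_nat R) -Hn' -volB volE.
rewrite gtr_pMl //; rewrite /vol normr_gt0 -unitfE -unitmxE unitmxZ ?unitmx_mul ?Bu ?unitmx_inv //.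
by rewrite unitfE pnatr_eq0 -lt0n.
Qed.

End Lattice.

Lemma norm_between {R : realType} (a b x : R) : a <= x <= b -> `|x| <= Num.max `|a| `|b|.
Proof.
move=> /andP[ax xb]; have h1 : `|a| <= Num.max `|a| `|b| by rewrite le_max lexx.
have h2 : `|b| <= Num.max `|a| `|b| by rewrite le_max lexx orbT.
have := ler_norm (- a); have := ler_norm b; rewrite normrN ler_norml => h3 h4.
by lra.
Qed.

Lemma strip_action_restrict {R : realType} {m : nat} (psi : 'rV[int]_m -> R -> R)
    (c : 'rV[int]_m -> R -> 'rV[R]_m) (a b b' : R) : strip_action psi c a b ->
  a < b' <= b -> (forall k, psi k b' = b') -> strip_action psi c a b'.
Proof.
move=> SA /andP[ab' b'b] fb'; have inab y : a <= y <= b' -> a <= y <= b.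
  by move=> /andP[-> h]; exact: le_trans b'b.
split => //; try by case: SA.
  by move=> r; have [N HN] := sa_proper SA r; exists N => k y /inab; exact: HN.
by have [r Hr] := sa_dense SA; exists r => y v /inab; exact: Hr.
Qed.

(** The end [se] is folded in two: besides integer translations, its only identification is
    translation by [al], half a period that is not a period. *)
Definition half_shift {R : realType} {m : nat} {M : Type} (Q : 'rV[R]_m -> R -> M) (se : R) (al : 'rV[R]_m) : Prop :=
  [/\ exists k, al + al = ir k, forall k, al <> ir k, forall t, Q (t + al) se = Q t se
    & forall t t', Q t se = Q t' se -> exists k, t' = t + ir k \/ t' = t + al + ir k].

(** * The action on heights and the orbit of a compact leaf *)

Section Leaf.
Context {R : realType} {m : nat} {M : topologicalType}.
Variables (G : set ('rV[R]_m.+1 -> 'rV[R]_m.+1)) (p : 'rV[R]_m.+1 -> M).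
Hypothesis LF : leaf_action G p.
Notation V := 'rV[R]_m.+1.
Notation pt := (@cons_mx R m).

Definition phi (g : V -> V) (y : R) : R := g (pt y 0) ord0 ord0.
Definition tau (g : V -> V) (y : R) : 'rV[R]_m := rsub (g (pt y 0)).

Lemma ptE (z : V) : pt (z ord0 ord0) (rsub z) = z.
Proof. by apply: rsub_inj; rewrite ?cons_mx0 ?rsub_cons. Qed.

Lemma ptD y v w : pt y v + pt 0 w = pt y (v + w).
Proof. by apply: rsub_inj; rewrite ?rsubD ?rsub_cons // mxE !cons_mx0 addr0. Qed.

Lemma pt_inj y v y' v' : pt y v = pt y' v' -> y = y' /\ v = v'.
Proof.
move=> E; split; first by rewrite -(cons_mx0 y v) E cons_mx0.
by rewrite -(rsub_cons y v) E rsub_cons.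
Qed.

Lemma pt_norm (y : R) (v : 'rV[R]_m) (r : R) : `|y| <= r -> `|v| <= r -> `|pt y v| <= r.
Proof.
move=> yr vr; apply: mx_norm_le => [|i j]; first exact: le_trans yr.
by rewrite mxE; case: unliftP => [k _|_] //; apply: le_trans vr; exact: mx_entry_le.
Qed.

Lemma pt_cvg {T : Type} {F : set_system T} {FF : Filter F} (f : T -> R) (g : T -> 'rV[R]_m) (y : R) (v : 'rV[R]_m) :
  f @ F --> y -> g @ F --> v -> (fun t => pt (f t) (g t)) @ F --> pt y v.
Proof.
move=> fy gv; apply: cvg_mx => i j; rewrite mxE; under eq_fun do rewrite mxE.
by case: (unlift ord0 j) => [k|] //; exact: (@cvg_entry R T F FF 1 m g v ord0 k gv).
Qed.

Lemma actE g y v : G g -> g (pt y v) = pt (phi g y) (v + tau g y).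
Proof.
move=> Gg; have -> : pt y v = pt y 0 + pt 0 v by rewrite ptD add0r.
by rewrite (lf_trans LF) // -[g (pt y 0)]ptE ptD addrC.
Qed.

Lemma phi_comp g h y : G g -> G h -> phi (g \o h) y = phi g (phi h y).
Proof. by move=> Gg Gh; rewrite {1}/phi /= (actE _ _ Gh) (actE _ _ Gg) cons_mx0. Qed.

Lemma tau_comp g h y : G g -> G h -> tau (g \o h) y = tau g (phi h y) + tau h y.
Proof. by move=> Gg Gh; rewrite {1}/tau /= (actE _ _ Gh) (actE _ _ Gg) rsub_cons add0r addrC. Qed.

Lemma phi_id y : phi id y = y.
Proof. by rewrite /phi cons_mx0. Qed.

Lemma tau_id y : tau id y = 0.
Proof. by rewrite /tau rsub_cons. Qed.

Lemma phi_cont g : G g -> continuous (phi g).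
Proof.
move=> Gg y.
have h1 : (fun y => pt y 0) @ y --> pt y 0 by apply: pt_cvg; [exact: cvg_id|exact: cvg_cst].
have h2 : g @ pt y 0 --> g (pt y 0) by exact: (act_cont (lf_homeo LF) Gg).
have h3 : (fun y => g (pt y 0)) @ y --> g (pt y 0) by exact: (cvg_comp _ _ h1 h2).
exact: (@cvg_entry R R (nbhs y) (nbhs_filter y) 1 m.+1 _ _ ord0 ord0 h3).
Qed.

Lemma tau_cont g : G g -> continuous (tau g).
Proof.
move=> Gg y.
have h1 : (fun y => pt y 0) @ y --> pt y 0 by apply: pt_cvg; [exact: cvg_id|exact: cvg_cst].
have h2 : g @ pt y 0 --> g (pt y 0) by exact: (act_cont (lf_homeo LF) Gg).
have h3 : (fun y => g (pt y 0)) @ y --> g (pt y 0) by exact: (cvg_comp _ _ h1 h2).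
apply: (@cvg_mx R R (nbhs y) (nbhs_filter y)) => i j; rewrite /tau mxE; under eq_fun do rewrite mxE.
exact: (@cvg_entry R R (nbhs y) (nbhs_filter y) 1 m.+1 _ _ ord0 (lift ord0 j) h3).
Qed.

Lemma lf_id : G id. Proof. exact: act_id (lf_homeo LF). Qed.

Lemma lf_comp g h : G g -> G h -> G (g \o h). Proof. exact: (act_comp (lf_homeo LF)). Qed.

Lemma lf_inv g : G g -> G (fun_inv g). Proof. by case/(act_inv (lf_homeo LF)). Qed.

Lemma lf_compV g : G g -> g \o fun_inv g = id.
Proof. by move=> Gg; have [_ _ K] := act_inv (lf_homeo LF) Gg; apply/funext => x; exact: K. Qed.

Lemma lf_Vcomp g : G g -> fun_inv g \o g = id.
Proof. by move=> Gg; have [_ K _] := act_inv (lf_homeo LF) Gg; apply/funext => x; exact: K. Qed.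

Lemma phiK g : G g -> cancel (phi g) (phi (fun_inv g)).
Proof. by move=> Gg y; rewrite -phi_comp ?lf_Vcomp ?phi_id //; exact: lf_inv. Qed.

Lemma phiVK g : G g -> cancel (phi (fun_inv g)) (phi g).
Proof. by move=> Gg y; rewrite -phi_comp ?lf_compV ?phi_id //; exact: lf_inv. Qed.

Lemma phi_inj g : G g -> injective (phi g).
Proof. by move=> Gg; exact: can_inj (phiK Gg). Qed.

Lemma tauV g y : G g -> tau (fun_inv g) (phi g y) = - tau g y.
Proof.
move=> Gg; have := tau_comp y (lf_inv Gg) Gg; rewrite lf_Vcomp // tau_id => /esym/eqP.
by rewrite addr_eq0 => /eqP.
Qed.

Lemma lf_eq g h y : G g -> G h -> phi g y = phi h y -> tau g y = tau h y -> g = h.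
Proof.
move=> Gg Gh E1 E2; have Ghg := lf_comp (lf_inv Gh) Gg.
have E : (fun_inv h \o g) = id.
  have [free _] := lf_fpd LF; apply: (free (pt y 0)) => //=.
  rewrite (actE _ _ Gg) E1 E2 -(actE _ _ Gh); have [_ K _] := act_inv (lf_homeo LF) Gh; exact: K.
apply/funext => x; have [_ _ K] := act_inv (lf_homeo LF) Gh.
by rewrite -[LHS]K; congr h; move/funeqP: E => /(_ x).
Qed.

Lemma proj_pt y v y' v' : p (pt y v) = p (pt y' v') <-> exists2 g, G g & phi g y = y' /\ v + tau g y = v'.
Proof.
rewrite (proj_eq (lf_orbit LF)); split => [[g Gg]|[g Gg [h1 h2]]].
  by rewrite actE // => /pt_inj[h1 h2]; exists g.
by exists g => //; rewrite actE // h1 h2.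
Qed.

Lemma phi_mono g : G g -> (forall x y, x < y -> phi g x < phi g y) \/ (forall x y, x < y -> phi g y < phi g x).
Proof.
move=> Gg.
have c1 : {within [set` `]-oo, +oo[], continuous (phi g)} by apply: continuous_subspaceT; exact: phi_cont.
have c2 : {in `]-oo, +oo[ &, injective (phi g)} by move=> x y _ _; exact: phi_inj.
have [H|H] := @itv_continuous_inj_mono R (phi g) `]-oo, +oo[ c1 c2; [left|right] => x y xy;
  by rewrite H ?in_itv.
Qed.

Section CompactLeaf.
Variable y0 : R.
Hypothesis leaf_compact : compact [set p (pt y0 v) | v in [set: 'rV[R]_m]].

Definition leaf_orbit : set R := [set y | exists2 g, G g & phi g y0 = y].
Notation D := leaf_orbit.

Lemma orbit_self : D y0. Proof. by exists id; [exact: lf_id|rewrite phi_id]. Qed.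

Lemma orbit_act g y : G g -> D y -> D (phi g y).
Proof.
by move=> Gg [h Gh <-]; exists (g \o h); [exact: lf_comp|rewrite phi_comp].
Qed.

Lemma orbit_closed : closed D.
Proof.
pose q y := p (pt y 0).
have -> : D = q @^-1` [set p (pt y0 v) | v in [set: 'rV[R]_m]].
  apply/seteqP; split => y.
    by move=> [g Gg gy]; exists (- tau g y0) => //; apply/proj_pt; exists g => //; rewrite gy addNr.
  by move=> [v _ /proj_pt[g Gg [gy _]]]; exists g.
apply: closed_comp; last exact: compact_closed (lf_hausdorff LF) leaf_compact.
move=> y _; have h1 : (fun y => pt y 0) @ y --> pt y 0 by apply: pt_cvg; [exact: cvg_id|exact: cvg_cst].
have h2 : p @ pt y 0 --> p (pt y 0) by exact: (proj_cont (lf_orbit LF)).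
exact: (cvg_comp _ _ h1 h2).
Qed.

(** The orbit is closed and countable, so one of its points is isolated; the group carries this to
    all of them. *)
Lemma orbit_isolated y : D y -> exists2 d : R, 0 < d & forall z, D z -> `|z - y| < d -> z = y.
Proof.
move=> [h Gh hy].
have [s Hs] := act_countable (lf_homeo LF) (lf_fpd LF) (lf_orbit LF) (lf_hausdorff LF).
have [|_ [g Gg <-] [d d0 Hd]] := @closed_countable_isolated R D (fun k => phi (s k) y0) y0 orbit_closed orbit_self.
  by move=> z [g Gg <-]; have [k <-] := Hs g Gg; exists k.
pose f := g \o fun_inv h; have Gf : G f by apply: lf_comp => //; exact: lf_inv.
have fy : phi f y = phi g y0 by rewrite phi_comp //; [rewrite -hy phiK|exact: lf_inv].
have [d' d'0 Hd'] := continuous_dist (W := R^o) y (phi_cont Gf) (ltac:(lra) : 0 < d / 2).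
exists d' => // z Dz zy; apply: (phi_inj Gf); rewrite fy; apply: Hd; first exact: orbit_act.
by rewrite -fy (le_lt_trans (Hd' z zy)) //; lra.
Qed.

(** The compact leaf is covered by the image of one bounded set so thin around [y0] that it meets no
    other height of the orbit; the element that brings a point back into it therefore fixes [y0]. *)
Lemma leaf_cocompact : exists r : R, forall v, exists2 g, G g & phi g y0 = y0 /\ `|v + tau g y0| <= r.
Proof.
have [d d0 iso] := orbit_isolated orbit_self.
pose B (N : nat) : set V := [set z : V | `|z| < N%:R /\ `|pt y0 0 - pt (z ord0 ord0) 0| < d].
have : \forall N \near \oo, [set p (pt y0 v) | v in [set: 'rV[R]_m]] `<=` (fun k => exists2 z, B N z & p z = k).
  move/compact_near_coveringP: leaf_compact => /(_ nat \oo (fun N k => exists2 z, B N z & p z = k)); apply.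
  move=> _ [v _ <-].
  pose N0 := (Num.truncn `|pt y0 v|).+1.
  have oB : open (B N0).
    apply: openI; first exact: open_norm_lt.
    apply: (@open_comp _ _ (fun z : V => pt (z ord0 ord0) 0) [set w | `|pt y0 0 - w| < d]); last exact: open_dist_lt.
    move=> z _; have FF := @nbhs_filter V z.
    apply: pt_cvg; last exact: cvg_cst.
    by apply: (@cvg_entry R V (nbhs z) FF 1 m.+1 id z ord0 ord0); exact: cvg_id.
  have Bv : B N0 (pt y0 v) by split; [exact: truncnS_gt|rewrite cons_mx0 subrr normr0].
  exists (p @` B N0, [set N | (N0 <= N)%N]).
    split; last by exists N0.
    by apply: open_nbhs_nbhs; split; [exact: (proj_open (lf_homeo LF) (lf_orbit LF) oB)|exists (pt y0 v)].
  move=> [k N] /= [[z [z1 z2] <-] N0N]; exists z => //; split => //.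
  by apply: (lt_le_trans z1); rewrite ler_nat.
move=> [N _ /(_ N (leqnn N)) HN]; exists N%:R => v.
have [z [z1 z2]] := HN _ (ex_intro2 _ _ v I erefl).
rewrite -[z]ptE => /esym/proj_pt[g Gg [E1 E2]]; exists g => //; rewrite E1 E2; split.
  apply: iso; first by exists g.
  apply: le_lt_trans z2; have := mx_entry_le (pt y0 0 - pt (z ord0 ord0) 0) ord0 ord0.
  by rewrite !mxE unlift_none distrC.
by apply/ltW/(le_lt_trans _ z1); exact: rsub_norm.
Qed.

(** An element carrying [y0] to [y] can be corrected, by cocompactness on the leaf, to have bounded
    displacement; properness then leaves finitely many. *)
Lemma orbit_locally_finite (r : R) : finite_set [set y | D y /\ `|y| <= r].
Proof.
have [r1 H1] := leaf_cocompact.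
have cb s : compact [set x : V | `|x| <= s] by exact: compact_norm_le.
have := @act_proper _ _ _ G p cb (lf_homeo LF) (lf_fpd LF) (lf_orbit LF) (lf_hausdorff LF) (Num.max (Num.max `|y0| r) r1).
set S := [set _ | _]; move=> fS.
apply: sub_finite_set (finite_image (fun g => phi g y0) fS) => y /= [[g Gg gy] yr].
have [h Gh [hy0 hr]] := H1 (tau g y0).
have Ggh := lf_comp Gg Gh.
exists (g \o h); last by rewrite phi_comp // hy0.
split => //; exists (pt y0 0); split; first by apply: pt_norm; rewrite ?normr0 !le_max ?lexx // normr_ge0.
rewrite (actE _ _ Ggh) phi_comp // tau_comp // hy0 add0r gy.
by apply: pt_norm; rewrite !le_max ?yr ?hr ?orbT.
Qed.

(** The points whose height lies between two orbit heights form a nonempty invariant convex set,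
    hence the whole space. *)
Lemma orbit_unbounded x : (exists2 y, D y & x < y) /\ (exists2 y, D y & y < x).
Proof.
pose C : set V := [set z | exists y y', [/\ D y, D y' & y <= z ord0 ord0 <= y']].
have H z : C z.
  apply: (@invariant_affine_full R m.+1 M G p (lf_homeo LF) (lf_fpd LF) (lf_orbit LF) (lf_hausdorff LF)
    (lf_compact LF) C (pt y0 0)); last first.
  - by exists y0, y0; rewrite cons_mx0 lexx; split => //; exact: orbit_self.
  - move=> g w Gg [y [y' [Dy Dy' /andP[h1 h2]]]].
    rewrite -[w]ptE actE //; have [inc|dec] := phi_mono Gg.
      exists (phi g y), (phi g y'); split; [exact: orbit_act|exact: orbit_act|].
      have le u v : u <= v -> phi g u <= phi g v by rewrite le_eqVlt => /orP[/eqP -> //|/inc/ltW].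
      by rewrite cons_mx0 !le.
    exists (phi g y'), (phi g y); split; [exact: orbit_act|exact: orbit_act|].
    have le u v : u <= v -> phi g v <= phi g u by rewrite le_eqVlt => /orP[/eqP -> //|/dec/ltW].
    by rewrite cons_mx0 !le.
  move=> w w' t [y [y' [Dy Dy' /andP[h1 h2]]]] [z1 [z2 [Dz Dz' /andP[h3 h4]]]] /andP[t0 t1].
  exists (Num.min y z1), (Num.max y' z2); rewrite !mxE.
  split; [by case: leP|by case: leP|].
  have e : w ord0 ord0 + t * (w' ord0 ord0 - w ord0 ord0) = (1 - t) * w ord0 ord0 + t * w' ord0 ord0 by ring.
  have a1 : Num.min y z1 <= w ord0 ord0 by rewrite ge_min h1.
  have a2 : Num.min y z1 <= w' ord0 ord0 by rewrite ge_min h3 orbT.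
  have a3 : w ord0 ord0 <= Num.max y' z2 by rewrite le_max h2.
  have a4 : w' ord0 ord0 <= Num.max y' z2 by rewrite le_max h4 orbT.
  have s0 : 0 <= 1 - t by lra.
  rewrite e; apply/andP; split.
    have -> : Num.min y z1 = (1 - t) * Num.min y z1 + t * Num.min y z1 by ring.
    by apply: lerD; apply: ler_wpM2l.
  have -> : Num.max y' z2 = (1 - t) * Num.max y' z2 + t * Num.max y' z2 by ring.
  by apply: lerD; apply: ler_wpM2l.
have [_ [y' [_ Dy' /andP[_]]]] := H (pt (x + 1) 0); rewrite cons_mx0 => h1.
have [y [_ [Dy _ /andP[+ _]]]] := H (pt (x - 1) 0); rewrite cons_mx0 => h2.
by split; [exists y' => //; lra|exists y => //; lra].
Qed.

Lemma orbit_succ y : D y -> exists y', [/\ D y', y < y' & forall z, D z -> y < z -> y' <= z].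
Proof.
move=> Dy; have [d d0 iso] := orbit_isolated Dy.
pose S : set R := [set z | D z /\ y + d <= z].
have [[w Dw yw] _] := orbit_unbounded (y + d).
have infS : has_inf S by split; [exists w; split => //; exact: ltW|exists (y + d) => z []].
have cS : closed S by apply: closedI; [exact: orbit_closed|exact: closed_ge].
have [Di yi] := closed_inf cS infS.
exists (inf S); split => //; first lra.
move=> z Dz yz; apply: (inf_lower_bound infS); split => //.
rewrite leNgt; apply/negP => h; have E : z = y by apply: iso => //; rewrite gtr0_norm ?subr_gt0 //; lra.
by rewrite E ltxx in yz.
Qed.

Lemma orbit_floor x : exists y, [/\ D y, y <= x & forall z, D z -> z <= x -> z <= y].
Proof.
pose S : set R := [set z | D z /\ z <= x].
have [_ [w Dw wx]] := orbit_unbounded x.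
have supS : has_sup S by split; [exists w; split => //; exact: ltW|exists x => z []].
have cS : closed S by apply: closedI; [exact: orbit_closed|exact: closed_le].
have [Di yi] := closed_sup cS supS.
by exists (sup S); split => // z Dz zx; apply: (sup_upper_bound supS).
Qed.

End CompactLeaf.

Section LeafStrip.
Variables y0 y1 : R.
Hypothesis leaf_compact : compact [set p (pt y0 v) | v in [set: 'rV[R]_m]].
Notation D := (leaf_orbit y0).
Hypothesis y01 : [/\ D y1, y0 < y1 & forall z, D z -> y0 < z -> y1 <= z].

Definition increasing (g : V -> V) := forall x y, x < y -> phi g x < phi g y.
Definition decreasing (g : V -> V) := forall x y, x < y -> phi g y < phi g x.

Lemma increasing_le g x y : increasing g -> x <= y -> phi g x <= phi g y.
Proof. by move=> H; rewrite le_eqVlt => /orP[/eqP -> //|/H/ltW]. Qed.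

Lemma decreasing_le g x y : decreasing g -> x <= y -> phi g y <= phi g x.
Proof. by move=> H; rewrite le_eqVlt => /orP[/eqP -> //|/H/ltW]. Qed.

(** No orbit height lies strictly between [y0] and [y1], hence none lies inside the image of this
    interval under [phi g]. *)
Lemma orbit_no_cross g d : G g -> D d ->
  (forall z, y0 <= z <= y1 -> d <= phi g z) \/ (forall z, y0 <= z <= y1 -> phi g z <= d).
Proof.
move=> Gg Dd; have [_ y01' succ] := y01.
pose w := phi (fun_inv g) d; have Dw : D w by apply: orbit_act => //; exact: lf_inv.
have -> : d = phi g w by rewrite phiVK.
have [wy|wy] := ltP y0 w.
  have h := succ _ Dw wy; have [inc|dec] := phi_mono Gg; [right|left] => z /andP[z0 z1].
    by apply: increasing_le => //; lra.
  by apply: decreasing_le => //; lra.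
have [inc|dec] := phi_mono Gg; [left|right] => z /andP[z0 z1].
  by apply: increasing_le => //; lra.
by apply: decreasing_le => //; lra.
Qed.

Definition stabilizer (g : V -> V) := [/\ G g, phi g y0 = y0 & increasing g].

Lemma stabilizer1 g : stabilizer g -> phi g y1 = y1.
Proof.
move=> [Gg g0 inc]; have [Dy1 y01' succ] := y01; have y0in : y0 <= y0 <= y1 by rewrite lexx ltW.
apply/eqP; rewrite eq_le; apply/andP; split; last first.
  by apply: succ; [exact: orbit_act|rewrite -[ltLHS]g0 inc].
have y1in : y0 <= y1 <= y1 by rewrite lexx ltW.
have [H|H] := orbit_no_cross Gg Dy1; last exact: H.
by have := H y0 y0in; rewrite g0 leNgt y01'.
Qed.

Lemma stabilizer_end g : G g -> phi g y0 = y0 -> phi g y1 = y1 -> stabilizer g.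
Proof.
move=> Gg g0 g1; split => //; have [_ y01' _] := y01.
by have [//|dec] := phi_mono Gg; have := dec _ _ y01'; rewrite g0 g1 ltNge ltW.
Qed.

Lemma stabilizer_comp g h : stabilizer g -> stabilizer h -> stabilizer (g \o h).
Proof.
move=> [Gg g0 gi] [Gh h0 hi]; split; first exact: lf_comp.
  by rewrite phi_comp // h0.
by move=> x y xy; rewrite (phi_comp x Gg Gh) (phi_comp y Gg Gh); exact: gi _ _ (hi _ _ xy).
Qed.

Lemma stabilizer_inv g : stabilizer g -> stabilizer (fun_inv g).
Proof.
move=> sg; have [Gg g0 gi] := sg; apply: stabilizer_end; first exact: lf_inv.
  by rewrite -[X in phi _ X]g0 phiK.
by rewrite -[X in phi _ X](stabilizer1 sg) phiK.
Qed.

Lemma stabilizer_id : stabilizer id.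
Proof. by split; [exact: lf_id|rewrite phi_id|move=> x y; rewrite !phi_id]. Qed.

(** Evaluating [tau] at [y0] embeds the stabilizer in R^m as a discrete subgroup, injectively by
    freeness. It is cocompact because a decreasing element fixing [y0] becomes increasing after
    composition with one fixed decreasing element. *)
Lemma stabilizer_lattice : exists E : 'rV[int]_m -> V -> V,
  [/\ forall k, stabilizer (E k), forall g, stabilizer g -> exists k, E k = g,
      forall k l, E (k + l) = E k \o E l & injective E].
Proof.
pose T : set 'rV[R]_m := [set t | exists2 g, stabilizer g & tau g y0 = t].
have T0 : T 0 by exists id; [exact: stabilizer_id|rewrite tau_id].
have TB s t : T s -> T t -> T (s - t).
  move=> [g sg <-] [h sh <-]; exists (g \o fun_inv h); first exact/stabilizer_comp/stabilizer_inv.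
  have [Gg g0 _] := sg; have [Gh h0 _] := sh; have [_ hV _] := stabilizer_inv sh.
  rewrite tau_comp ?hV //; last exact: lf_inv.
  by rewrite -[X in tau (fun_inv h) X]h0 tauV.
have Td r : finite_set [set t | T t /\ `|t| <= r].
  have cb s : compact [set x : V | `|x| <= s] by exact: compact_norm_le.
  have := @act_proper _ _ _ G p cb (lf_homeo LF) (lf_fpd LF) (lf_orbit LF) (lf_hausdorff LF) (Num.max `|y0| r).
  set S := [set _ | _]; move=> fS.
  apply: sub_finite_set (finite_image (fun g => tau g y0) fS) => t /= [[g [Gg g0 _] gt] tr].
  exists g => //; split => //; exists (pt y0 0).
  rewrite actE // g0 gt add0r; split; apply: pt_norm; rewrite ?normr0 le_max ?lexx ?normr_ge0 // ?tr ?orbT //.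
have [r Tc] : exists r : R, forall v, exists2 t, T t & `|v - t| <= r.
  have [r Hr] := leaf_cocompact leaf_compact.
  have [[r0 [Gr0 r00 r0d]]|nod] := pselect (exists g, [/\ G g, phi g y0 = y0 & decreasing g]).
    exists (r + `|tau r0 y0|) => v; have [g Gg [g0 gr]] := Hr (- v).
    have [gi|gd] := phi_mono Gg.
      exists (tau g y0); first by exists g.
      by rewrite distrC addrC (le_trans gr) // lerDl.
    exists (tau (r0 \o g) y0).
      exists (r0 \o g) => //; split; [exact: lf_comp|by rewrite phi_comp // g0|].
      by move=> x y xy; rewrite (phi_comp x Gr0 Gg) (phi_comp y Gr0 Gg); exact: r0d _ _ (gd _ _ xy).
    rewrite tau_comp // g0 distrC -addrA [tau g y0 - v]addrC addrC.
    by rewrite (le_trans (ler_normD _ _)) // lerD2r.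
  exists r => v; have [g Gg [g0 gr]] := Hr (- v); exists (tau g y0); last by rewrite distrC addrC.
  exists g => //; split => //; have [//|gd] := phi_mono Gg.
  by case: nod; exists g.
have [B Bu HB] := lattice_basis T0 TB Td Tc.
have [E HE] := choice (fun k => (let: ex_intro2 g sg gk := (HB (ir k *m B)).2 (ex_intro _ k erefl) in
  ex_intro _ g (conj sg gk)) : exists g, stabilizer g /\ tau g y0 = ir k *m B).
have inj g h : stabilizer g -> stabilizer h -> tau g y0 = tau h y0 -> g = h.
  by move=> [Gg g0 _] [Gh h0 _]; apply: lf_eq => //; rewrite g0.
exists E; split.
- by move=> k; case: (HE k).
- move=> g sg; have [|k Hk] := (HB (tau g y0)).1; first by exists g.
  by exists k; have [sE tE] := HE k; apply: inj => //; rewrite tE.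
- move=> k l; have [sk tk] := HE k; have [sl tl] := HE l; have [skl tkl] := HE (k + l).
  apply: inj => //; first exact: stabilizer_comp.
  have [Gk _ _] := sk; have [Gl l0 _] := sl.
  by rewrite tkl tau_comp // l0 tk tl irD mulmxDl.
move=> k l Ekl; have [_ tk] := HE k; have [_ tl] := HE l; apply: (@ir_inj R).
by rewrite -(mulmxK Bu (ir k)) -tk Ekl tl mulmxK.
Qed.

Variable E : 'rV[int]_m -> V -> V.
Hypothesis E_stab : forall k, stabilizer (E k).
Hypothesis E_surj : forall g, stabilizer g -> exists k, E k = g.
Hypothesis ED : forall k l, E (k + l) = E k \o E l.
Hypothesis E_inj : injective E.

Let EG k : G (E k). Proof. by case: (E_stab k). Qed.

(** The inverse is used so that [E k] carries the height [strip_psi k y] to [y], with displacement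
    [strip_c k y]: the form in which a chart absorbs it as a translation of [t]. *)
Definition strip_psi (k : 'rV[int]_m) (y : R) : R := phi (E (- k)) y.
Definition strip_c (k : 'rV[int]_m) (y : R) : 'rV[R]_m := tau (E k) (strip_psi k y).

Let E0 : E 0 = id.
Proof.
have h : E 0 = E 0 \o E 0 by rewrite -ED addr0.
apply/funext => x; apply: (act_inj (lf_homeo LF) (EG 0)).
by move/funeqP: h => /(_ x) /= <-.
Qed.

Let EN k : E k \o E (- k) = id. Proof. by rewrite -ED subrr E0. Qed.

Lemma strip_psiD k l y : strip_psi (k + l) y = strip_psi k (strip_psi l y).
Proof. by rewrite /strip_psi opprD ED phi_comp. Qed.

Lemma strip_phi_psi k y : phi (E k) (strip_psi k y) = y.
Proof. by rewrite /strip_psi -phi_comp // EN phi_id. Qed.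

Lemma strip_tau k y : tau (E (- k)) y = - strip_c k y.
Proof.
have := tau_comp y (EG k) (EG (- k)); rewrite EN tau_id => /esym/eqP.
by rewrite addr_eq0 => /eqP h; rewrite /strip_c /strip_psi h opprK.
Qed.

Lemma strip_cD k l y : strip_c (k + l) y = strip_c k (strip_psi l y) + strip_c l y.
Proof.
apply: oppr_inj; rewrite -strip_tau opprD ED tau_comp // strip_tau strip_tau.
by rewrite [RHS]opprD.
Qed.

(** Cocompactness of [G] bounds the image of the point but may carry the strip elsewhere. As the
    orbit is locally finite, only finitely many pairs of ends can occur; composing with the inverse
    of a representative of the pair returns to the stabilizer at bounded cost. *)
Lemma strip_dense : exists r : R, forall y (v : 'rV[R]_m), y0 <= y <= y1 -> exists k, `|v - strip_c k y| <= r.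
Proof.
have [r0 r0_gt0 coc] := act_cocompact (lf_homeo LF) (lf_orbit LF) (lf_compact LF).
have [[dp Ddp hp] _] := orbit_unbounded y0 r0.
have [_ [dm Ddm hm]] := orbit_unbounded y0 (- r0).
pose F : set R := [set y | D y /\ `|y| <= Num.max `|dm| `|dp|].
have fF : finite_set F := orbit_locally_finite leaf_compact _.
have y01' : y0 < y1 by case: y01.
have pair_in g y : G g -> y0 <= y <= y1 -> `|phi g y| < r0 -> F (phi g y0) /\ F (phi g y1).
  move=> Gg yin; rewrite ltr_norml => /andP[g1 g2].
  have Dy1 : D y1 by case: y01.
  have bnd z : y0 <= z <= y1 -> D z -> F (phi g z).
    move=> zin Dz; split; first exact: orbit_act.
    have h1 : dm <= phi g z by have [H|H] := orbit_no_cross Gg Ddm; [exact: H|have := H y yin; lra].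
    have h2 : phi g z <= dp by have [H|H] := orbit_no_cross Gg Ddp; [have := H y yin; lra|exact: H].
    by apply: norm_between; rewrite h1.
  have Dy0 : D y0 by exact: orbit_self.
  by split; apply: bnd => //; rewrite lexx ltW.
have rep (ab : R * R) : exists hB : (V -> V) * R, (exists h, G h /\ (phi h y0, phi h y1) = ab) ->
    [/\ G hB.1, (phi hB.1 y0, phi hB.1 y1) = ab & forall z, - r0 <= z <= r0 -> `|tau (fun_inv hB.1) z| <= hB.2].
  have [[h [Gh hab]]|no] := pselect (exists h, G h /\ (phi h y0, phi h y1) = ab); last by exists (id, 0) => /no.
  have [B _ HB] := segment_bounded (- r0) r0 (@tau_cont _ (lf_inv Gh)).
  by exists (h, B).
have [f Hf] := choice rep.
have [N HN] := finite_upper_bound (fun ab : R * R => (f ab).2) (finite_setX fF fF).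
exists (N + r0) => y v yin; have [g Gg gr] := coc (pt y v).
move: gr; rewrite actE // => gr.
have gr1 : `|phi g y| < r0 by apply: le_lt_trans gr; have := mx_entry_le (pt (phi g y) (v + tau g y)) ord0 ord0; rewrite cons_mx0.
have gr2 : `|v + tau g y| <= r0 by rewrite ltW // (le_lt_trans _ gr) // -[X in `|X| <= _](rsub_cons (phi g y)); exact: rsub_norm.
have [F0 F1] := pair_in g y Gg yin gr1.
have [|Gh [h0 h1] hb] := Hf (phi g y0, phi g y1); first by exists g.
have HNab := HN _ (conj F0 F1 : (F `*` F) (phi g y0, phi g y1)).
set h := (f _).1 in Gh h0 h1 hb; pose l := fun_inv h \o g.
have Ghi := lf_inv Gh.
have sl : stabilizer l.
  apply: stabilizer_end; [exact: lf_comp| |].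
    by rewrite phi_comp // -h0 phiK.
  by rewrite phi_comp // -h1 phiK.
have [k Ek] := E_surj sl; exists (- k).
have -> : v - strip_c (- k) y = v + tau l y by rewrite -strip_tau opprK Ek.
rewrite tau_comp // addrCA (le_trans (ler_normD _ _)) // lerD //.
apply: le_trans HNab; apply: hb; move: gr1; rewrite ltr_norml => /andP[/ltW -> /ltW ->] //.
Qed.

Theorem leaf_strip_action : strip_action strip_psi strip_c y0 y1.
Proof.
have y01' : y0 < y1 by case: y01.
split => //.
- by move=> y; rewrite /strip_psi oppr0 E0 phi_id.
- exact: strip_psiD.
- by move=> k; apply: phi_cont.
- by move=> k; case: (E_stab (- k)).
- by move=> k; case: (E_stab (- k)).
- by move=> k; apply: stabilizer1.
- exact: strip_cD.
- move=> k y; have -> : strip_c k = fun y => - tau (E (- k)) y by apply/funext => z; rewrite strip_tau opprK.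
  by apply: cvgN; apply: tau_cont.
- move=> r.
  have cb s : compact [set x : V | `|x| <= s] by exact: compact_norm_le.
  have := @act_proper _ _ _ G p cb (lf_homeo LF) (lf_fpd LF) (lf_orbit LF) (lf_hausdorff LF) (Num.max (Num.max `|y0| `|y1|) r).
  set S := [set _ | _]; move=> fS.
  have fK : finite_set [set k | S (E k)] by apply: (finite_preimage (f := E)) => // k l _ _; exact: E_inj.
  have [N HN] := finite_upper_bound (fun k : 'rV[int]_m => `|ir k : 'rV[R]_m|) fK.
  exists N => k y yin ckr; apply: HN; split; first exact: EG.
  have bnd z : y0 <= z <= y1 -> `|z| <= Num.max `|y0| `|y1|.
    exact: norm_between.
  exists (pt (strip_psi k y) 0); rewrite actE // strip_phi_psi add0r.
  split; apply: pt_norm; rewrite ?normr0 ?le_max ?normr_ge0 ?ckr ?orbT //; apply/orP; left; rewrite -le_max; apply: bnd => //.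
  have [Gk k0 ki] := E_stab (- k); move/andP: yin => [h1 h2].
  apply/andP; split; [rewrite -[leLHS]k0|rewrite -[leRHS](stabilizer1 (E_stab (- k)))]; exact: increasing_le.
exact: strip_dense.
Qed.

End LeafStrip.

Record strip_setup (y0 y1 : R) (E : 'rV[int]_m -> V -> V) : Prop := StripSetup {
  ss_leaf : compact [set p (pt y0 v) | v in [set: 'rV[R]_m]];
  ss_succ : [/\ leaf_orbit y0 y1, y0 < y1 & forall z, leaf_orbit y0 z -> y0 < z -> y1 <= z];
  ss_stab : forall k, stabilizer y0 (E k);
  ss_surj : forall g, stabilizer y0 g -> exists k, E k = g;
  ss_D : forall k l, E (k + l) = E k \o E l;
  ss_inj : injective E
}.

Lemma strip_setup_exists y0 y :
  compact [set p (pt y v) | v in [set: 'rV[R]_m]] -> leaf_orbit y y0 ->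
  exists y1 E, strip_setup y0 y1 E.
Proof.
move=> lc [g Gg gy].
have lc0 : compact [set p (pt y0 v) | v in [set: 'rV[R]_m]].
  have -> // : [set p (pt y0 v) | v in [set: 'rV[R]_m]] = [set p (pt y v) | v in [set: 'rV[R]_m]].
  apply/seteqP; split => _ [v _ <-].
    exists (v - tau g y) => //; apply/proj_pt; exists g => //; by rewrite subrK.
  by exists (v + tau g y) => //; apply/esym/proj_pt; exists g.
have [y1 succ] := orbit_succ lc0 (orbit_self y0).
have [E [E1 E2 E3 E4]] := stabilizer_lattice lc0 succ.
by exists y1, E.
Qed.

Section Setup.
Variables (y0 y1 : R) (E : 'rV[int]_m -> V -> V).
Hypothesis SS : strip_setup y0 y1 E.
Notation psi := (strip_psi E).
Notation c := (strip_c E).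

Lemma setup_action : strip_action psi c y0 y1.
Proof.
exact: (leaf_strip_action (ss_leaf SS) (ss_succ SS) (ss_stab SS) (ss_surj SS) (ss_D SS) (ss_inj SS)).
Qed.

Let SA := setup_action.

Let EG k : G (E k). Proof. by case: (ss_stab SS k). Qed.

Lemma decreasing_inv g : G g -> decreasing g -> decreasing (fun_inv g).
Proof.
move=> Gg gd x y xy; rewrite ltNge; apply/negP => h.
by have := decreasing_le gd h; rewrite !(phiVK Gg) leNgt xy.
Qed.

(** The image of [y0] is an orbit height above [z], so at least [y1]; the same holds for the inverse
    of [r], and the two bounds force equality. *)
Lemma swap_ends r z : G r -> decreasing r -> phi r z = z -> y0 < z < y1 -> phi r y0 = y1 /\ phi r y1 = y0.
Proof.
move=> Gr rd rz /andP[y0z zy1]; have [Dy1 y01 succ] := ss_succ SS.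
have up g : G g -> decreasing g -> phi g z = z -> y1 <= phi g y0.
  move=> Gg gd gz; apply: succ; first exact: orbit_act (orbit_self y0).
  by rewrite (lt_trans y0z) // -[ltLHS]gz; exact: gd.
have Gri := lf_inv Gr; have rid := decreasing_inv Gr rd.
have riz : phi (fun_inv r) z = z by rewrite -[X in phi _ X]rz phiK.
have h1 := up _ Gr rd rz; have h2 := up _ Gri rid riz.
have h3 : phi r y1 <= y0.
  have [//|h] := leP (phi r y1) y0.
  have := succ _ (orbit_act Gr Dy1) h; rewrite leNgt => /negP[].
  by rewrite (lt_trans _ zy1) // -[ltRHS]rz; exact: rd.
have h4 : phi r y1 = y0.
  apply/eqP; rewrite eq_le h3 /=; have := decreasing_le rd h2.
  by rewrite (phiVK Gr).
split => //; apply/eqP; rewrite eq_le h1 andbT.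
have h5 : phi (fun_inv r) y1 <= y0.
  have [//|h] := leP (phi (fun_inv r) y1) y0.
  have := succ _ (orbit_act Gri Dy1) h; rewrite leNgt => /negP[].
  by rewrite (lt_trans _ zy1) // -[ltRHS]riz; exact: rid.
by have := decreasing_le rd h5; rewrite (phiVK Gr).
Qed.

Lemma swap_conj r : G r -> phi r y0 = y1 -> phi r y1 = y0 -> forall k, exists k', E k' = r \o E k \o fun_inv r.
Proof.
move=> Gr r0 r1 k; apply: (ss_surj SS).
have e1 : phi (fun_inv r) y0 = y1 by rewrite -r1 phiK.
have e2 : phi (fun_inv r) y1 = y0 by rewrite -r0 phiK.
have Gri := lf_inv Gr; have Gk := EG k; have [_ k0 _] := ss_stab SS k.
have k1 := stabilizer1 (ss_succ SS) (ss_stab SS k).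
have Grk := lf_comp Gr Gk.
apply: (stabilizer_end (ss_succ SS)); first exact: lf_comp.
  by rewrite (phi_comp _ Grk Gri) e1 (phi_comp _ Gr Gk) k1.
by rewrite (phi_comp _ Grk Gri) e2 (phi_comp _ Gr Gk) k0.
Qed.

Lemma fixed_phi x : fixed psi x <-> forall k, phi (E k) x = x.
Proof. by split => H k; [rewrite -[k]opprK|]; exact: H. Qed.

(* The reflection [r] exchanges the end matrices of an [r]-invariant block up
   to the involution [k |-> k'] of the lattice, so it commutes with the lattice
   because the mean of the two matrices is invertible. *)
Lemma swap_centre_fixed r z : G r -> decreasing r -> phi r z = z -> y0 < z < y1 -> fixed psi z.
Proof.
move=> Gr rd rz zin; have [r0 r1] := swap_ends Gr rd rz zin.
have Gri := lf_inv Gr; have rid := decreasing_inv Gr rd.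
have riz : phi (fun_inv r) z = z by rewrite -[X in phi _ X]rz phiK.
apply: contrapT => nfz.
have zin' : y0 <= z <= y1 by move/andP: zin => [/ltW -> /ltW ->].
have [al [be [blk /andP[alz zbe]]]] := block_exists SA zin'.
have [[_ _ _ fa fb] nofix] := blk.
have alz' : al < z by rewrite lt_neqAle alz andbT; apply: contra_notN nfz => /eqP <-.
have zbe' : z < be by rewrite lt_neqAle zbe andbT; apply: contra_notN nfz => /eqP ->.
have fr x : fixed psi x -> fixed psi (phi r x).
  move=> /fixed_phi fx; apply/fixed_phi => k.
  have e1 : phi (fun_inv r) y0 = y1 by rewrite -r1 phiK.
  have e2 : phi (fun_inv r) y1 = y0 by rewrite -r0 phiK.
  have [k' Hk'] := swap_conj Gri e1 e2 k.
  have : phi (fun_inv r) (phi (E k) (phi r x)) = x.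
    have Gir := lf_inv Gri; have Grk := lf_comp Gri (EG k).
    have irr : fun_inv (fun_inv r) = r.
      by rewrite -[RHS](compA r id id) -[X in r \o X](lf_compV Gri) compA (lf_compV Gr).
    by rewrite -{2}(fx k') Hk' irr (phi_comp _ Grk Gr) (phi_comp _ Gri (EG k)).
  by move=> h; rewrite -[LHS](phiVK Gr) h.
have fri x : fixed psi x -> fixed psi (phi (fun_inv r) x).
  move=> /fixed_phi fx; apply/fixed_phi => k.
  have [k' Hk'] := swap_conj Gr r0 r1 k.
  apply: (phi_inj Gr); have := fx k'.
  have Grk := lf_comp Gr (EG k).
  by rewrite Hk' (phi_comp _ Grk Gri) (phi_comp _ Gr (EG k)) (phiVK Gr).
have end1 g : G g -> decreasing g -> phi g z = z -> (forall x, fixed psi x -> fixed psi (phi g x)) ->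
    be <= phi g al /\ phi g be <= al.
  move=> Gg gd gz fg; split; rewrite leNgt; apply/negP => h.
    by apply: (nofix (phi g al)); [rewrite h andbT (lt_trans alz') // -[ltLHS]gz gd|exact: fg].
  by apply: (nofix (phi g be)); [rewrite h /= (lt_trans _ zbe') // -[ltRHS]gz gd|exact: fg].
have [h1 h2] := end1 _ Gr rd rz fr; have [h3 h4] := end1 _ Gri rid riz fri.
have ral : phi r al = be.
  apply/eqP; rewrite eq_le h1 andbT; have := decreasing_le rd h4.
  by rewrite (phiVK Gr).
have rbe : phi r be = al.
  apply/eqP; rewrite eq_le h2 /=; have := decreasing_le rd h3.
  by rewrite (phiVK Gr).
have cfix x k : fixed psi x -> c k x = tau (E k) x by move=> fx; rewrite /strip_c fx.
have ceq x k k' : E k' = r \o E k \o fun_inv r -> fixed psi x -> fixed psi (phi r x) -> c k' (phi r x) = c k x.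
  move=> Ek' fx frx; rewrite !cfix // Ek'; have Grk := lf_comp Gr (EG k).
  rewrite (tau_comp _ Grk Gri) (tau_comp _ Gr (EG k)) (phiK Gr) (tauV _ Gr).
  by have /fixed_phi -> := fx; rewrite addrAC subrr add0r.
have [L [K K0 [inv _]]] := chart0_bilipschitz SA.
have comm k : E k \o r = r \o E k.
  have [k' Hk'] := swap_conj Gr r0 r1 k.
  have ea := ceq al k k' Hk' fa; have eb := ceq be k k' Hk' fb; rewrite ral in ea; rewrite rbe in eb.
  have sum : ir (k' - k) *m (end_matrix c al + end_matrix c be) = 0.
    have := ea fb; have := eb fa; rewrite !(c_fixed SA) // => e1 e2.
    by rewrite irD irN mulmxBl !mulmxDr e1 e2 [X in _ - X]addrC subrr.
  have : `|ir (k' - k) : 'rV[R]_m| <= K * `|ir (k' - k) *m mix c al be (1 / 2)|.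
    by apply: inv blk _; lra.
  have -> : mix c al be (1 / 2) = (1 / 2) *: (end_matrix c al + end_matrix c be).
    by rewrite /mix scalerDr; congr (_ + _ *: _); field.
  rewrite -scalemxAr sum scaler0 normr0 mulr0 normr_le0 -(@ir0 R) => /eqP/ir_inj/eqP.
  rewrite subr_eq0 => /eqP kk; rewrite kk in Hk'.
  by apply/funext => x /=; rewrite {1}Hk' /=; have [_ K1 _] := act_inv (lf_homeo LF) Gr; rewrite K1.
apply: nfz; apply/fixed_phi => k.
have e : phi r (phi (E k) z) = phi (E k) z.
  by rewrite -(phi_comp _ Gr (EG k)) -comm (phi_comp _ (EG k) Gr) rz.
apply/eqP; rewrite eq_le !leNgt; apply/andP; split; apply/negP => h; have := rd _ _ h; rewrite rz e ltNge ltW //.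
Qed.

(** The lattice preserves the height [z] and acts cocompactly there, so the leaf is the image of a
    ball. *)
Lemma fixed_leaf_compact z : fixed psi z -> y0 <= z <= y1 -> compact [set p (pt z v) | v in [set: 'rV[R]_m]].
Proof.
move=> fz zin; have [r Hr] := sa_dense SA.
have -> : [set p (pt z v) | v in [set: 'rV[R]_m]] = (fun v => p (pt z v)) @` [set v | `|v| <= r].
  apply/seteqP; split => _ [v Hv <-]; last by exists v.
  have [k Hk] := Hr z v zin; exists (v - c k z) => //.
  apply/proj_pt; exists (E k) => //; move/fixed_phi: (fz) => ->; split => //.
  by rewrite /strip_c fz subrK.
apply: continuous_compact; last exact: compact_norm_le.
apply: continuous_subspaceT => v; have FF := @nbhs_filter 'rV[R]_m v.
have h1 : (fun v => pt z v) @ v --> pt z v by apply: pt_cvg; [exact: cvg_cst|exact: cvg_id].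
have h2 : p @ pt z v --> p (pt z v) by exact: (proj_cont (lf_orbit LF)).
exact: (cvg_comp _ _ h1 h2).
Qed.

Section StripMap.
Variable b : R.
Hypothesis b_in : y0 < b <= y1.
Hypothesis b_fixed : fixed psi b.

Variables (Y : 'rV[R]_m -> R -> R) (W : 'rV[R]_m -> R -> 'rV[R]_m).
Hypothesis SP : strip_parametrization psi c y0 b Y W.

Definition strip_map (t : 'rV[R]_m) (s : R) : M := p (pt (Y t s) (W t s)).
Notation Q := strip_map.

Lemma strip_map_cont : {within [set z : 'rV[R]_m * R | 0 <= z.2 <= 1], continuous (fun z => Q z.1 z.2)}.
Proof.
have [[cont _ _ _ _] _] := SP.
apply/subspace_continuousP => -[t s] /= s01.
have FF : Filter (within [set z : 'rV[R]_m * R | 0 <= z.2 <= 1] (nbhs (t, s))) by exact: within_filter.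
have near (eps : R) : 0 < eps -> \forall z \near within [set z : 'rV[R]_m * R | 0 <= z.2 <= 1] (nbhs (t, s)),
    `|Y z.1 z.2 - Y t s| <= eps /\ `|W z.1 z.2 - W t s| <= eps.
  move=> e0; have [d d0 Hd] := cont t s eps e0 s01.
  exists ([set t' | `|t - t'| < d], [set s' | `|s - s'| < d]).
    by split; [exact: (@near_dist_lt R 'rV[R]_m t d d0)|exact: (@near_dist_lt R R^o s d d0)].
  by move=> [t' s'] /= [h1 h2] s'01; apply: Hd; rewrite // distrC.
have h1 : (fun z => pt (Y z.1 z.2) (W z.1 z.2)) @ within [set z : 'rV[R]_m * R | 0 <= z.2 <= 1] (nbhs (t, s)) --> pt (Y t s) (W t s).
  apply: pt_cvg.
    apply/(@cvgrPdist_le R R^o) => eps /near; apply: filterS => z [h _]; by rewrite distrC.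
  by apply/cvgrPdist_le => eps /near; apply: filterS => z [_ h]; rewrite distrC.
have h2 : p @ pt (Y t s) (W t s) --> p (pt (Y t s) (W t s)) by exact: (proj_cont (lf_orbit LF)).
exact: (cvg_comp _ _ h1 h2).
Qed.

Lemma strip_map_period t l s : 0 <= s <= 1 -> Q (t + ir l) s = Q t s.
Proof.
have [[_ _ _ equi _] _] := SP; move=> s01; have [h1 h2] := equi t l s s01.
apply/esym/proj_pt; exists (E l) => //.
rewrite -h1 (strip_phi_psi (ss_stab SS) (ss_D SS)) h1; split => //.
by rewrite h2 /strip_c h1.
Qed.

Lemma strip_map_stab g t t' s s' : stabilizer y0 g -> 0 <= s <= 1 -> 0 <= s' <= 1 ->
  phi g (Y t s) = Y t' s' -> W t s + tau g (Y t s) = W t' s' -> s = s' /\ exists k, t' = t + ir k.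
Proof.
have [[_ _ inj equi _] _] := SP.
move=> /(ss_surj SS)[k <-] s01 s'01 hY hW; have [h1 h2] := equi t k s s01.
have e1 : Y (t + ir k) s = Y t' s' by rewrite -hY -h1 (strip_phi_psi (ss_stab SS) (ss_D SS)).
have e2 : W (t + ir k) s = W t' s' by rewrite h2 /strip_c h1 hW.
by have [e3 e4] := inj _ _ _ _ s01 s'01 e1 e2; split => //; exists k.
Qed.

Lemma strip_map_onto (z : V) : y0 <= z ord0 ord0 <= b -> exists t s, 0 <= s <= 1 /\ Q t s = p z.
Proof.
have [[_ [_ onto] _ _ _] _] := SP.
move=> zin; have [t [s [s01 h1 h2]]] := onto _ (rsub z) zin; exists t, s; split => //.
by rewrite /strip_map h1 h2 ptE.
Qed.

Definition strip_end (se z : R) : Prop := [/\ 0 <= se <= 1, fixed psi z, forall t, Y t se = z,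
  end_matrix c z \in unitmx & exists w, forall t, W t se = t *m end_matrix c z + w].

Lemma strip_ends : strip_end 0 y0 /\ strip_end 1 b.
Proof.
have [[_ _ inj _ [ends _]] [[w0 h0] [w1 h1]]] := SP.
have unit se z w : 0 <= se <= 1 -> (forall t, Y t se = z) -> (forall t, W t se = t *m end_matrix c z + w) -> end_matrix c z \in unitmx.
  move=> se01 Yz Wz; rewrite -row_free_unit -kermx_eq0; apply/eqP/row_matrixP => i; rewrite row0.
  have [||//] := inj (row i (kermx (end_matrix c z))) 0 se se se01 se01; first by rewrite !Yz.
  by rewrite !Wz -row_mul mulmx_ker row0 mul0mx.
have z01 : 0 <= (0 : R) <= 1 by rewrite lexx ler01.
have o01 : 0 <= (1 : R) <= 1 by rewrite lexx ler01.
split; split => //.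
- by move=> k; apply: (sa_psi_a SA).
- by move=> t; case: (ends t).
- by apply: (unit 0 y0 w0) => // t; case: (ends t).
- by exists w0.
- by move=> t; case: (ends t).
- by apply: (unit 1 b w1) => // t; case: (ends t).
- by exists w1.
Qed.

Lemma stab_end_tau k z : fixed psi z -> tau (E k) z = ir k *m end_matrix c z.
Proof. by move=> fz; rewrite -(c_fixed SA) // /strip_c fz. Qed.

(** The shift is [tau r z] read through the end matrix. The square of [r] is in the lattice, so
    [al + al] is integral; [al] is not, since [r] is decreasing. By [dich] an element fixing [z] is
    in the lattice, or becomes so after composition with [r]. *)
Lemma end_shift se z r : strip_end se z -> G r -> decreasing r -> phi r z = z ->
  (forall g, G g -> phi g z = z -> stabilizer y0 g \/ stabilizer y0 (r \o g)) ->
  exists al, half_shift Q se al.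
Proof.
move=> [se01 fz Yz Au [w Wz]] Gr rd rz dich; set A := end_matrix c z in Au Wz.
have ndec (g : V -> V) : increasing g -> decreasing g -> False.
  by move=> gi gd; have := gi 0 1 ltr01; rewrite ltNge ltW //; exact: gd.
have [k2 Hk2] : exists k, tau r z + tau r z = ir k *m A.
  have Grr := lf_comp Gr Gr.
  have rrz : phi (r \o r) z = z by rewrite (phi_comp _ Gr Gr) rz rz.
  have [/(ss_surj SS)[k Ek]|[_ _ inc]] := dich _ Grr rrz.
    by exists k; rewrite -stab_end_tau // Ek (tau_comp _ Gr Gr) rz.
  exfalso; apply: (ndec _ inc) => x y xy; rewrite !(phi_comp _ Gr Grr) !(phi_comp _ Gr Gr).
  exact: rd _ _ (rd _ _ (rd _ _ xy)).
pose al := tau r z *m invmx A.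
have alA : al *m A = tau r z by rewrite mulmxKV.
have al2 : al + al = ir k2 by rewrite -mulmxDl Hk2 mulmxK.
exists al; split.
- by exists k2.
- move=> k ak; have : r = E k by apply: (lf_eq Gr (EG k)) (_ : phi r z = phi (E k) z) _; rewrite ?rz; [have /fixed_phi -> := fz|rewrite stab_end_tau // -ak alA].
  by move=> rE; apply: (ndec r) => //; rewrite rE; case: (ss_stab SS k).
- move=> t; rewrite /strip_map !Yz !Wz; apply/esym/proj_pt; exists r => //; split => //.
  by rewrite mulmxDl alA addrAC.
move=> t t'; rewrite /strip_map !Yz !Wz => /proj_pt[g Gg [gz gt]].
have gt' : t' *m A = t *m A + tau g z.
  by apply: (addIr w); rewrite -gt addrAC.
have [/(ss_surj SS)[k Ek]|/(ss_surj SS)[k Ek]] := dich g Gg gz; [exists k; left|exists (k - k2); right].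
  apply: (can_inj (mulmxK Au)); rewrite gt' mulmxDl -Ek stab_end_tau //.
apply: (can_inj (mulmxK Au)); rewrite gt' !mulmxDl irD irN mulmxBl -Hk2 -(stab_end_tau k fz) Ek.
rewrite (tau_comp _ Gr Gg) gz alA; apply/rowP => j; rewrite !mxE; ring.
Qed.

End StripMap.

End Setup.

(** * The manifold as a strip with identified ends *)

Section Models.
Variable y : R.
Hypothesis leaf_compact : compact [set p (pt y v) | v in [set: 'rV[R]_m]].

Definition strip_model (Q : 'rV[R]_m -> R -> M) : Prop :=
  [/\ {within [set z : 'rV[R]_m * R | 0 <= z.2 <= 1], continuous (fun z => Q z.1 z.2)},
      forall x, exists t s, 0 <= s <= 1 /\ Q t s = x,
      forall t l s, 0 <= s <= 1 -> Q (t + ir l) s = Q t s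
    & forall t t' s s', 0 < s < 1 -> 0 <= s' <= 1 -> Q t s = Q t' s' -> s = s' /\ exists k, t' = t + ir k].

Lemma cell_cover y0 y1 E x : strip_setup y0 y1 E ->
  (forall g, G g -> decreasing g -> exists2 h, G h & phi h y0 = y0 /\ decreasing h) ->
  exists2 g, G g & y0 <= phi g x <= y1.
Proof.
move=> SS H; have [Dy1 y01 succ] := ss_succ SS.
have [d [Dd dx dmax]] := orbit_floor (ss_leaf SS) x.
have [g [Gg gd gi]] : exists g, [/\ G g, phi g y0 = d & increasing g].
  have [g Gg gd] := Dd; have [gi|gdec] := phi_mono Gg; first by exists g.
  have [h Gh [h0 hd]] := H g Gg gdec; exists (g \o h); split; first exact: lf_comp.
    by rewrite phi_comp // h0.
  by move=> z z' zz; rewrite !(phi_comp _ Gg Gh); exact: gdec _ _ (hd _ _ zz).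
exists (fun_inv g); first exact: lf_inv.
have le z z' : phi g z <= phi g z' -> z <= z' by move=> h; rewrite leNgt; apply/negP => /gi; rewrite ltNge h.
apply/andP; split; apply: le; rewrite (phiVK Gg) ?gd //.
rewrite leNgt; apply/negP => h; have := dmax _ (orbit_act Gg Dy1) (ltW h).
by rewrite -gd leNgt gi.
Qed.

(** The ends go to orbit heights, which the strip has only at its own ends; a translate that meets
    the interior is therefore the strip itself, kept or reversed. *)
Lemma cell_interior y0 y1 E g x : strip_setup y0 y1 E -> G g -> y0 < x < y1 -> y0 <= phi g x <= y1 ->
  stabilizer y0 g \/ [/\ decreasing g, phi g y0 = y1 & phi g y1 = y0].
Proof.
move=> SS Gg xin xin'; have succ' := ss_succ SS; have [Dy1 y01 succ] := succ'.
have Dy0 : leaf_orbit y0 y0 := orbit_self y0.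
have nD z : leaf_orbit y0 z -> y0 <= z <= y1 -> z = y0 \/ z = y1.
  move=> Dz /andP[z0 z1]; have [->|ne] := eqVneq z y0; [by left|right].
  by apply/eqP; rewrite eq_le z1 /=; apply: succ => //; rewrite lt_neqAle eq_sym ne.
have xin2 : y0 <= x <= y1 by move/andP: xin => [/ltW -> /ltW ->].
have Ngx : phi g x <> y0 /\ phi g x <> y1.
  have aux d : leaf_orbit y0 d -> phi g x <> d.
    move=> Dd gx; have Dx : leaf_orbit y0 x.
      by rewrite -(phiK Gg x) gx; apply: orbit_act => //; exact: lf_inv.
    by have /andP[h1 h2] := xin; have [h|h] := nD x Dx xin2; [rewrite h ltxx in h1|rewrite h ltxx in h2].
  by split; apply: aux.
have in0 : y0 <= y0 <= y1 by rewrite lexx ltW.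
have in1 : y0 <= y1 <= y1 by rewrite lexx ltW.
have lo z : y0 <= z <= y1 -> y0 <= phi g z.
  move=> zin; have [H|H] := orbit_no_cross succ' Gg Dy0; first exact: H.
  by case: Ngx.1; apply/eqP; rewrite eq_le (H x xin2); case/andP: xin'.
have hi z : y0 <= z <= y1 -> phi g z <= y1.
  move=> zin; have [H|H] := orbit_no_cross succ' Gg Dy1; last exact: H.
  by case: Ngx.2; apply/eqP; rewrite eq_le (H x xin2) andbT; case/andP: xin'.
have g0 := nD _ (orbit_act Gg Dy0) (introT andP (conj (lo _ in0) (hi _ in0))).
have g1 := nD _ (orbit_act Gg Dy1) (introT andP (conj (lo _ in1) (hi _ in1))).
have ne : phi g y0 <> phi g y1 by move=> /(phi_inj Gg) e; rewrite e ltxx in y01.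
case: g0 g1 => [g0|g0] [g1|g1]; rewrite g0 g1 // in ne *.
  by left; exact: (stabilizer_end succ').
right; split => //; have [gi|//] := phi_mono Gg.
by have := gi _ _ y01; rewrite g0 g1 ltNge ltW.
Qed.

Theorem increasing_model : (forall g, G g -> increasing g) ->
  exists Q eta eta', [/\ strip_model Q, continuous (eta : 'rV[R]_m -> 'rV[R]_m), cancel eta' eta,
    forall t, Q (eta t) 1 = Q t 0 & forall t t' (s : R), s = 0 \/ s = 1 -> Q t s = Q t' s -> exists k, t' = t + ir k].
Proof.
move=> inc; have [y1 [E SS]] := strip_setup_exists leaf_compact (orbit_self y).
have succ' := ss_succ SS; have [Dy1 y01 succ] := succ'.
have SA := setup_action SS.
have [Y [W SP]] := strip_parametrizationP SA.
have fb : fixed (strip_psi E) y1 by move=> k; exact: (sa_psi_b SA).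
have [end0 end1] := strip_ends SS fb SP.
have [z01 fz0 Yat0 A0u [w0 Wat0]] := end0; have [u01 fz1 Yat1 A1u [w1 Wat1]] := end1.
set A0 := end_matrix _ y in A0u Wat0; set A1 := end_matrix _ y1 in A1u Wat1.
have [ga Gga gay] := Dy1.
(* The gluing element [ga] raises [y] to [y1]. Since [W] is affine on both ends, the map [eta] below
   solves [W (eta t) 1 = W t 0 + tau ga y]. *)
pose e0 := w0 + tau ga y - w1.
pose Q := strip_map Y W.
have stab_of0 g : G g -> phi g y = y -> stabilizer y g by move=> Gg gy; split => //; exact: inc.
have stab_of1 g : G g -> phi g y1 = y1 -> stabilizer y g.
  move=> Gg g1; apply: stab_of0 => //.
  have in0 : y <= y <= y1 by rewrite lexx ltW.
  have lt h : G h -> phi h y1 = y1 -> phi h y <= y.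
    move=> Gh h1; rewrite leNgt; apply/negP => hy.
    have := succ _ (orbit_act Gh (orbit_self y)) hy.
    by rewrite leNgt -[ltRHS]h1 inc.
  apply/eqP; rewrite eq_le lt //=.
  have := lt _ (lf_inv Gg) (ltac:(by rewrite -[X in phi _ X]g1 (phiK Gg)) : phi (fun_inv g) y1 = y1).
  by move=> /(increasing_le (inc g Gg)); rewrite (phiVK Gg).
exists Q, (fun t => (t *m A0 + e0) *m invmx A1), (fun t => (t *m A1 - e0) *m invmx A0); split.
- split.
  + exact: (@strip_map_cont _ _ _ _ _ SP).
  + move=> x; have [z <-] := proj_surj (lf_orbit LF) x.
    have [|g Gg gin] := cell_cover (z ord0 ord0) SS.
      by move=> g Gg gd; have := inc g Gg 0 1 ltr01; rewrite ltNge ltW //; exact: gd.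
    have [|t [s [s01 Qts]]] := @strip_map_onto _ _ _ _ _ SP (g z).
      by rewrite -[z]ptE actE // cons_mx0.
    by exists t, s; split => //; rewrite /Q Qts (proj_act (lf_orbit LF)).
  + by move=> t l s s01; exact: (strip_map_period SS SP t l s01).
  + move=> t t' s s' s01 s'01 /proj_pt[g Gg [gY gW]].
    have [[_ [rng _] _ _ [_ rng']] _] := SP.
    have s01' : 0 <= s <= 1 by move/andP: s01 => [/ltW -> /ltW ->].
    have [|sg|[gd _ _]] := cell_interior SS Gg (rng' t s s01); first by rewrite gY; exact: rng.
      exact: (strip_map_stab SS SP sg s01' s'01 gY gW).
    by have := inc g Gg 0 1 ltr01; rewrite ltNge ltW //; exact: gd.
- move=> t; have FF := @nbhs_filter 'rV[R]_m t.
  apply: cvg_mulmx; last exact: cvg_cst.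
  apply: cvgD; last exact: cvg_cst.
  by apply: cvg_mulmx; [exact: cvg_id|exact: cvg_cst].
- by move=> t; rewrite mulmxKV // subrK mulmxK.
- move=> t; rewrite /Q /strip_map Yat0 Yat1 Wat0 Wat1 mulmxKV //; apply/esym/proj_pt; exists ga => //.
  by split => //; apply/rowP => j; rewrite !mxE; ring.
move=> t t' s s01; have s01' : 0 <= s <= 1 by case: s01 => ->; rewrite ?lexx ?ler01.
move=> /proj_pt[g Gg [gY gW]].
have sg : stabilizer y g by case: s01 gY => ->; rewrite ?Yat0 ?Yat1; [exact: stab_of0|exact: stab_of1].
by have [_] := strip_map_stab SS SP sg s01' s01' gY gW.
Qed.

Lemma decreasing_fixed_point r a b : G r -> a <= b -> a <= phi r a -> phi r b <= b ->
  exists2 z, a <= z <= b & phi r z = z.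
Proof.
move=> Gr ab ha hb.
have fc : {within `[a, b], continuous (fun y => phi r y - y)}.
  apply: continuous_subspaceT => x; apply: cvgB; [exact: phi_cont|exact: cvg_id].
have [|z] := @IVT R (fun y => phi r y - y) a b 0 ab fc.
  by rewrite ge_min le_max !subr_le0 !subr_ge0 ha hb orbT.
by rewrite in_itv /= => zin /eqP; rewrite subr_eq0 => /eqP hz; exists z.
Qed.

(** A decreasing map of the line has a fixed height [z]. If it is not in the orbit of the compact
    leaf, it lies strictly between two consecutive orbit heights, and [swap_centre_fixed] shows that
    the lattice fixes it. *)
Lemma compact_centre r : G r -> decreasing r ->
  exists z, compact [set p (pt z v) | v in [set: 'rV[R]_m]] /\ phi r z = z.
Proof.
move=> Gr rd.
have [z rz] : exists z, phi r z = z.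
  have [h|h] := leP 0 (phi r 0).
    have [|z _ hz] := decreasing_fixed_point Gr h h; last by exists z.
    exact: decreasing_le.
  have [|z _ hz] := decreasing_fixed_point Gr (ltW h) _ (ltW h); last by exists z.
  exact: decreasing_le rd (ltW h).
exists z; split => //.
have [d [Dd dz dmax]] := orbit_floor leaf_compact z.
have [y1 [E SS]] := strip_setup_exists leaf_compact Dd.
have [ez|dz'] := eqVneq d z; first by rewrite -ez; exact: ss_leaf SS.
have [Dy1 dy1 succ] := ss_succ SS.
have zin : d < z < y1.
  rewrite lt_neqAle dz' dz /= ltNge; apply/negP => h.
  have Dy1' : leaf_orbit y y1.
    have [g' Gg' gd'] := Dd; have [h' Gh' hd'] := Dy1.
    by exists (h' \o g'); [exact: lf_comp|rewrite (phi_comp _ Gh' Gg') gd'].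
  by have := dmax _ Dy1' h; rewrite leNgt dy1.
have fz := swap_centre_fixed SS Gr rd rz zin.
by apply: (fixed_leaf_compact SS fz); move/andP: zin => [/ltW -> /ltW ->].
Qed.

(** The strip runs only from the centre [z] of [r] to the centre [b] of [r1], a reflection
    exchanging [z] with the next height [y1] of its orbit: [r1] folds the part above [b] onto the
    part below. Each end is folded by the reflection centred there. *)
Theorem decreasing_model r : G r -> decreasing r ->
  exists Q al be, [/\ strip_model Q, half_shift Q 0 al, half_shift Q 1 be & forall t t', Q t 0 <> Q t' 1].
Proof.
move=> Gr rd; have [z [lcz rz]] := compact_centre Gr rd.
have [y1 [E SS]] := strip_setup_exists lcz (orbit_self z).
have succ' := ss_succ SS; have [Dy1 y01 succ] := succ'.
have [r1 [Gr1 r1d r1z]] : exists r1, [/\ G r1, decreasing r1 & phi r1 z = y1].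
  have [g Gg gz] := Dy1; have [gi|gd] := phi_mono Gg; last by exists g.
  exists (g \o r); split; [exact: lf_comp| |by rewrite phi_comp // rz].
  by move=> x x' xx; rewrite !(phi_comp _ Gg Gr); exact: gi _ _ (rd _ _ xx).
have [||b /andP[zb by1] r1b] := decreasing_fixed_point Gr1 (ltW y01).
- by rewrite r1z ltW.
- by rewrite -[leRHS]r1z; apply: decreasing_le (ltW y01).
have zb' : z < b by rewrite lt_neqAle zb andbT; apply/eqP => e; move: y01; rewrite -r1z e r1b ltxx.
have by1' : b < y1.
  rewrite lt_neqAle by1 andbT; apply/eqP => e; move: (r1d _ _ y01); rewrite r1z -e r1b ltxx //.
have bin : z < b < y1 by rewrite zb'.
have fb := swap_centre_fixed SS Gr1 r1d r1b bin.
have [_ r1y1] := swap_ends SS Gr1 r1d r1b bin.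
have b_in : z < b <= y1 by rewrite zb'.
have SA := strip_action_restrict (setup_action SS) b_in fb.
have [Y [W SP]] := strip_parametrizationP SA.
have [end0 end1] := strip_ends SS fb SP.
have swap g : G g -> phi g z = y1 -> phi g y1 = z -> stabilizer z (r1 \o g).
  move=> Gg g0 g1; apply: (stabilizer_end succ'); first exact: lf_comp.
    by rewrite (phi_comp _ Gr1 Gg) g0.
  by rewrite (phi_comp _ Gr1 Gg) g1.
have [|al Hal] := end_shift SS end0 Gr rd rz.
  move=> g Gg gz; have [gi|gd] := phi_mono Gg; [by left|right; split; first exact: lf_comp].
    by rewrite (phi_comp _ Gr Gg) gz.
  by move=> x x' xx; rewrite !(phi_comp _ Gr Gg); exact: rd _ _ (gd _ _ xx).
have [|be Hbe] := end_shift SS end1 Gr1 r1d r1b.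
  move=> g Gg gb; have [|sg|[_ g0 g1]] := cell_interior SS Gg bin; [by rewrite gb zb|by left|right].
  exact: swap.
have [[_ [rng _] _ _ [ends rng']] _] := SP.
exists (strip_map Y W), al, be; split => //.
- split.
  + exact: (@strip_map_cont _ _ _ _ _ SP).
  + move=> x; have [w <-] := proj_surj (lf_orbit LF) x.
    have [|g Gg /andP[g1 g2]] := cell_cover (w ord0 ord0) SS; first by move=> g Gg gd; exists r.
    have [h Gh hin] : exists2 h, G h & z <= phi h (w ord0 ord0) <= b.
      have [gb|gb] := leP (phi g (w ord0 ord0)) b; first by exists g => //; rewrite g1.
      exists (r1 \o g); first exact: lf_comp.
      have := decreasing_le r1d (ltW gb); have := decreasing_le r1d g2.
      by rewrite r1y1 r1b (phi_comp _ Gr1 Gg) => -> ->.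
    have [|t [s [s01 Qts]]] := @strip_map_onto _ _ _ _ _ SP (h w).
      by rewrite -[w]ptE actE // cons_mx0.
    by exists t, s; split => //; rewrite Qts (proj_act (lf_orbit LF)).
  + by move=> t l s s01; exact: (strip_map_period SS SP t l s01).
  + move=> t t' s s' s01 s'01 /proj_pt[g Gg [gY gW]].
    have s01' : 0 <= s <= 1 by move/andP: s01 => [/ltW -> /ltW ->].
    have /andP[Y1 Y2] := rng' t s s01; have /andP[Y3 Y4] := rng t' s' s'01.
    have Yin : z < Y t s < y1 by rewrite Y1 (lt_trans Y2).
    have [|sg|[gd g0 g1]] := cell_interior SS Gg Yin.
    * by rewrite gY Y3 (le_trans Y4).
    * exact: (strip_map_stab SS SP sg s01' s'01 gY gW).
    have sh := swap g Gg g0 g1; have [k Ek] := ss_surj SS sh; have [_ _ hi] := sh.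
    have hb : phi (r1 \o g) b = b by rewrite -Ek; exact: (fixed_phi E b).1.
    have := hi _ _ Y2; rewrite hb (phi_comp _ Gr1 Gg) gY ltNge -{1}r1b.
    by rewrite (decreasing_le r1d Y4).
move=> t t' /proj_pt[g Gg [gY _]]; move: gY; have [-> _] := ends t; have [_ ->] := ends t' => gb.
have Db : leaf_orbit z b by exists g.
by have := succ _ Db zb'; rewrite leNgt by1'.
Qed.

End Models.

End Leaf.

(** * The circle and the torus as quotients of Euclidean spaces *)

Section Circle.
Context {R : realType}.

Let turn (x : R) : R := pi *+ 2 * x.

Lemma circle_proof (x : R) : [set z : R * R | z.1 ^+ 2 + z.2 ^+ 2 = 1] (cos (turn x), sin (turn x)).
Proof. exact: cos2Dsin2. Qed.

Definition ev (x : R) : circle R := exist _ (cos (turn x), sin (turn x)) (mem_set (circle_proof x)).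

Lemma ev_cont : continuous ev.
Proof.
apply: continuous_comp_initial => x.
have tc : turn @ x --> turn x by apply: cvgZl_tmp; exact: cvg_id.
apply: (@cvg_pair _ _ _ _ (nbhs (cos (turn x))) (nbhs (sin (turn x)))).
  exact: (cvg_comp _ _ tc (@continuous_cos R (turn x))).
exact: (cvg_comp _ _ tc (@continuous_sin R (turn x))).
Qed.

Lemma circle_inj (w w' : circle R) : (set_val w).1 = (set_val w').1 -> (set_val w).2 = (set_val w').2 -> w = w'.
Proof. by move=> h1 h2; apply: val_inj; apply: injective_projections. Qed.

Lemma circle_hausdorff : hausdorff_space (circle R).
Proof.
move=> w w' cl; apply: val_inj; have H : hausdorff_space (R * R)%type by exact: norm_hausdorff.
apply: H => A B Aw Bw; have [z [h1 h2]] := cl _ _ (@initial_continuous _ _ set_val w A Aw) (@initial_continuous _ _ set_val w' B Bw).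
by exists (set_val z).
Qed.

Lemma pi2_gt0 : 0 < pi *+ 2 :> R. Proof. by rewrite mulrn_wgt0 // pi_gt0. Qed.

Lemma evD1 (x : R) : ev (x + 1) = ev x.
Proof. by apply: circle_inj => /=; rewrite /turn mulrDr mulr1 ?cosD2pi ?sinD2pi. Qed.

Lemma evDz (x : R) (k : int) : ev (x + k%:~R) = ev x.
Proof.
have H (n : nat) y : ev (y + n%:R) = ev y.
  by elim: n => [|n IH]; rewrite ?addr0 // -natr1 addrA evD1.
case: k => n; first exact: H.
by rewrite -[LHS](H n.+1) NegzE mulrNz subrK.
Qed.

Lemma cos_turn1 (x : R) : 0 <= x < 1 -> cos (turn x) = 1 -> x = 0.
Proof.
move=> /andP[x0 x1] cx; have p0 := pi2_gt0.
have key (z : R) : 0 <= z <= 1 / 2 -> cos (turn z) = 1 -> z = 0.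
  move=> /andP[z0 z1] cz; have h : turn z = 0.
    apply: cos_inj; rewrite ?in_itv /= ?lexx ?pi_ge0 ?cos0 //.
    rewrite /turn mulr_ge0 ?(ltW p0) //= mulr2n.
    have : (pi + pi) * z <= (pi + pi) * (1 / 2) by rewrite ler_wpM2l // -mulr2n ltW.
    by lra.
  by move/eqP: h; rewrite mulf_eq0 (gt_eqF p0) => /eqP.
have [h|h] := leP x (1 / 2); first by apply: key => //; rewrite x0.
have : 1 - x = 0.
  apply: key; first lra.
  have -> : turn (1 - x) = - turn x + pi *+ 2 by rewrite /turn; ring.
  by rewrite cosD2pi cosN.
by lra.
Qed.

Lemma ev_eq (x y : R) : ev x = ev y -> exists k : int, y = x + k%:~R.
Proof.
move=> E; have c1 : cos (turn x) = cos (turn y) by have := congr1 (fun w : circle R => (set_val w).1) E.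
have c2 : sin (turn x) = sin (turn y) by have := congr1 (fun w : circle R => (set_val w).2) E.
exists (Num.floor (y - x)); pose f := y - x - (Num.floor (y - x))%:~R.
suff : f = 0 by rewrite /f; lra.
apply: cos_turn1; first by rewrite /f subr_ge0 floor_le /= ltrBlDl -[1]/(1%:~R) -intrD floorD1_gt.
have := evDz (y - x) (- Num.floor (y - x)); rewrite intrN -/f => /(congr1 (fun w : circle R => (set_val w).1)) /= ->.
have -> : turn (y - x) = turn y - turn x by rewrite /turn; ring.
by rewrite cosB c1 c2 -!expr2 cos2Dsin2.
Qed.

Lemma int_near0 (k : int) : -1 < (k%:~R : R) < 1 -> k = 0.
Proof.
have -> : -1 = (-1)%:~R :> R by [].
by rewrite -[X in _ && (_ < X)]/(1%:~R) !ltr_int => /andP[]; lia.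
Qed.

Lemma ev_inj_near (al x y : R) : al < x < al + 1 -> al <= y <= al + 1 -> ev x = ev y -> x = y.
Proof.
move=> /andP[x1 x2] /andP[y1 y2] /ev_eq[k Ek].
have k0 : k = 0 by apply: int_near0; lra.
by rewrite Ek k0 addr0.
Qed.

Lemma ev_onto (al : R) (w : circle R) : exists2 x, al <= x <= al + 1 & ev x = w.
Proof.
have [x Hx] : exists x, ev x = w.
  have /set_mem/= := valP w; set c := (val w).1; set s := (val w).2 => cs.
  have p0 := pi2_gt0.
  have c1 : -1 <= c <= 1 by rewrite -ler_norml -(@expr_le1 _ 2) // real_normK ?num_real //; have := sqr_ge0 s; lra.
  have ca : cos (acos c) = c by apply: acosK; rewrite in_itv.
  have sa : sin (acos c) = `|s| by rewrite sin_acos // -sqrtr_sqr; congr Num.sqrt; lra.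
  have tK z : turn (z / (pi *+ 2)) = z by rewrite /turn mulrC divfK // gt_eqF.
  have [s0|s0] := leP 0 s.
    by exists (acos c / (pi *+ 2)); apply: circle_inj; rewrite /= tK ?ca ?sa ?ger0_norm.
  exists (- acos c / (pi *+ 2)); apply: circle_inj; rewrite /= tK ?cosN ?sinN ?ca ?sa //.
  by rewrite ltr0_norm // opprK.
exists (x - (Num.floor (x - al))%:~R); last by rewrite -intrN evDz.
have h1 := floor_le (x - al); have h2 := floorD1_gt (x - al).
by move: h2; rewrite intrD => h2; lra.
Qed.

End Circle.

Section Torus.
Context {R : realType} {d : nat}.

Lemma cvg_torus {T : Type} {F : set_system T} {FF : Filter F} (f : T -> torus R d) (a : torus R d) :
  (forall i, (fun t => f t i) @ F --> a i) -> f @ F --> a.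
Proof.
move=> H; apply/cvg_sup => i U [_ /= [[W oW <-]]] /= Wa /filterS; apply; apply: H.
exact: open_nbhs_nbhs.
Qed.

Lemma torus_hausdorff : hausdorff_space (torus R d).
Proof. apply: hausdorff_product => i; exact: circle_hausdorff. Qed.

Definition tev (t : 'rV[R]_d) : torus R d := fun i => ev (t ord0 i).

Lemma tev_cont : continuous tev.
Proof.
move=> t; have FF := @nbhs_filter 'rV[R]_d t; apply: cvg_torus => i.
have h : (fun t : 'rV[R]_d => t ord0 i) @ t --> t ord0 i.
  by apply: (@cvg_entry R 'rV[R]_d (nbhs t) FF 1 d id t ord0 i); exact: cvg_id.
exact: (cvg_comp _ _ h (@ev_cont R (t ord0 i))).
Qed.

Lemma tev_eq (t t' : 'rV[R]_d) : tev t = tev t' <-> exists k, t' = t + ir k.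
Proof.
split => [E|[k ->]].
  have H i : exists k : int, t' ord0 i = t ord0 i + k%:~R by apply: ev_eq; exact: (congr1 (fun f => f i) E).
  have [k Hk] := choice H; exists (\row_i k i); apply/rowP => i; by rewrite !mxE -Hk.
by apply/funext => i; rewrite /tev !mxE evDz.
Qed.

Lemma tev_onto (f : torus R d) : exists2 t, `|t| <= 1 / 2 & tev t = f.
Proof.
have H i : exists x, - (1 / 2) <= x <= - (1 / 2) + 1 /\ ev x = f i.
  by have [x h1 h2] := ev_onto (- (1 / 2)) (f i); exists x.
have [t Ht] := choice H; exists (\row_i t i).
  apply: mx_norm_le => // i j; have [/andP[h1 h2] _] := Ht j; rewrite mxE ler_norml.
  by lra.
by apply/funext => i; rewrite /tev mxE; case: (Ht i).
Qed.

End Torus.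

(** A map from a compact set onto a Hausdorff space is a quotient map; in this pointwise form,
    continuity at [y] is tested along the fibre over [y] only. *)
Lemma quotient_continuous_at {S X Z : topologicalType} (D : set S) (q : S -> X) (f : X -> Z) (y : X) :
  compact D -> hausdorff_space X -> {within D, continuous q} -> (forall x, exists2 k, D k & q k = x) ->
  (forall k, D k -> q k = y -> (fun k => f (q k)) @ within D (nbhs k) --> f y) -> {for y, continuous f}.
Proof.
move=> /compact_near_coveringP Dc HX /subspace_continuousP qc onto H N fN.
have : \forall z \near y, D `<=` (fun k => D k -> q k = z -> N (f z)).
  apply: (Dc X (nbhs y) (fun z k => D k -> q k = z -> N (f z)) _) => k Dk.
  have [qk|qk] := pselect (q k = y).
    have h : \forall k' \near within D (nbhs k), N (f (q k')) by exact: H Dk qk N fN.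
    exists ([set k' | D k' -> N (f (q k'))], setT); first by split; [exact: h|exact: filterT].
    by move=> [k' z] /= [h1 _] Dk' <-; exact: h1.
  have [[A B] /= [/set_mem Ak /set_mem By] [oA oB /eqP AB]] : exists2 AB : set X * set X, (q k \in AB.1 /\ y \in AB.2) & [/\ open AB.1, open AB.2 & AB.1 `&` AB.2 == set0].
    by move: HX; rewrite open_hausdorff => /(_ (q k) y); apply; apply/eqP.
  have h : \forall k' \near within D (nbhs k), A (q k').
    by apply: (qc k Dk A); apply: open_nbhs_nbhs.
  exists ([set k' | D k' -> A (q k')], B); first by split; [exact: h|apply: open_nbhs_nbhs].
  move=> [k' z] /= [h1 Bz] Dk' E; have : (A `&` B) z by split => //; rewrite -E; exact: h1.
  by rewrite AB.
by apply: filterS => z Hz; have [k Dk qk] := onto z; exact: (Hz k Dk Dk qk).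
Qed.

(** * Bundles over the circle from parametrizations over arcs *)

Section ArcTrivialization.
Context {R : realType} {m : nat} {M : topologicalType}.
Hypothesis M_hausdorff : hausdorff_space M.
Variables (Q : 'rV[R]_m * R -> M) (al : R) (q : M -> circle R).
Definition arc_domain : set ('rV[R]_m * R) := [set z | `|z.1| <= 1 / 2 /\ al <= z.2 <= al + 1].
Notation D := arc_domain.
Hypothesis Qc : {within D, continuous Q}.
Hypothesis Q_onto : forall x, exists2 z, D z & Q z = x.
Hypothesis qQ : forall z, D z -> q (Q z) = ev z.2.
Hypothesis Q_rel : forall z z', D z -> D z' -> al < z.2 < al + 1 ->
  (Q z = Q z' <-> z.2 = z'.2 /\ exists k, z'.1 = z.1 + ir k).

Lemma arc_compact : compact D.
Proof.
have -> : D = [set x : 'rV[R]_m | `|x| <= 1 / 2] `*` `[al, al + 1].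
  by apply/seteqP; split => -[t s] /=; rewrite in_itv.
apply: compact_setX; [exact: compact_norm_le|exact: segment_compact].
Qed.

Lemma within_snd (z : 'rV[R]_m * R) : (fun z : 'rV[R]_m * R => ev z.2) @ within D (nbhs z) --> ev z.2.
Proof.
apply: cvg_within_filter.
have h : (fun z : 'rV[R]_m * R => z.2) @ z --> z.2 by exact: cvg_snd.
exact: (cvg_comp _ _ h (@ev_cont R z.2)).
Qed.

Lemma within_fst (z : 'rV[R]_m * R) : (fun z : 'rV[R]_m * R => tev z.1) @ within D (nbhs z) --> tev z.1.
Proof.
apply: cvg_within_filter.
have h : (fun z : 'rV[R]_m * R => z.1) @ z --> z.1 by exact: cvg_fst.
exact: (cvg_comp _ _ h (@tev_cont R m z.1)).
Qed.

Lemma arc_interior z : D z -> ev z.2 <> ev al -> al < z.2 < al + 1.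
Proof.
move=> [_ /andP[h1 h2]] ne; rewrite !lt_neqAle h1 h2 !andbT; apply/andP; split; apply/eqP => E; apply: ne.
  by rewrite E.
by rewrite E evD1.
Qed.

Lemma near_interior (z : 'rV[R]_m * R) : al < z.2 < al + 1 -> \forall z' \near within D (nbhs z), D z' /\ al < z'.2 < al + 1.
Proof.
move=> /andP[h1 h2]; have h : (fun z : 'rV[R]_m * R => z.2) @ z --> z.2 by exact: cvg_snd.
have n1 : \forall z' \near z, al < z'.2 by apply: (cvgr_gt _ h).
have n2 : \forall z' \near z, z'.2 < al + 1 by apply: (cvgr_lt _ h).
by apply: filterS2 n1 n2 => z' -> -> Dz'.
Qed.

Lemma arc_projection_continuous : continuous q.
Proof.
move=> y; apply: (quotient_continuous_at arc_compact M_hausdorff Qc Q_onto) => k Dk qk.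
rewrite -qk qQ //; apply: cvg_trans (@within_snd k).
apply: near_eq_cvg; apply: (@filterS _ _ (nbhs_filter k) setT) => [z _ Dz|].
  by rewrite qQ.
exact: (@filterT _ _ (nbhs_filter k)).
Qed.

(** Over the open arc, [Q] and the map [(ev, tev)] make the same identifications on one compact box;
    each of [phi] and [psi] descends along one of the two. *)
Theorem arc_trivialization : exists phi psi, local_trivialization (F := torus R m) q [set w | w <> ev al] phi psi.
Proof.
have [sel Hsel] := choice (fun x => (let: ex_intro2 z Dz h := Q_onto x in ex_intro _ z (conj Dz h)) : exists z, D z /\ Q z = x).
have onto2 (wf : circle R * torus R m) : exists z, D z /\ (ev z.2, tev z.1) = wf.
  case: wf => w f; have [s s1 s2] := ev_onto al w; have [t t1 t2] := tev_onto f.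
  by exists (t, s); split => //=; rewrite s2 t2.
have [sel2 Hsel2] := choice onto2.
pose phi x := tev (sel x).1; pose psi wf := Q (sel2 wf).
have phiQ z : D z -> al < z.2 < al + 1 -> phi (Q z) = tev z.1.
  move=> Dz zin; have [Ds Qs] := Hsel (Q z).
  by have [_ [k hk]] := (Q_rel Dz Ds zin).1 (esym Qs); apply/esym/tev_eq; exists k.
have psiE z : D z -> al < z.2 < al + 1 -> psi (ev z.2, tev z.1) = Q z.
  move=> Dz zin; have [Ds e12] := Hsel2 (ev z.2, tev z.1); have es := congr1 fst e12; have ts := congr1 snd e12; rewrite /= in es ts.
  have sin : al < (sel2 (ev z.2, tev z.1)).2 < al + 1.
    apply: arc_interior => //; rewrite es => E.
    have alin : al <= al <= al + 1 by rewrite lexx lerDl ler01.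
    by have := ev_inj_near zin alin E => e; move: zin; rewrite e ltxx.
  have e2 : (sel2 (ev z.2, tev z.1)).2 = z.2.
    by apply: (ev_inj_near sin) => //; case: Dz.
  apply: (Q_rel Ds Dz sin).2; split => //; have /tev_eq[k hk] := ts; by exists k.
have phic x : q x <> ev al -> {for x, continuous phi}.
  move=> Ux; apply: (quotient_continuous_at arc_compact M_hausdorff Qc Q_onto) => k Dk qk.
  have kin : al < k.2 < al + 1 by apply: arc_interior => //; rewrite -qQ // qk.
  rewrite -qk phiQ //; apply: cvg_trans (@within_fst k).
  by apply: near_eq_cvg; apply: filterS (near_interior kin) => z [Dz zin] /=; rewrite phiQ.
have psic w f : w <> ev al -> {for (w, f), continuous psi}.
  move=> wU.
  have H2 : hausdorff_space (circle R * torus R m)%type.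
    move=> [w1 f1] [w2 f2] cl; congr (_, _).
      apply: circle_hausdorff => A B Aw Bw.
      have [[w' f'] [/= h1 h2]] := cl (fst @^-1` A) (fst @^-1` B) (cvg_fst Aw) (cvg_fst Bw).
      by exists w'.
    apply: torus_hausdorff => A B Aw Bw.
    have [[w' f'] [/= h1 h2]] := cl (snd @^-1` A) (snd @^-1` B) (cvg_snd Aw) (cvg_snd Bw).
    by exists f'.
  have c2 : {within D, continuous (fun z => (ev z.2, tev z.1) : circle R * torus R m)}.
    apply/subspace_continuousP => z Dz.
    apply: (@cvg_pair _ _ _ _ (nbhs (ev z.2)) (nbhs (tev z.1))); [exact: within_snd|exact: within_fst].
  have on2 wf : exists2 z, D z & (ev z.2, tev z.1) = wf by have [h1 h2] := Hsel2 wf; exists (sel2 wf).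
  apply: (quotient_continuous_at arc_compact H2 c2 on2) => k Dk ek.
  have ek1 : ev k.2 = w by exact: (congr1 fst ek).
  have kin : al < k.2 < al + 1 by apply: arc_interior => //; rewrite ek1.
  rewrite -ek psiE //; move/subspace_continuousP: Qc => /(_ k Dk); apply: cvg_trans.
  by apply: near_eq_cvg; apply: filterS (near_interior kin) => z [Dz zin]; rewrite psiE.
exists phi, psi; split.
- by apply/subspace_continuousP => x Ux; apply: cvg_within_filter; exact: phic.
- by apply/subspace_continuousP => -[w f] [wU _]; apply: cvg_within_filter; exact: psic.
- move=> x Ux; have [Ds Qs] := Hsel x; rewrite -[in q x]Qs qQ // psiE //.
  by apply: arc_interior => //; rewrite -qQ // Qs.
move=> w f wU; have [Ds e12] := Hsel2 (w, f); have es := congr1 fst e12; have ts := congr1 snd e12; rewrite /= in es ts.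
have sin : al < (sel2 (w, f)).2 < al + 1 by apply: arc_interior => //; rewrite es.
by rewrite /psi qQ // es phiQ.
Qed.

End ArcTrivialization.

Lemma within_comp {S S' X : topologicalType} (B : set S) (C : set S') (u : S -> S') (f : S' -> X) :
  continuous u -> (forall z, B z -> C (u z)) -> {within C, continuous f} -> {within B, continuous (f \o u)}.
Proof.
move=> uc BC /subspace_continuousP fc; apply/subspace_continuousP => z Bz N fN.
have h1 : nbhs (u z) [set w | C w -> N (f w)] by exact: (fc (u z) (BC z Bz) N fN).
have h2 : nbhs z [set z' | C (u z') -> N (f (u z'))] by exact: (uc z _ h1).
by apply: filterS h2 => z' h Bz'; apply: h; exact: BC.
Qed.

Lemma paste_continuous {R : realType} {S X : topologicalType} (D : set S) (h : S -> R) (f g : S -> X) : closed D -> continuous h ->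
  {within D `&` [set z | 0 <= h z], continuous f} -> {within D `&` [set z | h z <= 0], continuous g} ->
  (forall z, D z -> h z = 0 -> f z = g z) ->
  {within D, continuous (fun z => if 0 <= h z then f z else g z)}.
Proof.
move=> Dc hc fc gc fg.
have -> : D = (D `&` [set z | 0 <= h z]) `|` (D `&` [set z | h z <= 0]).
  apply/seteqP; split => z; last by move=> [[]|[]].
  by move=> Dz; have [h0|h0] := leP 0 (h z); [left|right; split => //; exact: ltW].
apply: withinU_continuous.
- by apply: closedI => //; apply: (closed_comp _ (@closed_ge R 0)) => z _; exact: hc.
- by apply: closedI => //; apply: (closed_comp _ (@closed_le R 0)) => z _; exact: hc.
- by apply: (subspace_eq_continuous _ fc) => z /set_mem[_ /= hz]; rewrite /from_subspace hz.
apply: (subspace_eq_continuous _ gc) => z /set_mem[Dz /= h0].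
by rewrite /from_subspace; case: ifP => // h1; rewrite fg //; apply/eqP; rewrite eq_le h0 h1.
Qed.

Section ArcGlue.
Context {R : realType} {m : nat} {M : topologicalType}.
Hypothesis M_hausdorff : hausdorff_space M.
Notation D al := (@arc_domain R m al).

Lemma arc_domain_closed al : closed (D al).
Proof. apply: compact_closed; [exact: norm_hausdorff|exact: arc_compact]. Qed.

Definition arc_model (q : M -> circle R) (al : R) (Q : 'rV[R]_m * R -> M) : Prop :=
  [/\ {within D al, continuous Q}, forall x, exists2 z, D al z & Q z = x, forall z, D al z -> q (Q z) = ev z.2
    & forall z z', D al z -> D al z' -> al < z.2 < al + 1 -> (Q z = Q z' <-> z.2 = z'.2 /\ exists k, z'.1 = z.1 + ir k)].

Lemma circle_open (w : circle R) : open [set w' : circle R | w' <> w].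
Proof.
have -> : [set w' | w' <> w] = ~` [set w] by [].
by apply: closed_openC; apply: accessible_closed_set1; apply: hausdorff_accessible; exact: circle_hausdorff.
Qed.

(** The two arcs are cut at different points of the circle, so their interiors cover it. *)
Lemma bundle_of_arcs q Q Q' : arc_model q 0 Q -> arc_model q (- (1 / 2)) Q' -> fibre_bundle (torus R m) q.
Proof.
move=> [h1 h2 h3 h4] [h1' h2' h3' h4']; split; first exact: (arc_projection_continuous M_hausdorff h1 h2 h3).
move=> w; have [w0|w0] := pselect (w = ev 0); last first.
  exists [set w' | w' <> ev 0]; split => //; first exact: circle_open.
  exact: (arc_trivialization M_hausdorff h1 h2 h3 h4).
exists [set w' | w' <> ev (- (1 / 2))]; split; [exact: circle_open| |].
  rewrite w0 /= => E; have := @ev_inj_near R (- (1 / 2)) 0 (- (1 / 2)) _ _ E.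
  have a1 : - (1 / 2) < (0 : R) < - (1 / 2) + 1 by lra.
  have a2 : - (1 / 2) <= (- (1 / 2) : R) <= - (1 / 2) + 1 by lra.
  by move=> /(_ a1 a2); lra.
exact: (arc_trivialization M_hausdorff h1' h2' h3' h4').
Qed.

Lemma unit_cases (s : R) : 0 <= s <= 1 -> [\/ s = 0, s = 1 | 0 < s < 1].
Proof.
move=> /andP[s0 s1]; have [->|n0] := eqVneq s 0; first by constructor 1.
have [->|n1] := eqVneq s 1; first by constructor 2.
by constructor 3; rewrite !lt_neqAle eq_sym n0 n1 s0 s1.
Qed.

Lemma box_representative (t : 'rV[R]_m) : exists t' k, `|t'| <= 1 / 2 /\ t = t' + ir k.
Proof.
by have [t' h1 /tev_eq[k hk]] := tev_onto (tev t); exists t', k.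
Qed.

Section Increasing.
Variables (Q : 'rV[R]_m -> R -> M) (eta eta' : 'rV[R]_m -> 'rV[R]_m).
Hypothesis QM : strip_model Q.
Hypothesis eta_cont : continuous eta.
Hypothesis etaK : cancel eta' eta.
Hypothesis Qeta : forall t, Q (eta t) 1 = Q t 0.
Hypothesis Qend : forall t t' (s : R), s = 0 \/ s = 1 -> Q t s = Q t' s -> exists k, t' = t + ir k.

(** The projection is [s] modulo 1. Over the arc that starts at 0 the model is [Q] itself; over the
    one that starts at [- (1 / 2)], negative [s] are reached through the gluing, as
    [Q (eta t) (1 + s)]. *)
Lemma increasing_bundle : exists q : M -> circle R, fibre_bundle (torus R m) q.
Proof.
have [Qc Qonto Qper Qrel] := QM.
have [sel Hsel] := choice (fun x => let: ex_intro t (ex_intro s h) := Qonto x in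
  ex_intro (fun z : 'rV[R]_m * R => 0 <= z.2 <= 1 /\ Q z.1 z.2 = x) (t, s) h).
pose q x := ev (sel x).2.
have i0 : 0 <= (0 : R) <= 1 by rewrite lexx ler01.
have i1 : 0 <= (1 : R) <= 1 by rewrite lexx ler01.
have ev01 : ev 0 = ev 1 :> circle R by rewrite -[1]add0r evD1.
have qQ t s : 0 <= s <= 1 -> q (Q t s) = ev s.
  move=> s01; rewrite /q; have [s01' E] := Hsel (Q t s).
  case: (unit_cases s01) => [es|es|sin]; last by have [e _] := Qrel _ _ _ _ sin s01' (esym E); rewrite -e.
    case: (unit_cases s01') => [->|->|sin']; rewrite ?es //.
    by have [e _] := Qrel _ _ _ _ sin' s01 E; move: sin'; rewrite e es ltxx.
  case: (unit_cases s01') => [->|->|sin']; rewrite ?es //.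
  by have [e _] := Qrel _ _ _ _ sin' s01 E; move: sin'; rewrite e es ltxx andbF.
have Qrel' t t' s : 0 <= s <= 1 -> Q t s = Q t' s -> exists k, t' = t + ir k.
  move=> s01 E; case: (unit_cases s01) => [es|es|sin].
  - by apply: (Qend (s := s)) => //; left.
  - by apply: (Qend (s := s)) => //; right.
  - by have [_] := Qrel _ _ _ _ sin s01 E.
exists q; apply: (@bundle_of_arcs q (fun z => Q z.1 z.2) (fun z => if 0 <= z.2 then Q z.1 z.2 else Q (eta z.1) (1 + z.2))).
  split.
  - by apply: continuous_subspaceW Qc => z [_] /=; rewrite add0r.
  - move=> x; have [t [s [s01 E]]] := Qonto x; have [t' [k [t'b Et]]] := box_representative t.
    by exists (t', s); [split; rewrite // add0r|rewrite /= -E Et Qper].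
  - by move=> z [_]; rewrite add0r => zin; exact: qQ.
  - move=> z z' [_]; rewrite !add0r => z01 [_ z'01] zin; split => [E|[E [k Ek]]].
      by rewrite add0r in z'01; exact: (Qrel _ _ _ _ zin z'01 E).
    by rewrite -E Ek Qper.
split.
- apply: paste_continuous; first exact: arc_domain_closed.
  + by move=> z; exact: cvg_snd.
  + by apply: continuous_subspaceW Qc => z [[_ /andP[_ h1]] /= h2]; rewrite h2 /= (le_trans h1) //; lra.
  + apply: (@within_comp _ _ _ _ [set z : 'rV[R]_m * R | 0 <= z.2 <= 1] (fun z : 'rV[R]_m * R => (eta z.1, 1 + z.2)) (fun z => Q z.1 z.2) _ _ Qc) => [z|z].
      apply: (@cvg_pair _ _ _ _ (nbhs (eta z.1)) (nbhs (1 + z.2))).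
        have h : (fun z : 'rV[R]_m * R => z.1) @ z --> z.1 by exact: cvg_fst.
        have h2 : eta @ z.1 --> eta z.1 by exact: eta_cont.
        exact: (cvg_comp _ _ h h2).
      by apply: cvgD; [exact: cvg_cst|exact: cvg_snd].
    by move=> [[_ /andP[h1 _]] /= h2]; lra.
  + by move=> z _ /= ->; rewrite addr0 Qeta.
- move=> x; have [t [s [s01 E]]] := Qonto x; move/andP: (s01) => [s0 s1].
  have [s2|s2] := leP s (1 / 2).
    have [t' [k [t'b Et]]] := box_representative t.
    exists (t', s); first by split => //=; lra.
    by rewrite /= s0 -E Et Qper.
  have [t' [k [t'b Et]]] := box_representative (eta' t).
  have [s3|s3] := eqVneq s 1.
    exists (t', 0); first by split => //=; lra.
    by rewrite /= lexx -E s3 -[t]etaK Qeta Et Qper.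
  have s1' : s < 1 by rewrite lt_neqAle s3.
  exists (t', s - 1); first by split => //=; lra.
  rewrite /= ifN -?ltNge ?subr_lt0 // addrC subrK -E.
  have [k' Ek'] : exists k', t = eta t' + ir k'.
    apply: (Qend (s := 1)); first by right.
    by rewrite -[in RHS](etaK t) !Qeta Et Qper.
  by rewrite Ek' Qper.
- move=> z [_ /andP[h1 h2]]; case: ifP => [z0|/negbT]; first by apply: qQ; rewrite z0 /=; lra.
  by rewrite -ltNge => z0; rewrite qQ; [rewrite addrC evD1|lra].
move=> z z' [_ /andP[h1 h2]] [_ /andP[h3 h4]] /andP[h5 h6]; split => [|[E [k Ek]]].
  case: ifP => [z0|/negbT]; case: ifP => [z'0|/negbT]; rewrite -?ltNge.
  - move=> E; have zin : 0 <= z.2 <= 1 by rewrite z0 /=; lra.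
    have zin' : 0 <= z'.2 <= 1 by rewrite z'0 /=; lra.
    have e : z.2 = z'.2.
      case: (unit_cases zin) => [e1|e1|sin]; [|by lra|by have [] := Qrel _ _ _ _ sin zin' E].
      case: (unit_cases zin') => [e2|e2|sin']; [by rewrite e1|by lra|by have [] := Qrel _ _ _ _ sin' zin (esym E)].
    by split => //; apply: (Qrel' _ _ _ zin); rewrite E e.
  - move=> z'0 E; exfalso; have zin : 0 <= z.2 <= 1 by rewrite z0 /=; lra.
    have sin : 0 < 1 + z'.2 < 1 by lra.
    by have [e _] := Qrel _ _ _ _ sin zin (esym E); lra.
  - move=> z0 E; exfalso; have zin : 0 <= z'.2 <= 1 by rewrite z'0 /=; lra.
    have sin : 0 < 1 + z.2 < 1 by lra.
    by have [e _] := Qrel _ _ _ _ sin zin E; lra.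
  move=> z'0 z0 E.
  have sin : 0 < 1 + z.2 < 1 by lra.
  have zin' : 0 <= 1 + z'.2 <= 1 by lra.
  have [e [k Ek]] := Qrel _ _ _ _ sin zin' E; split; first lra.
  by apply: (Qend (s := 0)); [left|rewrite -!Qeta Ek Qper].
rewrite -E Ek; case: ifP => [z0|/negbT]; first by rewrite Qper // z0 /=; lra.
rewrite -ltNge => z0.
have [k' ->] : exists k', eta (z.1 + ir k) = eta z.1 + ir k'.
  by apply: (Qend (s := 1)); [right|rewrite !Qeta Qper].
by rewrite Qper //; lra.
Qed.

End Increasing.

Section Decreasing.
Variables (Q : 'rV[R]_m -> R -> M) (al be : 'rV[R]_m).
Hypothesis QM : strip_model Q.
Hypothesis Qal : half_shift Q 0 al.
Hypothesis Qbe : half_shift Q 1 be.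
Hypothesis Q01 : forall t t', Q t 0 <> Q t' 1.

(** If no single coordinate is odd on both vectors, a coordinate odd only on [ka] plus one odd only
    on [kb] is. *)
Lemma odd_character (ka kb : 'rV[int]_m) : (exists i, odd `|ka ord0 i|) -> (exists i, odd `|kb ord0 i|) ->
  exists (e : bool) i j, [/\ e ==> (i != j),
    odd `|(ka ord0 i + (if e then ka ord0 j else 0))%R| & odd `|(kb ord0 i + (if e then kb ord0 j else 0))%R|].
Proof.
move=> [i ai] [j bj].
have [bi|bi] := boolP (odd `|kb ord0 i|); first by exists false, i, i; rewrite !addr0.
have [aj|aj] := boolP (odd `|ka ord0 j|); first by exists false, j, j; rewrite !addr0.
exists true, i, j; split => //=; last 2 first.
- by move: ai aj; lia.
- by move: bi bj; lia.
by apply/eqP => E; rewrite E bj in bi.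
Qed.

(** If all coordinates of the doubled translation were even, [t] itself would be a period. *)
Lemma half_shift_odd se t : half_shift Q se t -> exists2 k : 'rV[int]_m, t + t = ir k & exists i, odd `|k ord0 i|.
Proof.
move=> [[k Ek] nk _ _]; exists k => //; apply: contrapT => ev.
have H i : exists z : int, k ord0 i = z + z.
  have : ~~ odd `|k ord0 i| by apply/negP => h; apply: ev; exists i.
  by move=> h; exists (k ord0 i %/ 2)%Z; lia.
have [l Hl] := choice H; apply: (nk (\row_i l i)); apply/rowP => i.
have := congr1 (fun u : 'rV[R]_m => u ord0 i) Ek; rewrite !mxE Hl intrD; lra.
Qed.

(** Both folds change [chi] by a half-integer, so [2 * chi] is defined modulo 1 on [M]. The fibre
    over [ev u] consists of two copies of a torus of dimension [m - 1] times [[0, 1]], at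
    [chi = u / 2] and [chi = u / 2 + 1 / 2]; the folds exchange the copies, joining them end to end
    into a torus of dimension [m]. *)
Lemma decreasing_bundle : exists q : M -> circle R, fibre_bundle (torus R m) q.
Proof.
have [Qc Qonto Qper Qrel] := QM.
have [ka Eka oka] := half_shift_odd Qal; have [kb Ekb okb] := half_shift_odd Qbe.
have [e [i [j [eij oa ob]]]] := odd_character oka okb.
have [_ _ Qsa Qra] := Qal; have [_ _ Qsb Qrb] := Qbe.
pose chi (t : 'rV[R]_m) : R := t ord0 i + (if e then t ord0 j else 0).
pose chz (k : 'rV[int]_m) : int := k ord0 i + (if e then k ord0 j else 0).
have chiD t t' : chi (t + t') = chi t + chi t' by rewrite /chi !mxE; case: (e); ring.
have chiB t t' : chi (t - t') = chi t - chi t' by rewrite /chi !mxE; case: (e); ring.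
have chiZ (s : R) t : chi (s *: t) = s * chi t by rewrite /chi !mxE; case: (e); ring.
have chir k : chi (ir k) = (chz k)%:~R by rewrite /chi /chz intrD !mxE; case: (e).
have half t k : t + t = ir k -> odd `|chz k| -> exists n : int, chi t = n%:~R + 1 / 2.
  move=> E o; pose n := ((chz k - 1) %/ 2)%Z; exists n; have := congr1 chi E; rewrite chiD chir.
  have -> : chz k = n + n + 1 by rewrite /n; lia.
  by rewrite !intrD; qlra.
have [na Ena] := half _ _ Eka oa; have [nb Enb] := half _ _ Ekb ob.
have nint (n k : int) : n%:~R + 1 / 2 <> k%:~R :> R.
  move=> E; have : ((n + n + 1)%:~R : R) = (k + k)%:~R by rewrite !intrD; qlra.
  by move=> /intr_inj; lia.
pose ei (n : int) : 'rV[int]_m := \row_k (if k == i then n else 0).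
have chei n : chz (ei n) = n.
  rewrite /chz !mxE eqxx; case: (e) eij => [/= ij|_]; last by rewrite addr0.
  by rewrite eq_sym (negbTE ij) addr0.
(* [kap] is the holonomy of passing both folds once. The period [l] corrects it to lie in the kernel
   of [chi], so that it acts within one copy of the fibre. *)
pose l := ei (- na - nb - 1); pose kap := al + be + ir l.
have chikap : chi kap = 0 by rewrite /kap !chiD chir chei Ena Enb !intrD !intrN; qlra.
(* Entry [i] is determined by [chi = z.2 / 2], which frees the coordinate [z.1 ord0 i] to run around
   the circle formed by the two copies; subtracting its multiple of [kap] spreads the holonomy
   evenly along that circle. *)
pose T (z : 'rV[R]_m * R) : 'rV[R]_m := (\row_k (if k == i then z.2 / 2 - (if e then z.1 ord0 j else 0) else z.1 ord0 k)) - z.1 ord0 i *: kap.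
have chiT z : chi (T z) = z.2 / 2.
  rewrite /T chiB chiZ chikap mulr0 subr0 /chi !mxE eqxx; case: (e) eij => [/= ij|_]; last by rewrite subr0 addr0.
  by rewrite eq_sym (negbTE ij) subrK.
have pc k (z : 'rV[R]_m * R) : (fun z : 'rV[R]_m * R => z.1 ord0 k) @ z --> z.1 ord0 k.
  have h1 : (fun z : 'rV[R]_m * R => z.1) @ z --> z.1 by exact: cvg_fst.
  have FF := @nbhs_filter 'rV[R]_m z.1.
  have h2 : (fun t : 'rV[R]_m => t ord0 k) @ z.1 --> z.1 ord0 k.
    by apply: (@cvg_entry R 'rV[R]_m (nbhs z.1) FF 1 m id z.1 ord0 k); exact: cvg_id.
  exact: (cvg_comp _ _ h1 h2).
have Tc : continuous T.
  move=> z; apply: cvg_mx => a k; under eq_fun do rewrite !mxE; rewrite !mxE.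
  apply: cvgB; last by apply: cvgZl; exact: pc.
  case: (k == i); last exact: pc.
  apply: cvgB; first by apply: cvgM; [exact: cvg_snd|exact: cvg_cst].
  by case: (e); [exact: pc|exact: cvg_cst].
have TD (x : 'rV[R]_m) u (k : 'rV[int]_m) : T (x + ir k, u) = T (x, u) +
    ir (\row_k' (if k' == i then - (if e then k ord0 j else 0) else k ord0 k')) - (k ord0 i)%:~R *: kap.
  apply/rowP => k'; rewrite /T !mxE /=; case: (k' == i); last by ring.
  by case: (e); rewrite ?intrN; ring.
have TI (z z' : 'rV[R]_m * R) K n : z'.1 ord0 i = z.1 ord0 i + n%:~R -> T z' = T z + ir K - n%:~R *: kap ->
    exists k, z'.1 = z.1 + ir k.
  move=> hi hT; exists (\row_k (if k == i then n else K ord0 k)); apply/rowP => k; rewrite !mxE.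
  case: eqP => [->|/eqP ki]; first exact: hi.
  have := congr1 (fun t : 'rV[R]_m => t ord0 k) hT; rewrite /T !mxE (negbTE ki) hi.
  by move: (z.1 ord0 k) (z'.1 ord0 k) (z.1 ord0 i) (kap ord0 k) => a1 a2 a3 a4; qlra.
have Rel t t' s s' : 0 <= s <= 1 -> 0 <= s' <= 1 -> Q t s = Q t' s' -> s = s' /\
    exists k, [\/ t' = t + ir k, s = 0 /\ t' = t + al + ir k | s = 1 /\ t' = t + be + ir k].
  move=> s01 s'01 E; case: (unit_cases s01) => [es|es|sin]; last first.
    by have [e1 [k Ek]] := Qrel _ _ _ _ sin s'01 E; split => //; exists k; constructor 1.
  - case: (unit_cases s'01) => [es'|es'|sin'].
    + by case: (Q01 (t := t') (t' := t)); rewrite -es -es'.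
    + rewrite es es' in E *; split => //; have [k [Ek|Ek]] := Qrb _ _ E; exists k; [constructor 1|constructor 3] => //.
    + have [e1 _] := Qrel _ _ _ _ sin' s01 (esym E); move: sin'; rewrite e1 es ltxx andbF //.
  case: (unit_cases s'01) => [es'|es'|sin'].
  - rewrite es es' in E *; split => //; have [k [Ek|Ek]] := Qra _ _ E; exists k; [constructor 1|constructor 2] => //.
  - by case: (Q01 (t := t) (t' := t')); rewrite -es -es'.
  by have [e1 _] := Qrel _ _ _ _ sin' s01 (esym E); move: sin'; rewrite e1 es ltxx.
have [sel Hsel] := choice (fun x => let: ex_intro t (ex_intro s h) := Qonto x in
  ex_intro (fun z : 'rV[R]_m * R => 0 <= z.2 <= 1 /\ Q z.1 z.2 = x) (t, s) h).
pose q x := ev (2 * chi (sel x).1).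
have qQ t s : 0 <= s <= 1 -> q (Q t s) = ev (2 * chi t).
  move=> s01; rewrite /q; have [s01' E] := Hsel (Q t s).
  have [_ [k H]] := Rel _ _ _ _ s01 s01' (esym E).
  have sh (c : R) (N : int) : 2 * c = N%:~R -> ev (2 * (chi t + c)) = ev (2 * chi t) :> circle R.
    by move=> h; rewrite mulrDr h evDz.
  have [c [N [-> hc]]] : exists c N, chi (sel (Q t s)).1 = chi t + c /\ 2 * c = N%:~R.
    case: H => [H|[_ H]|[_ H]]; rewrite H ?chiD ?Ena ?Enb chir.
    - by exists (chz k)%:~R, (chz k + chz k); rewrite intrD; split; qlra.
    - by exists (na%:~R + 1 / 2 + (chz k)%:~R), (na + na + 1 + chz k + chz k); rewrite !intrD; split; qlra.
    by exists (nb%:~R + 1 / 2 + (chz k)%:~R), (nb + nb + 1 + chz k + chz k); rewrite !intrD; split; qlra.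
  exact: (sh c N hc).
(* The two halves of the circle traverse the two copies of the fibre. They meet at height 0 through
   the fold [al], and at height 1, where the coordinate is [1 / 2] or [- (1 / 2)], through [be]. *)
pose Qh (z : 'rV[R]_m * R) := if 0 <= z.1 ord0 i then Q (T z) (2 * z.1 ord0 i) else Q (T z + al) (- (2 * z.1 ord0 i)).
have box (z : 'rV[R]_m * R) : `|z.1| <= 1 / 2 -> -1 <= 2 * z.1 ord0 i <= 1.
  by move=> /(le_trans (mx_entry_le z.1 ord0 i)); rewrite ler_norml => /andP[h1 h2]; qlra.
have qh z : `|z.1| <= 1 / 2 -> q (Qh z) = ev z.2.
  move=> /box/andP[b1 b2]; rewrite /Qh; case: ifP => [h|/negbT].
    by rewrite qQ ?chiT; [congr ev; qlra|qlra].
  rewrite -ltNge => h; rewrite qQ ?(chiD (T z)) ?chiT ?Ena; last qlra.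
  by rewrite -(evDz z.2 (na + na + 1)); congr ev; rewrite !intrD; qlra.
have same (z z' : 'rV[R]_m * R) : z.2 = z'.2 -> z.1 ord0 i = z'.1 ord0 i -> forall s t0, 0 <= s <= 1 -> Q (T z + t0) s = Q (T z' + t0) s ->
    exists k, z'.1 = z.1 + ir k.
  move=> eu ei' s t0 s01 E; have [_ [k H]] := Rel _ _ _ _ s01 s01 E.
  have ec : chi (T z + t0) = chi (T z' + t0) by rewrite (chiD (T z)) (chiD (T z')) !chiT eu.
  apply: (TI z z' k 0); first by rewrite ei' addr0.
  rewrite scale0r subr0; case: H => [H|[_ H]|[_ H]].
  - by apply: (addIr t0); rewrite H addrAC.
  - move: ec; rewrite H !chiD Ena chir => ec; case: (nint na (- chz k)); rewrite intrN; qlra.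
  - move: ec; rewrite H !chiD Enb chir => ec; case: (nint nb (- chz k)); rewrite intrN; qlra.
have mixed (z z' : 'rV[R]_m * R) : `|z.1| <= 1 / 2 -> `|z'.1| <= 1 / 2 -> z.2 = z'.2 -> 0 <= z.1 ord0 i -> z'.1 ord0 i < 0 ->
    Q (T z) (2 * z.1 ord0 i) = Q (T z' + al) (- (2 * z'.1 ord0 i)) -> exists k, z'.1 = z.1 + ir k.
  move=> /box/andP[b1 b2] /box/andP[b3 b4] eu h h' E.
  have s01 : 0 <= 2 * z.1 ord0 i <= 1 by qlra.
  have s01' : 0 <= - (2 * z'.1 ord0 i) <= 1 by qlra.
  have [es [k H]] := Rel _ _ _ _ s01 s01' E.
  case: H => [H|[e1 _]|[e1 H]]; last 1 first.
  - apply: (TI z z' (k - ka - l) (-1)); first by rewrite intrN; qlra.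
    apply: (addIr al); rewrite H !irD !irN intrN scaleN1r opprK -Eka /kap.
    by apply/rowP => k'; rewrite !mxE; ring.
  - have := congr1 chi H; rewrite (chiD (T z')) (chiD (T z)) !chiT Ena chir eu => ec.
    by case: (nint na (chz k)); qlra.
  move/eqP: es; rewrite e1 eq_sym oppr_eq0 mulf_eq0 pnatr_eq0 /= => /eqP h0.
  by rewrite h0 ltxx in h'.
have conv (z z' : 'rV[R]_m * R) (k : 'rV[int]_m) : `|z.1| <= 1 / 2 -> `|z'.1| <= 1 / 2 -> z.2 = z'.2 -> z'.1 = z.1 + ir k -> k ord0 i = 0 \/ k ord0 i = -1 -> Qh z = Qh z'.
  move=> /box/andP[b1 b2] /box/andP[b3 b4] eu ex kcase.
  have eT : T z' = T (z.1 + ir k, z.2) by rewrite eu -ex; case: (z').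
  have eT2 : T z = T (z.1, z.2) by case: (z).
  have ei' : z'.1 ord0 i = z.1 ord0 i + (k ord0 i)%:~R by rewrite ex !mxE.
  case: kcase => k0.
    rewrite k0 addr0 in ei'; rewrite /Qh ei' eT TD k0 scale0r subr0 -eT2; case: ifP => [h|/negbT].
      by rewrite Qper //; qlra.
    by rewrite -ltNge => h; rewrite [X in _ = Q X _]addrAC Qper //; qlra.
  rewrite k0 intrN in ei'; have zi : z.1 ord0 i = 1 / 2 by qlra.
  have zi' : z'.1 ord0 i = - (1 / 2) by qlra.
  rewrite /Qh zi zi' ifT; last qlra.
  rewrite ifF; last by apply/negbTE; rewrite -ltNge; qlra.
  have -> : 2 * (1 / 2) = 1 :> R by qlra.
  have -> : - (2 * - (1 / 2)) = 1 :> R by qlra.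
  have i1 : 0 <= (1 : R) <= 1 by rewrite lexx ler01.
  rewrite eT TD k0 -eT2 intrN scaleN1r opprK; set K := ir _.
  have -> : T z + K + kap + al = T z + be + K + ir ka + ir l.
    by rewrite -Eka /kap; apply/rowP => k'; rewrite !mxE; ring.
  by rewrite !Qper // Qsb.
have near1 (z z' : 'rV[R]_m * R) (k : 'rV[int]_m) : `|z.1| <= 1 / 2 -> `|z'.1| <= 1 / 2 -> z'.1 = z.1 + ir k -> [\/ k ord0 i = 0, k ord0 i = -1 | k ord0 i = 1].
  move=> /box/andP[b1 b2] /box/andP[b3 b4] ex.
  have ei' : z'.1 ord0 i = z.1 ord0 i + (k ord0 i)%:~R by rewrite ex !mxE.
  have h1 : (k ord0 i)%:~R <= (1%:~R : R) by qlra.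
  have h2 : ((-1)%:~R : R) <= (k ord0 i)%:~R by rewrite intrN; qlra.
  move: h1 h2; rewrite !ler_int => h1 h2.
  have : k ord0 i = 0 \/ k ord0 i = -1 \/ k ord0 i = 1 by lia.
  by case=> [|[|]]; [constructor 1|constructor 2|constructor 3].
have QhN (x : 'rV[R]_m) u (k : 'rV[int]_m) : k ord0 i = 0 -> `|2 * x ord0 i| <= 1 -> Qh (x + ir k, u) = Qh (x, u).
  move=> k0; rewrite ler_norml => /andP[b1 b2]; rewrite /Qh /= TD k0 scale0r subr0 !mxE k0 addr0; case: ifP => [h|/negbT].
    by rewrite Qper //; qlra.
  by rewrite -ltNge => h; rewrite addrAC Qper //; qlra.
have Qh_onto u0 x : exists2 z, D u0 z & Qh z = x.
  have [t [s [s01 <-]]] := Qonto x; move/andP: (s01) => [s0 s1].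
  have [u uin /ev_eq[N EN]] := ev_onto u0 (ev (2 * chi t)).
  (* [T] is inverted with the circle coordinate prescribed to be [r]; the other coordinates are then
     reduced to the box by integer translations that do not touch coordinate [i]. *)
  have red (r : R) (t1 : 'rV[R]_m) : `|r| <= 1 / 2 -> chi t1 = u / 2 ->
      exists z : 'rV[R]_m * R, [/\ `|z.1| <= 1 / 2, z.2 = u, z.1 ord0 i = r & Qh z = if 0 <= r then Q t1 (2 * r) else Q (t1 + al) (- (2 * r))].
    move=> r2 ct; pose x0 : 'rV[R]_m := \row_k (if k == i then r else t1 ord0 k + r * kap ord0 k).
    have x0i : x0 ord0 i = r by rewrite mxE eqxx.
    have Tx0 : T (x0, u) = t1.
      rewrite /T /x0 /=; move: (kap) chikap => kp ck.
      apply/rowP => k; rewrite !mxE eqxx /=; case: eqP => [->|_]; last by ring.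
      move: ct ck; rewrite /chi; case: (e) eij => [/= ij|_] => h1 h2; last by rewrite !addr0 in h1 h2; rewrite h1 h2; ring.
      rewrite eq_sym (negbTE ij); move: h1 h2; move: (t1 ord0 i) (t1 ord0 j) (kp ord0 i) (kp ord0 j) => a1 a2 a3 a4 h1 h2.
      have -> : a3 = - a4 by qlra.
      by rewrite -h1; ring.
    have [x1 [k [x1b Ek]]] := box_representative (\row_k' (if k' == i then 0 else x0 ord0 k')).
    pose k1 : 'rV[int]_m := \row_k' (if k' == i then 0 else - k ord0 k').
    exists (x0 + ir k1, u); split => //=.
    - apply: mx_norm_le => // a b; rewrite ord1 !mxE; case: eqP => [_|/eqP bi]; first by rewrite addr0.
      have := congr1 (fun w : 'rV[R]_m => w ord0 b) Ek; rewrite !mxE (negbTE bi) => ->.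
      by rewrite intrN addrK; exact: le_trans (mx_entry_le _ _ _) x1b.
    - by rewrite !mxE eqxx addr0.
    rewrite QhN; [by rewrite /Qh /= x0i Tx0|by rewrite mxE eqxx|].
    by rewrite x0i normrM normr_nat; qlra.
  have Du (z : 'rV[R]_m * R) : `|z.1| <= 1 / 2 -> z.2 = u -> D u0 z by move=> h1 h2; split; rewrite ?h2.
  (* Since [2 * chi t = u + N], the parity of [N] tells in which of the two copies of the fibre the
     point lies. *)
  pose N2 := (N %/ 2)%Z; have [eN|oN] : N = N2 + N2 \/ N = N2 + N2 + 1 by rewrite /N2; lia.
    have [||z [z1 z2 z3 z4]] := red (s / 2) (t - ir (ei N2)).
    - by rewrite ger0_norm; qlra.
    - rewrite chiB chir chei; move: EN; rewrite eN intrD; qlra.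
    exists z; first exact: Du.
    rewrite z4 ifT; last qlra.
    rewrite -irN Qper; last qlra.
    by congr Q; qlra.
  have [||z [z1 z2 z3 z4]] := red (- (s / 2)) (t - al - ir (ei (N2 - na))).
  - by rewrite normrN ger0_norm; qlra.
  - rewrite !chiB chir chei Ena; move: EN; rewrite oN !intrD intrN; qlra.
  exists z; first exact: Du.
  rewrite z4; case: ifP => [h|/negbT _].
    have es : s = 0 by qlra.
    rewrite es mul0r oppr0 mulr0 -irN Qper; last by rewrite lexx ler01.
    by rewrite -Qsa subrK.
  rewrite -irN addrAC subrK Qper; last qlra.
  by congr Q; qlra.
have arc u0 : arc_model q u0 Qh.
  split; [|exact: Qh_onto|by move=> z [zb _]; exact: qh|].
    apply: (@paste_continuous R _ _ (D u0) (fun z => z.1 ord0 i) (fun z => Q (T z) (2 * z.1 ord0 i)) (fun z => Q (T z + al) (- (2 * z.1 ord0 i)))).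
    - exact: arc_domain_closed.
    - by move=> z; exact: pc.
    - apply: (@within_comp _ _ _ _ [set z : 'rV[R]_m * R | 0 <= z.2 <= 1] (fun z : 'rV[R]_m * R => (T z, 2 * z.1 ord0 i)) (fun z => Q z.1 z.2) _ _ Qc) => [z|z].
        apply: (@cvg_pair _ _ _ _ (nbhs (T z)) (nbhs (2 * z.1 ord0 i))); first exact: Tc.
        by apply: cvgM; [exact: cvg_cst|exact: pc].
      by move=> [[/box/andP[h1 h2] _] /= h3]; qlra.
    - apply: (@within_comp _ _ _ _ [set z : 'rV[R]_m * R | 0 <= z.2 <= 1] (fun z : 'rV[R]_m * R => (T z + al, - (2 * z.1 ord0 i))) (fun z => Q z.1 z.2) _ _ Qc) => [z|z].
        apply: (@cvg_pair _ _ _ _ (nbhs (T z + al)) (nbhs (- (2 * z.1 ord0 i)))).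
          by apply: cvgD; [exact: Tc|exact: cvg_cst].
        by apply: cvgN; apply: cvgM; [exact: cvg_cst|exact: pc].
      by move=> [[/box/andP[h1 h2] _] /= h3]; qlra.
    by move=> z _ ->; rewrite mulr0 oppr0 Qsa.
  move=> z z' [zb zu] [zb' zu'] zin; split => [E|[eu [k Ek]]]; last first.
    have [k0|k0|k0] := near1 z z' k zb zb' Ek.
    - by apply: (conv z z' k) => //; left.
    - by apply: (conv z z' k) => //; right.
    apply/esym; apply: (conv z' z (- k)) => //; last by right; rewrite mxE k0.
    by rewrite Ek irN addrK.
  have n2 : 2 != 0 :> R by rewrite pnatr_eq0.
  have eu : z.2 = z'.2 by apply: (ev_inj_near zin zu'); rewrite -!qh ?E.
  split => //; have /andP[b1 b2] := box z zb; have /andP[b3 b4] := box z' zb'.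
  move: E; rewrite /Qh; case: ifP => [h|/negbT]; case: ifP => [h'|/negbT]; rewrite -?ltNge.
  - move=> E; have s01 : 0 <= 2 * z.1 ord0 i <= 1 by qlra.
    have s01' : 0 <= 2 * z'.1 ord0 i <= 1 by qlra.
    have [es _] := Rel _ _ _ _ s01 s01' E.
    by apply: (same z z' eu _ _ 0 s01); [exact: (mulfI n2 es)|rewrite !addr0 E es].
  - by move=> h' E; exact: (mixed z z' zb zb' eu h h' E).
  - move=> h E; have [k ->] := mixed z' z zb' zb (esym eu) h' h (esym E).
    by exists (- k); rewrite irN addrK.
  move=> h' h E; have s01 : 0 <= - (2 * z.1 ord0 i) <= 1 by qlra.
  have s01' : 0 <= - (2 * z'.1 ord0 i) <= 1 by qlra.
  have [es _] := Rel _ _ _ _ s01 s01' E.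
  by apply: (same z z' eu _ _ al s01); [exact: (mulfI n2 (oppr_inj es))|rewrite E es].
by exists q; apply: bundle_of_arcs (arc 0) (arc _).
Qed.

End Decreasing.

End ArcGlue.

(** * From the flow to the bundle *)

Lemma norm_close {R : realType} {V : normedModType R} (a b : V) : `|a - b| <= 1 -> `|b| <= `|a| + 1.
Proof.
move=> ab; have -> : b = a - (a - b) by rewrite opprB addrC subrK.
by rewrite (le_trans (ler_normB _ _)) // lerD2l.
Qed.

Lemma flow_cvg {R : realType} {n d : nat} (X : 'rV[R]_d -> 'M[R]_n.+1) {T : Type} {F : set_system T} {FF : Filter F}
    (v : T -> 'rV[R]_d) (x : T -> 'rV[R]_n) (v0 : 'rV[R]_d) (x0 : 'rV[R]_n) : affine_family X ->
  v @ F --> v0 -> x @ F --> x0 -> (fun t => flow X (v t) (x t)) @ F --> flow X v0 x0.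
Proof.
move=> XA vc xc; have [C C0 H] := flow_lipschitz XA (Num.max (`|v0| + 1) (`|x0| + 1)).
apply/cvgrPdist_le => eps eps0.
have e0 : 0 < Num.min 1 (eps / (2 * C)) by rewrite lt_min ltr01 divr_gt0 // mulr_gt0.
move/cvgrPdist_le: vc => /(_ _ e0) vc; move/cvgrPdist_le: xc => /(_ _ e0) xc.
apply: filterS2 vc xc => t; rewrite !le_min => /andP[v1 v2] /andP[x1 x2].
apply: (le_trans (H _ _ _ _ _ _ _ _)); rewrite ?le_max ?lerDl ?norm_close ?ler01 ?orbT //.
have h : `|v0 - v t| + `|x0 - x t| <= eps / C.
  have -> : eps / C = eps / (2 * C) + eps / (2 * C) by field; rewrite gt_eqF.
  exact: lerD.
by rewrite mulrC -ler_pdivlMr.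
Qed.

Section LeafBundle.
Context {R : realType} {m : nat} {M : topologicalType}.
Variables (G : set ('rV[R]_m.+1 -> 'rV[R]_m.+1)) (p : 'rV[R]_m.+1 -> M).
Hypothesis G_homeo : homeomorphism_group G.
Hypothesis G_fpd : free_properly_discontinuous G.
Hypothesis Gp : orbit_map G p.
Hypothesis M_hausdorff : hausdorff_space M.
Hypothesis M_compact : compact [set: M].

Lemma bundle_of_leaf (H : set ('rV[R]_m.+1 -> 'rV[R]_m.+1)) (q : 'rV[R]_m.+1 -> M) y : leaf_action H q ->
  compact [set q (cons_mx y v) | v in [set: 'rV[R]_m]] -> exists f : M -> circle R, fibre_bundle (torus R m) f.
Proof.
move=> LF lc; have [[r [Hr rd]]|nod] := pselect (exists r, H r /\ decreasing r).
  have [Q [al [be [QM Qal Qbe Q01]]]] := decreasing_model LF lc Hr rd.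
  exact: (decreasing_bundle M_hausdorff QM Qal Qbe Q01).
have inc g : H g -> increasing g.
  by move=> Hg; have [//|gd] := phi_mono LF Hg; case: nod; exists g.
have [Q [eta [eta' [QM etac etaK Qeta Qend]]]] := increasing_model LF lc inc.
exact: (increasing_bundle M_hausdorff QM etac etaK Qeta Qend).
Qed.

(** The slice conjugates the flow to translations, and the compact orbit through [x0 = p x1] becomes
    the leaf at height [S x1]. *)
Lemma bundle_of_flow (X : 'rV[R]_m -> 'M[R]_m.+2) (H : set {compact-open, M -> M}) : generates_flow G p H X ->
  (exists x : M, compact [set f x | f in H]) -> exists f : M -> circle R, fibre_bundle (torus R m) f.
Proof.
move=> [XA Xcomm Xfree Xorb] [x0 orbc].
have [c [L [S [cc Lc Sc LS cLS]]]] := global_sliceP XA Xfree.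
have [f fE] : exists f : 'rV[R]_m.+1 -> 'rV[R]_m.+1, forall x, f x = cons_mx (S x) (L x).
  by exists (fun x => cons_mx (S x) (L x)).
have [f' f'E0] : exists f' : 'rV[R]_m.+1 -> 'rV[R]_m.+1, forall z, f' z = flow X (rsub z) (c (z ord0 ord0)).
  by exists (fun z => flow X (rsub z) (c (z ord0 ord0))).
have f'E s v : f' (cons_mx s v) = flow X v (c s) by rewrite f'E0 rsub_cons cons_mx0.
have fK : cancel f f' by move=> x; rewrite fE f'E cLS.
have f'K : cancel f' f by move=> z; rewrite -[z]ptE f'E fE; have [-> ->] := LS (rsub z) (z ord0 ord0).
have fc : continuous f.
  have -> : f = fun x => cons_mx (S x) (L x) by apply/funext => x; exact: fE.
  move=> x; have FF := @nbhs_filter 'rV[R]_m.+1 x.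
  by apply: pt_cvg; [exact: Sc|exact: Lc].
have f'c : continuous f'.
  have -> : f' = fun z => flow X (rsub z) (c (z ord0 ord0)) by apply/funext => z; exact: f'E0.
  move=> z; have FF := @nbhs_filter 'rV[R]_m.+1 z.
  apply: flow_cvg => //.
    have h := @cvg_entry R 'rV[R]_m.+1 (nbhs z) FF 1 m.+1 id z; apply: cvg_mx => i j; rewrite mxE; under eq_fun do rewrite mxE.
    by apply: h; exact: cvg_id.
  have h : (fun z : 'rV[R]_m.+1 => z ord0 ord0) @ z --> z ord0 ord0.
    by apply: (@cvg_entry R 'rV[R]_m.+1 (nbhs z) FF 1 m.+1 id z ord0 ord0); exact: cvg_id.
  have h2 : c @ z ord0 ord0 --> c (z ord0 ord0) by exact: cc.
  exact: (cvg_comp _ _ h h2).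
have fflow v x : f (flow X v x) = f x + cons_mx 0 v.
  have [h1 h2] := LS (v + L x) (S x); have h := flowD XA v (L x) (c (S x)); rewrite cLS in h.
  by rewrite -h !fE h1 h2 ptD addrC.
have f'flow z v : f' (z + cons_mx 0 v) = flow X v (f' z).
  by have h := fflow v (f' z); rewrite f'K in h; rewrite -h fK.
have LF : leaf_action (conj_group G f f') (p \o f').
  apply: LeafAction (conj_homeomorphism_group G_homeo fc f'c fK f'K) (conj_fpd f'c fK f'K G_fpd)
    (conj_orbit_map fc f'c fK f'K Gp) M_hausdorff M_compact _.
  by move=> _ z v [g Gg <-]; rewrite [LHS]/= f'flow -Xcomm // fflow.
have [x1 x1E] := proj_surj Gp x0.
apply: (bundle_of_leaf (y := S x1) LF).
have -> // : [set (p \o f') (cons_mx (S x1) v) | v in [set: 'rV[R]_m]] = [set f x0 | f in H].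
have E v : (p \o f') (cons_mx (S x1) v) = p (flow X (v - L x1) x1).
  have h := flowD XA (v - L x1) (L x1) (c (S x1)); rewrite subrK cLS in h.
  by rewrite -h -f'E.
apply/seteqP; split => [_ [v _ <-]|_ [h Hh <-]].
  rewrite E; have [|h Hh hE] := (Xorb x1 (flow X (v - L x1) x1)).2; first by exists (v - L x1).
  by exists h => //; rewrite -x1E.
have [y1 y1E] := proj_surj Gp (h x0).
have [|v vE] := (Xorb x1 y1).1; first by exists h => //; rewrite x1E y1E.
by exists (v + L x1) => //; rewrite E addrK -vE.
Qed.

End LeafBundle.

Theorem proposition4p1 (R : realType) (n : nat) (n_gt0 : (0 < n)%N)
    (G : set ('rV[R]_n -> 'rV[R]_n)) (M : topologicalType)
    (p : 'rV[R]_n -> M)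
    (M_aspherical : differentiable_aspherical_manifold G p)
    (M_compact : compact [set: M])
    (dim_Aff0 : lie_group_of_dim R n.-1 (Aff0 p) compose_co id fun_inv)
    (Aff0_commutative : forall f g, Aff0 p f -> Aff0 p g ->
      compose_co f g = compose_co g f)
    (Aff0_compact_orbit : exists x : M, compact [set f x | f in Aff0 p]) :
  exists q : M -> circle R, fibre_bundle (torus R n.-1) q.
Proof.
case: n n_gt0 G p M_aspherical dim_Aff0 Aff0_commutative Aff0_compact_orbit => // m _ G p.
move=> [[[M_hausdorff _ _] G_homeo G_fpd Gp] _] HL HC orbit_compact.
have [r [e [E [P [F LA]]]]] := affine_lifts G_homeo G_fpd Gp M_hausdorff M_compact HL HC.
have [X XF] := flow_of_local_affine G_homeo G_fpd Gp M_hausdorff M_compact HL.1 LA.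
exact: (bundle_of_flow G_homeo G_fpd Gp M_hausdorff M_compact XF orbit_compact).
Qed.
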